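(* Let $\{e^{tA}\}_{t\ge0}$ be a strongly continuous semigroup on a complex Banach space $X$ generated by $A$. Let $U$ and $Y$ be complex Banach spaces, $B\in\mathcal L(U,X)$, $C\in\mathcal L(X,Y)$, and $1\le p<\infty$. Write $A_\alpha:=A-\alpha I$. Then the following are equivalent: (i) $\{e^{tA}\}_{t\ge0}$ is exponentially stable; (ii) $\mathbb G$ is a bounded operator on $L^p(\mathbb R_+,X)$; (iii) $\sigma(A)\cap\overline{\mathbb C}_+=\emptyset$ and $\displaystyle\sup_{v\in\mathcal S(\mathbb R,X)}\frac{\|\int_{\mathbb R}(A_\alpha-is)^{-1}v(s)e^{is(\cdot)}\,ds\|_{L^p(\mathbb R,X)}}{\|\int_{\mathbb R}v(s)e^{is(\cdot)}\,ds\|_{L^p(\mathbb R,X)}}<\infty$ for all $\alpha\ge0$; (iv) $\sigma(A)\cap\overline{\mathbb C}_+=\emptyset$, $\displaystyle\sup_{u\in\mathcal S(\mathbb R,U)}\frac{\|\int_{\mathbb R}(A_\alpha-is)^{-1}Bu(s)e^{is(\cdot)}\,ds\|_{L^p(\mathbb R,X)}}{\|\int_{\mathbb R}u(s)e^{is(\cdot)}\,ds\|_{L^p(\mathbb R,U)}}<\infty$ for all $\alpha\ge0$, and the system $(A,B,C)$ is stabilizable; (v) $\sigma(A)\cap\overline{\mathbb C}_+=\emptyset$, $\displaystyle\sup_{v\in\mathcal S(\mathbb R,X)}\frac{\|\int_{\mathbb R}C(A_\alpha-is)^{-1}v(s)e^{is(\cdot)}\,ds\|_{L^p(\mathbb R,Y)}}{\|\int_{\mathbb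 R}v(s)e^{is(\cdot)}\,ds\|_{L^p(\mathbb R,X)}}<\infty$ for all $\alpha\ge0$, and the system $(A,B,C)$ is detectable; (vi) $\sigma(A)\cap\overline{\mathbb C}_+=\emptyset$, $\displaystyle\sup_{u\in\mathcal S(\mathbb R,U)}\frac{\|\int_{\mathbb R}C(A_\alpha-is)^{-1}Bu(s)e^{is(\cdot)}\,ds\|_{L^p(\mathbb R,Y)}}{\|\int_{\mathbb R}u(s)e^{is(\cdot)}\,ds\|_{L^p(\mathbb R,U)}}<\infty$ for all $\alpha\ge0$, and the system $(A,B,C)$ is both stabilizable and detectable. Moreover, if $\{e^{tA}\}_{t\ge0}$ is exponentially stable, then the norm of the input-output operator $\mathbb L=\mathcal C\mathbb G\mathcal B$ (from $L^p(\mathbb R_+,U)$ to $L^p(\mathbb R_+,Y)$) is equal to $$\sup_{u\in\mathcal S(\mathbb R,U)}\frac{\|\int_{\mathbb R}C(A-is)^{-1}Bu(s)e^{is(\cdot)}\,ds\|_{L^p(\mathbb R,Y)}}{\|\int_{\mathbb R}u(s)e^{is(\cdot)}\,ds\|_{L^p(\mathbb R,U)}}.$$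
   Context: $\mathbb R_+=[0,\infty)$, $\overline{\mathbb C}_+=\{\lambda\in\mathbb C:\operatorname{Re}\lambda\ge0\}$. $\mathcal S(\mathbb R,X)$ is the Schwartz class of rapidly decreasing $X$-valued functions; suprema are over nonzero functions, and a supremum is regarded as $+\infty$ if for some Schwartz function the integral in the numerator does not define an element of the indicated $L^p$ space. Exponentially stable means $\|e^{tA}\|\le Me^{\omega t}$, $t\ge0$, for some $M\ge1$, $\omega<0$. $(\mathbb Gf)(t)=\int_0^te^{(t-\tau)A}f(\tau)\,d\tau$, $t\ge0$; $\mathcal B,\mathcal C$ are pointwise application of $B,C$ to functions, so $(\mathbb Lu)(t)=C\int_0^te^{(t-\tau)A}Bu(\tau)\,d\tau$. The system $(A,B,C)$ is $x(t)=e^{tA}x_0+\int_0^te^{(t-\tau)A}Bu(\tau)\,d\tau$, $y(t)=Cx(t)$, $t\ge0$. It is stabilizable if there is $F\in\mathcal L(X,U)$ such that $A+BF$ generates an exponentially stable semigroup, and detectable if there is $K\in\mathcal L(Y,X)$ such that $A+KC$ generates an exponentially stable semigroup. *)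

(* Defs.v *)
From HB Require Import structures.
From mathcomp Require Import all_boot all_order all_algebra.
From mathcomp Require Import complex.
From mathcomp Require Import all_classical all_reals all_analysis.

Set Implicit Arguments.
Unset Strict Implicit.
Unset Printing Implicit Defensive.

Import Order.TTheory GRing.Theory Num.Theory.
Import numFieldNormedType.Exports.

Local Open Scope classical_set_scope.
Local Open Scope ring_scope.
Local Open Scope complex_scope.

(* A complex Banach space is a [completeNormedModType R[i]].  The library norm
   takes values in [R[i]] (with zero imaginary part); [rnorm] is the same
   number seen in [R]. *)
Definition rnorm (R : realType) (V : normedModType R[i]) (x : V) : R :=
  complex.Re `|x|.

Definition simple (R : realType) (V : normedModType R[i]) (s : R -> V) : Prop :=
  finite_set (range s) /\
  forall x, @measurable _ (measurableTypeR R) (s @^-1` [set x]).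

Definition simple_integrable (R : realType) (V : normedModType R[i])
    (D : set R) (s : R -> V) : Prop :=
  simple s /\
  forall x, x != 0 -> (lebesgue_measure (D `&` s @^-1` [set x]) < +oo)%E.

(* The value 0 may be taken on a set of infinite measure: [fine +oo = 0], and
   the term is multiplied by the vector 0 anyway. *)
Definition simple_integral (R : realType) (V : normedModType R[i])
    (D : set R) (s : R -> V) : V :=
  \sum_(x \in range s) (fine (lebesgue_measure (D `&` s @^-1` [set x])))%:C *: x.

Definition strongly_measurable (R : realType) (V : normedModType R[i])
    (D : set R) (f : R -> V) : Prop :=
  exists s : nat -> R -> V, (forall n, simple (s n)) /\
    {ae @lebesgue_measure R, forall t, D t -> s n t @[n --> \oo] --> f t}.

Definition bochner_approx (R : realType) (V : normedModType R[i])
    (D : set R) (f : R -> V) (s : nat -> R -> V) : Prop :=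
  (forall n, simple_integrable D (s n)) /\
  (\int[lebesgue_measure]_(t in D) (rnorm (f t - s n t))%:E)%E
    @[n --> \oo] --> 0%E.

Definition bochner_integrable (R : realType) (V : normedModType R[i])
    (D : set R) (f : R -> V) : Prop :=
  strongly_measurable D f /\ exists s, bochner_approx D f s.

(* Equal to 0 when [f] is not Bochner integrable on [D]. *)
Definition bochner_integral (R : realType) (V : normedModType R[i])
    (D : set R) (f : R -> V) : V :=
  xget 0 [set v | strongly_measurable D f /\
    exists2 s, bochner_approx D f s &
      simple_integral D (s n) @[n --> \oo] --> v].

Definition Lpnorm (R : realType) (V : normedModType R[i])
    (D : set R) (p : R) (f : R -> V) : \bar R :=
  ('N[@lebesgue_measure R]_(p%:E) [(fun t => (rnorm (f t))%:E) \_ D])%E.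

(* Functions, not classes: values outside [D] and on null sets are
   irrelevant. *)
Definition in_Lp (R : realType) (V : normedModType R[i])
    (D : set R) (p : R) (f : R -> V) : Prop :=
  strongly_measurable D f /\ (Lpnorm D p f < +oo)%E.

Definition Lp_bounded (R : realType) (V W : normedModType R[i])
    (D : set R) (p : R) (F : (R -> V) -> R -> W) : Prop :=
  exists M : R, forall f, in_Lp D p f ->
    in_Lp D p (F f) /\ (Lpnorm D p (F f) <= M%:E * Lpnorm D p f)%E.

(* Supremum of nonnegative quotients, taken in [0, +oo]: the empty supremum
   is 0. *)
Definition sup_ratio (R : realType) (I : Type) (S : set I)
    (num den : I -> \bar R) : \bar R :=
  ereal_sup ([set 0%E] `|` [set (num i / den i)%E | i in S]).

Definition Lp_opnorm (R : realType) (V W : normedModType R[i])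
    (D : set R) (p : R) (F : (R -> V) -> R -> W) : \bar R :=
  sup_ratio [set f | in_Lp D p f /\ Lpnorm D p f != 0%E]
    (fun f => Lpnorm D p (F f)) (fun f => Lpnorm D p f).

(* The library derivative needs domain and codomain over the same field. *)
Definition has_deriv (R : realType) (V : normedModType R[i])
    (f : R -> V) (t : R) (l : V) : Prop :=
  (h^-1)%:C *: (f (t + h) - f t) @[h --> (0 : R)^'] --> l.

(* [d n] is the n-th derivative of [v]. *)
Definition schwartz (R : realType) (V : normedModType R[i])
    (v : R -> V) : Prop :=
  exists d : nat -> R -> V,
    [/\ d 0%N = v,
        forall n t, has_deriv (d n) t (d n.+1 t) &
        forall m n, exists M : R, forall t, `|t| ^+ m * rnorm (d n t) <= M].

Definition imag (R : realType) (s : R) : R[i] := 0 +i* s.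

Definition expi (R : realType) (x : R) : R[i] := cos x +i* sin x.

Definition osc_integrand (R : realType) (V : normedModType R[i])
    (g : R -> V) (t s : R) : V := expi (s * t) *: g s.

Definition osc_integral (R : realType) (V : normedModType R[i])
    (g : R -> V) (t : R) : V := bochner_integral setT (osc_integrand g t).

Definition osc_Lpnorm (R : realType) (V : normedModType R[i])
    (p : R) (g : R -> V) : \bar R :=
  if `[< (forall t, bochner_integrable setT (osc_integrand g t)) /\
         in_Lp setT p (osc_integral g) >]
  then Lpnorm setT p (osc_integral g) else +oo%E.

Definition multiplier_sup (R : realType) (V W : normedModType R[i])
    (p : R) (N : R -> V -> W) : \bar R :=
  sup_ratio [set v | schwartz v /\ v <> (fun=> 0)]
    (fun v => osc_Lpnorm p (fun s => N s (v s)))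
    (fun v => osc_Lpnorm p v).

(* The values of [papp A] outside [pdom A] are irrelevant. *)
Record partial_op (X : Type) := PartialOp {
  pdom : set X;
  papp : X -> X }.

(* A - l I *)
Definition op_shift (R : realType) (X : normedModType R[i])
    (A : partial_op X) (l : R[i]) : partial_op X :=
  PartialOp (pdom A) (fun x => papp A x - l *: x).

Definition op_add (R : realType) (X : normedModType R[i])
    (A : partial_op X) (P : X -> X) : partial_op X :=
  PartialOp (pdom A) (fun x => papp A x + P x).

Definition op_inv (R : realType) (X : normedModType R[i])
    (A : partial_op X) (y : X) : X :=
  xget 0 [set x | pdom A x /\ papp A x = y].

Definition resolvent_set (R : realType) (X : normedModType R[i])
    (A : partial_op X) : set R[i] :=
  [set l | set_bij (pdom A) [set: X] (papp (op_shift A l)) /\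
     exists M : R, forall y, rnorm (op_inv (op_shift A l) y) <= M * rnorm y].

Definition spectrum (R : realType) (X : normedModType R[i])
    (A : partial_op X) : set R[i] := ~` resolvent_set A.

Definition closed_right_half_plane (R : realType) : set R[i] :=
  [set l | 0 <= complex.Re l].

(* Only the values at nonnegative times matter. *)
Definition C0_semigroup (R : realType) (X : normedModType R[i])
    (T : R -> {linear X -> X}) : Prop :=
  [/\ forall x, T 0 x = x,
      forall (s t : R) x, 0 <= s -> 0 <= t -> T (s + t) x = T s (T t x),
      forall t : R, 0 <= t -> continuous (T t) &
      forall x, T h x @[h --> (0 : R)^'+] --> x].

(* [A], as a graph, is the right derivative of [T] at 0. *)
Definition generates (R : realType) (X : normedModType R[i])
    (A : partial_op X) (T : R -> {linear X -> X}) : Prop :=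
  forall x y, (pdom A x /\ papp A x = y) <->
    ((h^-1)%:C *: (T h x - x) @[h --> (0 : R)^'+] --> y).

Definition exp_stable (R : realType) (X : normedModType R[i])
    (T : R -> {linear X -> X}) : Prop :=
  exists M w : R, [/\ 1 <= M, w < 0 &
    forall t : R, 0 <= t -> forall x, rnorm (T t x) <= M * expR (w * t) * rnorm x].

Definition generates_exp_stable (R : realType) (X : normedModType R[i])
    (A : partial_op X) : Prop :=
  exists T : R -> {linear X -> X},
    [/\ C0_semigroup T, generates A T & exp_stable T].

Definition stabilizable (R : realType) (X U : normedModType R[i])
    (A : partial_op X) (B : U -> X) : Prop :=
  exists2 F : {linear X -> U}, continuous F &
    generates_exp_stable (op_add A (B \o F)).

Definition detectable (R : realType) (X Y : normedModType R[i])
    (A : partial_op X) (C : X -> Y) : Prop :=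
  exists2 K : {linear Y -> X}, continuous K &
    generates_exp_stable (op_add A (K \o C)).

Definition Rplus (R : realType) : set R := `[0, +oo[.

Definition Gop (R : realType) (X : normedModType R[i])
    (T : R -> {linear X -> X}) (f : R -> X) (t : R) : X :=
  bochner_integral `[0, t] (fun tau => T (t - tau) (f tau)).

Definition Lop (R : realType) (X U Y : normedModType R[i])
    (T : R -> {linear X -> X}) (B : U -> X) (C : X -> Y) (u : R -> U) : R -> Y :=
  C \o Gop T (B \o u).

(* Main.v *)
Require Import Defs.
From HB Require Import structures.
From mathcomp Require Import all_boot all_order all_algebra.
From mathcomp Require Import complex.
From mathcomp Require Import zify ring lra.
From mathcomp Require Import all_classical all_reals all_analysis.
From mathcomp Require Import measurable_realfun.
Set Implicit Arguments.
Unset Strict Implicit.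
Unset Printing Implicit Defensive.
Import Order.TTheory GRing.Theory Num.Theory.
Import numFieldNormedType.Exports.
Local Open Scope classical_set_scope.
Local Open Scope ring_scope.
Local Open Scope complex_scope.

(* For a stable semigroup T with generator A, (A - l)^{-1} = - \int_0^oo e^{-lu} T u du, hence the
   multiplier s |-> (A - is)^{-1} acts on transforms of functions as minus the convolution
   K f t = \int_{tau <= t} T (t - tau) (f tau), which Young's inequality bounds on L^p. Transforms of
   Schwartz functions are dense in L^p (Gaussians, then intervals, Borel sets and simple functions), so
   the multiplier supremum is the L^p norm of K. Translation invariance of K identifies this norm with
   the one on the half line, which gives the norm equality. Conversely, applying K or G to the piece of
   an orbit over [0, 1] bounds the L^p norm of the orbit, and Datko's argument makes T contractive at a
   time depending only on the bounds. This gives (ii) => (i), and, followed by a continuity argument in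
   the shift a, (iii) => (i). Finally, if R' is the resolvent of A + BF or A + KC, the identities
   R = R' + R B F R' and R = R' + R' K C R reduce (iv), (v) and (vi) to (iii). *)

(** * Norms with real values *)

Section rnorm_theory.
Context (R : realType) (V : normedModType R[i]).
Implicit Types (x y : V).

(** Two difficulties shape the development. The conditions speak of functions known up to null sets,
    with norms and Bochner integrals over a domain; [ae_version] moves them to everywhere defined
    functions on the whole line, where convolution, translation and transform live. And the time
    integral that represents the resolvent must be exchanged with the transform in frequency. This
    is done on Riemann sums: finite sums of bounded operators commute with any Bochner integral, and
    dominated convergence gives the limit. The factor 2 in Young's inequality is generous, because
    that inequality only provides finiteness and makes approximation errors small. The bounds are
    used at the critical shift, the infimum of the stabilizing ones, which is not known in advance.
    Above it the multiplier is finite a priori, so the perturbation term of the resolvent identity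
    can be absorbed. Inserting such an identity into a multiplier bound requires its argument to be
    a Schwartz function; hence the closure of the Schwartz class under the resolvents of a stable
    semigroup. *)

Lemma normE x : `|x| = (rnorm x)%:C.
Proof.
rewrite /rnorm; have := normr_ge0 x; rewrite lecE /= => /andP[/eqP h _].
by case: `|x| h => a b /= ->.
Qed.

Lemma rnorm_ge0 x : 0 <= rnorm x.
Proof. by have := normr_ge0 x; rewrite lecE => /andP[]. Qed.

Lemma rnorm0 : rnorm (0 : V) = 0.
Proof. by rewrite /rnorm normr0. Qed.

Lemma rnorm_eq0 x : rnorm x = 0 -> x = 0.
Proof. by move=> h; apply/normr0_eq0; rewrite normE h. Qed.

Lemma rnorm_eq0P x : (rnorm x == 0) = (x == 0).
Proof. by apply/eqP/eqP => [/rnorm_eq0//|->]; rewrite rnorm0. Qed.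

Lemma ler_rnormD x y : rnorm (x + y) <= rnorm x + rnorm y.
Proof.
have := ler_normD x y; rewrite !normE -rmorphD lecE /= => /andP[_ //].
Qed.

Lemma rnormN x : rnorm (- x) = rnorm x.
Proof. by rewrite /rnorm normrN. Qed.

Lemma rnormC x y : rnorm (x - y) = rnorm (y - x).
Proof. by rewrite -rnormN opprB. Qed.

Lemma ler_rnormB x y : rnorm (x - y) <= rnorm x + rnorm y.
Proof. by rewrite -(rnormN y); exact: ler_rnormD. Qed.

Lemma ler_rnorm_dist (z x y : V) : rnorm (x - y) <= rnorm (x - z) + rnorm (z - y).
Proof. by rewrite -[x - y](subrKA z); exact: ler_rnormD. Qed.

Lemma lerB_rnorm x y : rnorm x - rnorm y <= rnorm (x - y).
Proof. by rewrite lerBlDr -{1}(subrK y x); exact: ler_rnormD. Qed.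

Lemma ler_dist_rnorm x y : `|rnorm x - rnorm y| <= rnorm (x - y).
Proof.
rewrite ler_norml lerB_rnorm andbT lerNl opprB.
by rewrite [leRHS]rnormC lerB_rnorm.
Qed.

Lemma rnormZ (a : R[i]) x : rnorm (a *: x) = complex.Re `|a| * rnorm x.
Proof.
rewrite /rnorm normrZ (normE x) /=.
by case: `|a| => u v /=; rewrite mulr0 subr0.
Qed.

Lemma Re_norm_real (r : R) : complex.Re `|r%:C| = `|r|.
Proof. by rewrite normc_def /= expr0n /= addr0 sqrtr_sqr. Qed.

Lemma rnormZr (r : R) x : rnorm (r%:C *: x) = `|r| * rnorm x.
Proof. by rewrite rnormZ Re_norm_real. Qed.

Lemma ler_rnorm_sum (I : Type) (r : seq I) (P : pred I) (F : I -> V) :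
  rnorm (\sum_(i <- r | P i) F i) <= \sum_(i <- r | P i) rnorm (F i).
Proof.
elim/big_rec2: _ => [|i y1 y2 _ h]; first by rewrite rnorm0.
by apply: le_trans (ler_rnormD _ _) _; rewrite lerD2l.
Qed.

(** The library measures distances in [R[i]]; through this equivalence limits of vectors are handled
    as limits of real numbers. *)
Lemma cvg_rnormP (T : Type) (F : set_system T) {FF : Filter F} (f : T -> V) l :
  f x @[x --> F] --> l <-> rnorm (f x - l) @[x --> F] --> (0 : R).
Proof.
split=> [/cvgrPdist_lt h|/cvgr0Pnorm_lt h].
  apply/cvgr0Pnorm_lt => e e0; have := h e%:C; rewrite ltcR => /(_ e0).
  apply: filterS => t; rewrite normE ltcR rnormC.
  by rewrite ger0_norm ?rnorm_ge0.
(* In the order of [R[i]], positivity forces the imaginary part to vanish, so this epsilon is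
   real. *)
apply/cvgrPdist_lt => -[e b]; rewrite ltcE /= => /andP[/eqP -> e0].
have := h e e0; apply: filterS => t.
by rewrite normE ltcR rnormC ger0_norm ?rnorm_ge0.
Qed.

Lemma cvg_rnorm_le (T : Type) (F : set_system T) {FF : Filter F}
    (f : T -> V) l (g : T -> R) :
  (\forall x \near F, rnorm (f x - l) <= g x) -> g x @[x --> F] --> (0 : R) ->
  f x @[x --> F] --> l.
Proof.
move=> h g0; apply/cvg_rnormP; apply: (squeeze_cvgr _ (cvg_cst 0) g0).
by apply: filterS h => t ->; rewrite rnorm_ge0.
Qed.

Lemma cvg_rnorm (T : Type) (F : set_system T) {FF : Filter F} (f : T -> V) l :
  f x @[x --> F] --> l -> rnorm (f x) @[x --> F] --> rnorm l.
Proof.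
move=> /cvg_rnormP h; apply/cvgrPdist_lt => e e0.
move/cvgr0Pnorm_lt : h => /(_ e e0); apply: filterS => t; apply: le_lt_trans.
by rewrite distrC (le_trans (ler_dist_rnorm _ _)) // ler_norm.
Qed.

Lemma rnorm_cvg_le (u : nat -> V) (l : V) (c : R) : u n @[n --> \oo] --> l ->
  (\forall n \near \oo, rnorm (u n) <= c) -> rnorm l <= c.
Proof.
by move=> ul; apply: (@cvgr_to_le nat); exact: cvg_rnorm.
Qed.

Lemma cvg_rnorm_unique (T : Type) (F : set_system T) {FF : ProperFilter F}
  (f : T -> V) (l l' : V) : f x @[x --> F] --> l -> f x @[x --> F] --> l' -> l = l'.
Proof. exact: (@cvg_unique _ (@norm_hausdorff _ V)). Qed.

End rnorm_theory.

Section bounded_linear.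
Context (R : realType) (V W : normedModType R[i]).

Lemma continuous_linear_bound (L : {linear V -> W}) : continuous L ->
  exists2 K : R, 0 < K & forall x, rnorm (L x) <= K * rnorm x.
Proof.
move=> /(_ 0); rewrite /continuous_at raddf0 => /cvg_rnormP.
move=> /cvgr0Pnorm_lt /(_ 1 ltr01) /nbhs_normP[[e b]] /=.
rewrite ltcE /= => /andP[/eqP -> e0] h'; have h y : rnorm y < e -> rnorm (L y) < 1.
  move=> ye; have := h' y; rewrite /ball_ /= sub0r normrN normE ltcR => /(_ ye).
  by rewrite subr0 ger0_norm ?rnorm_ge0.
exists (2 / e); first by rewrite divr_gt0.
move=> x; have [->|x0] := eqVneq x 0; first by rewrite raddf0 !rnorm0 mulr0.
have rx : 0 < rnorm x by rewrite lt_neqAle eq_sym rnorm_eq0P x0 rnorm_ge0.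
set r := e / 2 / rnorm x.
have r0 : 0 < r by rewrite !divr_gt0.
have /h : rnorm (r%:C *: x) < e.
  rewrite rnormZr gtr0_norm // /r.
  by rewrite divfK ?gt_eqF // ltr_pdivrMr // ltr_pMr // ltr1n.
rewrite linearZ rnormZr gtr0_norm //= mulrC.
rewrite -ltr_pdivlMr // => /ltW/le_trans; apply.
by rewrite /r le_eqVlt; apply/orP; left; apply/eqP; field; rewrite !gt_eqF.
Qed.

End bounded_linear.

Section complete.
Context (R : realType) (V : completeNormedModType R[i]).

Lemma rnorm_cauchy_cvg (u : nat -> V) :
  (forall e : R, 0 < e -> exists N, forall m n, (N <= m)%N -> (N <= n)%N ->
     rnorm (u m - u n) < e) -> exists l : V, u n @[n --> \oo] --> l.
Proof.
move=> h; apply/cvg_ex/cauchy_cvgP/cauchy_exP => -[e b] /=.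
rewrite ltcE /= => /andP[/eqP -> e0]; have [N hN] := h e e0.
exists (u N); exists N => // n Nn; rewrite /= -ball_normE /ball_ /= normE ltcR.
exact: hN.
Qed.

End complete.

(** * The uniform boundedness principle *)

Section uniform_boundedness.
Context (R : realType) (V : completeNormedModType R[i]) (W : normedModType R[i]).

(* Sokal's elementary argument: among [x + z] and [x - z] one is mapped to a
   vector of norm at least that of the image of [z], so one can walk by steps
   of size [3^-n] and keep the images large. *)
Lemma uniform_boundedness (L : nat -> {linear V -> W}) :
  (forall n, continuous (L n)) ->
  (forall x, exists M : R, forall n, rnorm (L n x) <= M) ->
  exists2 M : R, 0 < M & forall n x, rnorm (L n x) <= M * rnorm x.
Proof.
move=> cL bL; apply: contrapT => nM.
pose opb n : set R := [set rnorm (L n x) | x in [set x | rnorm x <= 1]].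
pose N n := sup (opb n).
have hs n : has_sup (opb n).
  split; first by exists (rnorm (L n 0)), 0 => //=; rewrite rnorm0.
  have [K K0 hK] := continuous_linear_bound (cL n).
  exists K => _ [x /= x1 <-]; apply: le_trans (hK x) _.
  by rewrite -[leRHS]mulr1 ler_wpM2l // ltW.
have N0 n : 0 <= N n.
  apply: le_trans (rnorm_ge0 (L n 0)) _; apply: ub_le_sup; first by case: (hs n).
  by exists 0 => //=; rewrite rnorm0.
have LN n x : rnorm (L n x) <= N n * rnorm x.
  have [->|x0] := eqVneq x 0; first by rewrite raddf0 !rnorm0 mulr0.
  have rx : 0 < rnorm x by rewrite lt_neqAle eq_sym rnorm_eq0P x0 rnorm_ge0.
  rewrite -ler_pdivrMr //.
  have -> : rnorm (L n x) / rnorm x = rnorm (L n ((rnorm x)^-1%:C *: x)).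
    by rewrite linearZ rnormZr ger0_norm 1?mulrC // invr_ge0 ltW.
  apply: ub_le_sup; first by case: (hs n).
  exists ((rnorm x)^-1%:C *: x) => //=.
  by rewrite rnormZr ger0_norm ?mulVf ?gt_eqF // invr_ge0 ltW.
have Ninf (M : R) : exists n, M < N n.
  apply: contrapT => h; apply: nM; exists (Num.max M 1).
    by rewrite lt_max ltr01 orbT.
  move=> n x; apply: le_trans (LN n x) _; apply: ler_wpM2r; first exact: rnorm_ge0.
  rewrite le_max; apply/orP; left; rewrite leNgt; apply/negP => hn; apply: h.
  by exists n.
(* Norms above [n * 3^n] leave images of size about [n] after a step of size [3^-n]. *)
have [k hk] := choice (fun n => Ninf (n%:R * 3 ^+ n)).
have Nk0 n : 0 < N (k n) by apply: le_lt_trans (hk n); rewrite mulr_ge0 // exprn_ge0.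
have step n (x : V) : exists y, rnorm (y - x) <= 3^-1 ^+ n /\
    3 / 4 * N (k n) * 3^-1 ^+ n <= rnorm (L (k n) y).
  have e0 : 0 < (3^-1 : R) ^+ n by rewrite exprn_gt0.
  have [_ [z /= z1 <-] hz] : exists2 r, opb (k n) r & 3 / 4 * N (k n) < r.
    apply: sup_gt; first by case: (hs (k n)).
    by rewrite -/(N (k n)) gtr_pMl //; lra.
  pose w := (3^-1 ^+ n)%:C *: z.
  have rw : rnorm w <= 3^-1 ^+ n.
    by rewrite rnormZr gtr0_norm // -[leRHS]mulr1 ler_pM2l.
  have hw : 3 / 4 * N (k n) * 3^-1 ^+ n <= rnorm (L (k n) w).
    by rewrite linearZ rnormZr gtr0_norm // mulrC ler_pM2l // ltW.
  (* [2 L w = L (x + w) - L (x - w)], so the larger of the two images is at least as long as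
     [L w]. *)
  have h2 : rnorm (L (k n) w) <=
      Num.max (rnorm (L (k n) (x + w))) (rnorm (L (k n) (x - w))).
    set m := Num.max _ _.
    have : rnorm (2%:C *: L (k n) w) <= m + m.
      have -> : 2%:C *: L (k n) w = L (k n) (x + w) - L (k n) (x - w).
        rewrite (raddfD (L (k n))) (raddfB (L (k n))); set a := L (k n) x; set b := L (k n) w.
        rewrite (_ : a + b - (a - b) = b + b); last first.
          by rewrite opprB addrCA; congr (_ + _); rewrite addrAC subrr add0r.
        by rewrite (_ : 2%:C = 1 + 1) ?scalerDl ?scale1r // -rmorphD.
      apply: le_trans (ler_rnormB _ _) _.
      by apply: lerD; rewrite le_max lexx ?orbT.
    by rewrite rnormZr ger0_norm // => h; lra.
  case: (leP (rnorm (L (k n) (x + w))) (rnorm (L (k n) (x - w)))) h2 => _ h2.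
    by exists (x - w); rewrite addrAC subrr add0r rnormN; split=> //; exact: le_trans h2.
  by exists (x + w); rewrite addrAC subrr add0r; split=> //; exact: le_trans h2.
have [f hf] := choice (fun p : nat * V => step p.1 p.2).
pose fix u n := if n is m.+1 then f (n, u m) else f (0%N, 0).
have u1 n : rnorm (u n.+1 - u n) <= 3^-1 ^+ n.+1 by case: (hf (n.+1, u n)).
have u2 n : 3 / 4 * N (k n) * 3^-1 ^+ n <= rnorm (L (k n) (u n)).
  by case: n => [|n]; [case: (hf (0%N, 0))|case: (hf (n.+1, u n))].
have ud n m : rnorm (u (n + m)%N - u n) <= 2^-1 * 3^-1 ^+ n * (1 - 3^-1 ^+ m).
  elim: m => [|m IH].
    by rewrite addn0 subrr rnorm0 expr0 subrr mulr0.
  apply: le_trans (ler_rnorm_dist (u (n + m)%N) _ _) _; rewrite addnS.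
  apply: le_trans (lerD (u1 _) IH) _; rewrite exprS exprD exprS.
  set a := 3^-1 ^+ n; set b := 3^-1 ^+ m.
  by rewrite le_eqVlt; apply/orP; left; apply/eqP; field.
have ud' n m : rnorm (u (n + m)%N - u n) <= 2^-1 * 3^-1 ^+ n.
  apply: le_trans (ud n m) _; rewrite -[leRHS]mulr1; apply: ler_wpM2l.
    by rewrite mulr_ge0 // exprn_ge0.
  by rewrite gerBl exprn_ge0.
have c3 : (3^-1 : R) ^+ n @[n --> \oo] --> (0 : R).
  by apply: cvg_expr; rewrite ger0_norm ?invf_lt1 // ltr1n.
have [l ul] : exists l : V, u n @[n --> \oo] --> l.
  apply: rnorm_cauchy_cvg => e e0.
  move/cvgr0Pnorm_lt : c3 => /(_ e e0)[M _ hM]; exists M => m n Mm Mn.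
  apply: le_lt_trans (ler_rnorm_dist (u M) _ _) _.
  apply: (@le_lt_trans _ _ (3^-1 ^+ M)); last first.
    by apply: le_lt_trans (ler_norm _) (hM M _) => /=.
  rewrite [X in _ + X]rnormC.
  have := ud' M (m - M)%N; have := ud' M (n - M)%N; rewrite !subnKC //.
  lra.
have lu n : rnorm (l - u n) <= 2^-1 * 3^-1 ^+ n.
  have : rnorm (u m - u n) @[m --> \oo] --> rnorm (l - u n).
    by apply: cvg_rnorm; apply: cvgB => //; exact: cvg_cst.
  move=> /cvgr_to_le; apply.
  by exists n => // m /= nm; rewrite -(subnKC nm).
have [M hM] := bL l.
(* The image of [u n] has norm at least 3/4 of [N (k n) * 3^-n] and that of [l - u n] at most 1/2 of
   it; the remaining quarter exceeds [n / 4], hence [M]. *)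
pose n := (Num.truncn (4 * M)).+1.
have Mn : 4 * M < n%:R by exact: truncnS_gt.
have e0 : 0 < (3^-1 : R) ^+ n by rewrite exprn_gt0.
have h1 : n%:R < N (k n) * 3^-1 ^+ n.
  by rewrite exprVn ltr_pdivlMr // exprn_gt0.
have h2 : rnorm (L (k n) (l - u n)) <= N (k n) * 3^-1 ^+ n / 2.
  apply: le_trans (LN _ _) _; rewrite -mulrA ler_wpM2l // mulrC; exact: lu.
have h3 := u2 n; have h4 := hM (k n).
have h5 : rnorm (L (k n) (u n)) <= rnorm (L (k n) l) + rnorm (L (k n) (l - u n)).
  by rewrite -[X in L _ X](subKr l) raddfB ler_rnormB.
set z := N (k n) * 3^-1 ^+ n in h1 h2; rewrite -mulrA -/z in h3.
lra.
Qed.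
End uniform_boundedness.

(** * Strong measurability *)

Section finite_valued.
Context (R : realType).
Implicit Types (T : Type).

(** The notion [simple] for an arbitrary codomain, so that pairs, booleans and integers can label
    the pieces when several simple functions are combined. *)
Definition fsimple T (s : R -> T) : Prop :=
  finite_set (range s) /\
  forall x, @measurable _ (measurableTypeR R) (s @^-1` [set x]).

Lemma fsimple_preimage T (s : R -> T) (A : set T) : fsimple s ->
  @measurable _ (measurableTypeR R) (s @^-1` A).
Proof.
move=> [fs ms].
have -> : s @^-1` A = \bigcup_(x in range s `&` A) (s @^-1` [set x]).
  apply/seteqP; split=> [t At|t [x [_ Ax] /= ->]//].
  by exists (s t) => //; split => //; exists t.
by apply: fin_bigcup_measurable => [|x _]; [exact: finite_setIl | exact: ms].
Qed.

Lemma fsimple_comp T1 T2 (g : T1 -> T2) (s : R -> T1) :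
  fsimple s -> fsimple (g \o s).
Proof.
move=> hs; split; last by move=> x; rewrite comp_preimage; exact: fsimple_preimage.
by have := finite_image g (proj1 hs); rewrite image_comp.
Qed.

Lemma fsimple_pair T1 T2 (s1 : R -> T1) (s2 : R -> T2) :
  fsimple s1 -> fsimple s2 -> fsimple (fun t => (s1 t, s2 t)).
Proof.
move=> [f1 m1] [f2 m2]; split.
  apply: (sub_finite_set _ (finite_setX f1 f2)) => _ [t _ <-] /=.
  by split; exists t.
move=> [x y]; have -> : (fun t => (s1 t, s2 t)) @^-1` [set (x, y)] =
  (s1 @^-1` [set x]) `&` (s2 @^-1` [set y]).
  by apply/seteqP; split=> [t [/= -> ->]|t [/= -> ->]].
exact: measurableI.
Qed.

Lemma fsimple_comp2 T1 T2 T3 (g : T1 -> T2 -> T3) (s1 : R -> T1) (s2 : R -> T2) :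
  fsimple s1 -> fsimple s2 -> fsimple (fun t => g (s1 t) (s2 t)).
Proof.
by move=> h1 h2; apply: (fsimple_comp (fun p => g p.1 p.2) (fsimple_pair h1 h2)).
Qed.

Lemma fsimple_cst T (x : T) : fsimple (fun=> x).
Proof.
split; first by apply: (sub_finite_set _ (finite_set1 x)) => _ [t _ <-].
move=> y; have [->|xy] := pselect (y = x).
  by rewrite (_ : _ @^-1` _ = setT) //; apply/seteqP; split.
by rewrite (_ : _ @^-1` _ = set0) //; apply/seteqP; split => // t /= /esym.
Qed.

Lemma fsimple_bool (b : R -> bool) :
  @measurable _ (measurableTypeR R) [set t | b t] -> fsimple b.
Proof.
move=> mb; split; first exact: finite_finset.
case; first by [].
rewrite (_ : _ @^-1` _ = ~` [set t | b t]); first exact: measurableC.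
by apply/seteqP; split=> t /=; [move=> -> | move/negP/negbTE].
Qed.

Lemma fsimple_in (D : set R) : @measurable _ (measurableTypeR R) D ->
  fsimple (fun t => t \in D).
Proof.
move=> mD; apply: fsimple_bool; rewrite (_ : [set t | _] = D) //.
by apply/seteqP; split=> t /=; rewrite inE.
Qed.

(** The line splits along the finitely many values of [s], and on each piece a single [phi x]
    acts. *)
Lemma measurable_fsimple_dep T (s : R -> T) (phi : T -> R -> R) : fsimple s ->
  (forall x, measurable_fun setT (phi x)) ->
  measurable_fun setT (fun t => phi (s t) t).
Proof.
move=> [fs ms] mphi _ B mB; rewrite setTI.
have -> : (fun t => phi (s t) t) @^-1` B =
    \bigcup_(x in range s) ((s @^-1` [set x]) `&` (phi x @^-1` B)).
  apply/seteqP; split=> [t Bt|t [x _ [/= <-]]//].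
  by exists (s t) => //; exists t.
apply: fin_bigcup_measurable => // x _; apply: measurableI; first exact: ms.
by rewrite -[X in measurable X]setTI; exact: mphi.
Qed.

(* Within [1 / n] of the identity once [n] exceeds [`|t|]. *)
Definition dsc (n : nat) (t : R) : R :=
  if `|t| < n%:R then (Num.floor (n%:R * t))%:~R / n%:R else 0.

Lemma fsimple_dsc n : fsimple (dsc n).
Proof.
have h : fsimple (fun t : R => if `|t| < n%:R then Num.floor (n%:R * t) else 0).
  split.
    (* For [|t| < n] the floor lies between [-n^2] and [n^2]; adding [n^2] indexes its values by
       natural numbers. *)
    apply: (@sub_finite_set _ _ ((fun k : nat => k%:Z - (n * n)%:Z) @` `I_(n * n + n * n).+1)).
      move=> _ [t _ <-] /=; have [tn|tn] := ltP `|t| n%:R; last first.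
        exists (n * n)%N; last by rewrite subrr.
        by rewrite /= ltnS leq_addr.
      move: tn; rewrite ltr_norml => /andP[t1 t2].
      have f1 : - (n * n)%:Z <= Num.floor (n%:R * t).
        rewrite floor_ge_int rmorphN /= -pmulrn natrM -mulrN.
        by rewrite ler_wpM2l // ltW.
      have f2 : Num.floor (n%:R * t) <= (n * n)%:Z.
        rewrite -(ler_int R) (le_trans (floor_le _)) // -pmulrn natrM.
        by rewrite ler_wpM2l // ltW.
      exists (absz (Num.floor (n%:R * t) + (n * n)%:Z)) => /=; last first.
        by rewrite gez0_abs ?addrK //; lia.
      by lia.
    exact/finite_image/finite_II.
  have mb : fsimple (fun t : R => `|t| < n%:R).
    apply: fsimple_bool.
    rewrite (_ : [set t | _] = `]- n%:R, n%:R[%classic); first exact: measurable_itv.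
    by apply/seteqP; split=> t /=; rewrite ltr_norml in_itv.
  move=> z; pose A : set R := [set t | z%:~R <= n%:R * t] `&` [set t | n%:R * t < (z + 1)%:~R].
  have mA : @measurable _ (measurableTypeR R) A.
    have mn : measurable_fun setT (fun t : R => n%:R * t) by apply: measurable_funM.
    apply: measurableI.
      have := measurable_fun_ler (measurable_cst (z%:~R : R)) mn.
      by move=> /(_ measurableT [set true] I); rewrite setTI.
    have := measurable_fun_ltr mn (measurable_cst ((z + 1)%:~R : R)).
    by move=> /(_ measurableT [set true] I); rewrite setTI.
  (* Only the preimage of [z] matters: [z + 1] stands for any other floor value, and the 0
     reproduces the default, which counts when [z = 0]. *)
  have := fsimple_comp2 (fun a b => if a then (if b then z else z + 1) else 0) mb (fsimple_in mA).
  move=> /(fsimple_preimage [set z]); congr measurable.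
  apply/seteqP; split=> t /=; case: ifP => // _.
    case: ifPn => // tA /eqP; first rewrite /=.
      by move=> _; apply/floor_def; move: tA; rewrite inE => -[/= -> ->].
    by rewrite -subr_eq0 addrAC subrr add0r oner_eq0.
  move=> tz; rewrite ifT // inE; split=> /=; rewrite -tz.
    exact: floor_le.
  exact: floorD1_gt.
have := fsimple_comp (fun z : int => (z%:~R / n%:R : R)) h.
congr fsimple; apply/funext => t /=; rewrite /dsc; case: ifP => //.
by rewrite mul0r.
Qed.

Lemma dsc_cvg t : dsc n t @[n --> \oo] --> t.
Proof.
apply/cvgrPdist_lt => e e0; near=> n.
have n0 : 0 < n%:R :> R by near: n; exists 1%N => // k /=; rewrite ltr0n.
rewrite /dsc ifT; last by near: n; exact: nbhs_infty_gtr.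
have f1 := floor_le (n%:R * t); have f2 := floorD1_gt (n%:R * t).
rewrite ltr_norml; apply/andP; split.
  apply: (@lt_le_trans _ _ 0); first by rewrite oppr_lt0.
  by rewrite subr_ge0 ler_pdivrMr // (mulrC t).
rewrite ltrBlDr -ltrBlDl ltr_pdivlMr // mulrBl (mulrC t).
apply: le_lt_trans (_ : n%:R * t - 1 < _); last by move: f2; rewrite intrD; lra.
rewrite lerD2l lerN2 -ler_pdivrMl // mulr1.
by near: n; exact: nbhs_infty_ger.
Unshelve. all: by end_near. Qed.

End finite_valued.

Section nice_functions.
Context (R : realType) (V : normedModType R[i]).
Implicit Types (f : R -> V).

(* Strong measurability in Pettis' form (separable range, measurable
   distances), with no exceptional null set. *)
Definition smeas f : Prop :=
  (exists x : nat -> V, x 0%N = 0 /\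
     forall t (e : R), 0 < e -> exists n, rnorm (f t - x n) < e) /\
  forall y, measurable_fun setT (fun t => rnorm (f t - y)).

Lemma smeas_rnorm f : smeas f -> measurable_fun setT (fun t => rnorm (f t)).
Proof.
by move=> [_ /(_ 0)]; congr measurable_fun; apply/funext => t; rewrite subr0.
Qed.

Lemma smeas_fsimple f : fsimple f -> smeas f.
Proof.
move=> hf; have [ff _] := hf; split; last first.
  by move=> y; exact: (measurable_fsimple_dep (phi := fun x _ => rnorm (x - y)) hf).
have /finite_seqP[r hr] := ff.
exists (fun n => if n is m.+1 then nth 0 r m else 0); split=> // t e e0.
have : f t \in r by have : range f (f t) by [exists t]; rewrite hr.
move=> /(nthP 0)[i _ hi]; exists i.+1.
by rewrite hi subrr rnorm0.
Qed.

Lemma smeas_lim (F : nat -> R -> V) f : (forall n, smeas (F n)) ->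
  (forall t, F n t @[n --> \oo] --> f t) -> smeas f.
Proof.
move=> hF Ff; split.
  have [x hx] := choice (fun n => proj1 (hF n)).
  (* A pairing merges the countable sets attached to all the [F n]; index 0 is reserved for the
     vector 0. *)
  exists (fun k => if k is m.+1 then
    (if unpickle m is Some (i, j) then x i j else 0) else 0); split=> // t e e0.
  have /cvg_rnormP/cvgr0Pnorm_lt/(_ (e / 2)) := Ff t.
  rewrite divr_gt0 // => /(_ isT)[n _ /(_ n (leqnn n))] /=.
  rewrite ger0_norm ?rnorm_ge0 // => h1.
  have [_ /(_ t (e / 2))] := hx n; rewrite divr_gt0 // => /(_ isT)[m h2].
  exists (pickle (n, m)).+1; rewrite pickleK.
  apply: le_lt_trans (ler_rnorm_dist (F n t) _ _) _; rewrite rnormC.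
  by rewrite [ltRHS]splitr ltrD.
move=> y; apply: (@measurable_fun_cvg _ _ _ _ (fun n t => rnorm (F n t - y))).
  by move=> n; case: (hF n).
move=> t _; apply: (@cvg_rnorm R V); apply: cvgB; [exact: Ff|exact: cvg_cst].
Qed.

(** [s n t] is a nearest point to [f t] among the first [n + 1] points of the dense sequence. As
    this sequence starts with 0, the error is at most the norm of [f t], which provides the majorant
    in dominated convergence. *)
Lemma smeas_approx f : smeas f -> exists s : nat -> R -> V,
  [/\ forall n, fsimple (s n), forall n t, rnorm (f t - s n t) <= rnorm (f t) &
      forall t, s n t @[n --> \oo] --> f t].
Proof.
move=> [[x [x0 hx]] mf].
pose fix s n t {struct n} := if n is m.+1 then
  (if rnorm (f t - x m.+1) < rnorm (f t - s m t) then x m.+1 else s m t) else x 0%N.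
have ss n : fsimple (s n).
  elim: n => [|n IH]; first exact: fsimple_cst.
  apply: (fsimple_comp2 (fun (b : bool) y => if b then x n.+1 else y) _ IH).
  apply: fsimple_bool.
  have := measurable_fun_ltr (mf (x n.+1))
    (measurable_fsimple_dep (phi := fun y t => rnorm (f t - y)) IH mf).
  by move=> /(_ measurableT [set true] I); rewrite setTI.
have smin n t m : (m <= n)%N -> rnorm (f t - s n t) <= rnorm (f t - x m).
  elim: n => [|n IH]; first by rewrite leqn0 => /eqP ->.
  rewrite leq_eqVlt ltnS => /orP[/eqP ->|/IH h] /=; case: ltP => // h2.
  by apply: le_trans h; exact: ltW.
exists s; split=> //.
  by move=> n t; rewrite -[X in _ <= rnorm X]subr0 -x0; exact: smin.
move=> t; apply/cvg_rnormP/cvgr0Pnorm_lt => e e0.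
have [n hn] := hx t e e0; exists n => // m /= nm.
by rewrite ger0_norm ?rnorm_ge0 // rnormC (le_lt_trans _ hn) // smin.
Qed.

Lemma smeas_add f g : smeas f -> smeas g -> smeas (fun t => f t + g t).
Proof.
move=> /smeas_approx[s [s1 _ s2]] /smeas_approx[s' [s1' _ s2']].
apply: (@smeas_lim (fun n t => s n t + s' n t)).
  by move=> n; apply: smeas_fsimple; exact: fsimple_comp2.
by move=> t; apply: cvgD.
Qed.

Lemma smeas_cst (x : V) : smeas (fun=> x).
Proof. exact/smeas_fsimple/fsimple_cst. Qed.

Lemma smeas_if (b : R -> bool) f g : @measurable _ (measurableTypeR R) [set t | b t] ->
  smeas f -> smeas g -> smeas (fun t => if b t then f t else g t).
Proof.
move=> mb /smeas_approx[s [s1 _ s2]] /smeas_approx[s' [s1' _ s2']].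
apply: (@smeas_lim (fun n t => if b t then s n t else s' n t)).
  move=> n; apply: smeas_fsimple.
  exact: (fsimple_comp2 (fun (b : bool) (p : V * V) => if b then p.1 else p.2)
    (fsimple_bool mb) (fsimple_pair (s1 n) (s1' n))).
by move=> t; case: ifP.
Qed.

Lemma smeas_indic (D : set R) f : @measurable _ (measurableTypeR R) D ->
  smeas f -> smeas (fun t => if t \in D then f t else 0).
Proof.
move=> mD hf; apply: smeas_if => //; last exact: smeas_cst.
rewrite (_ : [set t | _] = D) //.
by apply/seteqP; split=> t /=; rewrite inE.
Qed.

Lemma smeas_comp f (h : R -> R) : measurable_fun setT h -> smeas f -> smeas (f \o h).
Proof.
move=> mh [[x [x0 hx]] mf]; split; first by exists x; split=> // t; exact: hx.
by move=> y; exact: (measurableT_comp (mf y) mh).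
Qed.

End nice_functions.

Section caratheodory.
Context (R : realType) (V W : normedModType R[i]).

(** With time frozen on the grid [dsc m] and [f] replaced by a simple function, only finitely many
    values occur; the two limits are then taken in turn. Separate continuity suffices, as for a
    strongly continuous semigroup applied to a function. *)
Lemma smeas_car (Phi : R -> V -> W) (f : R -> V) :
  (forall x, continuous (Phi ^~ x)) -> (forall t, continuous (Phi t)) ->
  smeas f -> smeas (fun t => Phi t (f t)).
Proof.
move=> c1 c2 /smeas_approx[s [s1 _ s2]].
apply: (@smeas_lim _ _ (fun n t => Phi t (s n t))) => [n|t]; last first.
  exact: (@cvg_comp _ _ _ (s ^~ t) (Phi t) _ _ _ (s2 t) (c2 t (f t))).
apply: (@smeas_lim _ _ (fun m t => Phi (dsc m t) (s n t))) => [m|t].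
  apply: smeas_fsimple; exact: (fsimple_comp2 Phi (fsimple_dsc _ m) (s1 n)).
exact: (@cvg_comp _ _ _ (fun m => dsc m t) (Phi ^~ (s n t)) _ _ _ (@dsc_cvg R t) (c1 _ t)).
Qed.

Lemma smeas_continuous_comp (L : V -> W) f : continuous L -> smeas f -> smeas (L \o f).
Proof.
move=> cL; apply: (smeas_car (Phi := fun=> L)) => // x; exact: cst_continuous.
Qed.

Lemma smeas_continuous (f : R -> V) : continuous f -> smeas f.
Proof.
move=> cf; apply: (@smeas_lim _ _ (fun m t => f (dsc m t))) => [m|t].
  apply: smeas_fsimple; exact: (fsimple_comp f (fsimple_dsc _ m)).
exact: (@cvg_comp _ _ _ (fun m => dsc m t) f _ _ _ (@dsc_cvg R t) (cf t)).
Qed.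

End caratheodory.

Section strongly_measurable.
Context (R : realType) (V : normedModType R[i]).
Notation mu := (@lebesgue_measure R).

(** The function is set to 0 outside [D] and on the null set where the simple functions may fail to
    converge. *)
Lemma strongly_measurable_smeas (D : set R) (f : R -> V) :
  @measurable _ (measurableTypeR R) D -> strongly_measurable D f ->
  exists g (N : set R), [/\ smeas g, @measurable _ (measurableTypeR R) N, mu N = 0%E,
    forall t, D t -> ~ N t -> f t = g t & forall t, ~ D t -> g t = 0].
Proof.
move=> mD [s [ss [N [mN N0 sN]]]].
have mDN : @measurable _ (measurableTypeR R) (D `\` N) by exact: measurableD.
exists (fun t => if t \in D `\` N then f t else 0), N; split=> //.
- apply: (@smeas_lim _ _ (fun n t => if t \in D `\` N then s n t else 0)).
    by move=> n; apply: smeas_indic => //; apply: smeas_fsimple; exact: ss.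
  move=> t; case: ifPn => [|_]; last exact: cvg_cst.
  rewrite inE => -[Dt Nt]; apply: contrapT => h; apply: Nt; apply: sN => /=.
  by apply: contra_not h; exact.
- by move=> t Dt Nt; rewrite ifT // inE.
- by move=> t Dt; rewrite ifF //; apply/negbTE; rewrite notin_setE => -[].
Qed.

Lemma smeas_strongly_measurable (D N : set R) (f g : R -> V) :
  smeas g -> @measurable _ (measurableTypeR R) N -> mu N = 0%E ->
  (forall t, D t -> ~ N t -> f t = g t) -> strongly_measurable D f.
Proof.
move=> /smeas_approx[s [s1 _ s2]] mN N0 fg; exists s; split; first exact: s1.
exists N; split=> // t /= h; apply: contrapT => Nt; apply: h => Dt.
by rewrite fg.
Qed.

End strongly_measurable.

(** * Integrals of nonnegative real functions *)

Section real_integrals.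
Context (R : realType).
Notation mu := (@lebesgue_measure R).
Implicit Types (F G : R -> R).

Import HBNNSimple.

(** The integral is a supremum over simple functions lying below the integrand; cutting such a
    function to 0 on [N] keeps its integral and puts it below the other integrand. This covers
    integrands that are not known to be measurable. *)
Lemma ge0_integral_null (N : set R) (F G : R -> \bar R) :
  @measurable _ (measurableTypeR R) N -> mu N = 0%E ->
  (forall t, (0 <= F t)%E) -> (forall t, (0 <= G t)%E) ->
  (forall t, ~ N t -> F t = G t) ->
  (\int[mu]_t F t = \int[mu]_t G t)%E.
Proof.
move=> mN N0.
suff h (F' G' : R -> \bar R) : (forall t, (0 <= F' t)%E) ->
    (forall t, (0 <= G' t)%E) -> (forall t, ~ N t -> F' t = G' t) ->
    (\int[mu]_t F' t <= \int[mu]_t G' t)%E.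
  by move=> F0 G0 FG; apply/eqP; rewrite eq_le !h // => t /FG.
move=> F0 G0 FG; rewrite !ge0_integralTE //.
apply: ge_ereal_sup => _ [k /= kF <-].
pose k' := proj_nnsfun k (measurableC mN).
rewrite -integralT_nnsfun.
have -> : (\int[mu]_x (k x)%:E = \int[mu]_x (k' x)%:E)%E.
  apply: ge0_ae_eq_integral => //.
  - exact/measurable_EFinP.
  - exact/measurable_EFinP.
  - by move=> t _; rewrite lee_fin.
  - by move=> t _; rewrite lee_fin.
  exists N; split=> // t /= h; apply: contrapT => Nt; apply: h => _.
  by rewrite /k' /= mindicE mem_set // mulr1.
rewrite integralT_nnsfun; apply: ereal_sup_ubound; exists k' => //= t.
rewrite mindicE; have [Nt|Nt] := pselect (N t).
  by rewrite memNset ?mulr0 //; exact.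
by rewrite mem_set // mulr1 -FG.
Qed.

Lemma le_integralT F G : measurable_fun setT F -> measurable_fun setT G ->
  (forall t, 0 <= F t <= G t) ->
  (\int[mu]_t (F t)%:E <= \int[mu]_t (G t)%:E)%E.
Proof.
move=> mF mG FG; apply: ge0_le_integral => //.
- by move=> t _; rewrite lee_fin; case/andP: (FG t).
- exact/measurable_EFinP.
- exact/measurable_EFinP.
- by move=> t _; rewrite lee_fin; case/andP: (FG t).
Qed.

Lemma integralTD F G : measurable_fun setT F -> measurable_fun setT G ->
  (forall t, 0 <= F t) -> (forall t, 0 <= G t) ->
  (\int[mu]_t (F t + G t)%:E = \int[mu]_t (F t)%:E + \int[mu]_t (G t)%:E)%E.
Proof.
move=> mF mG F0 G0; under eq_integral do rewrite EFinD.
rewrite ge0_integralD //.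
- by move=> t _; rewrite lee_fin.
- exact/measurable_EFinP.
- by move=> t _; rewrite lee_fin.
- exact/measurable_EFinP.
Qed.

Lemma integralTZ (c : R) F : measurable_fun setT F -> (forall t, 0 <= F t) -> 0 <= c ->
  (\int[mu]_t (c * F t)%:E = c%:E * \int[mu]_t (F t)%:E)%E.
Proof.
move=> mF F0 c0; under eq_integral do rewrite EFinM.
rewrite ge0_integralZl_EFin //.
- by move=> t _; rewrite lee_fin.
- exact/measurable_EFinP.
Qed.

Lemma integralT_ge0 F : (forall t, 0 <= F t) -> (0 <= \int[mu]_t (F t)%:E)%E.
Proof. by move=> F0; apply: integral_ge0 => t _; rewrite lee_fin. Qed.

Lemma dominated_cvg0T (F : nat -> R -> R) G :
  (forall n, measurable_fun setT (F n)) -> measurable_fun setT G ->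
  (forall n t, 0 <= F n t <= G t) ->
  (\int[mu]_t (G t)%:E < +oo)%E ->
  (forall t, F n t @[n --> \oo] --> (0 : R)) ->
  (\int[mu]_t (F n t)%:E)%E @[n --> \oo] --> 0%E.
Proof.
move=> mF mG FG G1 F0.
have G0 t : 0 <= G t by case/andP: (FG 0%N t) => /le_trans h /h.
have iG : mu.-integrable setT (EFin \o G).
  apply/integrableP; split; first exact/measurable_EFinP.
  by under eq_integral do rewrite /= ger0_norm //.
have [||||//|_ _] := @dominated_convergence _ _ _ mu setT measurableT
  (fun n => EFin \o F n) (cst 0%E) (EFin \o G).
- by move=> n; apply/measurable_EFinP; exact: mF.
- exact: measurable_cst.
- by apply: aeW => t _; apply: cvg_EFin; [exact: nearW|exact: F0].
- exact: iG.
- apply: aeW => t n _ /=; case/andP: (FG n t) => h1 h2.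
  by rewrite lee_fin ger0_norm.
by rewrite integral0.
Qed.

Lemma cvge0_near_lt (d : nat -> \bar R) : d n @[n --> \oo] --> 0%E ->
  forall e : R, 0 < e -> \forall n \near \oo, (d n < e%:E)%E.
Proof.
move=> d0 e e0; have [fd] := (fine_cvgP _ _).1 d0.
move=> /cvgr0Pnorm_lt /(_ e e0); apply: filterS2 fd => n fd h.
by rewrite -(fineK fd) lte_fin (le_lt_trans (ler_norm _)).
Qed.

End real_integrals.

(** * The Bochner integral *)

Section simple_integrals.
Context (R : realType) (V : normedModType R[i]).
Notation mu := (@lebesgue_measure R).

Lemma integral_label (I : choiceType) (l : R -> I) (g : I -> R) : fsimple l ->
  (forall i, 0 <= g i) ->
  (\int[mu]_t (g (l t))%:E = \sum_(i \in range l) mu (l @^-1` [set i]) * (g i)%:E)%E.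
Proof.
move=> [fl ml] g0.
transitivity (\int[mu]_t (\sum_(i \in range l) (g i * \1_(l @^-1` [set i]) t)%:E))%E.
  apply: eq_integral => t _; rewrite (fsbigD1 (l t)) //=; last by exists t.
  rewrite indicE mem_set // mulr1 fsbig1 ?adde0 // => i [_ /= /eqP il].
  by rewrite indicE memNset ?mulr0 //= => /esym/eqP; rewrite (negbTE il).
rewrite ge0_integral_fsum //; last 2 first.
- by move=> i; apply/measurable_EFinP; apply: measurable_funM => //; apply: measurable_indic; exact: ml.
- by move=> i t _; rewrite lee_fin mulr_ge0.
apply: eq_fsbigr => i _; rewrite integralTZ //.
- by rewrite integral_indic // setIT muleC.
- by apply: measurable_indic; exact: ml.
Qed.

(** The label may be finer than the level sets of the integrand. Linearity follows by labelling with
    the pair of values of two simple functions. *)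
Lemma simple_integral_label (I : choiceType) (l : R -> I) (phi : I -> V) :
  fsimple l -> (forall i, phi i != 0 -> (mu (l @^-1` [set i]) < +oo)%E) ->
  simple_integral setT (phi \o l) =
  \sum_(i \in range l) (fine (mu (l @^-1` [set i])))%:C *: phi i.
Proof.
move=> hl fin; have [fl ml] := hl.
pose c i := (fine (mu (l @^-1` [set i]))).
have fB : finite_set (range (phi \o l)) by case: (fsimple_comp phi hl).
rewrite /simple_integral.
transitivity (\sum_(z \in range (phi \o l)) \sum_(i \in range l)
   (if phi i == z then (c i)%:C *: phi i else 0)); last first.
  rewrite exchange_fsbig //; apply: eq_fsbigr => i /set_mem[t _ <-].
  rewrite (fsbigD1 (phi (l t))) //=; last by exists t.
  rewrite eqxx fsbig1 ?addr0 // => z [_ /= /eqP].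
  by rewrite eq_sym => /negbTE ->.
apply: eq_fsbigr => z _; rewrite setTI.
have [->|z0] := eqVneq z 0.
  by rewrite scaler0 fsbig1 // => i _; case: eqP => // ->; rewrite scaler0.
have fz : finite_set (range l `&` phi @^-1` [set z]) by exact: finite_setIl.
rewrite -(fsbig_widen (range l `&` phi @^-1` [set z])) //=; last first.
  by move=> i [li /not_andP[//|/= /eqP/negbTE ->]].
rewrite fsbig_finite //.
transitivity (\sum_(i <- finmap.enum_fset (fset_set (range l `&` phi @^-1` [set z]))) (c i)%:C *: z); last first.
  apply: eq_big_seq => i; rewrite in_fset_set // inE => -[_ /= ->].
  by rewrite eqxx.
rewrite -scaler_suml -rmorph_sum /=; congr (_%:C *: _).
rewrite (_ : _ @^-1` [set z] = \big[setU/set0]_(i \in range l `&` phi @^-1` [set z])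
    (l @^-1` [set i])); last first.
  rewrite fsbig_setU //; apply/seteqP; split=> [t /= tz|t [i [_ /= iz] /= lt]].
    by exists (l t) => //; split=> //; exists t.
  by rewrite lt.
rewrite measure_fsbig //; last first.
  by apply/trivIsetP => i j _ _ ij; apply/seteqP; split => // t [/= -> /eqP]; rewrite (negbTE ij).
rewrite fsbig_finite //.
transitivity (fine (\sum_(i <- finmap.enum_fset (fset_set (range l `&` phi @^-1` [set z]))) (c i)%:E)%E).
  congr fine; apply: eq_big_seq => i; rewrite in_fset_set // inE => -[_ /= iz].
  by rewrite fineK // ge0_fin_numE // fin // iz.
by rewrite sumEFin.
Qed.

Lemma simple_integral_in (D : set R) (s : R -> V) :
  simple s -> @measurable _ (measurableTypeR R) D ->
  simple_integral D s = simple_integral setT (fun t => if t \in D then s t else 0).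
Proof.
move=> ss mD; set s' := fun t => _.
have ss' : fsimple s'.
  exact: (fsimple_comp2 (fun (b : bool) x => if b then x else 0) (fsimple_in mD) ss).
rewrite /simple_integral (fsbig_widen (range s) (range s `|` range s')) //=; last first.
- move=> x [_ Nx] /=; rewrite (_ : _ `&` _ = set0) ?measure0 /= ?scale0r //.
  by apply/seteqP; split=> // t [_ /= tx]; apply: Nx; exists t.
rewrite (fsbig_widen (range s') (range s `|` range s')) //=; last first.
- move=> x [_ Nx] /=; rewrite (_ : _ `&` _ = set0) ?measure0 /= ?scale0r //.
  by apply/seteqP; split=> // t [_ /= tx]; apply: Nx; exists t.
apply: eq_fsbigr => x _; have [->|x0] := eqVneq x 0; first by rewrite !scaler0.
congr (_%:C *: _); congr fine; congr (mu _).
apply/seteqP; split=> t /=; rewrite /s'.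
  by move=> [Dt <-]; rewrite mem_set.
move=> [_]; have [Dt|Dt] := pselect (D t); first by rewrite mem_set.
by rewrite memNset // => /esym/eqP; rewrite (negbTE x0).
Qed.

Lemma simple_integrableP (s : R -> V) :
  simple_integrable setT s <-> fsimple s /\ (\int[mu]_t (rnorm (s t))%:E < +oo)%E.
Proof.
split=> [[ss fs]|[ss fs]].
  split=> //; rewrite (integral_label (g := fun x => rnorm x) ss); last first.
    exact: rnorm_ge0.
  rewrite fsbig_finite //=; last by case: ss.
  apply: lte_sum_pinfty => x _; have [->|x0] := eqVneq x 0.
    by rewrite rnorm0 mule0.
  have := fs x x0; rewrite setTI => h.
  by rewrite -ge0_fin_numE ?mule_ge0 ?lee_fin ?rnorm_ge0 // fin_numM // ge0_fin_numE.
split=> // x x0; rewrite setTI; have rx : 0 < rnorm x.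
  by rewrite lt_neqAle eq_sym rnorm_eq0P x0 rnorm_ge0.
have ms : @measurable _ (measurableTypeR R) (s @^-1` [set x]) by exact: (proj2 ss).
rewrite ltey; apply/negP => /eqP h.
(* Chebyshev: a nonzero value taken on a set of infinite measure would make the integral
   infinite. *)
have : (\int[mu]_t (rnorm x * \1_(s @^-1` [set x]) t)%:E <= \int[mu]_t (rnorm (s t))%:E)%E.
  apply: le_integralT.
  - by apply: measurable_funM => //; exact: measurable_indic.
  - by apply: smeas_rnorm; exact: smeas_fsimple.
  - move=> t; rewrite mulr_ge0 ?rnorm_ge0 //= indicE.
    have [tx|tx] := eqVneq (s t) x; first by rewrite mem_set // mulr1 tx.
    by rewrite memNset ?mulr0 ?rnorm_ge0 //; apply/eqP.
rewrite integralTZ; [|exact: measurable_indic|by move=> t; rewrite indicE|exact: rnorm_ge0].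
have -> : (\int[mu]_t (\1_(s @^-1` [set x]) t)%:E = +oo)%E.
  by rewrite integral_indic // setIT; exact: h.
by rewrite gt0_muley ?lte_fin // leNgt fs.
Qed.

Lemma rnorm_simple_integral (s : R -> V) : simple_integrable setT s ->
  ((rnorm (simple_integral setT s))%:E <= \int[mu]_t (rnorm (s t))%:E)%E.
Proof.
move=> [ss fs]; have fr : finite_set (range s) by case: ss.
rewrite (integral_label (g := fun x => rnorm x) ss); last exact: rnorm_ge0.
rewrite /simple_integral !fsbig_finite //=.
apply: (@le_trans _ _ (\sum_(x <- finmap.enum_fset (fset_set (range s)))
    (fine (mu (s @^-1` [set x])) * rnorm x)%:E)%E).
  rewrite sumEFin lee_fin; apply: le_trans (ler_rnorm_sum _ _ _) _.
  apply: ler_sum => x _; rewrite rnormZr setTI ger0_norm //.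
  exact: fine_ge0.
apply: lee_sum => x _; have [->|x0] := eqVneq x 0.
  by rewrite rnorm0 mulr0 mule0.
have := fs x x0; rewrite setTI => h.
by rewrite EFinM fineK // ge0_fin_numE.
Qed.

Lemma simple_integral_lin (a b : R[i]) (s1 s2 : R -> V) :
  simple_integrable setT s1 -> simple_integrable setT s2 ->
  simple_integral setT (fun t => a *: s1 t + b *: s2 t) =
  a *: simple_integral setT s1 + b *: simple_integral setT s2.
Proof.
move=> [ss1 f1] [ss2 f2]; pose l t := (s1 t, s2 t).
have hl : fsimple l := fsimple_pair ss1 ss2.
have fl : finite_set (range l) by case: hl.
have fin p : p != (0, 0) -> (mu (l @^-1` [set p]) < +oo)%E.
  have ml : @measurable _ (measurableTypeR R) (l @^-1` [set p]) by case: hl.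
  case: p ml => x y ml; rewrite xpair_eqE negb_and => /orP[x0|y0].
    apply: le_lt_trans (f1 x x0); rewrite setTI; apply: le_measure; rewrite ?inE //.
      exact: (proj2 ss1).
    by move=> t /= [].
  apply: le_lt_trans (f2 y y0); rewrite setTI; apply: le_measure; rewrite ?inE //.
    exact: (proj2 ss2).
  by move=> t /= [].
rewrite (simple_integral_label (phi := fun p => a *: p.1 + b *: p.2) hl); last first.
  by move=> p h; apply: fin; apply: contra_neq h => ->; rewrite !scaler0 addr0.
rewrite (simple_integral_label (phi := fst) hl); last first.
  by move=> p p0; apply: fin; apply: contra_neq p0 => ->.
rewrite (simple_integral_label (phi := snd) hl); last first.
  by move=> p p0; apply: fin; apply: contra_neq p0 => ->.
rewrite !fsbig_finite // !scaler_sumr -big_split /=; apply: eq_bigr => p _.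
by rewrite scalerDr !scalerA ![_%:C * _]mulrC.
Qed.

End simple_integrals.

Section bochner.
Context (R : realType) (V : normedModType R[i]).
Notation mu := (@lebesgue_measure R).
Implicit Types (f g : R -> V) (s : nat -> R -> V).

Definition nint f : \bar R := (\int[mu]_t (rnorm (f t))%:E)%E.

Definition binteg f : Prop := smeas f /\ (nint f < +oo)%E.

Definition bint f : V := bochner_integral setT f.

Lemma nint_ge0 f : (0 <= nint f)%E.
Proof. by apply: integralT_ge0 => t; exact: rnorm_ge0. Qed.

Lemma nint_le f g : smeas f -> smeas g -> (forall t, rnorm (f t) <= rnorm (g t)) ->
  (nint f <= nint g)%E.
Proof.
move=> hf hg fg; apply: le_integralT; [exact: smeas_rnorm|exact: smeas_rnorm|].
by move=> t; rewrite rnorm_ge0 fg.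
Qed.

Lemma smeas_scale (a : R[i]) f : smeas f -> smeas (fun t => a *: f t).
Proof.
by move=> hf; apply: (smeas_continuous_comp (L := fun x => a *: x)) => // x; apply: scaler_continuous.
Qed.

Lemma smeas_opp f : smeas f -> smeas (fun t => - f t).
Proof.
by move=> /(smeas_scale (-1)); congr smeas; apply/funext => t; rewrite scaleN1r.
Qed.

Lemma smeas_sub f g : smeas f -> smeas g -> smeas (fun t => f t - g t).
Proof. by move=> hf /smeas_opp hg; exact: smeas_add. Qed.

Lemma nint_scale (a : R[i]) f : smeas f ->
  nint (fun t => a *: f t)%R = ((complex.Re `|a|)%:E * nint f)%E.
Proof.
move=> hf; rewrite /nint; under eq_integral do rewrite rnormZ.
rewrite integralTZ //; first exact: smeas_rnorm.
  by move=> t; exact: rnorm_ge0.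
exact: (@rnorm_ge0 R (R[i]^o)).
Qed.

Lemma nint_opp f : nint (fun t => - f t)%R = nint f.
Proof. by apply: eq_integral => t _; rewrite rnormN. Qed.

Lemma nint_add f g : smeas f -> smeas g ->
  (nint (fun t => f t + g t)%R <= nint f + nint g)%E.
Proof.
move=> hf hg; rewrite -integralTD.
- apply: le_integralT.
  + by apply: smeas_rnorm; exact: smeas_add.
  + by apply: measurable_funD; exact: smeas_rnorm.
  + by move=> t; rewrite rnorm_ge0 ler_rnormD.
- exact: smeas_rnorm.
- exact: smeas_rnorm.
- by move=> t; exact: rnorm_ge0.
- by move=> t; exact: rnorm_ge0.
Qed.

Lemma nint_dist h f g : smeas f -> smeas g -> smeas h ->
  (nint (fun t => f t - g t)%R <= nint (fun t => f t - h t)%R + nint (fun t => h t - g t)%R)%E.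
Proof.
move=> hf hg hh; apply: le_trans (nint_add _ _).
- by under [X in (_ <= nint X)%E]eq_fun do rewrite subrKA.
- exact: smeas_sub.
- exact: smeas_sub.
Qed.

Lemma nintC f g : nint (fun t => f t - g t)%R = nint (fun t => g t - f t)%R.
Proof. by apply: eq_integral => t _; rewrite rnormC. Qed.

Lemma binteg_lin (a b : R[i]) f g : binteg f -> binteg g ->
  binteg (fun t => a *: f t + b *: g t).
Proof.
move=> [hf if_] [hg ig]; have haf := smeas_scale a hf; have hbg := smeas_scale b hg.
split; first exact: smeas_add.
apply: le_lt_trans (nint_add haf hbg) _; rewrite !nint_scale //.
by rewrite lte_add_pinfty // lte_mul_pinfty ?lee_fin ?(@rnorm_ge0 R (R[i]^o)) // ge0_fin_numE ?nint_ge0.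
Qed.

Lemma binteg_dominated f (G : R -> R) : smeas f -> measurable_fun setT G ->
  (forall t, rnorm (f t) <= G t) -> (\int[mu]_t (G t)%:E < +oo)%E -> binteg f.
Proof.
move=> hf mG fG iG; split=> //; apply: le_lt_trans iG.
apply: le_integralT => //; first exact: smeas_rnorm.
by move=> t; rewrite rnorm_ge0 fG.
Qed.

Lemma bochner_approxP f s : bochner_approx setT f s <->
  (forall n, fsimple (s n) /\ (nint (s n) < +oo)%E) /\
  nint (fun t => f t - s n t)%R @[n --> \oo] --> 0%E.
Proof.
by split=> -[h1 h2]; split=> // n; apply/simple_integrableP; exact: h1.
Qed.

Lemma bochner_approx_exists f : binteg f -> exists s, bochner_approx setT f s.
Proof.
move=> [hf if_]; have [s [s1 s2 s3]] := smeas_approx hf; exists s.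
have hs n : smeas (s n) by exact: smeas_fsimple.
apply/bochner_approxP; split=> [n|].
  split=> //; apply: (@le_lt_trans _ _ (nint f + nint f)%E); last exact: lte_add_pinfty.
  apply: (@le_trans _ _ (nint (fun t => f t + - (f t - s n t))%R)).
    by under [X in (_ <= nint X)%E]eq_fun do rewrite opprB addrCA subrr addr0.
  apply: le_trans (nint_add hf (smeas_opp (smeas_sub hf (hs n)))) _.
  by rewrite !nint_opp; apply: leeD => //; apply: nint_le => //; exact: smeas_sub.
apply: (dominated_cvg0T (G := fun t => rnorm (f t))) => //.
- by move=> n; apply: smeas_rnorm; exact: smeas_sub.
- exact: smeas_rnorm.
- by move=> n t; rewrite rnorm_ge0 s2.
- move=> t; under eq_fun do rewrite rnormC; apply/cvg_rnormP; exact: s3.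
Qed.

(** The relation from which [bochner_integral] selects a value; it is used until the limit is known
    to be unique. *)
Definition isint f (v : V) := exists2 s, bochner_approx setT f s &
  simple_integral setT (s n) @[n --> \oo] --> v.

Lemma isint_norm f v : smeas f -> isint f v -> ((rnorm v)%:E <= nint f)%E.
Proof.
move=> hf [s /bochner_approxP[s1 s2] sv].
have hs n : smeas (s n) by apply: smeas_fsimple; case: (s1 n).
have sb n : ((rnorm (simple_integral setT (s n)))%:E <= nint f + nint (fun t => f t - s n t)%R)%E.
  apply: le_trans (rnorm_simple_integral _) _; first exact/simple_integrableP/s1.
  rewrite (nintC f); apply: le_trans (nint_add hf (smeas_sub (hs n) hf)).
  by under [X in (_ <= nint X)%E]eq_fun do rewrite addrC subrK.
have [->|fin] := eqVneq (nint f) +oo%E; first by rewrite leey.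
rewrite -ltey in fin; rewrite -(@fineK _ (nint f)) ?ge0_fin_numE ?nint_ge0 //.
rewrite lee_fin; apply/ler_addgt0Pr => e e0.
apply: (rnorm_cvg_le sv).
have := cvge0_near_lt s2 e0; apply: filterS => n h.
rewrite -lee_fin EFinD fineK ?ge0_fin_numE ?nint_ge0 //.
by apply: le_trans (sb n) _; rewrite leeD2l // ltW.
Qed.

Lemma isint_lin (a b : R[i]) f g v w : smeas f -> smeas g ->
  isint f v -> isint g w ->
  isint (fun t => a *: f t + b *: g t) (a *: v + b *: w).
Proof.
move=> hf hg [s /bochner_approxP[s1 s2] sv] [s' /bochner_approxP[s1' s2'] sw].
have hs n : smeas (s n) by apply: smeas_fsimple; case: (s1 n).
have hs' n : smeas (s' n) by apply: smeas_fsimple; case: (s1' n).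
exists (fun n t => a *: s n t + b *: s' n t).
  apply/bochner_approxP; split=> [n|].
    split; first exact: (fsimple_comp2 (fun x y => a *: x + b *: y) (s1 n).1 (s1' n).1).
    by case: (@binteg_lin a b (s n) (s' n)) => //; split=> //; case: (s1 n); case: (s1' n).
  pose d n := ((complex.Re `|a|)%:E * nint (fun t => f t - s n t)%R +
               (complex.Re `|b|)%:E * nint (fun t => g t - s' n t)%R)%E.
  have d0 : d n @[n --> \oo] --> 0%E.
    rewrite -[X in _ --> X]adde0 -[X in _ --> (X + _)%E](mule0 (complex.Re `|a|)%:E).
    rewrite -[X in _ --> (_ + X)%E](mule0 (complex.Re `|b|)%:E).
    by apply: cvgeD; [rewrite !mule0|exact: cvgeZl|exact: cvgeZl].
  apply: (squeeze_cvge _ (cvg_cst 0%E) d0); apply: nearW => n.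
  rewrite nint_ge0 /= /d -!nint_scale; [|exact: smeas_sub|exact: smeas_sub].
  apply: le_trans (nint_add _ _); [|exact/smeas_scale/smeas_sub|exact/smeas_scale/smeas_sub].
  by under [X in (_ <= nint X)%E]eq_fun do rewrite !scalerBr addrACA -opprD.
rewrite (_ : (fun n => _) = (fun n => a *: simple_integral setT (s n) +
    b *: simple_integral setT (s' n))); last first.
  apply/funext => n; rewrite simple_integral_lin //; apply/simple_integrableP.
    exact: s1.
  exact: s1'.
by apply: cvgD; apply: cvgZl_tmp.
Qed.

(** By linearity [v - w] is an integral of [f - f], whose norm has integral 0. *)
Lemma isint_unique f v w : smeas f -> isint f v -> isint f w -> v = w.
Proof.
move=> hf iv iw; have := isint_lin 1 (-1) hf hf iv iw.
move=> /isint_norm; rewrite !scale1r !scaleN1r => h.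
apply/eqP; rewrite -subr_eq0 -rnorm_eq0P eq_le rnorm_ge0 andbT -lee_fin.
apply: le_trans (h _) _.
  by apply: smeas_add; exact: smeas_scale.
rewrite /nint; under eq_integral do rewrite scale1r scaleN1r subrr rnorm0.
by rewrite integral0.
Qed.

End bochner.

Section bochner_complete.
Context (R : realType) (V : completeNormedModType R[i]).
Notation mu := (@lebesgue_measure R).
Implicit Types (f g : R -> V).

Lemma approx_isint f s : binteg f -> bochner_approx setT f s ->
  exists2 v, isint f v & simple_integral setT (s n) @[n --> \oo] --> v.
Proof.
move=> [hf _] fs; have /bochner_approxP[s1 s2] := fs.
have hs n : smeas (s n) by apply: smeas_fsimple; case: (s1 n).
suff [v hv] : exists v : V, simple_integral setT (s n) @[n --> \oo] --> v.
  by exists v => //; exists s.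
apply: rnorm_cauchy_cvg => e e0.
have e2 : 0 < e / 2 by rewrite divr_gt0.
have [N _ hN] := cvge0_near_lt s2 e2; exists N => m n Nm Nn.
rewrite -lte_fin; have -> : simple_integral setT (s m) - simple_integral setT (s n) =
    simple_integral setT (fun t => 1 *: s m t + (-1) *: s n t).
  rewrite simple_integral_lin ?scale1r ?scaleN1r //.
    exact/simple_integrableP/s1.
  exact/simple_integrableP/s1.
apply: le_lt_trans (rnorm_simple_integral _) _.
  apply/simple_integrableP; split.
    exact: (fsimple_comp2 (fun x y => 1 *: x + (-1) *: y) (s1 m).1 (s1 n).1).
  by case: (@binteg_lin _ _ 1 (-1) (s m) (s n)) => //; split=> //; case: (s1 m); case: (s1 n).
rewrite -/(nint _); under [X in nint X]eq_fun do rewrite scale1r scaleN1r.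
apply: le_lt_trans (nint_dist (hs m) (hs n) hf) _.
by rewrite nintC [e]splitr EFinD; apply: lteD; exact: hN.
Qed.

Lemma bint_isint f : binteg f -> isint f (bint f).
Proof.
move=> bf; have [s fs] := bochner_approx_exists bf.
have [v iv _] := approx_isint bf fs.
have : [set v | strongly_measurable setT f /\ isint f v] !=set0.
  exists v; split=> //.
  by apply: (@smeas_strongly_measurable _ _ _ set0 f f) => //; case: bf.
by move=> /(@xgetPex V 0)/= [_].
Qed.

Lemma isint_bint f v : binteg f -> isint f v -> bint f = v.
Proof. by move=> bf; apply: isint_unique (bint_isint bf); case: bf. Qed.

Lemma rnorm_bint f : binteg f -> ((rnorm (bint f))%:E <= nint f)%E.
Proof. by move=> bf; apply: isint_norm (bint_isint bf); case: bf. Qed.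

Lemma rnorm_bint_le f (c : R) : binteg f -> (nint f <= c%:E)%E -> rnorm (bint f) <= c.
Proof. by move=> /rnorm_bint h /(le_trans h); rewrite lee_fin. Qed.

Lemma bint_lin (a b : R[i]) f g : binteg f -> binteg g ->
  bint (fun t => a *: f t + b *: g t) = a *: bint f + b *: bint g.
Proof.
move=> bf bg; apply: isint_bint; first exact: binteg_lin.
by apply: isint_lin; [case: bf|case: bg|exact: bint_isint|exact: bint_isint].
Qed.

Lemma binteg0 : binteg (fun=> 0 : V).
Proof.
split; first exact: smeas_cst.
by rewrite /nint; under eq_integral do rewrite rnorm0; rewrite integral0.
Qed.

Lemma bint0 : bint (fun=> 0 : V) = 0.
Proof.
apply/rnorm_eq0/eqP; rewrite eq_le rnorm_ge0 andbT; apply: rnorm_bint_le => //.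
  exact: binteg0.
by rewrite /nint; under eq_integral do rewrite rnorm0; rewrite integral0.
Qed.

Lemma bintegD f g : binteg f -> binteg g -> binteg (fun t => f t + g t).
Proof.
move=> bf bg; have := binteg_lin 1 1 bf bg.
by congr binteg; apply/funext => t; rewrite !scale1r.
Qed.

Lemma bintegB f g : binteg f -> binteg g -> binteg (fun t => f t - g t).
Proof.
move=> bf bg; have := binteg_lin 1 (-1) bf bg.
by congr binteg; apply/funext => t; rewrite scale1r scaleN1r.
Qed.

Lemma bintegZ (a : R[i]) f : binteg f -> binteg (fun t => a *: f t).
Proof.
move=> bf; have := binteg_lin a 0 bf binteg0.
by congr binteg; apply/funext => t; rewrite scaler0 addr0.
Qed.

Lemma bintD f g : binteg f -> binteg g -> bint (fun t => f t + g t) = bint f + bint g.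
Proof.
move=> bf bg; transitivity (bint (fun t => 1 *: f t + 1 *: g t)).
  by congr bint; apply/funext => t; rewrite !scale1r.
by rewrite bint_lin //; congr (_ + _); exact: scale1r.
Qed.

Lemma bintB f g : binteg f -> binteg g -> bint (fun t => f t - g t) = bint f - bint g.
Proof.
move=> bf bg; transitivity (bint (fun t => 1 *: f t + (-1) *: g t)).
  by congr bint; apply/funext => t; rewrite scale1r scaleN1r.
by rewrite bint_lin // scale1r scaleN1r.
Qed.

Lemma bintZ (a : R[i]) f : binteg f -> bint (fun t => a *: f t) = a *: bint f.
Proof.
move=> bf; have := bint_lin a 0 bf binteg0; rewrite bint0 scaler0 addr0 => <-.
by congr bint; apply/funext => t; rewrite addr0.
Qed.

Lemma binteg_sum (I : Type) (r : seq I) (F : I -> R -> V) :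
  (forall i, binteg (F i)) -> binteg (fun t => \sum_(i <- r) F i t).
Proof.
move=> bF; elim: r => [|i r IH].
  by under eq_fun do rewrite big_nil; exact: binteg0.
by under eq_fun do rewrite big_cons; exact: bintegD.
Qed.

Lemma bint_sum (I : Type) (r : seq I) (F : I -> R -> V) :
  (forall i, binteg (F i)) ->
  bint (fun t => \sum_(i <- r) F i t) = \sum_(i <- r) bint (F i).
Proof.
move=> bF; elim: r => [|i r IH].
  by under eq_fun do rewrite big_nil; rewrite big_nil bint0.
under eq_fun do rewrite big_cons.
by rewrite bintD // ?IH ?big_cons //; exact: binteg_sum.
Qed.

Lemma bint_dist f g : binteg f -> binteg g ->
  ((rnorm (bint f - bint g))%:E <= nint (fun t => f t - g t)%R)%E.
Proof. by move=> bf bg; rewrite -bintB //; apply: rnorm_bint; exact: bintegB. Qed.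

Lemma bint_dominated_cvg (F : nat -> R -> V) f (G : R -> R) :
  (forall n, smeas (F n)) -> measurable_fun setT G ->
  (\int[mu]_t (G t)%:E < +oo)%E -> (forall n t, rnorm (F n t) <= G t) ->
  (forall t, F n t @[n --> \oo] --> f t) ->
  binteg f /\ bint (F n) @[n --> \oo] --> bint f.
Proof.
move=> hF mG iG FG Ff; have hf : smeas f := smeas_lim hF Ff.
have fG t : rnorm (f t) <= G t.
  apply: (rnorm_cvg_le (Ff t)).
  by apply: nearW => n; exact: FG.
have bf : binteg f by apply: binteg_dominated mG _ iG.
have bF n : binteg (F n) by apply: binteg_dominated mG _ iG.
split=> //.
have d0 : nint (fun t => F n t - f t)%R @[n --> \oo] --> 0%E.
  apply: (dominated_cvg0T (G := fun t => 2 * G t)).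
  - by move=> n; apply: smeas_rnorm; exact: smeas_sub.
  - exact: measurable_funM.
  - move=> n t; rewrite rnorm_ge0 (le_trans (ler_rnormB _ _)) // mulr2n mulrDl !mul1r.
    exact: lerD.
  - rewrite integralTZ //; last by move=> t; apply: le_trans (fG t); exact: rnorm_ge0.
    by rewrite lte_mul_pinfty // ge0_fin_numE // integralT_ge0 // => t.
  - by move=> t; apply/cvg_rnormP; exact: Ff.
apply/cvg_rnormP/cvgr0Pnorm_lt => e e0.
have := cvge0_near_lt d0 e0; apply: filterS => n h.
by rewrite ger0_norm ?rnorm_ge0 // -lte_fin (le_lt_trans _ h) // bint_dist.
Qed.

Lemma bint_indic (E : set R) (x : V) : @measurable _ (measurableTypeR R) E ->
  (mu E < +oo)%E ->
  binteg (fun t => if t \in E then x else 0) /\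
  bint (fun t => if t \in E then x else 0) = (fine (mu E))%:C *: x.
Proof.
move=> mE fE; pose s t := if t \in E then x else 0.
have ss : fsimple s := fsimple_comp (fun b : bool => if b then x else 0) (fsimple_in mE).
have bs : binteg s.
  split; first exact: smeas_fsimple.
  rewrite (_ : nint s = \int[mu]_t (rnorm x * \1_E t)%:E)%E; last first.
    apply: eq_integral => t _; rewrite indicE /s; case: ifP => _; rewrite ?mulr1 //.
    by rewrite rnorm0 mulr0.
  rewrite integralTZ; [|exact: measurable_indic|by move=> t; rewrite indicE|exact: rnorm_ge0].
  rewrite integral_indic // setIT lte_mul_pinfty ?lee_fin ?rnorm_ge0 //.
split=> //; apply: isint_bint => //; exists (fun=> s).
  apply/bochner_approxP; split=> [n|]; first by case: bs.
  rewrite (_ : (fun=> nint (fun t => s t - s t)%R) = fun=> 0%E); first exact: cvg_cst.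
  apply/funext => _; rewrite /nint; under eq_integral do rewrite subrr rnorm0.
  by rewrite integral0.
suff -> : simple_integral setT s = (fine (mu E))%:C *: x by exact: cvg_cst.
have [x0|x0] := eqVneq x 0.
  rewrite x0 scaler0 /simple_integral fsbig1 // => _ [t _ <-].
  by rewrite /s x0 if_same scaler0.
rewrite /simple_integral (fsbig_widen (range s) [set x; 0]) //=; last 2 first.
- by move=> _ [t _ <-]; rewrite /s; case: ifP; [left|right].
- move=> y [_ Ny] /=; rewrite (_ : _ `&` _ = set0) ?measure0 ?scale0r //.
  by apply/seteqP; split => // t [_ /= ty]; apply: Ny; exists t.
rewrite (fsbigD1 x) //=; [|by left]; rewrite fsbig1 ?addr0; last first.
  by move=> y [[->|->] yx]; [case: yx|rewrite scaler0].
rewrite setTI (_ : s @^-1` [set x] = E) //; apply/seteqP; split=> t /=; rewrite /s.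
  by case: ifP => [/[!inE]//|_ /esym/eqP]; rewrite (negbTE x0).
by move=> Et; rewrite mem_set.
Qed.

End bochner_complete.

Section bochner_map.
Context (R : realType) (V W : completeNormedModType R[i]).

Lemma bint_linear (L : {linear V -> W}) (f : R -> V) : continuous L -> binteg f ->
  binteg (L \o f) /\ bint (L \o f) = L (bint f).
Proof.
move=> cL bf; have [hf if_] := bf.
have [K K0 hK] := continuous_linear_bound cL.
have hLf : smeas (L \o f) by exact: smeas_continuous_comp.
have nL (g : R -> V) : smeas g -> (nint (L \o g) <= K%:E * nint g)%E.
  move=> hg; rewrite -integralTZ; last 3 first.
  - exact: smeas_rnorm.
  - by move=> t; exact: rnorm_ge0.
  - exact: ltW.
  apply: le_integralT; first by apply: smeas_rnorm; exact: smeas_continuous_comp.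
    by apply: measurable_funM => //; exact: smeas_rnorm.
  by move=> t; rewrite rnorm_ge0 /=.
have fin (g : R -> V) : smeas g -> (nint g < +oo)%E -> (nint (L \o g) < +oo)%E.
  move=> hg ig; apply: le_lt_trans (nL g hg) _.
  by rewrite lte_mul_pinfty ?lee_fin ?ltW // ge0_fin_numE ?nint_ge0.
have bLf : binteg (L \o f) by split=> //; exact: fin.
split=> //; apply: isint_bint => //.
have [s /bochner_approxP[s1 s2] sv] := bint_isint bf.
have hs n : smeas (s n) by apply: smeas_fsimple; case: (s1 n).
have ha : bochner_approx setT (L \o f) (fun n => L \o s n).
  apply/bochner_approxP; split=> [n|].
    by split; [apply: fsimple_comp; case: (s1 n)|apply: fin => //; case: (s1 n)].
  have d0 : (K%:E * nint (fun t => f t - s n t)%R)%E @[n --> \oo] --> 0%E.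
    by rewrite -(mule0 K%:E); exact: cvgeZl.
  apply: (squeeze_cvge _ (cvg_cst 0%E) d0); apply: nearW => n.
  rewrite nint_ge0 /=; apply: le_trans (nL _ (smeas_sub hf (hs n))).
  by rewrite le_eqVlt; apply/orP; left; apply/eqP/eq_integral => t _; rewrite /= raddfB.
exists (fun n => L \o s n) => //.
have -> : (fun n => simple_integral setT (L \o s n)) =
    (fun n => L (simple_integral setT (s n))).
  apply/funext => n; have [ss fs] := proj2 (simple_integrableP (s n)) (s1 n).
  rewrite (simple_integral_label (phi := L) ss); last first.
    move=> x Lx; have := fs x; rewrite setTI; apply.
    by apply: contra_neq Lx => ->; rewrite raddf0.
  rewrite /simple_integral !fsbig_finite //=; try by case: ss.
  rewrite linear_sum; apply: eq_bigr => x _.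
  by rewrite linearZ setTI.
exact: (@cvg_comp _ _ _ (fun n => simple_integral setT (s n)) L _ _ _ sv (cL _)).
Qed.

End bochner_map.

(** * Functions equal almost everywhere *)

Section ae_congruence.
Context (R : realType) (V : completeNormedModType R[i]).
Notation mu := (@lebesgue_measure R).

Lemma ge0_integral_null_in (D N : set R) (F G : R -> R) :
  @measurable _ (measurableTypeR R) N -> mu N = 0%E ->
  (forall t, 0 <= F t) -> (forall t, 0 <= G t) ->
  (forall t, D t -> ~ N t -> F t = G t) -> (forall t, ~ D t -> ~ N t -> G t = 0) ->
  (\int[mu]_(t in D) (F t)%:E = \int[mu]_t (G t)%:E)%E.
Proof.
move=> mN N0 F0 G0 FG G00; rewrite integral_mkcond.
apply: (ge0_integral_null mN N0) => [t|t|t Nt]; rewrite ?patchE.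
- by case: ifP => _; rewrite lee_fin.
- by rewrite lee_fin.
- have [Dt|Dt] := pselect (D t); first by rewrite mem_set // FG.
  by rewrite memNset // G00.
Qed.

(* [g] is everywhere defined and vanishes outside [D]; this turns integrals and norms over [D] into
   integrals and norms over the whole line. *)
Definition ae_version (D : set R) (f g : R -> V) := exists N : set R,
  [/\ @measurable _ (measurableTypeR R) N, mu N = 0%E,
    forall t, D t -> ~ N t -> f t = g t & forall t, ~ D t -> g t = 0].

Lemma ae_version_refl (f : R -> V) : ae_version setT f f.
Proof.
exists set0; split; [exact: measurable0|exact: measure0|by []|].
by move=> t /(_ I).
Qed.

Lemma nint_in (D : set R) (f g s : R -> V) : ae_version D f g ->
  (\int[mu]_(t in D) (rnorm (f t - s t))%:E =
   nint (fun t => g t - (if t \in D then s t else 0))%R)%E.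
Proof.
move=> [N [mN N0 fg g0]]; apply: (ge0_integral_null_in mN N0) => t.
- exact: rnorm_ge0.
- exact: rnorm_ge0.
- by move=> Dt Nt; rewrite mem_set // fg.
- by move=> Dt Nt; rewrite memNset // g0 // subrr rnorm0.
Qed.

Lemma bochner_approx_in (D : set R) (f g : R -> V) s :
  @measurable _ (measurableTypeR R) D -> ae_version D f g ->
  bochner_approx D f s -> bochner_approx setT g (fun n t => if t \in D then s n t else 0).
Proof.
move=> mD fg [s1 s2]; split=> [n|]; last first.
  rewrite (_ : (fun n => _) = fun n => \int[mu]_(t in D) (rnorm (f t - s n t))%:E)%E //.
  by apply/funext => n; rewrite (nint_in _ fg).
have [ss fs] := s1 n; split=> [|x x0].
  exact: (fsimple_comp2 (fun (b : bool) x => if b then x else 0) (fsimple_in mD) ss).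
rewrite setTI (_ : _ @^-1` _ = D `&` s n @^-1` [set x]); first exact: fs.
apply/seteqP; split=> t /=; last by move=> [Dt]; rewrite mem_set.
have [Dt|Dt] := pselect (D t); first by rewrite mem_set.
by rewrite memNset // => /esym/eqP; rewrite (negbTE x0).
Qed.

Lemma bochner_approx_of_version (D : set R) (f g : R -> V) :
  @measurable _ (measurableTypeR R) D -> ae_version D f g -> binteg g ->
  exists s, bochner_approx D f s.
Proof.
move=> mD fg bg; have [N [mN N0 fgN g0]] := fg.
have [s /bochner_approxP[s1 s2] sv] := bint_isint bg.
have hs n : smeas (s n) by apply: smeas_fsimple; case: (s1 n).
exists s; split=> [n|].
  have [ss fs] := (simple_integrableP (s n)).2 (s1 n); split=> // x x0.
  apply: le_lt_trans (fs x x0); apply: le_measure; rewrite ?inE.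
  - by apply: measurableI => //; exact: (proj2 ss).
  - by apply: measurableI => //; exact: (proj2 ss).
  - exact: setSI.
rewrite (_ : (fun n => _) = fun n => nint (fun t => g t - (if t \in D then s n t else 0))%R); last first.
  by apply/funext => n; exact: (nint_in _ fg).
apply: (squeeze_cvge _ (cvg_cst 0%E) s2); apply: nearW => n.
rewrite nint_ge0 /=; apply: nint_le.
- by apply: smeas_sub; [case: bg|exact: smeas_indic].
- by apply: smeas_sub => //; case: bg.
- move=> t; have [Dt|Dt] := pselect (D t); first by rewrite mem_set.
  by rewrite memNset // g0 // subrr rnorm0 rnorm_ge0.
Qed.

Lemma bochner_integral_version (D : set R) (f g : R -> V) :
  @measurable _ (measurableTypeR R) D -> ae_version D f g -> binteg g ->
  bochner_integral D f = bint g.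
Proof.
move=> mD fg bg; have [s fs] := bochner_approx_of_version mD fg bg.
(* The value selected by [xget] comes with an unknown approximating sequence, so every such sequence
   must be shown to converge to [bint g]. *)
have lim s' : bochner_approx D f s' ->
    simple_integral D (s' n) @[n --> \oo] --> bint g.
  move=> fs'; have gs := bochner_approx_in mD fg fs'.
  rewrite (_ : (fun n => _) = fun n => simple_integral setT (fun t => if t \in D then s' n t else 0)).
    by have [v iv sv] := approx_isint bg gs; rewrite (isint_bint bg iv).
  apply/funext => n; rewrite simple_integral_in //.
  by case: fs' => /(_ n)[].
have [N [mN N0 fgN g0]] := fg.
have hf : strongly_measurable D f.
  by apply: smeas_strongly_measurable mN N0 fgN; case: bg.
have : [set v : V | strongly_measurable D f /\ exists2 s, bochner_approx D f s &
    simple_integral D (s n) @[n --> \oo] --> v] !=set0.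
  by exists (bint g); split=> //; exists s => //; exact: lim.
move=> /(@xgetPex V 0)[_ [s' fs' s'v]].
by apply: (cvg_rnorm_unique s'v); exact: lim.
Qed.

Lemma bochner_integrable_version (f : R -> V) :
  bochner_integrable setT f <-> exists g, ae_version setT f g /\ binteg g.
Proof.
split=> [[hf [s fs]]|[g [fg bg]]]; last first.
  split; last by exact: (bochner_approx_of_version measurableT fg bg).
  have [N [mN N0 fgN g0]] := fg.
  by apply: smeas_strongly_measurable mN N0 fgN; case: bg.
have [g [N [hg mN N0 fgN g0]]] := strongly_measurable_smeas measurableT hf.
have fg : ae_version setT f g by exists N; split.
exists g; split=> //; split=> //.
have /bochner_approxP[s1 s2] := bochner_approx_in measurableT fg fs.
have [n _ /(_ n (leqnn n)) /= hn] := cvge0_near_lt s2 (@ltr01 R).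
set u := fun t => (if t \in setT then s n t else 0) in hn.
have [su iu] := s1 n.
apply: (@le_lt_trans _ _ (nint (fun t => g t - u t)%R + nint u)%E); last first.
  by rewrite lte_add_pinfty // (lt_trans hn) // ltry.
apply: le_trans (nint_add _ _); [|apply: smeas_sub => //; exact: smeas_fsimple|exact: smeas_fsimple].
by under [X in (_ <= nint X)%E]eq_fun do rewrite subrK.
Qed.

Lemma strongly_measurable_version (D : set R) (f : R -> V) :
  @measurable _ (measurableTypeR R) D -> strongly_measurable D f <->
  exists g, ae_version D f g /\ smeas g.
Proof.
move=> mD; split=> [/(strongly_measurable_smeas mD)|[g [[N [mN N0 fg g0]] hg]]].
  by move=> [g [N [hg mN N0 fg g0]]]; exists g; split=> //; exists N; split.
exact: smeas_strongly_measurable fg.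
Qed.

End ae_congruence.

(** * L^p norms *)

Section Lp.
Context (R : realType) (V : completeNormedModType R[i]).
Notation mu := (@lebesgue_measure R).
Variables (p : R) (hp : 1 <= p).
Implicit Types (f g : R -> V).

Let p0 : 0 < p. Proof. exact: lt_le_trans hp. Qed.
Let pN0 : p != 0. Proof. by rewrite gt_eqF. Qed.

Definition Jp f : \bar R := (\int[mu]_t (rnorm (f t) `^ p)%:E)%E.
Definition Np f : \bar R := Lpnorm setT p f.

Lemma Np_Lnorm f : Np f = ('N[mu]_(p%:E) [EFin \o (fun t => rnorm (f t))])%E.
Proof. by rewrite /Np /Lpnorm patch_setT. Qed.

Lemma Lnorm_powR (h : R -> R) : (forall t, 0 <= h t) ->
  ('N[mu]_(p%:E) [EFin \o h] = (\int[mu]_t (h t `^ p)%:E) `^ p^-1)%E.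
Proof.
move=> h0; rewrite unlock.
suff -> : (\int[mu]_t (`|(EFin \o h) t| `^ p) = \int[mu]_t (h t `^ p)%:E)%E by [].
by apply: eq_integral => t _ /=; rewrite ger0_norm.
Qed.

Lemma NpE f : Np f = ((Jp f) `^ p^-1)%E.
Proof. by rewrite Np_Lnorm Lnorm_powR // => t; exact: rnorm_ge0. Qed.

Lemma Jp_ge0 f : (0 <= Jp f)%E.
Proof. by apply: integralT_ge0 => t; exact: powR_ge0. Qed.

Lemma Np_ge0 f : (0 <= Np f)%E.
Proof. by rewrite NpE poweR_ge0. Qed.

Lemma JpE f : Jp f = (Np f `^ p)%E.
Proof. by rewrite NpE -poweRrM mulVf // poweRe1 ?Jp_ge0. Qed.

Lemma measurable_rnormp f : smeas f -> measurable_fun setT (fun t => rnorm (f t) `^ p).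
Proof.
by move=> hf; apply: (measurableT_comp (measurable_powR p)); exact: smeas_rnorm.
Qed.

Lemma Np_lty f : (Np f < +oo)%E = (Jp f < +oo)%E.
Proof.
apply/idP/idP => h; first by rewrite JpE poweR_lty.
by rewrite NpE poweR_lty.
Qed.

Lemma Np_le_powR f c : 0 <= c -> (Np f <= c%:E)%E = (Jp f <= (c `^ p)%:E)%E.
Proof.
move=> c0; apply/idP/idP => h.
  rewrite JpE -poweR_EFin; apply: gt0_ler_poweR => //; first exact: ltW.
  - by rewrite in_itv /= Np_ge0 leey.
  - by rewrite in_itv /= lee_fin c0 leey.
rewrite NpE -(@powRr1 _ c) // -(@mulfV _ p) // powRrM -poweR_EFin.
apply: gt0_ler_poweR => //; first by rewrite invr_ge0 ltW.
  by rewrite in_itv /= Jp_ge0 leey.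
by rewrite in_itv /= lee_fin powR_ge0 leey.
Qed.

Lemma Np_le_Jp f g : (Jp f <= Jp g)%E -> (Np f <= Np g)%E.
Proof.
move=> h; rewrite !NpE; apply: gt0_ler_poweR => //; first by rewrite invr_ge0 ltW.
  by rewrite in_itv /= Jp_ge0 leey.
by rewrite in_itv /= Jp_ge0 leey.
Qed.

Lemma Np_le f g : smeas f -> smeas g -> (forall t, rnorm (f t) <= rnorm (g t)) ->
  (Np f <= Np g)%E.
Proof.
move=> hf hg fg; apply: Np_le_Jp; apply: le_integralT; try exact: measurable_rnormp.
move=> t; rewrite powR_ge0 /= ge0_ler_powR ?nnegrE ?rnorm_ge0 //; exact: ltW.
Qed.

Lemma Np_add f g : smeas f -> smeas g ->
  (Np (fun t => f t + g t)%R <= Np f + Np g)%E.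
Proof.
move=> hf hg; rewrite !Np_Lnorm.
pose a t := rnorm (f t); pose b t := rnorm (g t).
apply: le_trans (minkowski_EFin mu (smeas_rnorm hf) (smeas_rnorm hg) hp).
rewrite Lnorm_powR; last by move=> t; exact: rnorm_ge0.
rewrite [leRHS](@Lnorm_powR (a \+ b)); last by move=> t; rewrite addr_ge0 ?rnorm_ge0.
apply: gt0_ler_poweR; first by rewrite invr_ge0 ltW.
- by rewrite in_itv /= Jp_ge0 leey.
- rewrite in_itv /= leey andbT; apply: integralT_ge0 => t; exact: powR_ge0.
apply: le_integralT; first by apply: measurable_rnormp; exact: smeas_add.
  apply: (measurableT_comp (measurable_powR p)).
  by apply: measurable_funD; exact: smeas_rnorm.
move=> t; rewrite powR_ge0 /= ge0_ler_powR ?nnegrE ?rnorm_ge0 ?addr_ge0 ?rnorm_ge0 ?ler_rnormD //.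
exact: ltW.
Qed.

Lemma Np_opp f : Np (fun t => - f t) = Np f.
Proof.
suff h : Jp (fun t => - f t) = Jp f by rewrite !NpE h.
by apply: eq_integral => t _; rewrite rnormN.
Qed.

Lemma Np_sub f g : smeas f -> smeas g ->
  (Np (fun t => f t - g t)%R <= Np f + Np g)%E.
Proof. by move=> hf hg; rewrite -(Np_opp g); apply: Np_add => //; exact: smeas_opp. Qed.

Lemma NpC f g : Np (fun t => f t - g t) = Np (fun t => g t - f t).
Proof.
suff h : Jp (fun t => f t - g t) = Jp (fun t => g t - f t) by rewrite !NpE h.
by apply: eq_integral => t _; rewrite rnormC.
Qed.

Lemma Np_le_sub f g : smeas f -> smeas g ->
  (Np f <= Np g + Np (fun t => f t - g t)%R)%E.
Proof.
move=> hf hg; apply: le_trans (Np_add hg (smeas_sub hf hg)).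
by under [X in (_ <= Np X)%E]eq_fun do rewrite addrC subrK.
Qed.

Lemma Np_dominated (F : nat -> R -> V) (G : R -> R) :
  (forall n, smeas (F n)) -> measurable_fun setT G ->
  (\int[mu]_t (G t)%:E < +oo)%E -> (forall n t, rnorm (F n t) `^ p <= G t) ->
  (forall t, F n t @[n --> \oo] --> 0) ->
  forall e : R, 0 < e -> \forall n \near \oo, (Np (F n) < e%:E)%E.
Proof.
move=> hF mG iG FG F0 e e0.
have J0 : Jp (F n) @[n --> \oo] --> 0%E.
  apply: (dominated_cvg0T (G := G)) => //.
  - by move=> n; exact: measurable_rnormp.
  - by move=> n t; rewrite powR_ge0 FG.
  move=> t; have /cvg_rnormP r0 := F0 t.
  under eq_fun do rewrite -[F _ t]subr0.
  (* Once the norms are below 1, their p-th powers are below the norms themselves, because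
     [1 <= p]. *)
  apply: (squeeze_cvgr _ (cvg_cst 0) r0); move/cvgr0Pnorm_lt : r0 => /(_ 1 ltr01).
  apply: filterS => n; rewrite ger0_norm ?rnorm_ge0 // => h.
  rewrite powR_ge0 /=; have [->|x0] := eqVneq (rnorm (F n t - 0)) 0.
    by rewrite powR0.
  by apply: ge1r_powR => //; rewrite ltW // andbT lt_neqAle eq_sym x0 rnorm_ge0.
have e2 : 0 < e / 2 by rewrite divr_gt0.
have := cvge0_near_lt J0 (powR_gt0 p e2); apply: filterS => n /ltW.
rewrite -Np_le_powR ?(ltW e2) // => /le_lt_trans; apply.
by rewrite lte_fin ltr_pdivrMr // ltr_pMr // ltr1n.
Qed.

Lemma Np_simple_approx f : smeas f -> (Np f < +oo)%E -> forall e : R, 0 < e ->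
  exists s : R -> V, [/\ fsimple s,
    forall x, x != 0 -> (mu (s @^-1` [set x]) < +oo)%E &
    (Np (fun t => f t - s t)%R < e%:E)%E].
Proof.
move=> hf Nf e e0; have [s [s1 s2 s3]] := smeas_approx hf.
have hs n : smeas (s n) by exact: smeas_fsimple.
have [||||//|n _ /(_ n (leqnn n)) /= hn] := @Np_dominated (fun n t => f t - s n t)
  (fun t => rnorm (f t) `^ p) _ _ _ _ _ e e0.
- by move=> n; exact: smeas_sub.
- exact: measurable_rnormp.
- by rewrite -Np_lty.
- move=> n t; apply: ge0_ler_powR; rewrite ?nnegrE ?rnorm_ge0 //; exact: ltW.
- move=> t; rewrite -(subrr (f t)); apply: cvgB; [exact: cvg_cst|exact: s3].
exists (s n); split=> // x x0.
have Ns : (Jp (s n) < +oo)%E.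
  rewrite -Np_lty; apply: le_lt_trans (Np_le_sub (hs n) hf) _.
  by rewrite NpC lte_add_pinfty // (lt_trans hn) // ltry.
have rx : 0 < rnorm x by rewrite lt_neqAle eq_sym rnorm_eq0P x0 rnorm_ge0.
have ms : @measurable _ (measurableTypeR R) (s n @^-1` [set x]) by exact: (proj2 (s1 n)).
rewrite ltey; apply/negP => /eqP h.
have : (\int[mu]_t (rnorm x `^ p * \1_(s n @^-1` [set x]) t)%:E <= Jp (s n))%E.
  apply: le_integralT.
  - by apply: measurable_funM => //; exact: measurable_indic.
  - exact: measurable_rnormp.
  - move=> t; rewrite mulr_ge0 ?powR_ge0 //= indicE.
    have [tx|tx] := eqVneq (s n t) x; first by rewrite mem_set // mulr1 tx.
    by rewrite memNset ?mulr0 ?powR_ge0 //; apply/eqP.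
rewrite integralTZ; [|exact: measurable_indic|by move=> t; rewrite indicE|exact: powR_ge0].
have -> : (\int[mu]_t (\1_(s n @^-1` [set x]) t)%:E = +oo)%E.
  by rewrite integral_indic // setIT; exact: h.
by rewrite gt0_muley ?lte_fin ?powR_gt0 // leNgt Ns.
Qed.

Lemma Lpnorm_version (D : set R) f g : ae_version D f g -> Lpnorm D p f = Np g.
Proof.
move=> [N [mN N0 fg g0]]; rewrite Np_Lnorm /Lpnorm !unlock; congr poweR.
apply: (ge0_integral_null mN N0) => t; try exact: poweR_ge0.
move=> Nt; congr (`| _ | `^ p)%E; rewrite patchE.
have [Dt|Dt] := pselect (D t); first by rewrite mem_set // fg.
by rewrite memNset //= g0 // rnorm0.
Qed.

Lemma in_Lp_version (D : set R) f : @measurable _ (measurableTypeR R) D ->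
  in_Lp D p f <-> exists g, [/\ ae_version D f g, smeas g & (Np g < +oo)%E].
Proof.
move=> mD; split=> [[/(strongly_measurable_version _ mD)[g [fg hg]] Nf]|[g [fg hg Ng]]].
  by exists g; split=> //; rewrite -(Lpnorm_version fg).
split; last by rewrite (Lpnorm_version fg).
by apply/(strongly_measurable_version _ mD); exists g.
Qed.

End Lp.

Section Lp_map.
Context (R : realType) (V W : completeNormedModType R[i]).
Variables (p : R) (hp : 1 <= p).

Lemma Np_scale_le (c : R) (f : R -> V) (g : R -> W) : 0 <= c -> smeas f -> smeas g ->
  (forall t, rnorm (g t) <= c * rnorm (f t)) -> (Np p g <= c%:E * Np p f)%E.
Proof.
have p0 : 0 < p by exact: lt_le_trans hp.
move=> c0 hf hg gf; rewrite !NpE //.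
rewrite -(@powRr1 _ c) // -(@mulfV _ p) ?gt_eqF // powRrM -poweR_EFin.
rewrite -poweRM ?lee_fin ?powR_ge0 ?Jp_ge0 //.
apply: gt0_ler_poweR; first by rewrite invr_ge0 ltW.
- by rewrite in_itv /= Jp_ge0 leey.
- by rewrite in_itv /= leey andbT mule_ge0 ?lee_fin ?powR_ge0 ?Jp_ge0.
rewrite -integralTZ ?powR_ge0 //; last 2 first.
- exact: measurable_rnormp.
- by move=> t; exact: powR_ge0.
apply: le_integralT; first exact: measurable_rnormp.
  by apply: measurable_funM => //; exact: measurable_rnormp.
move=> t; rewrite powR_ge0 /= -powRM ?rnorm_ge0 //.
by apply: ge0_ler_powR; rewrite ?nnegrE ?mulr_ge0 ?rnorm_ge0 ?gf // ltW.
Qed.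

End Lp_map.

(** * Semigroups *)

Section complex_exponential.
Context (R : realType).

Definition cexp (z : R[i]) : R[i] := (expR (complex.Re z))%:C * expi (complex.Im z).

Lemma expiD (x y : R) : expi (x + y) = expi x * expi y.
Proof. by rewrite /expi cosD sinD; simpc; rewrite [X in _ +i* X]addrC. Qed.

Lemma expi0 : expi (0 : R) = 1.
Proof. by rewrite /expi cos0 sin0. Qed.

Lemma norm_expi (x : R) : complex.Re `|expi x| = 1.
Proof. by rewrite normc_def /= cos2Dsin2 sqrtr1. Qed.

Lemma cexpD (z w : R[i]) : cexp (z + w) = cexp z * cexp w.
Proof.
case: z w => a b [c d]; rewrite /cexp /= expiD expRD rmorphM /=.
by rewrite -!mulrA; congr (_ * _); rewrite mulrCA.
Qed.

Lemma cexp0 : cexp 0 = 1.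
Proof. by rewrite /cexp /= expR0 expi0 mulr1. Qed.

Definition cn (z : R[i]) : R := complex.Re `|z|.

Lemma Re_normM (a b : R[i]) : complex.Re `|a * b| = complex.Re `|a| * complex.Re `|b|.
Proof. exact: (@rnormZ R (R[i]^o) a b). Qed.

Lemma norm_cexp (z : R[i]) : complex.Re `|cexp z| = expR (complex.Re z).
Proof. by rewrite /cexp Re_normM norm_expi mulr1 Re_norm_real ger0_norm ?expR_ge0. Qed.

Lemma cexp_imag (x : R) : cexp (imag x) = expi x.
Proof. by rewrite /cexp /imag /= expR0 mul1r. Qed.

Lemma Re_norm_le (z : R[i]) : complex.Re `|z| <= `|complex.Re z| + `|complex.Im z|.
Proof.
case: z => a b; rewrite normc_def /=.
rewrite -[leRHS]ger0_norm ?addr_ge0 // -sqrtr_sqr ler_wsqrtr //.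
rewrite -(real_normK (num_real a)) -(real_normK (num_real b)) sqrrD lerD2r lerDl.
by rewrite mulrn_wge0 // mulr_ge0.
Qed.

Lemma cn_ge0 (z : R[i]) : 0 <= cn z.
Proof. exact: (@rnorm_ge0 R (R[i]^o)). Qed.

Lemma cnD (z w : R[i]) : cn (z + w) <= cn z + cn w.
Proof. exact: (@ler_rnormD R (R[i]^o)). Qed.

Lemma cn0 : cn (0 : R[i]) = 0.
Proof. exact: (@rnorm0 R (R[i]^o)). Qed.

(* The library norm of [R[i]] takes values in [R[i]]; limits of complex scalars are taken in the
   real modulus [cn]. *)
Definition ccvg (T : Type) (F : set_system T) (c : T -> R[i]) (a : R[i]) : Prop :=
  cn (c x - a) @[x --> F] --> (0 : R).

Definition cderiv (c : R -> R[i]) (t : R) (c' : R[i]) : Prop :=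
  ccvg (0 : R)^' (fun h => h^-1%:C * (c (t + h) - c t)) c'.

Lemma cvg_dist0 (T : Type) (F : set_system T) {FF : Filter F} (u : T -> R) (v : R) :
  u x @[x --> F] --> v -> `|u x - v| @[x --> F] --> (0 : R).
Proof.
move=> uv; rewrite -[X in _ --> X](@normr0 _ R) -(subrr v).
by apply: cvg_norm; apply: cvgB => //; exact: cvg_cst.
Qed.

Lemma ccvg_ReIm (T : Type) (F : set_system T) {FF : Filter F} (f : T -> R[i]) (l : R[i]) :
  complex.Re (f x) @[x --> F] --> complex.Re l ->
  complex.Im (f x) @[x --> F] --> complex.Im l -> ccvg F f l.
Proof.
move=> /cvg_dist0 h1 /cvg_dist0 h2.
have h : `|complex.Re (f x) - complex.Re l| + `|complex.Im (f x) - complex.Im l|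
    @[x --> F] --> (0 : R) by rewrite -[X in _ --> X]addr0; exact: cvgD.
apply: squeeze_cvgr (cvg_cst 0) h; apply: nearW => t /=; rewrite cn_ge0 /=; apply: le_trans (Re_norm_le _) _.
by case: (f t) => a b; case: (l).
Qed.

Lemma is_derive_quot (f : R -> R) (t df : R) : is_derive t 1 f df ->
  h^-1 * (f (t + h) - f t) @[h --> (0 : R)^'] --> df.
Proof.
move=> [d <-]; have : h^-1 *: ((f \o shift t) (h *: 1) - f t) @[h --> (0 : R)^'] --> 'D_1 f t.
  exact: d.
by under eq_fun do rewrite /= /shift /= [_ *: 1]mulr1 [_ + t]addrC.
Qed.

Lemma cderiv_ReIm (f : R -> R[i]) (t : R) (l : R[i]) :
  is_derive t 1 (fun s => complex.Re (f s)) (complex.Re l) ->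
  is_derive t 1 (fun s => complex.Im (f s)) (complex.Im l) ->
  cderiv f t l.
Proof.
move=> /is_derive_quot h1 /is_derive_quot h2; apply: ccvg_ReIm.
  rewrite (_ : (fun h => _) = (fun h => h^-1 * (complex.Re (f (t + h)) - complex.Re (f t)))) //.
  apply/funext => h.
  by case: (f (t + h)) => a b; case: (f t) => c d /=; rewrite mul0r subr0.
rewrite (_ : (fun h => _) = (fun h => h^-1 * (complex.Im (f (t + h)) - complex.Im (f t)))) //.
apply/funext => h.
by case: (f (t + h)) => a b; case: (f t) => c d /=; rewrite mul0r addr0.
Qed.

Lemma cderiv_real (f : R -> R) (t df : R) : is_derive t 1 f df ->
  cderiv (fun s => (f s)%:C) t df%:C.
Proof.
by move=> fd; apply: (@cderiv_ReIm (fun s => (f s)%:C) t df%:C fd); exact: is_derive_cst.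
Qed.

Lemma is_derive_mull (a t : R) : is_derive t 1 (fun s => a * s) a.
Proof.
have := @is_deriveZ _ _ _ id a t 1 1 (is_derive_id t 1).
by rewrite [a *: 1]mulr1.
Qed.

Lemma cexp_mulE (a b s : R) : cexp (s%:C * (a +i* b)) =
  (expR (a * s) * cos (b * s)) +i* (expR (a * s) * sin (b * s)).
Proof. by rewrite /cexp /= !mul0r subr0 addr0 /expi !(mulrC s); simpc. Qed.

Lemma cexp_cvg (T : Type) (F : set_system T) {FF : Filter F} (u : T -> R) (t : R) (l : R[i]) :
  u x @[x --> F] --> t -> ccvg F (fun x => cexp ((u x)%:C * l)) (cexp (t%:C * l)).
Proof.
case: l => a b ut.
have ma (c : R) : c * u x @[x --> F] --> c * t by apply: cvgM => //; exact: cvg_cst.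
have ce : expR (a * u x) @[x --> F] --> expR (a * t).
  exact: (@cvg_comp _ _ _ (fun x => a * u x) expR _ _ _ (ma a) (@continuous_expR R _)).
apply: ccvg_ReIm.
  rewrite (_ : (fun x => _) = (fun x => expR (a * u x) * cos (b * u x))); last first.
    by apply/funext => x; rewrite cexp_mulE.
  rewrite cexp_mulE /=; apply: cvgM ce _.
  exact: (@cvg_comp _ _ _ (fun x => b * u x) cos _ _ _ (ma b) (@continuous_cos R _)).
rewrite (_ : (fun x => _) = (fun x => expR (a * u x) * sin (b * u x))); last first.
  by apply/funext => x; rewrite cexp_mulE.
rewrite cexp_mulE /=; apply: cvgM ce _.
exact: (@cvg_comp _ _ _ (fun x => b * u x) sin _ _ _ (ma b) (@continuous_sin R _)).
Qed.

Lemma cexp_cvg1 (l : R[i]) : ccvg (0 : R)^'+ (fun h => cexp ((- h)%:C * l)) 1.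
Proof.
have h : - x @[x --> (0 : R)^'+] --> (0 : R).
  rewrite -[X in _ --> X]oppr0; apply: cvgN; apply: cvg_within_filter; exact: cvg_id.
have E : cexp ((0 : R)%:C * l) = 1 by rewrite mul0r cexp0.
by rewrite -E; exact: (@cexp_cvg _ _ _ (fun h => - h) _ l h).
Qed.

Lemma cderiv_cexp (a : R[i]) (t : R) :
  cderiv (fun s => cexp (s%:C * a)) t (a * cexp (t%:C * a)).
Proof.
case: a => a b; have da := is_derive_mull a t; have db := is_derive_mull b t.
have de := is_derive1_comp (is_derive_expR (a * t)) da.
have dc := is_derive1_comp (is_derive_cos (b * t)) db.
have ds := is_derive1_comp (is_derive_sin (b * t)) db.
rewrite cexp_mulE; apply: cderiv_ReIm.
  rewrite (_ : (fun s => _) = (expR \o *%R a) * (cos \o *%R b)); last first.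
    by apply/funext => s; rewrite cexp_mulE.
  apply: is_derive_eq (is_deriveM de dc) _.
  by rewrite /= /GRing.scale /=; ring.
rewrite (_ : (fun s => _) = (expR \o *%R a) * (sin \o *%R b)); last first.
  by apply/funext => s; rewrite cexp_mulE.
apply: is_derive_eq (is_deriveM de ds) _.
by rewrite /= /GRing.scale /=; ring.
Qed.

End complex_exponential.

(** * Derivatives of vector-valued functions *)

Section derivative_rules.
Context (R : realType) (V : normedModType R[i]).
Implicit Types (f g : R -> V).

Lemma cvg_near_eq (T : Type) (F : set_system T) {FF : Filter F} (f g : T -> V) (l : V) :
  (\forall x \near F, f x = g x) -> f x @[x --> F] --> l -> g x @[x --> F] --> l.
Proof. by move=> fg; apply: cvg_trans; apply: near_eq_cvg; exact: fg. Qed.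

Lemma cvg_scale (T : Type) (F : set_system T) {FF : Filter F} (c : T -> R[i])
    (f : T -> V) (a : R[i]) (l : V) :
  ccvg F c a -> f x @[x --> F] --> l -> c x *: f x @[x --> F] --> a *: l.
Proof.
move=> ca fl; apply: (@cvg_rnorm_le R V _ _ _ _ _
  (fun x => (cn (c x - a) + cn a) * rnorm (f x - l) + cn (c x - a) * rnorm l)).
  apply: nearW => x; rewrite (_ : c x *: f x - a *: l = c x *: (f x - l) + (c x - a) *: l).
    apply: le_trans (ler_rnormD _ _) _; rewrite !rnormZ -!/(cn _) lerD2r.
    by apply: ler_wpM2r; [exact: rnorm_ge0|rewrite -{1}(subrK a (c x)) cnD].
  by rewrite scalerBr scalerBl addrA subrK.
have fl0 : rnorm (f x - l) @[x --> F] --> (0 : R) by exact: (cvg_rnormP _ _).1.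
have h : (cn (c x - a) + cn a) * rnorm (f x - l) + cn (c x - a) * rnorm l
    @[x --> F] --> (0 + cn a) * 0 + 0 * rnorm l.
  apply: cvgD; apply: cvgM; [|exact: fl0|exact: ca|exact: cvg_cst].
  by apply: cvgD; [exact: ca|exact: cvg_cst].
by move: h; rewrite mulr0 mul0r addr0.
Qed.

Lemma ccvg_id0 : ccvg (0 : R)^' (fun h => h%:C) 0.
Proof.
by apply: ccvg_ReIm => /=; [apply: cvg_within_filter; exact: cvg_id|exact: cvg_cst].
Qed.

Lemma has_deriv_cvg f t l : has_deriv f t l -> f (t + h) @[h --> (0 : R)^'] --> f t.
Proof.
move=> fd; have h : (h%:C *: (h^-1%:C *: (f (t + h) - f t))) + f t
    @[h --> (0 : R)^'] --> 0 *: l + f t.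
  by apply: cvgD; [apply: cvg_scale; [exact: ccvg_id0|exact: fd]|exact: cvg_cst].
rewrite scale0r add0r in h; move: h; apply: cvg_near_eq.
near=> k; rewrite scalerA -rmorphM /= mulfV ?scale1r ?subrK //.
by near: k; exact: nbhs_dnbhs_neq.
Unshelve. all: by end_near. Qed.

Lemma has_deriv_eq f t l l' : has_deriv f t l -> l = l' -> has_deriv f t l'.
Proof. by move=> h <-. Qed.

Lemma has_deriv_cst (x : V) t : has_deriv (fun=> x) t 0.
Proof.
rewrite /has_deriv; under eq_fun do rewrite subrr scaler0; exact: cvg_cst.
Qed.

Lemma has_deriv_add f g t l m : has_deriv f t l -> has_deriv g t m ->
  has_deriv (fun s => f s + g s) t (l + m).
Proof.
move=> h1 h2; have h : (h^-1%:C *: (f (t + h) - f t)) + (h^-1%:C *: (g (t + h) - g t))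
    @[h --> (0 : R)^'] --> l + m by exact: cvgD.
by move: h; apply: cvg_near_eq; apply: nearW => h /=; rewrite -scalerDr opprD addrACA.
Qed.

Lemma has_deriv_scale (c : R -> R[i]) f t (c' : R[i]) l : cderiv c t c' -> has_deriv f t l ->
  has_deriv (fun s => c s *: f s) t (c' *: f t + c t *: l).
Proof.
move=> cd fd.
have c0 : ccvg (0 : R)^' (fun=> c t) (c t).
  by rewrite /ccvg; under eq_fun do rewrite subrr cn0; exact: cvg_cst.
have h : (h^-1%:C * (c (t + h) - c t)) *: f (t + h) + c t *: (h^-1%:C *: (f (t + h) - f t))
    @[h --> (0 : R)^'] --> c' *: f t + c t *: l.
  apply: cvgD; apply: cvg_scale; [exact: cd|exact: has_deriv_cvg fd|exact: c0|exact: fd].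
move: h; apply: cvg_near_eq; apply: nearW => k.
rewrite [c t *: (_ *: _)]scalerA [c t * _]mulrC -!scalerA -scalerDr; congr (_ *: _).
by rewrite scalerBl scalerBr addrA subrK.
Qed.

End derivative_rules.

Section derivative_map.
Context (R : realType) (V W : normedModType R[i]).

Lemma has_deriv_map (L : {linear V -> W}) (f : R -> V) t l : continuous L -> has_deriv f t l ->
  has_deriv (L \o f) t (L l).
Proof.
move=> cL fd; have h : L (h^-1%:C *: (f (t + h) - f t)) @[h --> (0 : R)^'] --> L l.
  exact: (@cvg_comp _ _ _ (fun h => h^-1%:C *: (f (t + h) - f t)) L _ _ _ fd (cL l)).
by move: h; apply: cvg_near_eq; apply: nearW => h /=; rewrite linearZ raddfB.
Qed.

End derivative_map.

(** * Strongly continuous semigroups and their rescaling *)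

Section semigroups.
Context (R : realType) (X : completeNormedModType R[i]).
Implicit Types (T : R -> {linear X -> X}).

Lemma semigroup_near0 T : C0_semigroup T -> forall x (e : R), 0 < e ->
  exists2 d : R, 0 < d & forall h, 0 <= h -> h < d -> rnorm (T h x - x) < e.
Proof.
move=> [T0 _ _ Tc] x e e0; have /cvg_rnormP/cvgr0Pnorm_lt/(_ e e0)[d /= d0 hd] := Tc x; exists d => // h h0 hd'.
have [->|hN0] := eqVneq h 0; first by rewrite T0 subrr rnorm0.
have {}h0 : 0 < h by rewrite lt_neqAle eq_sym hN0.
have := hd h; rewrite /ball_ /= sub0r normrN gtr0_norm // => /(_ hd' h0).
by rewrite ger0_norm ?rnorm_ge0.
Qed.

(** Otherwise there are times tending to 0 at which the operator norms are unbounded, while each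
    orbit stays bounded by strong continuity, against uniform boundedness. *)
Lemma semigroup_bound_near0 T : C0_semigroup T ->
  exists d M : R, [/\ 0 < d, 1 <= M &
    forall t x, 0 <= t -> t <= d -> rnorm (T t x) <= M * rnorm x].
Proof.
move=> sT; have [T0 _ cT _] := sT; apply: contrapT => hN.
have h n : exists p : R * X, [/\ 0 <= p.1, p.1 <= n.+1%:R^-1 &
    n.+1%:R * rnorm p.2 < rnorm (T p.1 p.2)].
  apply: contrapT => h; apply: hN; exists n.+1%:R^-1, n.+1%:R; split.
  - by rewrite invr_gt0 ltr0n.
  - by rewrite ler1n.
  - move=> t x t0 tn; rewrite leNgt; apply/negP => hx; apply: h.
    by exists (t, x).
have [p hp] := choice h.
have cont n : continuous (T (p n).1) by apply: cT; case: (hp n).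
have bnd x : exists M : R, forall n, rnorm (T (p n).1 x) <= M.
  have [d d0 hd] := semigroup_near0 sT x ltr01.
  have [N hN0] : exists N : nat, forall n, (N <= n)%N -> n.+1%:R^-1 < d.
    exists (Num.truncn d^-1) => n Nn.
    rewrite -[ltRHS]invrK ltf_pV2 ?posrE ?invr_gt0 ?ltr0n //.
    by apply: lt_le_trans (truncnS_gt _) _; rewrite ler_nat ltnS.
  (* From index [N] on the orbit is within 1 of [x]; the sum takes care of the finitely many earlier
     times. *)
  exists (rnorm x + 1 + \sum_(i < N) rnorm (T (p i).1 x)) => n.
  have [Nn|nN] := leqP N n.
    apply: (@le_trans _ _ (rnorm x + 1)).
      rewrite -[X in rnorm X](subrK x) addrC; apply: le_trans (ler_rnormD _ _) _.
      rewrite lerD2l ltW //; case: (hp n) => p0 p1 _.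
      by apply: hd => //; apply: le_lt_trans p1 _; exact: hN0.
    by rewrite lerDl sumr_ge0 // => i _; exact: rnorm_ge0.
  rewrite (bigD1 (Ordinal nN)) //= addrCA lerDl addr_ge0 //.
    by rewrite addr_ge0 // rnorm_ge0.
  by rewrite sumr_ge0 // => i _; exact: rnorm_ge0.
have [M M0 hM] := uniform_boundedness cont bnd.
pose n := Num.truncn M; case: (hp n) => _ _.
rewrite ltNge => /negP; apply; apply: le_trans (hM n _) _.
by apply: ler_wpM2r; [exact: rnorm_ge0|rewrite ltW // truncnS_gt].
Qed.

Lemma semigroup_exp_bound T : C0_semigroup T ->
  exists M w : R, [/\ 1 <= M, 0 <= w &
    forall t x, 0 <= t -> rnorm (T t x) <= M * expR (w * t) * rnorm x].
Proof.
move=> sT; have [d [M [d0 M1 hM]]] := semigroup_bound_near0 sT.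
have [T0 TD _ _] := sT; have M0 : 0 < M by exact: lt_le_trans M1.
have step (k : nat) : forall t x, 0 <= t -> t <= k.+1%:R * d ->
    rnorm (T t x) <= M ^+ k.+1 * rnorm x.
  elim: k => [|k IH] t x t0 tk; first by rewrite expr1; apply: hM => //; rewrite mul1r in tk.
  have [td|td] := leP t d.
    apply: le_trans (hM t x t0 td) _; apply: ler_wpM2r; first exact: rnorm_ge0.
    by rewrite exprS ler_peMr ?exprn_ege1 // ltW.
  have -> : T t x = T d (T (t - d) x).
    by rewrite -TD ?(ltW d0) ?subr_ge0 ?(ltW td) // addrC subrK.
  apply: le_trans (hM d _ (ltW d0) (lexx _)) _; rewrite exprS -mulrA ler_pM2l //.
  apply: IH; first by rewrite subr_ge0 ltW.
  by rewrite lerBlDr; move: tk; rewrite (natrD _ 1%N) mulrDl mul1r addrC.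
(* With [k] the integer part of [t / d] the bound is [M^(k + 1)], and [M^k] is the exponential of
   [k ln M], at most [t ln M / d]. *)
exists M, (ln M / d); split=> //; first by rewrite divr_ge0 ?ln_ge0 // ltW.
move=> t x t0; pose k := Num.truncn (t / d).
have kd : k%:R * d <= t.
  by rewrite -ler_pdivlMr // truncn_le // divr_ge0 // ltW.
have kd' : t <= k.+1%:R * d by rewrite -ler_pdivrMr // ltW // truncnS_gt.
apply: le_trans (step k t x t0 kd') _; apply: ler_wpM2r; first exact: rnorm_ge0.
rewrite exprS ler_pM2l // -[in leLHS](lnK M0) -expRM_natl ler_expR.
by rewrite mulrC -mulrA ler_wpM2l ?ln_ge0 // ler_pdivlMl // mulrC.
Qed.

Lemma semigroup_cvg T (I : Type) (F : set_system I) {FF : Filter F} (s : I -> R)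
    (x : I -> X) (t : R) (y : X) : C0_semigroup T ->
  (forall n, 0 <= s n) -> 0 <= t -> s n @[n --> F] --> t -> x n @[n --> F] --> y ->
  T (s n) (x n) @[n --> F] --> T t y.
Proof.
move=> sT s0 t0 st xy; have [M [w [M1 w0 hM]]] := semigroup_exp_bound sT.
have [_ TD _ _] := sT.
have M0 : 0 < M by exact: lt_le_trans M1.
set C := M * expR (w * (t + 1)); have C0 : 0 < C by rewrite mulr_gt0 ?expR_gt0.
apply/cvg_rnormP/cvgr0Pnorm_lt => e e0.
have e2 : 0 < e / 2 / C by rewrite !divr_gt0.
have [d d0 hd] := semigroup_near0 sT y e2.
have dm : 0 < Num.min d 1 by rewrite lt_min d0 ltr01.
have n1 : \forall n \near F, `|s n - t| < Num.min d 1.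
  by move/cvgrPdist_lt : st => /(_ _ dm); apply: filterS => n; rewrite distrC.
have n2 : \forall n \near F, rnorm (x n - y) < e / 2 / C.
  by move/cvg_rnormP/cvgr0Pnorm_lt : xy => /(_ _ e2); apply: filterS => n; rewrite ger0_norm ?rnorm_ge0.
apply: filterS2 n1 n2 => n n1 n2; rewrite ger0_norm ?rnorm_ge0 //.
have [sd s1] : `|s n - t| < d /\ `|s n - t| < 1 by move: n1; rewrite lt_min => /andP.
have bC r z : 0 <= r -> r <= t + 1 -> rnorm (T r z) <= C * rnorm z.
  move=> r0 r1; apply: le_trans (hM r z r0) _; apply: ler_wpM2r; first exact: rnorm_ge0.
  by rewrite ler_pM2l // ler_expR ler_wpM2l.
have sn1 : s n <= t + 1 by move: s1; rewrite ltr_norml => /andP[_]; lra.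
apply: le_lt_trans (ler_rnorm_dist (T (s n) y) _ _) _.
rewrite [ltRHS]splitr; apply: ltrD.
  rewrite -linearB; apply: le_lt_trans (bC _ _ (s0 n) sn1) _.
  by rewrite mulrC -ltr_pdivlMr.
(* The operator at the smaller of the two times is factored out, and both times lie below
   [t + 1]. *)
suff : rnorm (T (s n) y - T t y) <= C * rnorm (T `|s n - t| y - y).
  move=> /le_lt_trans; apply; rewrite mulrC -ltr_pdivlMr //; exact: hd.
have [st'|st'] := leP t (s n).
  have -> : T (s n) y - T t y = T t (T `|s n - t| y - y).
    by rewrite linearB -TD // ger0_norm ?subr_ge0 // subrKC.
  by apply: bC => //; lra.
have -> : T (s n) y - T t y = - T (s n) (T `|s n - t| y - y).
  rewrite linearB -TD // distrC ger0_norm ?subr_ge0 ?(ltW st') // subrKC.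
  by rewrite opprB.
by rewrite rnormN; apply: bC.
Qed.

Lemma semigroup_continuous T : C0_semigroup T ->
  forall x, continuous (fun t : R => T (Num.max t 0) x).
Proof.
move=> sT x t; apply: semigroup_cvg => //; last exact: cvg_cst.
- by move=> u; rewrite le_max lexx orbT.
- by rewrite le_max lexx orbT.
apply/cvgrPdist_lt => e e0; near=> u.
apply: (@le_lt_trans _ _ `|t - u|); last by near: u; exact: cvgr_dist_lt.
by case: (leP t 0) => h1; case: (leP u 0) => h2; rewrite ?subrr ?normr0 // ?sub0r ?subr0 ?normrN;
  do ?(case: ger0P => ?); lra.
Unshelve. all: by end_near. Qed.

(** The semigroup [e^{-lt} T t], generated by [A - l] when [T] is generated by [A]. *)
Definition rescale (l : R[i]) T (t : R) : {linear X -> X} :=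
  [the {linear X -> X} of cexp ((- t)%:C * l) \*: T t].

Lemma rescaleE l T t x : rescale l T t x = cexp ((- t)%:C * l) *: T t x.
Proof. by []. Qed.

Lemma rnorm_rescale l T t x :
  rnorm (rescale l T t x) = expR (- t * complex.Re l) * rnorm (T t x).
Proof.
rewrite rescaleE rnormZ -/(cn _) {1}/cn norm_cexp; congr (expR _ * _).
by case: l => a b /=; rewrite mul0r subr0.
Qed.

Lemma ccvg_cst (I : Type) (F : set_system I) {FF : Filter F} (c : R[i]) : ccvg F (fun=> c) c.
Proof. by rewrite /ccvg; under eq_fun do rewrite subrr cn0; exact: cvg_cst. Qed.

Lemma rescale_C0 l T : C0_semigroup T -> C0_semigroup (rescale l T).
Proof.
move=> sT; have [T0 TD cT Tc] := sT; split.
- by move=> x; rewrite rescaleE T0 oppr0 mul0r cexp0 scale1r.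
- move=> s t x s0 t0; rewrite !rescaleE TD // linearZ scalerA -cexpD.
  by rewrite -mulrDl -rmorphD -opprD.
- move=> t t0 x; apply: (@cvg_scale R X); last exact: cT.
  exact: ccvg_cst.
- move=> x; rewrite -[X in _ --> X]scale1r; apply: (@cvg_scale R X); last exact: Tc.
  exact: cexp_cvg1.
Qed.

Lemma rescaleK l T t x : rescale (- l) (rescale l T) t x = T t x.
Proof. by rewrite !rescaleE scalerA -cexpD mulrN addNr cexp0 scale1r. Qed.

(** The product rule at 0. With [phi] arbitrary it applies both to an orbit and to a rescaled orbit,
    and so gives both directions of [generates_rescale]. *)
Lemma right_quot_rescale l (phi : R -> X) (x z : X) :
  h^-1%:C *: (phi h - x) @[h --> (0 : R)^'+] --> z ->
  h^-1%:C *: (cexp ((- h)%:C * l) *: phi h - x) @[h --> (0 : R)^'+] --> z - l *: x.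
Proof.
move=> hz.
have c1 := cexp_cvg1 l.
have c2 : ccvg (0 : R)^'+ (fun h => h^-1%:C * (cexp ((- h)%:C * l) - 1)) (- l).
  have h := cderiv_cexp (- l) 0; rewrite mul0r cexp0 mulr1 in h.
  have {}h : cn (x^-1%:C * (cexp ((0 + x)%:C * - l) - 1) - - l) @[x --> (0 : R)^'+] --> (0 : R).
    have le : (0 : R)^'+ `=>` (0 : R)^'.
      by apply: within_subset => y /=; case: ltgtP.
    have h' : cn (x^-1%:C * (cexp ((0 + x)%:C * - l) - 1) - - l) @[x --> (0 : R)^'] --> (0 : R).
      rewrite (_ : (fun y => _) = (fun y => cn (y^-1%:C *
        (cexp ((0 + y)%:C * - l) - cexp (0%:C * - l)) - - l))); first exact: h.
      by apply/funext => y; rewrite mul0r cexp0.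
    by move=> A /h'; exact: le.
  rewrite /ccvg (_ : (fun y => _) = (fun x => cn (x^-1%:C * (cexp ((0 + x)%:C * - l) - 1) - - l))) //.
  apply/funext => y; congr (cn (_ * (cexp _ - _) - _)).
  by rewrite add0r rmorphN mulNr mulrN.
have h : cexp ((- h)%:C * l) *: (h^-1%:C *: (phi h - x)) +
    (h^-1%:C * (cexp ((- h)%:C * l) - 1)) *: x @[h --> (0 : R)^'+] --> 1 *: z + (- l) *: x.
  by apply: cvgD; apply: (@cvg_scale R X) => //; exact: cvg_cst.
move: h; rewrite scale1r scaleNr; apply: (@cvg_near_eq R X); apply: nearW => h.
move: (cexp _) => c; rewrite scalerA mulrC -!scalerA -scalerDr; congr (_ *: _).
by rewrite scalerBr scalerBl scale1r addrA subrK.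
Qed.

Lemma generates_rescale l T (A : partial_op X) : generates A T ->
  generates (op_shift A l) (rescale l T).
Proof.
move=> gA x y; split=> /=.
  move=> [Ax <-]; apply: (@right_quot_rescale l (fun h => T h x)).
  by apply/gA.
(* Rescaling by [-l] undoes the rescaling by [l]. *)
move=> h; have h' : h^-1%:C *: (T h x - x) @[h --> (0 : R)^'+] --> y + l *: x.
  have := @right_quot_rescale (- l) (fun h => rescale l T h x) x y h.
  rewrite scaleNr opprK; apply: (@cvg_near_eq R X); apply: nearW => k.
  by rewrite -[in RHS](rescaleK l T).
by have [Ax ->] := (gA _ _).2 h'; split=> //; rewrite addrK.
Qed.

End semigroups.

(** * Reflections and translations of Lebesgue measure *)

Section affine_invariance.
Context (R : realType).
Local Notation mu := (@lebesgue_measure R).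

Lemma lebesgue_measure_reflect (c : R) (A : set R) :
  @measurable _ (measurableTypeR R) A -> mu ((fun x => c - x) @^-1` A) = mu A.
Proof.
move=> mA; have mc : measurable_fun [set: measurableTypeR R] (fun x : measurableTypeR R => c - x : measurableTypeR R).
  by apply: measurable_funB => //; exact: measurable_cst.
suff : mu A = pushforward mu (fun x : measurableTypeR R => c - x : measurableTypeR R) A by [].
apply: lebesgue_measure_unique => //= _ [[a b]] _ <-.
rewrite /pushforward.
have -> : (fun x => c - x) @^-1` `]a, b]%classic = `[c - b, c - a[%classic.
  apply/seteqP; split => x /=; rewrite !in_itv /= => /andP[h1 h2]; apply/andP; split; lra.
rewrite !lebesgue_measure_itv /= !lte_fin ltrD2l ltrN2; case: ifP => // _.
by rewrite -!EFinB; congr EFin; ring.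
Qed.

Lemma integral_reflect (c : R) (F : R -> R) : measurable_fun setT F -> (forall x, 0 <= F x) ->
  (\int[mu]_x (F (c - x))%:E = \int[mu]_x (F x)%:E)%E.
Proof.
move=> mF F0; have mc : measurable_fun [set: measurableTypeR R] (fun x : measurableTypeR R => c - x : measurableTypeR R).
  by apply: measurable_funB => //; exact: measurable_cst.
have := @ge0_integral_pushforward _ _ _ _ R _ mc mu setT (EFin \o F) measurableT.
rewrite preimage_setT => /(_ _ _)/esym -> //.
- by apply: eq_measure_integral => A mA _; exact: lebesgue_measure_reflect.
- exact/measurable_EFinP.
- by move=> x _; rewrite lee_fin.
Qed.

Lemma integral_translate (c : R) (F : R -> R) : measurable_fun setT F -> (forall x, 0 <= F x) ->
  (\int[mu]_x (F (x - c))%:E = \int[mu]_x (F x)%:E)%E.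
Proof.
move=> mF F0; rewrite -(integral_reflect c mF F0).
(* A translation is the composition of two reflections: [c - (2c - x) = x - c]. *)
rewrite -[RHS](@integral_reflect (c + c) (fun x => F (c - x))) //.
  by apply: eq_integral => x _; congr (F _)%:E; ring.
by apply: measurableT_comp => //; apply: measurable_funB => //; exact: measurable_cst.
Qed.

End affine_invariance.

Section sequences.
Context (R : realType) (V : normedModType R[i]).

Lemma cvg_of_seq (f : R -> V) (t : R) :
  (forall u : nat -> R, u n @[n --> \oo] --> t -> f (u n) @[n --> \oo] --> f t) ->
  {for t, continuous f}.
Proof.
move=> h; apply/cvg_rnormP.
have := (@cvg_nbhsP R R^o (fun s => rnorm (f s - f t)) t 0).2; apply => u ut.
by have /cvg_rnormP := h u ut.
Qed.

(** The left-sided form is what the Riemann sums ask for: their nodes lie below the point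
    considered. It also allows integrands that jump after the end of an interval. *)
Lemma continuous_left_seq (g : R -> V) : continuous g ->
  forall (u : R) (v : nat -> R), (forall n, 0 <= v n <= u) -> v n @[n --> \oo] --> u ->
    g (v n) @[n --> \oo] --> g u.
Proof. by move=> gc u v _ vu; exact: (@cvg_comp _ _ _ v g _ _ _ vu (gc u)). Qed.

End sequences.

(** * Causal convolution with a stable semigroup *)

Section convolution.
Context (R : realType) (X : completeNormedModType R[i]).
Variables (T : R -> {linear X -> X}) (M w : R).
Hypotheses (sT : C0_semigroup T) (w0 : 0 < w) (M1 : 1 <= M)
  (hM : forall t x, 0 <= t -> rnorm (T t x) <= M * expR (- w * t) * rnorm x).
Local Notation mu := (@lebesgue_measure R).
Local Notation ek := (exponential_pdf w).
Implicit Types (f g : R -> X).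

Let M0 : 0 < M. Proof. exact: lt_le_trans M1. Qed.
Let Mw0 : 0 < M / w. Proof. exact: divr_gt0. Qed.

Lemma measurable_ek (t : R) : measurable_fun setT (fun tau : R => ek (t - tau)).
Proof.
apply: measurableT_comp; first exact: measurable_exponential_pdf.
by apply: measurable_funB => //; exact: measurable_cst.
Qed.

Lemma ek_ge0 u : 0 <= ek u.
Proof. by apply: exponential_pdf_ge0; exact: ltW. Qed.

Lemma ek_le u : ek u <= w.
Proof.
have [u0|u0] := leP 0 u; last by rewrite lt0_exponential_pdf // ltW.
rewrite exponential_pdfE //= -[leRHS]mulr1 ler_wpM2l ?(ltW w0) // -expR0 ler_expR.
by rewrite mulNr oppr_le0 mulr_ge0 // ltW.
Qed.

Lemma integral_ek t : (\int[mu]_tau (ek (t - tau))%:E = 1)%E.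
Proof.
rewrite integral_reflect ?integral_exponential_pdf //; last exact: ek_ge0.
exact: measurable_exponential_pdf.
Qed.

Lemma integral_ek' tau : (\int[mu]_t (ek (t - tau))%:E = 1)%E.
Proof.
rewrite integral_translate ?integral_exponential_pdf //; last exact: ek_ge0.
exact: measurable_exponential_pdf.
Qed.

(* [Num.max] keeps [T] away from negative times, where it is arbitrary. *)
Definition ckern f t tau : X := if tau <= t then T (Num.max (t - tau) 0) (f tau) else 0.
Definition sconv f t : X := bint (ckern f t).

Lemma ckern_gt f t tau : t < tau -> ckern f t tau = 0.
Proof. by move=> h; rewrite /ckern [tau <= t]leNgt h. Qed.

Lemma measurable_le_set (t : R) : @measurable _ (measurableTypeR R) [set tau | tau <= t].
Proof.
rewrite (_ : [set tau | tau <= t] = `]-oo, t]%classic); first exact: measurable_itv.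
by apply/seteqP; split => x /=; rewrite in_itv.
Qed.

Lemma smeas_ckern f t : smeas f -> smeas (ckern f t).
Proof.
move=> mf; apply: smeas_if; [exact: measurable_le_set| |exact: smeas_cst].
apply: (@smeas_car R X X (fun tau x => T (Num.max (t - tau) 0) x) f) => //.
  move=> x tau; have h : {for t - tau, continuous (fun s : R => T (Num.max s 0) x)}.
    exact: semigroup_continuous.
  apply: (@continuous_comp _ _ _ (fun tau => t - tau) (fun s : R => T (Num.max s 0) x)) => //.
  by apply: cvgB; [exact: cvg_cst|exact: cvg_id].
by move=> tau; case: sT => _ _ cT _; apply: cT; rewrite le_max lexx orbT.
Qed.

Lemma ckern_le f t tau : rnorm (ckern f t tau) <= M / w * (ek (t - tau) * rnorm (f tau)).
Proof.
rewrite /ckern; case: ifPn => [h|h]; last first.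
  by rewrite rnorm0; apply: mulr_ge0 (ltW Mw0) _; rewrite mulr_ge0 ?ek_ge0 ?rnorm_ge0.
have tt : 0 <= t - tau by rewrite subr_ge0.
rewrite (max_idPl tt); apply: le_trans (hM _ tt) _.
rewrite exponential_pdfE // mulrA ler_wpM2r ?rnorm_ge0 // mulrA.
by rewrite -[M / w * w]mulrA mulVf ?mulr1 // gt_eqF.
Qed.

(* The weight [ek] is a probability density: convolution with [T] is dominated by an average of the
   norms, and Young's inequality becomes Jensen's. *)
Definition tame f := smeas f /\
  forall t, (\int[mu]_tau (ek (t - tau) * rnorm (f tau))%:E < +oo)%E.

Lemma measurable_ekf f (t : R) : smeas f -> measurable_fun setT (fun tau : R => ek (t - tau) * rnorm (f tau)).
Proof. by move=> mf; apply: measurable_funM; [exact: measurable_ek|exact: smeas_rnorm]. Qed.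

Lemma ekf_ge0 f t tau : 0 <= ek (t - tau) * rnorm (f tau).
Proof. by rewrite mulr_ge0 ?ek_ge0 ?rnorm_ge0. Qed.

Lemma nint_ckern f t : smeas f ->
  (nint (ckern f t) <= (M / w)%:E * \int[mu]_tau (ek (t - tau) * rnorm (f tau))%:E)%E.
Proof.
move=> mf; rewrite -integralTZ; [|exact: measurable_ekf|exact: ekf_ge0|exact: ltW].
apply: le_integralT.
- by apply: smeas_rnorm; exact: smeas_ckern.
- by apply: measurable_funM; [exact: measurable_cst|exact: measurable_ekf].
- by move=> tau; rewrite rnorm_ge0 ckern_le.
Qed.

Lemma binteg_ckern f t : tame f -> binteg (ckern f t).
Proof.
move=> [mf hf]; split; first exact: smeas_ckern.
by apply: le_lt_trans (nint_ckern t mf) _; rewrite lte_mul_pinfty ?lee_fin ?ltW.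
Qed.

Lemma tame_bounded f (C : R) : smeas f -> (forall t, rnorm (f t) <= C) -> tame f.
Proof.
move=> mf hC; split=> // t; have C0 : 0 <= C by apply: le_trans (hC 0); exact: rnorm_ge0.
apply: (@le_lt_trans _ _ (\int[mu]_tau (C * ek (t - tau))%:E)%E).
  apply: le_integralT; first exact: measurable_ekf.
    by apply: measurable_funM; [exact: measurable_cst|exact: measurable_ek].
  by move=> tau; rewrite ekf_ge0 /= mulrC ler_wpM2r ?ek_ge0.
rewrite integralTZ ?integral_ek ?mule1 ?ltry //; first exact: measurable_ek.
by move=> tau; exact: ek_ge0.
Qed.

Lemma tame_scale (a : R[i]) f : tame f -> tame (fun t => a *: f t).
Proof.
move=> [mf hf]; split; first exact: smeas_scale.
move=> t; have E tau : ek (t - tau) * rnorm (a *: f tau) = complex.Re `|a| * (ek (t - tau) * rnorm (f tau)).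
  by rewrite rnormZ mulrCA.
under eq_integral do rewrite E.
rewrite integralTZ; [|exact: measurable_ekf|exact: ekf_ge0|exact: cn_ge0].
by rewrite lte_mul_pinfty // lee_fin; exact: cn_ge0.
Qed.

Lemma sconvD f g t : tame f -> tame g -> sconv (fun t => f t + g t) t = sconv f t + sconv g t.
Proof.
move=> tf tg; rewrite /sconv -bintD; [|exact: binteg_ckern..].
congr bint; apply/funext => tau; rewrite /ckern; case: ifP => _; last by rewrite addr0.
by rewrite linearD.
Qed.

Lemma sconvZ (a : R[i]) f t : tame f -> sconv (fun t => a *: f t) t = a *: sconv f t.
Proof.
move=> tf; rewrite /sconv -bintZ; last exact: binteg_ckern.
congr bint; apply/funext => tau; rewrite /ckern; case: ifP => _; last by rewrite scaler0.
by rewrite linearZ.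
Qed.

Lemma sconvB f g t : tame f -> tame g -> sconv (fun t => f t - g t) t = sconv f t - sconv g t.
Proof.
move=> tf tg; have := sconvD t tf (tame_scale (-1) tg).
rewrite sconvZ // scaleN1r => <-; congr (sconv _ t).
by apply/funext => s; rewrite scaleN1r.
Qed.

Lemma sconv_bounded f (C : R) t : smeas f -> (forall t, rnorm (f t) <= C) ->
  rnorm (sconv f t) <= M / w * C.
Proof.
move=> mf hC; apply: rnorm_bint_le; first by apply: binteg_ckern; exact: tame_bounded hC.
apply: le_trans (nint_ckern t mf) _; rewrite [X in (_ <= X)%E]EFinM; apply: lee_wpmul2l; first by rewrite lee_fin ltW.
have C0 : 0 <= C by apply: le_trans (hC 0); exact: rnorm_ge0.
rewrite -[leRHS]mule1 -(integral_ek t) -integralTZ //; last first.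
- by move=> tau; exact: ek_ge0.
- exact: measurable_ek.
apply: le_integralT; first exact: measurable_ekf.
  by apply: measurable_funM; [exact: measurable_cst|exact: measurable_ek].
by move=> tau; rewrite ekf_ge0 /= mulrC ler_wpM2r ?ek_ge0.
Qed.

Lemma bint_except1 f g (c : R) : (forall t, t != c -> f t = g t) -> binteg g -> bint f = bint g.
Proof.
move=> fg bg; apply: bochner_integral_version => //; exists [set c]; split=> //.
- exact: lebesgue_measure_set1.
- by move=> t _ tc; apply: fg; apply/eqP.
- by move=> t; apply: contra_notP.
Qed.

Lemma sconv_continuous f : tame f -> continuous (sconv f).
Proof.
move=> tf; have [mf hf] := tf.
move=> t; apply: cvg_of_seq => u ut.
(* At [tau = t] the cut-off [tau <= u n] may oscillate, so this single point is removed. *)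
pose F n tau := if tau == t then 0 else ckern f (u n) tau.
pose F0 tau := if tau == t then 0 else ckern f t tau.
have mt : @measurable _ (measurableTypeR R) [set tau | tau == t].
  rewrite (_ : [set tau | tau == t] = [set t]) //.
  by apply/seteqP; split => x /= => [/eqP|->].
have mF s : smeas (fun tau => if tau == t then 0 else ckern f s tau).
  by apply: smeas_if => //; [exact: smeas_cst|exact: smeas_ckern].
have ut1 : \forall n \near \oo, `|u n - t| < 1.
  by move/cvgrPdist_lt : ut => /(_ _ ltr01); apply: filterS => n; rewrite distrC.
have [N _ hN] := ut1.
have shiftN (v : nat -> X) (l : X) : v (n + N)%N @[n --> \oo] --> l -> v n @[n --> \oo] --> l.
  by rewrite cvg_shiftn.
apply: shiftN.
(* For [|u n - t| < 1] one has [ek (u n - tau) <= e^{2w} ek (t + 1 - tau)] when [tau <= u n]: moving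
   the weight to [t + 1] gives a majorant independent of [n]. *)
pose G tau := M / w * expR (2 * w) * (ek (t + 1 - tau) * rnorm (f tau)).
have [bF0 cF] : binteg F0 /\ bint (F (n + N)%N) @[n --> \oo] --> bint F0.
  apply: (@bint_dominated_cvg R X _ _ G).
  - by move=> n; exact: mF.
  - by apply: measurable_funM; [exact: measurable_cst|exact: measurable_ekf].
  - rewrite integralTZ; [|exact: measurable_ekf|exact: ekf_ge0|by rewrite mulr_ge0 ?expR_ge0 ?ltW].
    by rewrite lte_mul_pinfty ?lee_fin // mulr_ge0 ?expR_ge0 ?ltW.
  - move=> n tau; rewrite /F.
    have G0 : 0 <= G tau.
      by apply: mulr_ge0 (ekf_ge0 _ _ _); exact: mulr_ge0 (ltW Mw0) (expR_ge0 _).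
    case: ifP => _; first by rewrite rnorm0.
    have [h|h] := leP tau (u (n + N)%N); last by rewrite ckern_gt // rnorm0.
    apply: le_trans (ckern_le _ _ _) _; rewrite /G -[X in _ <= X]mulrA (ler_pM2l Mw0) mulrA.
    rewrite ler_wpM2r ?rnorm_ge0 //.
    have /= := hN (n + N)%N (leq_addl _ _); rewrite ltr_norml => /andP[h1 h2].
    rewrite !exponential_pdfE ?subr_ge0 //; last by lra.
    rewrite mulrCA ler_pM2l // -expRD ler_expR.
    by rewrite -subr_ge0 (_ : _ - _ = w * (1 - (t - u (n + N)%N))); [rewrite mulr_ge0 ?ltW //; lra|ring].
  move=> tau; rewrite /F /F0; case: eqP => [_|/eqP nt]; first exact: cvg_cst.
  have un : u (n + N)%N @[n --> \oo] --> t by rewrite cvg_shiftn.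
  have [tl|tg] : tau < t \/ t < tau by move: nt; case: (ltgtP tau t); [left|right|].
    have h : T (Num.max (u (n + N)%N - tau) 0) (f tau) @[n --> \oo] --> T (t - tau) (f tau).
      rewrite -[X in T X](max_idPl (_ : 0 <= t - tau)); last by rewrite subr_ge0 ltW.
      have c : {for t - tau, continuous (fun s : R => T (Num.max s 0) (f tau))}.
        exact: semigroup_continuous.
      apply: (@cvg_comp _ _ _ (fun n => u (n + N)%N - tau) _ _ _ _ _ c).
      by apply: cvgB => //; exact: cvg_cst.
    rewrite /ckern (ltW tl) (max_idPl (_ : 0 <= t - tau)); last by rewrite subr_ge0 ltW.
    move: h; apply: cvg_near_eq.
    have : \forall n \near \oo, tau < u (n + N)%N by exact: (cvgr_gt t un).
    by apply: filterS => n hn; rewrite (ltW hn).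
  rewrite /ckern [tau <= t]leNgt tg /=.
  have h : (0 : X) @[n --> \oo] --> (0 : X) by exact: cvg_cst.
  move: h; apply: cvg_near_eq.
  have : \forall n \near \oo, u (n + N)%N < tau by exact: (cvgr_lt t un).
  by apply: filterS => n hn; rewrite leNgt hn.
have e1 s : bint (fun tau => if tau == t then 0 else ckern f s tau) = sconv f s.
  rewrite /sconv; apply: (@bint_except1 _ _ t); last exact: binteg_ckern.
  by move=> tau /negPf ->.
have key (v : X) : v = bint F0 -> sconv f (u (n + N)%N) @[n --> \oo] --> v.
  by move=> ->; move: cF; apply: (@cvg_near_eq R X); apply: nearW => n; exact: e1.
by apply: key; exact/esym/e1.
Qed.

Lemma smeas_sconv f : tame f -> smeas (sconv f).
Proof. by move=> tf; apply: smeas_continuous; exact: sconv_continuous. Qed.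

End convolution.

(** * Young's inequality *)

Section young.
Context (R : realType) (X : completeNormedModType R[i]).
Variables (T : R -> {linear X -> X}) (M w : R).
Hypotheses (sT : C0_semigroup T) (w0 : 0 < w) (M1 : 1 <= M)
  (hM : forall t x, 0 <= t -> rnorm (T t x) <= M * expR (- w * t) * rnorm x).
Local Notation mu := (@lebesgue_measure R).
Local Notation ek := (exponential_pdf w).
Variables (p : R) (hp : 1 <= p).

Let p0 : 0 < p. Proof. exact: lt_le_trans hp. Qed.
Let M0 : 0 < M. Proof. exact: lt_le_trans M1. Qed.
Let Mw0 : 0 < M / w. Proof. exact: divr_gt0. Qed.

(** If [y > c] then [y / c <= (y / c)^p]. Integrated against the probability density [ek], with [c]
    equal to the p-th order mean, this gives Jensen's inequality up to a factor 2. *)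
Lemma le_add_powR (c y : R) : 0 < c -> 0 <= y -> y <= c + c * (c^-1 `^ p * y `^ p).
Proof.
move=> c0 y0; rewrite -powRM ?invr_ge0 ?(ltW c0) //.
have [yc|cy] := leP y c.
  by apply: le_trans yc _; rewrite lerDl mulr_ge0 ?powR_ge0 ?ltW.
apply: (@le_trans _ _ (c * (c^-1 * y))); first by rewrite mulrA divff ?mul1r ?gt_eqF.
apply: (@le_trans _ _ (c * (c^-1 * y) `^ p)).
  rewrite ler_pM2l //; apply: le1r_powR => //.
  by rewrite mulrC ler_pdivlMr // mul1r ltW.
by rewrite lerDr ltW.
Qed.

Lemma measurable_ekp (f : R -> X) (t : R) : smeas f ->
  measurable_fun setT (fun tau : R => ek (t - tau) * rnorm (f tau) `^ p).
Proof. by move=> mf; apply: measurable_funM; [exact: measurable_ek|exact: measurable_rnormp]. Qed.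

Lemma ekp_ge0 (f : R -> X) (t tau : R) : 0 <= ek (t - tau) * rnorm (f tau) `^ p.
Proof. by rewrite mulr_ge0 ?ek_ge0 ?powR_ge0. Qed.

Lemma integral_ek_split (f : R -> X) (c t : R) : smeas f -> 0 < c ->
  (\int[mu]_tau (ek (t - tau) * rnorm (f tau))%:E <=
   c%:E + (c * c^-1 `^ p)%:E * \int[mu]_tau (ek (t - tau) * rnorm (f tau) `^ p)%:E)%E.
Proof.
move=> mf c0; have cc0 : 0 <= c * c^-1 `^ p by rewrite mulr_ge0 ?powR_ge0 ?ltW.
have c0' := ltW c0.
rewrite -integralTZ //; [|exact: measurable_ekp|exact: ekp_ge0].
rewrite -[X in (X + _)%E]mule1 -(integral_ek w0 t) -integralTZ //; last first.
- by move=> tau; exact: ek_ge0.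
- exact: measurable_ek.
rewrite -integralTD; first last.
- by move=> tau; rewrite mulr_ge0 ?ekp_ge0.
- by move=> tau; rewrite mulr_ge0 ?ek_ge0.
- by apply: measurable_funM; [exact: measurable_cst|exact: measurable_ekp].
- by apply: measurable_funM; [exact: measurable_cst|exact: measurable_ek].
apply: le_integralT.
- exact: measurable_ekf.
- apply: measurable_funD; apply: measurable_funM; try exact: measurable_cst.
    exact: measurable_ek.
  exact: measurable_ekp.
- move=> tau; rewrite ekf_ge0 //=.
  have := ler_wpM2l (ek_ge0 w0 (t - tau)) (le_add_powR c0 (rnorm_ge0 (f tau))).
  by move=> /le_trans; apply; rewrite le_eqVlt; apply/orP; left; apply/eqP; ring.
Qed.

Lemma integral_ekp_lty (f : R -> X) (t : R) : smeas f -> (Np p f < +oo)%E ->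
  (\int[mu]_tau (ek (t - tau) * rnorm (f tau) `^ p)%:E < +oo)%E.
Proof.
move=> mf; rewrite Np_lty // => hf.
apply: (@le_lt_trans _ _ (w%:E * Jp p f)%E); last by rewrite lte_mul_pinfty ?Jp_ge0 ?lee_fin ?ltW.
rewrite /Jp -integralTZ ?(ltW w0) //; last first.
- by move=> tau; exact: powR_ge0.
- exact: measurable_rnormp.
apply: le_integralT; first exact: measurable_ekp.
  by apply: measurable_funM; [exact: measurable_cst|exact: measurable_rnormp].
by move=> tau; rewrite ekp_ge0 /= ler_wpM2r ?powR_ge0 // ek_le.
Qed.

Lemma tame_Lp (f : R -> X) : smeas f -> (Np p f < +oo)%E -> tame w f.
Proof.
move=> mf hf; split=> // t; apply: le_lt_trans (integral_ek_split t mf ltr01) _.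
by rewrite lte_add_pinfty ?ltry // lte_mul_pinfty ?integral_ekp_lty // lee_fin mul1r powR_ge0.
Qed.

Lemma jensen_ek (f : R -> X) (t a b : R) : smeas f ->
  (\int[mu]_tau (ek (t - tau) * rnorm (f tau))%:E = a%:E)%E ->
  (\int[mu]_tau (ek (t - tau) * rnorm (f tau) `^ p)%:E = b%:E)%E ->
  a `^ p <= 2 `^ p * b.
Proof.
move=> mf ha hb.
have a0 : 0 <= a by rewrite -lee_fin -ha; apply: integralT_ge0 => tau; exact: ekf_ge0.
have b0 : 0 <= b by rewrite -lee_fin -hb; apply: integralT_ge0 => tau; exact: ekp_ge0.
have h c : 0 < c -> a <= c + c * c^-1 `^ p * b.
  by move=> c0; rewrite -lee_fin EFinD EFinM -ha -hb; exact: integral_ek_split.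
move: b0; rewrite le_eqVlt => /orP[/eqP b0|b0].
  have : a <= 0.
    apply/ler_addgt0Pl => e e0; rewrite addr0.
    by have := h e e0; rewrite -b0 mulr0 addr0.
  move=> a0'; have -> : a = 0 by apply/eqP; rewrite eq_le a0' a0.
  by rewrite -b0 mulr0 powR0 // gt_eqF.
(* The choice [c = b^{1/p}] makes the two terms equal. It has to be positive, whence the separate
   treatment of [b = 0]. *)
have c0 : 0 < b `^ p^-1 by rewrite powR_gt0.
have := h _ c0; rewrite -mulrA.
have -> : (b `^ p^-1)^-1 `^ p * b = 1.
  rewrite -powRN -powRrM mulNr mulVf ?gt_eqF // powR_inv1 ?ltW // mulVf // gt_eqF //.
rewrite mulr1 -mulr2n -[_ *+ 2]mulr_natl => h2.
have := @ge0_ler_powR R p (ltW p0) a (2 * b `^ p^-1).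
rewrite !nnegrE => /(_ a0 _ h2); rewrite (@powRM _ 2) ?powR_ge0 //.
rewrite -powRrM mulVf ?gt_eqF // powRr1 ?(ltW b0) //; apply.
exact: mulr_ge0 (ltW c0).
Qed.

Lemma sconv_powR_le (f : R -> X) (t : R) : smeas f -> (Np p f < +oo)%E ->
  ((rnorm (sconv T f t) `^ p)%:E <=
   ((M / w * 2) `^ p)%:E * \int[mu]_tau (ek (t - tau) * rnorm (f tau) `^ p)%:E)%E.
Proof.
move=> mf hf; have tf := tame_Lp mf hf.
have hb := integral_ekp_lty t mf hf; have ha := tf.2 t.
have a0 : (0 <= \int[mu]_tau (ek (t - tau) * rnorm (f tau))%:E)%E.
  by apply: integralT_ge0 => tau; exact: ekf_ge0.
have b0 : (0 <= \int[mu]_tau (ek (t - tau) * rnorm (f tau) `^ p)%:E)%E.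
  by apply: integralT_ge0 => tau; exact: ekp_ge0.
have := rnorm_bint (binteg_ckern sT w0 M1 hM t tf).
move=> /le_trans/(_ (nint_ckern sT w0 M1 hM t mf)).
rewrite -/(sconv T f t).
case Ea : (\int[mu]_tau (ek (t - tau) * rnorm (f tau))%:E)%E a0 ha => [a| |] // a0 _.
case Eb : (\int[mu]_tau (ek (t - tau) * rnorm (f tau) `^ p)%:E)%E b0 hb => [b| |] // b0 _.
rewrite -!EFinM !lee_fin => h.
have ab := jensen_ek mf Ea Eb.
rewrite powRM ?(ltW Mw0) // -mulrA.
apply: le_trans (ler_wpM2l (powR_ge0 _ _) ab).
rewrite -powRM ?(ltW Mw0) //; apply: ge0_ler_powR => //; first exact: ltW.
  by rewrite nnegrE rnorm_ge0.
by rewrite nnegrE mulr_ge0 // ltW.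
Qed.

Lemma measurable_ek_prod (f : R -> X) : smeas f ->
  measurable_fun setT (fun z : measurableTypeR R * measurableTypeR R =>
    (ek (z.1 - z.2) * rnorm (f z.2) `^ p)%:E).
Proof.
move=> mf; apply/measurable_EFinP; apply: measurable_funM.
  apply: measurableT_comp; first exact: measurable_exponential_pdf.
  by apply: measurable_funB; [exact: measurable_fst|exact: measurable_snd].
apply: (@measurableT_comp _ _ _ _ _ _ (fun s : measurableTypeR R => rnorm (f s) `^ p)).
  exact: measurable_rnormp.
exact: measurable_snd.
Qed.

Lemma sconv_young (f : R -> X) : smeas f -> (Np p f < +oo)%E ->
  (Np p (sconv T f) <= (M / w * 2)%:E * Np p f)%E.
Proof.
move=> mf hf; have tf := tame_Lp mf hf.
have K0 : 0 <= M / w * 2 by rewrite mulr_ge0 // ltW.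
suff h : (Jp p (sconv T f) <= ((M / w * 2) `^ p)%:E * Jp p f)%E.
  move: h hf (Np_ge0 p f); rewrite [Jp p f]JpE //.
  case: (Np p f) => [r| |] //= h _ r0.
  by rewrite -EFinM Np_le_powR // ?(@powRM _ (M / w * 2)) //; exact: mulr_ge0.
have mF : measurable_fun setT (fun t : measurableTypeR R =>
    \int[mu]_tau (ek (t - tau) * rnorm (f tau) `^ p)%:E)%E.
  apply: (@measurable_fun_fubini_tonelli_F _ _ _ _ _ mu _ (measurable_ek_prod mf)).
  by move=> z; rewrite lee_fin ekp_ge0.
have sf := smeas_sconv sT w0 M1 hM tf.
apply: (@le_trans _ _ (\int[mu]_t (((M / w * 2) `^ p)%:E *
    \int[mu]_tau (ek (t - tau) * rnorm (f tau) `^ p)%:E))%E).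
  apply: ge0_le_integral => //.
  - by move=> t _; rewrite lee_fin powR_ge0.
  - by apply/measurable_EFinP; exact: measurable_rnormp.
  - apply: measurable_funeM.
    exact: mF.
  - by move=> t _; exact: sconv_powR_le.
rewrite ge0_integralZl //; first last.
- by rewrite lee_fin powR_ge0.
- by move=> t _; apply: integralT_ge0 => tau; exact: ekp_ge0.
apply: lee_wpmul2l; first by rewrite lee_fin powR_ge0.
(* After the exchange, the inner integral of [ek (t - tau)] over [t] equals 1. *)
have := @fubini_tonelli _ _ _ _ _ mu mu _ (measurable_ek_prod mf).
move=> /= ->; last by move=> z; rewrite lee_fin ekp_ge0.
rewrite /Jp le_eqVlt; apply/orP; left; apply/eqP; apply: eq_integral => tau _.
have E t : ek (t - tau) * rnorm (f tau) `^ p = rnorm (f tau) `^ p * ek (t - tau) by rewrite mulrC.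
under eq_integral do rewrite E.
rewrite integralTZ ?powR_ge0 ?integral_ek' ?mule1 //; last by move=> t; exact: ek_ge0.
apply: measurableT_comp; first exact: measurable_exponential_pdf.
by apply: measurable_funB => //; exact: measurable_cst.
Qed.

End young.

(** * Riemann sums over the half line *)

Section riemann_sums.
Context (R : realType) (X : completeNormedModType R[i]).
Local Notation mu := (@lebesgue_measure R).
Variables (w : R) (w0 : 0 < w).
Local Notation ek := (exponential_pdf w).

(** The mesh is [1 / (n + 1)] and the nodes fill [[0, n + 1[]: refinement and extension happen
    together, so the limit is the integral over the half line. *)
Definition rsum (n : nat) (g : R -> X) : X :=
  \sum_(k < n.+1 ^ 2) (n.+1%:R^-1)%:C *: g (k%:R / n.+1%:R).

(** The step function behind [rsum], in the reversed variable [tau = t - u], so that it is compared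
    directly with a causal kernel at time [t]. Each cell carries the value at its smallest [u]. *)
Definition rstep (n : nat) (g : R -> X) (t tau : R) : X :=
  \sum_(k < n.+1 ^ 2) if tau \in `]t - k.+1%:R / n.+1%:R, t - k%:R / n.+1%:R]%classic
    then g (k%:R / n.+1%:R) else 0.

Let N0 (n : nat) : (0 : R) < n.+1%:R. Proof. by rewrite ltr0n. Qed.

Lemma bint_rstep n g t : binteg (rstep n g t) /\ bint (rstep n g t) = rsum n g.
Proof.
have h (k : nat) : mu `]t - k.+1%:R / n.+1%:R, t - k%:R / n.+1%:R]%classic = (n.+1%:R^-1)%:E.
  rewrite lebesgue_measure_itv /= lte_fin ltrD2l ltrN2 ltr_pM2r ?invr_gt0 // ltr_nat ltnSn.
  by rewrite -EFinB; congr EFin; rewrite -natr1; field; rewrite gt_eqF.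
have b (k : nat) := @bint_indic R X `]t - k.+1%:R / n.+1%:R, t - k%:R / n.+1%:R]%classic
  (g (k%:R / n.+1%:R)) (measurable_itv _).
have b' (k : nat) := b k (_ : (mu _ < +oo)%E).
have {}b (k : nat) : binteg (fun tau => if tau \in `]t - k.+1%:R / n.+1%:R, t - k%:R / n.+1%:R]%classic
    then g (k%:R / n.+1%:R) else 0) /\ bint (fun tau => if tau \in `]t - k.+1%:R / n.+1%:R, t - k%:R / n.+1%:R]%classic
    then g (k%:R / n.+1%:R) else 0) = (n.+1%:R^-1)%:C *: g (k%:R / n.+1%:R).
  have := b k; rewrite h => /(_ (ltry _)) [b1 b2]; split=> //.
split; first by apply: binteg_sum => k; exact: (b k).1.
rewrite /rstep /rsum bint_sum; last by move=> k; exact: (b k).1.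
by apply: eq_bigr => k _; exact: (b k).2.
Qed.

Lemma rstep_lt0 n g (t tau : R) : t < tau -> rstep n g t tau = 0.
Proof.
move=> h; apply: big1 => k _; rewrite mem_setE in_itv /= ifF //.
apply/negP => /andP[_]; have : 0 <= (k : nat)%:R / n.+1%:R :> R by rewrite divr_ge0 ?ler0n.
by move: (_ / _) => x; lra.
Qed.

Lemma rstep_ge0 n g (t tau : R) : tau <= t ->
  let k := Num.truncn (n.+1%:R * (t - tau)) in
  rstep n g t tau = if (k < n.+1 ^ 2)%N then g (k%:R / n.+1%:R) else 0.
Proof.
move=> h k; have u0 : 0 <= n.+1%:R * (t - tau) by rewrite mulr_ge0 ?ler0n ?subr_ge0.
have kP (j : nat) : (tau \in `]t - j.+1%:R / n.+1%:R, t - j%:R / n.+1%:R]%classic) = (j == k).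
  rewrite mem_setE in_itv /= eq_sym /k truncn_eq // andbC.
  by rewrite lerBrDr -lerBrDl ltrBlDr -ltrBlDl ler_pdivrMr // ltr_pdivlMr // !(mulrC _ n.+1%:R).
rewrite /rstep; case: ifPn => hk.
  rewrite (bigD1 (Ordinal hk)) //= kP eqxx big1 ?addr0 // => j jk.
  rewrite kP ifF //; apply/negP => /eqP jk'; move/negP : jk; apply; apply/eqP.
  exact/val_inj.
apply: big1 => j _; rewrite kP ifF //; apply/negP => /eqP jk.
by move: hk; rewrite -jk ltn_ord.
Qed.

Variables (g : R -> X) (C : R).
Hypotheses
  (gc : forall (u : R) (v : nat -> R), (forall n, 0 <= v n <= u) -> v n @[n --> \oo] --> u ->
    g (v n) @[n --> \oo] --> g u)
  (gC : forall u, 0 <= u -> rnorm (g u) <= C * ek u) (C0 : 0 <= C).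

(** The node of a cell is at most 1 below the point, which costs a factor [e^w] in the weight and
    makes the majorant uniform in [n]. *)
Lemma rstep_le n t tau : rnorm (rstep n g t tau) <= C * expR w * ek (t - tau).
Proof.
have G0 : 0 <= C * expR w * ek (t - tau).
  by rewrite !mulr_ge0 ?expR_ge0 ?ek_ge0.
have [h|h] := leP tau t; last by rewrite rstep_lt0 // rnorm0.
rewrite rstep_ge0 //; set k := Num.truncn _; case: ifP => _; last by rewrite rnorm0.
have k0 : 0 <= k%:R / n.+1%:R :> R by rewrite divr_ge0 ?ler0n.
apply: le_trans (gC k0) _; rewrite -mulrA ler_wpM2l //.
rewrite !exponential_pdfE ?subr_ge0 //= [in leRHS]mulrCA ler_pM2l // -expRD ler_expR.
have kl : n.+1%:R * (t - tau) < k.+1%:R by exact: truncnS_gt.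
have : t - tau <= k%:R / n.+1%:R + 1.
  rewrite -(ler_pM2l (N0 n)) [leRHS]mulrDr [X in _ <= X + _]mulrC divfK ?gt_eqF //.
  apply: le_trans (ltW kl) _; rewrite -natr1 lerD2l mulr1 ler1n //.
move: (_ / _) => x h1; rewrite -subr_ge0 (_ : _ - _ = w * (x + 1 - (t - tau))); last by ring.
by rewrite mulr_ge0 ?(ltW w0) // subr_ge0.
Qed.

Lemma rstep_cvg t tau : rstep n g t tau @[n --> \oo] --> (if tau <= t then g (t - tau) else 0).
Proof.
case: (leP tau t) => h; last first.
  by under eq_fun do rewrite rstep_lt0 //; exact: cvg_cst.
pose k n := Num.truncn (n.+1%:R * (t - tau)).
have u0 : 0 <= t - tau by rewrite subr_ge0.
have kle n : (k n)%:R / n.+1%:R <= t - tau.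
  by rewrite ler_pdivrMr // mulrC truncn_le mulr_ge0 ?ler0n.
have kc : (k n)%:R / n.+1%:R @[n --> \oo] --> t - tau.
  have h1 : t - tau - n.+1%:R^-1 @[n --> \oo] --> t - tau.
    rewrite -[X in _ --> X]subr0; apply: cvgB; [exact: cvg_cst|exact: cvg_harmonic].
  apply: squeeze_cvgr h1 (cvg_cst _); apply: nearW => n; rewrite (kle n) andbT.
  by rewrite ler_pdivlMr // mulrBl mulVf ?gt_eqF // mulrC lerBlDr natr1 ltW // truncnS_gt.
have gk : g ((k n)%:R / n.+1%:R) @[n --> \oo] --> g (t - tau).
  by apply: (gc (v := fun n => (k n)%:R / n.+1%:R)) => // n; rewrite (kle n) divr_ge0 ?ler0n.
move: gk; apply: cvg_near_eq; near=> n.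
rewrite rstep_ge0 // -/(k n) ifT //.
rewrite -(ltr_nat R); apply: (@le_lt_trans _ _ (n.+1%:R * (t - tau))).
  by rewrite truncn_le mulr_ge0 ?ler0n.
rewrite natrX expr2 ltr_pM2l //.
apply: (@lt_le_trans _ _ n%:R); last by rewrite ler_nat.
by near: n; exact: nbhs_infty_gtr.
Unshelve. all: by end_near. Qed.

Lemma integral_rdom (t : R) : (\int[mu]_tau (C * expR w * ek (t - tau))%:E = (C * expR w)%:E)%E.
Proof.
rewrite integralTZ ?integral_ek ?mule1 ?mulr_ge0 ?expR_ge0 //; first exact: measurable_ek.
by move=> tau; exact: ek_ge0.
Qed.

Lemma rsum_cvg t : binteg (fun tau => if tau <= t then g (t - tau) else 0) /\
  rsum n g @[n --> \oo] --> bint (fun tau => if tau <= t then g (t - tau) else 0).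
Proof.
have [|||||b c] := @bint_dominated_cvg R X (fun n => rstep n g t)
    (fun tau => if tau <= t then g (t - tau) else 0) (fun tau => C * expR w * ek (t - tau)).
- by move=> n; have [[]] := bint_rstep n g t.
- by apply: measurable_funM; [exact: measurable_cst|exact: measurable_ek].
- by rewrite integral_rdom ltry.
- by move=> n tau; exact: rstep_le.
- by move=> tau; exact: rstep_cvg.
split=> //; move: c; under eq_fun do rewrite (bint_rstep _ g t).2.
by [].
Qed.

Lemma rsum_le n : rnorm (rsum n g) <= C * expR w.
Proof.
have [b <-] := bint_rstep n g 0; apply: rnorm_bint_le => //.
rewrite -(integral_rdom 0); apply: le_integralT.
- by apply: smeas_rnorm; exact: b.1.
- by apply: measurable_funM; [exact: measurable_cst|exact: measurable_ek].
- by move=> tau; rewrite rnorm_ge0 rstep_le.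
Qed.

End riemann_sums.

(** * Resolvents as convolutions *)

Section resolvent_formula.
Context (R : realType) (X : completeNormedModType R[i]).
Variables (T : R -> {linear X -> X}) (M w : R).
Hypotheses (sT : C0_semigroup T) (w0 : 0 < w) (M1 : 1 <= M)
  (hM : forall t x, 0 <= t -> rnorm (T t x) <= M * expR (- w * t) * rnorm x).
Local Notation mu := (@lebesgue_measure R).
Local Notation ek := (exponential_pdf w).

Let M0 : 0 < M. Proof. exact: lt_le_trans M1. Qed.
Let Mw0 : 0 < M / w. Proof. exact: divr_gt0. Qed.

Lemma orbit_le (h : R -> X) (C t u : R) : (forall s, rnorm (h s) <= C) -> 0 <= u ->
  rnorm (T (Num.max u 0) (h (t - u))) <= M / w * C * ek u.
Proof.
move=> hC u0; rewrite (max_idPl u0); apply: le_trans (hM _ u0) _.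
rewrite exponential_pdfE //= (_ : M / w * C * _ = M * expR (- w * u) * C); last first.
  by field; rewrite gt_eqF.
by apply: ler_wpM2l (hC _); rewrite mulr_ge0 ?expR_ge0 ?ltW.
Qed.

Lemma orbit_continuous (h : R -> X) (t : R) : continuous h ->
  continuous (fun u : R => T (Num.max u 0) (h (t - u))).
Proof.
move=> hc u; apply: semigroup_cvg => //.
- by move=> v; rewrite le_max lexx orbT.
- by rewrite le_max lexx orbT.
- apply/cvgrPdist_lt => e e0; near=> v.
  apply: (@le_lt_trans _ _ `|u - v|); last by near: v; exact: cvgr_dist_lt.
  by case: (leP u 0) => h1; case: (leP v 0) => h2; rewrite ?subrr ?normr0 // ?sub0r ?subr0 ?normrN;
    do ?(case: ger0P => ?); lra.
- apply: (@continuous_comp _ _ _ (fun u : R => t - u) h u _ (hc _)).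
  by apply: cvgB; [exact: cvg_cst|exact: cvg_id].
Unshelve. all: by end_near. Qed.

Lemma sconv_rsum (h : R -> X) (C t : R) : continuous h -> (forall s, rnorm (h s) <= C) ->
  rsum n (fun u => T (Num.max u 0) (h (t - u))) @[n --> \oo] --> sconv T h t.
Proof.
move=> hc hC; have C0 : 0 <= C by apply: le_trans (hC 0); exact: rnorm_ge0.
have K0 : 0 <= M / w * C by rewrite mulr_ge0 // ltW.
have [_ h1] := @rsum_cvg R X w w0 (fun u => T (Num.max u 0) (h (t - u))) (M / w * C)
  (continuous_left_seq (@orbit_continuous h t hc)) (fun u u0 => orbit_le t hC u0) K0 t.
rewrite /sconv (_ : ckern T h t = fun tau => if tau <= t then T (Num.max (t - tau) 0) (h (t - (t - tau))) else 0) //.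
by apply/funext => tau; rewrite subKr.
Qed.

Lemma rsum_orbit_le (h : R -> X) (C t : R) n : continuous h -> (forall s, rnorm (h s) <= C) ->
  rnorm (rsum n (fun u => T (Num.max u 0) (h (t - u)))) <= M / w * C * expR w.
Proof.
move=> hc hC; have C0 : 0 <= C by apply: le_trans (hC 0); exact: rnorm_ge0.
apply: (@rsum_le R X w w0 _ (M / w * C)).
- by move=> u u0; exact: orbit_le.
- by rewrite mulr_ge0 // ltW.
Qed.

Let cst_cont (y : X) : continuous (fun _ : R => y). Proof. by move=> t; exact: cvg_cst. Qed.

Let tame_cst (y : X) : tame w (fun _ : R => y).
Proof. by apply: (tame_bounded w0 (C := rnorm y)) => //; exact: smeas_cst. Qed.

(** For a constant function the Riemann sums do not involve [t]. *)
Lemma sconv_cst (y : X) (t : R) : sconv T (fun=> y) t = sconv T (fun=> y) 0.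
Proof.
have h1 := @sconv_rsum (fun=> y) (rnorm y) t (cst_cont (y:=y)) (fun=> lexx _).
have h2 := @sconv_rsum (fun=> y) (rnorm y) 0 (cst_cont (y:=y)) (fun=> lexx _).
exact: (cvg_rnorm_unique h1 h2).
Qed.

(* [sconv T (fun=> y)] does not depend on time: its value is [\int_0^oo T u y du]. *)
Definition res_op (y : X) : X := - sconv T (fun=> y) 0.

Lemma res_op_lin (a : R[i]) x y : res_op (a *: x + y) = a *: res_op x + res_op y.
Proof.
rewrite /res_op (@sconvD R X T M w sT w0 M1 hM (fun=> a *: x) (fun=> y)) //.
by rewrite (@sconvZ R X T M w sT w0 M1 hM a (fun=> x)) // opprD scalerN.
Qed.

Lemma res_opB x y : res_op (x - y) = res_op x - res_op y.
Proof. by rewrite addrC -scaleN1r res_op_lin scaleN1r addrC. Qed.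

Lemma res_opZ (a : R[i]) x : res_op (a *: x) = a *: res_op x.
Proof.
have := res_op_lin a x 0; rewrite addr0 => ->.
by have := res_opB 0 0; rewrite !subrr => ->; rewrite addr0.
Qed.

Lemma rnorm_res_op y : rnorm (res_op y) <= M / w * rnorm y.
Proof.
by rewrite rnormN; apply: (sconv_bounded sT w0 M1 hM) => //; exact: smeas_cst.
Qed.

Let ckern_shift (y : X) (h tau : R) : 0 <= h ->
  T h (ckern T (fun=> y) 0 tau) = if tau <= 0 then T (h - tau) y else 0.
Proof.
move=> h0; rewrite /ckern; case: ifPn => [t0|_]; last by rewrite linear0.
have t0' : 0 <= 0 - tau by rewrite sub0r oppr_ge0.
by case: sT => _ TD _ _; rewrite (max_idPl t0') sub0r -TD // -sub0r.
Qed.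

Let sconv_shift (y : X) (h : R) : 0 <= h ->
  T h (sconv T (fun=> y) 0) = bint (fun tau => if tau <= 0 then T (h - tau) y else 0) /\
  binteg (fun tau => if tau <= 0 then T (h - tau) y else 0).
Proof.
move=> h0; have cT : continuous (T h) by case: sT => _ _ cT _; exact: cT.
have [b1 b2] := bint_linear cT (binteg_ckern sT w0 M1 hM 0 (tame_cst y)).
rewrite /sconv -b2 (_ : (fun tau => if tau <= 0 then T (h - tau) y else 0) =
  T h \o ckern T (fun=> y) 0) //.
by apply/funext => tau /=; rewrite ckern_shift.
Qed.

(** Applying [T h] to the integral of the orbit over the half line removes its piece over [[0, h]].
    With the sign of [res_op] the difference is this piece, which is close to [h y]. *)
Lemma res_op_diff (y : X) (e : R) : 0 < e -> exists2 d : R, 0 < d & forall h, 0 < h -> h < d ->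
  rnorm (T h (res_op y) - res_op y - h%:C *: y) <= e * h.
Proof.
move=> e0; have [d d0 hd] := semigroup_near0 sT y e0; exists d => // h h0 hd'.
have [e1 b1] := sconv_shift y (ltW h0).
have b2 := binteg_ckern sT w0 M1 hM h (tame_cst y).
have mI : @measurable _ (measurableTypeR R) `]0, h]%classic by exact: measurable_itv.
have muI : mu `]0, h]%classic = h%:E.
  by rewrite lebesgue_measure_itv /= lte_fin h0 -EFinB subr0.
have [b3 e3] : binteg (fun tau => if tau \in `]0, h]%classic then y else 0) /\
    bint (fun tau => if tau \in `]0, h]%classic then y else 0) = h%:C *: y.
  by have := @bint_indic R X `]0, h]%classic y mI; rewrite muI => /(_ (ltry _)).
have -> : T h (res_op y) - res_op y = sconv T (fun=> y) h - T h (sconv T (fun=> y) 0).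
  by rewrite /res_op linearN opprK addrC (sconv_cst y h).
rewrite e1 /sconv -bintB // -e3 -bintB //; last exact: bintegB.
apply: rnorm_bint_le; first by apply: bintegB => //; exact: bintegB.
apply: (@le_trans _ _ (\int[mu]_tau (e * \1_(`]0, h]%classic) tau)%:E)%E).
  apply: le_integralT.
  - by apply: smeas_rnorm; apply: smeas_sub; [apply: smeas_sub; [exact: b2.1|exact: b1.1]|exact: b3.1].
  - by apply: measurable_funM => //; exact: measurable_cst.
  move=> tau; rewrite rnorm_ge0 /= indicE mem_setE in_itv /= /ckern.
  have [t0|t0] := leP tau 0.
    rewrite (le_trans t0 (ltW h0)) (max_idPl _) ?subr_ge0 ?(le_trans t0 (ltW h0)) //.
    by rewrite subrr subr0 /= mulr0 rnorm0.
  case: (leP tau h) => th; last by rewrite !subr0 rnorm0 mulr0.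
  rewrite subr0 mulr1 (max_idPl _) ?subr_ge0 //.
  by apply/ltW/hd; [rewrite subr_ge0|lra].
rewrite integralTZ ?(ltW e0) //.
rewrite (_ : (\int[mu]_t (\1_(`]0, h]%classic) t)%:E = h%:E)%E) ?EFinM //.
by rewrite integral_indic // setIT; exact: muI.
Qed.

Lemma res_op_quot (y : X) :
  h^-1%:C *: (T h (res_op y) - res_op y) @[h --> (0 : R)^'+] --> y.
Proof.
apply/cvg_rnormP/cvgr0Pnorm_le => e e0; have [d d0 hd] := res_op_diff y e0.
near=> h; have h0 : 0 < h by near: h; exact: nbhs_right_gt.
have hd' : h < d by near: h; exact: nbhs_right_lt.
rewrite ger0_norm ?rnorm_ge0 //.
have -> : h^-1%:C *: (T h (res_op y) - res_op y) - y =
    h^-1%:C *: (T h (res_op y) - res_op y - h%:C *: y).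
  by rewrite [in RHS]scalerBr scalerA -rmorphM /= mulVf ?scale1r // gt_eqF.
rewrite rnormZr ger0_norm ?invr_ge0 ?(ltW h0) // ler_pdivrMl // mulrC.
exact: hd.
Unshelve. all: by end_near. Qed.

Lemma res_op_commute (h : R) (x : X) : 0 <= h -> res_op (T h x) = T h (res_op x).
Proof.
move=> h0; rewrite /res_op linearN (sconv_shift x h0).1; congr (- bint _).
apply/funext => tau; rewrite /ckern; case: ifPn => // t0.
have t0' : 0 <= 0 - tau by rewrite sub0r oppr_ge0.
by case: sT => _ TD _ _; rewrite (max_idPl t0') -TD // sub0r addrC.
Qed.

Lemma continuous_res_op : continuous res_op.
Proof.
move=> y; apply: (@cvg_rnorm_le R X _ _ _ _ _ (fun x => M / w * rnorm (x - y))).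
  apply: nearW => x.
  rewrite -res_opB.
  exact: rnorm_res_op.
rewrite -(mulr0 (M / w)); apply: cvgM; first exact: cvg_cst.
by apply: (cvg_rnormP _ _).1; exact: cvg_id.
Qed.

Variable (A : partial_op X).
Hypothesis gA : generates A T.

Lemma res_op_right (y : X) : pdom A (res_op y) /\ papp A (res_op y) = y.
Proof. by apply/gA; exact: res_op_quot. Qed.

(** [res_op] is continuous and commutes with [T h], hence with difference quotients: those of [x]
    become those of [res_op x], which tend to [x]. *)
Lemma res_op_left (x : X) : pdom A x -> res_op (papp A x) = x.
Proof.
move=> Ax; have h1 : h^-1%:C *: (T h x - x) @[h --> (0 : R)^'+] --> papp A x by apply/gA.
have h2 : res_op (h^-1%:C *: (T h x - x)) @[h --> (0 : R)^'+] --> res_op (papp A x).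
  exact: (@cvg_comp _ _ _ (fun h => h^-1%:C *: (T h x - x)) res_op _ _ _ h1 (@continuous_res_op _)).
have h3 : h^-1%:C *: (T h (res_op x) - res_op x) @[h --> (0 : R)^'+] --> x.
  exact: res_op_quot.
apply: (cvg_rnorm_unique h2); move: h3; apply: (@cvg_near_eq R X).
near=> h; have h0 : 0 < h by near: h; exact: nbhs_right_gt.
rewrite -(res_op_commute _ (ltW h0)).
by rewrite res_opZ res_opB.
Unshelve. all: by end_near. Qed.

Lemma op_inv_res y : op_inv A y = res_op y.
Proof.
apply: xget_unique; first exact: res_op_right.
by move=> x [Ax <-]; rewrite res_op_left.
Qed.

Lemma bij_generator : set_bij (pdom A) [set: X] (papp A).
Proof.
split=> //.
- move=> x x' /set_mem Ax /set_mem Ax' e.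
  by rewrite -(res_op_left Ax) -(res_op_left Ax') e.
- by move=> y _; have [h1 h2] := res_op_right y; exists (res_op y).
Qed.

End resolvent_formula.

Lemma ae_versionT_map (R : realType) (V W : completeNormedModType R[i]) (g g' : R -> V)
    (Phi : R -> V -> W) : ae_version setT g g' ->
  ae_version setT (fun s => Phi s (g s)) (fun s => Phi s (g' s)).
Proof.
move=> [N [mN N0 h _]]; exists N; split=> //; first by move=> s _ Ns; rewrite h.
by move=> s /(_ I).
Qed.

(** * The oscillatory transform and the resolvent multiplier *)

Section osc_transform.
Context (R : realType) (V : completeNormedModType R[i]).
Implicit Types (g : R -> V).

Lemma expi_ccvg (I : Type) (F : set_system I) {FF : Filter F} (u : I -> R) (l : R) :
  u x @[x --> F] --> l -> ccvg F (fun x => expi (u x)) (expi l).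
Proof.
move=> ul; have E (x : R) : expi x = cexp (x%:C * imag 1).
  by rewrite -cexp_imag; congr cexp; rewrite /imag; simpc.
by rewrite E (_ : (fun x => _) = (fun x => cexp ((u x)%:C * imag 1))); [exact: cexp_cvg|
  apply/funext => x; exact: E].
Qed.

Lemma modulation_continuous (a : R) (x : V) : continuous (fun s : R => expi (s * a) *: x).
Proof.
move=> s; apply: (@cvg_scale R V _ _ _ (fun s : R => expi (s * a))); last exact: cvg_cst.
apply: expi_ccvg; apply: cvgM; [exact: cvg_id|exact: cvg_cst].
Qed.

Lemma cscale_continuous (a : R[i]) : continuous (fun x : V => a *: x).
Proof. by move=> x; apply: (@cvg_scale R V); [exact: ccvg_cst|exact: cvg_id]. Qed.

Lemma smeas_osc_integrand g t : smeas g -> smeas (osc_integrand g t).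
Proof.
move=> mg; apply: (@smeas_car R V V (fun s x => expi (s * t) *: x) g) => //.
  by move=> x; exact: modulation_continuous.
by move=> s; exact: cscale_continuous.
Qed.

Lemma rnorm_osc_integrand g t s : rnorm (osc_integrand g t s) = rnorm (g s).
Proof. by rewrite rnormZ norm_expi mul1r. Qed.

Lemma nint_osc_integrand g t : nint (osc_integrand g t) = nint g.
Proof. by apply: eq_integral => s _; rewrite rnorm_osc_integrand. Qed.

Lemma binteg_osc_integrand g t : binteg g -> binteg (osc_integrand g t).
Proof. by move=> [mg ng]; split; [exact: smeas_osc_integrand|rewrite nint_osc_integrand]. Qed.

Lemma rnorm_osc_integral g (C : R) t : binteg g -> (nint g <= C%:E)%E -> rnorm (osc_integral g t) <= C.
Proof.
move=> bg hC; apply: rnorm_bint_le; first exact: binteg_osc_integrand.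
by rewrite nint_osc_integrand.
Qed.

Lemma osc_integral_bounded g : binteg g -> exists C : R, forall t, rnorm (osc_integral g t) <= C.
Proof.
move=> bg; exists (fine (nint g)) => t; apply: rnorm_osc_integral => //.
by rewrite fineK // ge0_fin_numE ?bg.2 // nint_ge0.
Qed.

Lemma osc_integral_continuous g : binteg g -> continuous (osc_integral g).
Proof.
move=> bg t; apply: cvg_of_seq => u ut.
apply: (@bint_dominated_cvg R V _ _ (fun s => rnorm (g s)) _ _ _ _ _).2.
- by move=> n; apply: smeas_osc_integrand; exact: bg.1.
- by apply: smeas_rnorm; exact: bg.1.
- exact: bg.2.
- by move=> n s; rewrite rnorm_osc_integrand.
- move=> s; apply: (@cvg_scale R V _ _ _ (fun n => expi (s * u n))); last exact: cvg_cst.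
  by apply: expi_ccvg; apply: cvgM => //; exact: cvg_cst.
Qed.

Lemma smeas_osc_integral g : binteg g -> smeas (osc_integral g).
Proof. by move=> bg; apply: smeas_continuous; exact: osc_integral_continuous. Qed.

Lemma osc_integralD f g t : binteg f -> binteg g ->
  osc_integral (fun s => f s + g s) t = osc_integral f t + osc_integral g t.
Proof.
move=> bf bg; rewrite /osc_integral -!/(bint _) -bintD; [|exact: binteg_osc_integrand..].
by congr bint; apply/funext => s; rewrite /osc_integrand scalerDr.
Qed.

Lemma osc_integralZ (a : R[i]) f t : binteg f ->
  osc_integral (fun s => a *: f s : V) t = a *: osc_integral f t.
Proof.
move=> bf; rewrite /osc_integral -!/(bint _) -bintZ; last exact: binteg_osc_integrand.
by congr bint; apply/funext => s; rewrite /osc_integrand !scalerA mulrC.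
Qed.

Lemma osc_integral_ae g g' t : ae_version setT g g' -> binteg g' ->
  osc_integral g t = osc_integral g' t.
Proof.
move=> gg bg; apply: bochner_integral_version => //; last exact: binteg_osc_integrand.
exact: (ae_versionT_map (fun s x => expi (s * t) *: x) gg).
Qed.

Variables (p : R) (hp : 1 <= p).

Lemma osc_LpnormE g g' : ae_version setT g g' -> binteg g' ->
  osc_Lpnorm p g = Np p (osc_integral g').
Proof.
move=> gg bg; have E : osc_integral g = osc_integral g'.
  by apply/funext => t; exact: osc_integral_ae gg bg.
have mg := smeas_osc_integral bg.
rewrite /osc_Lpnorm; case: asboolP => [_|]; first by rewrite E.
(* In the second branch the norm is [+oo] by convention; if the transform of [g'] had a finite norm,
   the conditions of the first branch would hold. *)
rewrite E => h; apply/esym/eqP; rewrite -leye_eq leNgt; apply/negP => hlt; apply: h; split.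
  move=> t; apply/bochner_integrable_version; exists (osc_integrand g' t); split.
    exact: (ae_versionT_map (fun s x => expi (s * t) *: x) gg).
  exact: binteg_osc_integrand.
apply/in_Lp_version; first exact: measurableT.
by exists (osc_integral g'); split; [exact: ae_version_refl|exact: mg|exact: hlt].
Qed.

Lemma osc_Lpnorm_binteg g : binteg g -> osc_Lpnorm p g = Np p (osc_integral g).
Proof. by move=> bg; apply: osc_LpnormE => //; exact: ae_version_refl. Qed.

Lemma osc_Lpnorm_ge0 g : (0 <= osc_Lpnorm p g)%E.
Proof. by rewrite /osc_Lpnorm; case: ifP => // _; exact: Np_ge0. Qed.

Lemma osc_Lpnorm_lty g : (osc_Lpnorm p g < +oo)%E -> exists2 g', ae_version setT g g' & binteg g'.
Proof.
rewrite /osc_Lpnorm; case: asboolP => // -[h _] _.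
(* At time 0 the integrand is [g] itself. *)
have := h 0; rewrite (_ : osc_integrand g 0 = g).
  by move=> /bochner_integrable_version[g' [gg bg]]; exists g'.
by apply/funext => s; rewrite /osc_integrand mulr0 expi0 scale1r.
Qed.

Opaque Np osc_Lpnorm.

Lemma osc_Lpnorm_add f g :
  (osc_Lpnorm p (fun s => f s + g s : V)%R <= osc_Lpnorm p f + osc_Lpnorm p g)%E.
Proof.
have f0 := osc_Lpnorm_ge0 f; have g0 := osc_Lpnorm_ge0 g.
have [fy|fy] := eqVneq (osc_Lpnorm p f) +oo%E.
  by rewrite fy; case: (osc_Lpnorm p g) g0 => [r| |] // _; exact: leey.
have [gy|gy] := eqVneq (osc_Lpnorm p g) +oo%E.
  by rewrite gy; case: (osc_Lpnorm p f) f0 => [r| |] // _; exact: leey.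
have [f' ff bf] : exists2 f', ae_version setT f f' & binteg f'.
  by apply: osc_Lpnorm_lty; rewrite ltey; exact: fy.
have [g' gg bg] : exists2 g', ae_version setT g g' & binteg g'.
  by apply: osc_Lpnorm_lty; rewrite ltey; exact: gy.
rewrite (osc_LpnormE ff bf) (osc_LpnormE gg bg).
rewrite (@osc_LpnormE _ (fun s => f' s + g' s)); last exact: bintegD.
  rewrite (_ : osc_integral _ = fun t => osc_integral f' t + osc_integral g' t).
    by apply: Np_add => //; exact: smeas_osc_integral.
  by apply/funext => t; exact: osc_integralD.
have [N [mN N0 h1 _]] := ff; have [N' [mN' N0' h2 _]] := gg.
exists (N `|` N'); split.
- exact: measurableU.
- exact: null_set_setU.
- by move=> s _ /not_orP[n1 n2]; rewrite h1 // h2.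
- by move=> s /(_ I).
Qed.

End osc_transform.

#[global] Opaque Np osc_Lpnorm.

Section osc_map.
Context (R : realType) (V W : completeNormedModType R[i]).
Variables (p : R) (hp : 1 <= p) (L : {linear V -> W}) (K : R).
Hypotheses (cL : continuous L) (K0 : 0 < K) (hL : forall x, rnorm (L x) <= K * rnorm x).

Lemma osc_integral_map (g : R -> V) t : binteg g ->
  binteg (L \o g) /\ osc_integral (L \o g) t = L (osc_integral g t).
Proof.
move=> bg; split; first exact: (bint_linear cL bg).1.
have [_ <-] := bint_linear cL (binteg_osc_integrand t bg).
by congr bint; apply/funext => s /=; rewrite /osc_integrand /= linearZ.
Qed.

Lemma osc_Lpnorm_map (g : R -> V) :
  (osc_Lpnorm p (fun s => L (g s)) <= K%:E * osc_Lpnorm p g)%E.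
Proof.
have [gy|gy] := eqVneq (osc_Lpnorm p g) +oo%E.
  by rewrite gy gt0_muley ?lte_fin // leey.
have [g' gg bg] : exists2 g', ae_version setT g g' & binteg g'.
  by apply: (@osc_Lpnorm_lty R V p); rewrite ltey.
rewrite (osc_LpnormE p gg bg) (@osc_LpnormE _ _ p _ (L \o g')); last exact: (osc_integral_map 0 bg).1.
  apply: Np_scale_le => //; first exact: ltW.
  - exact: smeas_osc_integral.
  - by apply: smeas_osc_integral; exact: (osc_integral_map 0 bg).1.
  - by move=> t; rewrite (osc_integral_map t bg).2.
exact: (ae_versionT_map (fun _ x => L x) gg).
Qed.

End osc_map.

Section osc_resolvent.
Context (R : realType) (X : completeNormedModType R[i]).
Variables (T : R -> {linear X -> X}) (M w : R).
Hypotheses (sT : C0_semigroup T) (w0 : 0 < w) (M1 : 1 <= M)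
  (hM : forall t x, 0 <= t -> rnorm (T t x) <= M * expR (- w * t) * rnorm x).

Let M0 : 0 < M. Proof. exact: lt_le_trans M1. Qed.
Let Mw0 : 0 < M / w. Proof. exact: divr_gt0. Qed.

(** [(A - is)^{-1}] expressed through the semigroup, without its generator. *)
Definition res_at (s : R) (y : X) : X := res_op (rescale (imag s) T) y.

Lemma rescale_bound (l : R[i]) : 0 <= complex.Re l ->
  forall t x, 0 <= t -> rnorm (rescale l T t x) <= M * expR (- w * t) * rnorm x.
Proof.
move=> l0 t x t0; rewrite rnorm_rescale; apply: le_trans (hM x t0).
rewrite -[leRHS]mul1r ler_wpM2r ?rnorm_ge0 // -expR0 ler_expR mulNr oppr_le0.
exact: mulr_ge0.
Qed.

Lemma rescale_imag (s u : R) x : rescale (imag s) T u x = expi (s * - u) *: T u x.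
Proof.
rewrite rescaleE -cexp_imag; congr (cexp _ *: _).
by rewrite /imag; simpc; rewrite mulrC.
Qed.

Let sTs s : C0_semigroup (rescale (imag s) T). Proof. exact: rescale_C0. Qed.
Let hMs s : forall t x, 0 <= t -> rnorm (rescale (imag s) T t x) <= M * expR (- w * t) * rnorm x.
Proof. exact: rescale_bound. Qed.

Let cst_cont (y : X) : continuous (fun _ : R => y). Proof. by move=> t; exact: cvg_cst. Qed.

Lemma res_at_rsum (s : R) (y : X) :
  - rsum n (fun u => rescale (imag s) T (Num.max u 0) y) @[n --> \oo] --> res_at s y.
Proof.
apply: cvgN; apply: (@sconv_rsum R X _ M w (sTs s) w0 M1 (@hMs s) (fun=> y) (rnorm y) 0) => //.
Qed.

Lemma rnorm_res_at s y : rnorm (res_at s y) <= M / w * rnorm y.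
Proof. exact: (rnorm_res_op (sTs s) w0 M1 (@hMs s)). Qed.

(** [e^{ist} e^{-isu} = e^{is(t - u)}]: this turns the resolvent multiplier into a convolution in
    time. *)
Lemma osc_rsum n (s t : R) (y : X) :
  expi (s * t) *: rsum n (fun u => rescale (imag s) T (Num.max u 0) y) =
  rsum n (fun u => T (Num.max u 0) (expi (s * (t - u)) *: y)).
Proof.
rewrite /rsum scaler_sumr; apply: eq_bigr => k _.
have k0 : 0 <= (k : nat)%:R / n.+1%:R :> R by rewrite divr_ge0 ?ler0n.
have E (a : R[i]) (u : R) : T u (a *: y) = a *: T u y by rewrite linearZ.
rewrite (max_idPl k0) rescale_imag E mulrDr expiD.
by rewrite !scalerA; congr (_ *: _); rewrite [RHS]mulrC mulrAC.
Qed.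

Lemma rsum_osc_integrand n (g : R -> X) (t : R) : binteg g ->
  binteg (fun s => rsum n (fun u => T (Num.max u 0) (expi (s * (t - u)) *: g s))) /\
  bint (fun s => rsum n (fun u => T (Num.max u 0) (expi (s * (t - u)) *: g s))) =
  rsum n (fun u => T (Num.max u 0) (osc_integral g (t - u))).
Proof.
move=> bg.
have h (u : R) : binteg (fun s => T (Num.max u 0) (expi (s * (t - u)) *: g s)) /\
    bint (fun s => T (Num.max u 0) (expi (s * (t - u)) *: g s)) =
    T (Num.max u 0) (osc_integral g (t - u)).
  have cT : continuous (T (Num.max u 0)).
    by case: sT => _ _ cT _; apply: cT; rewrite le_max lexx orbT.
  exact: (bint_linear cT (binteg_osc_integrand (t - u) bg)).
split; first by apply: binteg_sum => k; apply: bintegZ; exact: (h _).1.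
rewrite /rsum bint_sum => [|k]; last by apply: bintegZ; exact: (h _).1.
by apply: eq_bigr => k _; rewrite bintZ ?(h _).2 //; exact: (h _).1.
Qed.

(** The integrals of [F t n] have two limits: under the integral sign the Riemann sums tend to the
    resolvent, and outside they are Riemann sums of the convolution of the transform. *)
Lemma osc_integral_res (g : R -> X) : binteg g ->
  binteg (fun s => res_at s (g s)) /\
  forall t, osc_integral (fun s => res_at s (g s)) t = - sconv T (osc_integral g) t.
Proof.
move=> bg; have [C hC] := osc_integral_bounded bg.
pose F t n (s : R) : X := - rsum n (fun u => T (Num.max u 0) (expi (s * (t - u)) *: g s)).
have bF t n : binteg (F t n).
  by have := bintegZ (-1) (rsum_osc_integrand n t bg).1; under eq_fun do rewrite scaleN1r.
have key t : binteg (osc_integrand (fun s => res_at s (g s)) t) /\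
    bint (F t n) @[n --> \oo] --> bint (osc_integrand (fun s => res_at s (g s)) t).
  have := @bint_dominated_cvg R X (F t) (osc_integrand (fun s => res_at s (g s)) t)
    (fun s => M / w * expR w * rnorm (g s)).
  apply.
  - by move=> n; exact: (bF t n).1.
  - by apply: measurable_funM; [exact: measurable_cst|apply: smeas_rnorm; exact: bg.1].
  - have MwE : 0 <= M / w * expR w by apply: mulr_ge0 (ltW Mw0) (expR_ge0 _).
    rewrite integralTZ ?lte_mul_pinfty // ?lee_fin //; first exact: bg.2.
      by apply: smeas_rnorm; exact: bg.1.
    by move=> s; exact: rnorm_ge0.
  - move=> n s; rewrite /F rnormN -osc_rsum rnormZ norm_expi mul1r.
    rewrite mulrAC.
    apply: (@rsum_orbit_le R X _ M w w0 M1 (@hMs s) (fun=> g s) (rnorm (g s)) 0 n) => //.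
  - move=> s; have h : expi (s * t) *: (- rsum n (fun u => rescale (imag s) T (Num.max u 0) (g s)))
        @[n --> \oo] --> expi (s * t) *: res_at s (g s).
      by apply: (@cvg_scale R X); [exact: ccvg_cst|exact: res_at_rsum].
    move: h; apply: (@cvg_near_eq R X); apply: nearW => n.
    by rewrite /F -osc_rsum scalerN.
split.
  have [[m i] _] := key 0; move: m i; rewrite nint_osc_integrand.
  rewrite (_ : osc_integrand _ 0 = fun s => res_at s (g s)); first by split.
  by apply/funext => s; rewrite /osc_integrand mulr0 expi0 scale1r.
move=> t; have [_ h1] := key t.
have h2 : bint (F t n) @[n --> \oo] --> - sconv T (osc_integral g) t.
  have h : - rsum n (fun u => T (Num.max u 0) (osc_integral g (t - u))) @[n --> \oo] -->
      - sconv T (osc_integral g) t.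
    apply: cvgN.
    exact: (@sconv_rsum R X T M w sT w0 M1 hM (osc_integral g) C t (osc_integral_continuous bg) hC).
  move: h; apply: (@cvg_near_eq R X); apply: nearW => n.
  have [b e] := rsum_osc_integrand n t bg; rewrite -e -scaleN1r -(bintZ _ b).
  by congr bint; apply/funext => s; rewrite scaleN1r.
exact: (cvg_rnorm_unique h1 h2).
Qed.

Lemma osc_Lpnorm_res_le (p : R) (g : R -> X) : 1 <= p ->
  (osc_Lpnorm p (fun s => res_at s (g s)) <= (M / w * 2)%:E * osc_Lpnorm p g)%E.
Proof.
move=> hp; have [gy|gy] := eqVneq (osc_Lpnorm p g) +oo%E.
  by rewrite gy gt0_muley ?leey // lte_fin mulr_gt0.
have glt : (osc_Lpnorm p g < +oo)%E by rewrite ltey.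
have [g' gg bg] := osc_Lpnorm_lty glt.
have [b e] := osc_integral_res bg.
rewrite (@osc_LpnormE R X p (fun s => res_at s (g s)) (fun s => res_at s (g' s))) //; last first.
  exact: (ae_versionT_map res_at gg).
rewrite (_ : osc_integral _ = fun t => - sconv T (osc_integral g') t); last first.
  by apply/funext => t; exact: e.
rewrite Np_opp; move: glt; rewrite (osc_LpnormE p gg bg) => glt.
by apply: (sconv_young sT w0 M1 hM hp) => //; exact: smeas_osc_integral.
Qed.

End osc_resolvent.

(** * Schwartz functions *)

Section mean_value_inequality.
Context (R : realType) (V : normedModType R[i]).
Implicit Types (f : R -> V).

Lemma has_deriv_near f t l : has_deriv f t l -> forall e : R, 0 < e ->
  exists2 d : R, 0 < d & forall h, `|h| < d -> rnorm (f (t + h) - f t - h%:C *: l) <= e * `|h|.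
Proof.
move=> fd e e0; have /cvg_rnormP/cvgr0Pnorm_le/(_ e e0)[d /= d0 hd] := fd; exists d => // h hd'.
have [->|h0] := eqVneq h 0; first by rewrite addr0 subrr scale0r subr0 rnorm0 normr0 mulr0.
have := hd h; rewrite /ball_ /= sub0r normrN => /(_ hd' h0).
rewrite ger0_norm ?rnorm_ge0 // => {}hd.
have -> : f (t + h) - f t - h%:C *: l = h%:C *: (h^-1%:C *: (f (t + h) - f t) - l).
  by rewrite scalerBr scalerA -rmorphM /= mulfV // scale1r.
by rewrite rnormZr mulrC ler_wpM2r.
Qed.

Lemma has_deriv_near_le f t l : has_deriv f t l -> forall e : R, 0 < e ->
  exists2 d : R, 0 < d & forall h, `|h| < d -> rnorm (f (t + h) - f t) <= (rnorm l + e) * `|h|.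
Proof.
move=> fd e e0; have [d d0 hd] := has_deriv_near fd e0; exists d => // h /hd h1.
rewrite -[X in rnorm X](subrK (h%:C *: l)); apply: le_trans (ler_rnormD _ _) _.
by rewrite rnormZr mulrDl addrC mulrC lerD2l.
Qed.

Lemma has_deriv_continuous f t l : has_deriv f t l -> {for t, continuous f}.
Proof.
move=> fd; have [d d0 hd] := has_deriv_near_le fd ltr01.
have K0 : 0 < rnorm l + 1 by rewrite ltr_wpDl ?rnorm_ge0.
apply/cvg_rnormP/cvgr0Pnorm_lt => e e0.
have m0 : 0 < Num.min d (e / (rnorm l + 1)) by rewrite lt_min d0 divr_gt0.
near=> s; rewrite ger0_norm ?rnorm_ge0 //.
have st : `|s - t| < Num.min d (e / (rnorm l + 1)).
  by rewrite distrC; near: s; exact: cvgr_dist_lt.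
move: st; rewrite lt_min => /andP[s1 s2].
have := hd (s - t) s1; rewrite subrKC => /le_lt_trans; apply.
by rewrite mulrC -ltr_pdivlMr.
Unshelve. all: by end_near. Qed.

(* The last point where the increment from [a] obeys the bound is [b]: past it, the derivative
   would keep the bound valid a little longer. *)
Lemma rnorm_mvt f (f' : R -> V) (a b C : R) : a <= b -> (forall t, has_deriv f t (f' t)) ->
  (forall t, a <= t <= b -> rnorm (f' t) <= C) -> rnorm (f b - f a) <= C * (b - a).
Proof.
move=> ab fd fC; apply/ler_addgt0Pr => e0 e00.
have [e [e1 e2]] : exists e, 0 < e /\ e * (b - a) <= e0.
  exists (e0 / (b - a + 1)); split; first by rewrite divr_gt0 // ltr_wpDl // subr_ge0.
  have h1 : 0 < b - a + 1 by rewrite ltr_wpDl // subr_ge0.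
  by rewrite mulrAC ler_pdivrMr // ler_pM2l // lerDl.
apply: (@le_trans _ _ ((C + e) * (b - a))); last by rewrite mulrDl lerD2l.
pose S := [set t | a <= t <= b /\ rnorm (f t - f a) <= (C + e) * (t - a)].
have Sa : S a by split; rewrite ?lexx ?ab // !subrr rnorm0 mulr0.
have supS : has_sup S by split; [exists a|exists b => t [/andP[]]].
have ac : a <= sup S by exact: (ub_le_sup supS.2 Sa).
have cb : sup S <= b by apply: ge_sup; [exists a|move=> t [/andP[]]].
(* If the bound failed at the supremum by some [gap], points of [S] closer than [gap / K] would
   violate it too, since both sides vary there at a total rate of at most [K]. *)
have Sc : rnorm (f (sup S) - f a) <= (C + e) * (sup S - a).
  rewrite leNgt; apply/negP => gt.
  pose K := rnorm (f' (sup S)) + 1 + `|C + e|.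
  have K0 : 0 < K by rewrite /K ltr_wpDr // ltr_wpDl ?rnorm_ge0.
  have [d d0 hd] := has_deriv_near_le (fd (sup S)) ltr01.
  pose gap := rnorm (f (sup S) - f a) - (C + e) * (sup S - a).
  have gap0 : 0 < gap by rewrite subr_gt0.
  have dd : 0 < Num.min d (gap / K) by rewrite lt_min d0 divr_gt0.
  have [t [tab ft] ts] := sup_adherent dd supS.
  have tc : t <= sup S by apply: ub_le_sup => //; exact: supS.2.
  have tn : `|t - sup S| = sup S - t by rewrite distrC ger0_norm // subr_ge0.
  have [h1 h2] : sup S - t < d /\ sup S - t < gap / K.
    by move: ts; rewrite ltrBlDr -ltrBlDl lt_min => /andP[].
  have := hd (t - sup S); rewrite tn subrKC => /(_ h1) h3.
  have := ler_rnorm_dist (f t) (f (sup S)) (f a); rewrite rnormC => h4.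
  rewrite ltr_pdivlMr // /gap /K in h2.
  have h5 : (C + e) * (t - a) = (C + e) * (sup S - a) - (C + e) * (sup S - t) by ring.
  have h6 : - (C + e) * (sup S - t) <= `|C + e| * (sup S - t).
    by rewrite ler_wpM2r ?subr_ge0 // -normrN ler_norm.
  rewrite rnormC in h4; rewrite rnormC in h3.
  have h7 : (sup S - t) * (rnorm (f' (sup S)) + 1 + `|C + e|) =
    (rnorm (f' (sup S)) + 1) * (sup S - t) + `|C + e| * (sup S - t) by ring.
  rewrite h7 in h2; lra.
move: cb; rewrite le_eqVlt => /orP[/eqP <- //|cb].
have [d d0 hd] := has_deriv_near_le (fd (sup S)) e1.
pose h := Num.min (d / 2) (b - sup S).
have h0 : 0 < h by rewrite lt_min divr_gt0 //= subr_gt0.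
have hd' : h < d.
  by apply: (@le_lt_trans _ _ (d / 2)); [rewrite ge_min lexx|rewrite ltr_pdivrMr // mulr_natr mulr2n ltrDl].
have hb : sup S + h <= b by rewrite -lerBrDl ge_min lexx orbT.
have Sh : S (sup S + h).
  split; first by rewrite hb (le_trans ac) // lerDl ltW.
  apply: le_trans (ler_rnorm_dist (f (sup S)) _ _) _.
  have := hd h; rewrite gtr0_norm // => /(_ hd') h1.
  have h2 : rnorm (f' (sup S)) <= C by apply: fC; rewrite ac ltW.
  have h3 : (rnorm (f' (sup S)) + e) * h <= (C + e) * h by rewrite ler_wpM2r ?(ltW h0) // lerD2r.
  have -> : (C + e) * (sup S + h - a) = (C + e) * h + (C + e) * (sup S - a) by ring.
  by apply: lerD => //; exact: le_trans h3.
have := ub_le_sup supS.2 Sh; rewrite gerDl leNgt h0 //.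
Qed.

Lemma has_deriv0_cst f : (forall t, has_deriv f t 0) -> forall t, f t = f 0.
Proof.
move=> fd t; apply/eqP; rewrite -subr_eq0 -rnorm_eq0P; apply/eqP/le_anti.
rewrite rnorm_ge0 andbT.
have h a b : a <= b -> rnorm (f b - f a) <= 0.
  move=> ab; have := @rnorm_mvt f (fun=> 0) a b 0 ab fd.
  by rewrite mul0r; apply => s _; rewrite rnorm0.
by case: (leP 0 t) => t0; [exact: h|rewrite rnormC; apply: h; exact: ltW].
Qed.

Lemma cvg_dnbhs_of_seq f (t : R) (l : V) :
  (forall u : nat -> R, (forall n, u n != t) -> u n @[n --> \oo] --> t ->
     f (u n) @[n --> \oo] --> l) ->
  f s @[s --> t^'] --> l.
Proof.
move=> h; apply/cvg_rnormP.
have := (@cvgr_dnbhsP R (fun s => rnorm (f s - l)) t 0).2; apply => u [ut1 ut].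
by have /cvg_rnormP := h u ut1 ut.
Qed.

End mean_value_inequality.

Section schwartz_class.
Context (R : realType) (V : normedModType R[i]).
Implicit Types (v : R -> V).

Definition rapid v := forall m : nat, exists M : R, forall t, `|t| ^+ m * rnorm (v t) <= M.

Lemma schwartz_rapid v : schwartz v -> rapid v.
Proof. by move=> [d [<- _ h]] m; exact: h. Qed.

Lemma schwartz_deriv v : schwartz v ->
  exists2 v' : R -> V, schwartz v' & forall t, has_deriv v t (v' t).
Proof.
move=> [d [d0 dd h]]; exists (d 1%N); last by move=> t; rewrite -d0; exact: dd.
by exists (fun n => d n.+1).
Qed.

(* Choosing derivatives one after the other inside [P] produces all of them at once. *)
Lemma schwartz_coind (P : (R -> V) -> Prop) :
  (forall v, P v -> rapid v /\ exists2 v' : R -> V, P v' & forall t, has_deriv v t (v' t)) ->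
  forall v, P v -> schwartz v.
Proof.
move=> hP v Pv.
have nxt (u : {u : R -> V | P u}) : exists u' : {u : R -> V | P u},
    forall t, has_deriv (sval u) t (sval u' t).
  by case: u => u Pu /=; have [_ [u' Pu' h]] := hP u Pu; exists (exist _ u' Pu').
have [D hD] := choice nxt.
pose d n := iter n D (exist _ v Pv).
exists (fun n => sval (d n)); split => //.
by move=> m n; have [r _] := hP _ (svalP (d n)); exact: r.
Qed.

Lemma rapid_add u v : rapid u -> rapid v -> rapid (fun t => u t + v t).
Proof.
move=> ru rv m; have [[M1 h1] [M2 h2]] := (ru m, rv m); exists (M1 + M2) => t.
apply: le_trans (lerD (h1 t) (h2 t)); rewrite -mulrDr ler_wpM2l ?exprn_ge0 //.
exact: ler_rnormD.
Qed.

Lemma rapid_le (K : R) u (W : normedModType R[i]) (v : R -> W) : 0 <= K -> rapid u ->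
  (forall t, rnorm (v t) <= K * rnorm (u t)) -> forall m : nat, exists M : R,
  forall t, `|t| ^+ m * rnorm (v t) <= M.
Proof.
move=> K0 ru h m; have [M hM] := ru m; exists (K * M) => t.
apply: le_trans (ler_wpM2l K0 (hM t)); rewrite mulrCA ler_wpM2l ?exprn_ge0 //.
Qed.

Lemma schwartz_add u v : schwartz u -> schwartz v -> schwartz (fun t => u t + v t).
Proof.
move=> su sv; apply: (@schwartz_coind (fun f => exists u v, [/\ schwartz u, schwartz v &
  f = fun t => u t + v t])); last by exists u, v.
move=> _ [{}u [{}v [{}su {}sv ->]]]; split.
  by apply: rapid_add; exact: schwartz_rapid.
have [u' su' hu] := schwartz_deriv su; have [v' sv' hv] := schwartz_deriv sv.
exists (fun t => u' t + v' t); first by exists u', v'.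
by move=> t; exact: has_deriv_add.
Qed.

Lemma has_deriv_cscale (a : R[i]) v t l : has_deriv v t l -> has_deriv (fun s => a *: v s) t (a *: l).
Proof.
move=> vl; have h : a *: (h^-1%:C *: (v (t + h) - v t)) @[h --> (0 : R)^'] --> a *: l.
  by apply: (@cvg_scale R V) => //; exact: ccvg_cst.
move: h; apply: (@cvg_near_eq R V); apply: nearW => h /=.
by rewrite scalerA mulrC -scalerA scalerBr.
Qed.

Lemma schwartz_scale (a : R[i]) v : schwartz v -> schwartz (fun t => a *: v t).
Proof.
move=> sv; apply: (@schwartz_coind (fun f => exists2 v, schwartz v & f = fun t => a *: v t)); last by exists v.
move=> _ [{}v {}sv ->]; split.
  apply: (@rapid_le (cn a) v); [exact: cn_ge0|exact: schwartz_rapid|].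
  by move=> t; rewrite rnormZ.
have [v' sv' hv] := schwartz_deriv sv; exists (fun t => a *: v' t); first by exists v'.
by move=> t; exact: has_deriv_cscale.
Qed.

Lemma cderiv_expi (s r : R) : cderiv (fun r => expi (s * r)) r (imag s * expi (s * r)).
Proof.
have E (x : R) : expi (s * x) = cexp (x%:C * imag s).
  by rewrite -cexp_imag; congr cexp; rewrite /imag; simpc; rewrite mulrC.
rewrite E (_ : (fun r => expi (s * r)) = (fun r => cexp (r%:C * imag s))); last by apply/funext.
exact: cderiv_cexp.
Qed.

Lemma cderiv_expi' (a r : R) : cderiv (fun r => expi (r * a)) r (imag a * expi (r * a)).
Proof.
have := cderiv_expi a r; rewrite [a * r]mulrC.
by rewrite (_ : (fun r => expi (a * r)) = (fun r => expi (r * a))) //; apply/funext => x; rewrite mulrC.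
Qed.

Lemma schwartz_modulate (a : R) v : schwartz v -> schwartz (fun s => expi (s * a) *: v s).
Proof.
move=> sv; apply: (@schwartz_coind (fun f => exists2 v, schwartz v & f = fun s => expi (s * a) *: v s));
  last by exists v.
move=> _ [{}v {}sv ->]; split.
  apply: (@rapid_le 1 v) => //; first exact: schwartz_rapid.
  by move=> t; rewrite rnormZ norm_expi.
have [v' sv' hv] := schwartz_deriv sv.
exists (fun s => expi (s * a) *: (imag a *: v s + v' s)).
  exists (fun s => imag a *: v s + v' s) => //.
  by apply: schwartz_add => //; exact: schwartz_scale.
move=> t; apply: has_deriv_eq (has_deriv_scale (cderiv_expi' a t) (hv t)) _.
by rewrite scalerDr scalerA mulrC.
Qed.

Lemma schwartz_continuous v : schwartz v -> continuous v.
Proof.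
by move=> /schwartz_deriv[v' _ hv] t; exact: has_deriv_continuous (hv t).
Qed.

Lemma rapid_oneDsqr v : rapid v -> exists M : R, forall t, rnorm (v t) <= M * (1 + t ^+ 2)^-1.
Proof.
move=> rv; have [[M0 h0] [M2 h2]] := (rv 0%N, rv 2%N); exists (M0 + M2) => t.
have t0 : 0 < 1 + t ^+ 2 by rewrite ltr_wpDr ?sqr_ge0.
rewrite ler_pdivlMr // mulrDr mulr1 lerD //; first by have := h0 t; rewrite expr0 mul1r.
by have := h2 t; rewrite real_normK ?num_real // mulrC.
Qed.

End schwartz_class.

Section schwartz_map.
Context (R : realType) (V W : normedModType R[i]).

Lemma schwartz_map (L : {linear V -> W}) (v : R -> V) : continuous L -> schwartz v ->
  schwartz (fun t => L (v t)).
Proof.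
move=> cL sv; have [K K0 hK] := continuous_linear_bound cL.
apply: (@schwartz_coind R W (fun f => exists2 v, schwartz v & f = fun t => L (v t))); last by exists v.
move=> _ [{}v {}sv ->]; split.
  by apply: (@rapid_le R V K v); [exact: ltW|exact: schwartz_rapid|move=> t; exact: hK].
have [v' sv' hv] := schwartz_deriv sv; exists (fun t => L (v' t)); first by exists v'.
by move=> t; exact: (has_deriv_map cL (hv t)).
Qed.

End schwartz_map.

Section oneDsqr_integral.
Context (R : realType).
Local Notation mu := (@lebesgue_measure R).

Lemma oneDsqr_gt0 (t : R) : 0 < 1 + t ^+ 2.
Proof. by rewrite ltr_wpDr ?sqr_ge0. Qed.

Lemma measurable_oneDsqrV : measurable_fun setT (fun t : R => (1 + t ^+ 2)^-1).
Proof. by apply: continuous_measurable_fun => t; exact: continuous_oneDsqrV. Qed.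

Lemma integral_oneDsqrV_lty (K : R) : 0 <= K ->
  (\int[mu]_t (K * (1 + t ^+ 2)^-1)%:E < +oo)%E.
Proof.
move=> K0; rewrite integralTZ //; [|exact: measurable_oneDsqrV|].
  apply: lte_mul_pinfty; rewrite ?lee_fin //.
  rewrite (@ge0_symfun_integralT R (fun t => (1 + t ^+ 2)^-1)).
  - rewrite (_ : [set x | _] = `[0, +oo[%classic); last first.
      by apply/seteqP; split => x/=; rewrite in_itv/= andbT.
    by have := @integral0y_oneDsqr R; rewrite /oneDsqr => ->; rewrite -EFinM ltry.
  - by move=> t; rewrite invr_ge0 ltW // oneDsqr_gt0.
  - by move=> t; exact: continuous_oneDsqrV.
  - by move=> t /=; rewrite sqrrN.
by move=> t; rewrite invr_ge0 ltW // oneDsqr_gt0.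
Qed.

End oneDsqr_integral.

Section schwartz_integral.
Context (R : realType) (V : completeNormedModType R[i]).
Implicit Types (v : R -> V).

Lemma binteg_oneDsqr v (M : R) : smeas v -> (forall t, rnorm (v t) <= M * (1 + t ^+ 2)^-1) -> binteg v.
Proof.
move=> mv hM; apply: (binteg_dominated mv) (hM) _.
  by apply: measurable_funM; [exact: measurable_cst|exact: measurable_oneDsqrV].
apply: integral_oneDsqrV_lty.
have := le_trans (rnorm_ge0 _) (hM 0).
by rewrite pmulr_lge0 // invr_gt0 oneDsqr_gt0.
Qed.

Lemma binteg_rapid v : smeas v -> rapid v -> binteg v.
Proof. by move=> mv rv; have [M hM] := rapid_oneDsqr rv; exact: binteg_oneDsqr hM. Qed.

Lemma binteg_schwartz v : schwartz v -> binteg v.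
Proof.
move=> sv; apply: binteg_rapid; last exact: schwartz_rapid.
by apply: smeas_continuous; exact: schwartz_continuous.
Qed.

End schwartz_integral.

(** * Translation of Bochner integrals and scalar densities *)

Section bochner_translation.
Context (R : realType) (V : completeNormedModType R[i]).
Implicit Types (f : R -> V).
Local Notation mu := (@lebesgue_measure R).

Lemma measurable_preimage (g : R -> R) (A : set R) : measurable_fun setT g ->
  @measurable _ (measurableTypeR R) A -> @measurable _ (measurableTypeR R) (g @^-1` A).
Proof. by move=> mg mA; have := mg measurableT A mA; rewrite setTI. Qed.

Lemma measurable_shift (h : R) : measurable_fun setT (fun x : R => x + h).
Proof. by apply: measurable_funD => //; exact: measurable_cst. Qed.

Lemma lebesgue_measure_shift (h : R) (A : set R) :
  @measurable _ (measurableTypeR R) A -> mu ((fun x => x + h) @^-1` A) = mu A.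
Proof.
move=> mA; rewrite -(lebesgue_measure_reflect h mA) -(lebesgue_measure_reflect 0).
  by congr (mu _); apply/seteqP; split=> x /=; rewrite sub0r [- x + h]addrC.
by apply: measurable_preimage => //; exact: measurable_shift.
Qed.

Lemma bint_translate f (h : R) : binteg f ->
  binteg (fun s => f (s + h)) /\ bint (fun s => f (s + h)) = bint f.
Proof.
move=> bf; have [mf nf] := bf.
have nE (g : R -> V) : smeas g -> nint (fun s => g (s + h)) = nint g.
  move=> mg; rewrite /nint -(@integral_translate R (- h) (fun t => rnorm (g t))).
  - by apply: eq_integral => t _; rewrite opprK.
  - exact: smeas_rnorm.
  - by move=> t; exact: rnorm_ge0.
have bfh : binteg (fun s => f (s + h)).
  by split; [exact: (smeas_comp (measurable_shift h) mf)|rewrite nE].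
split; [exact: bfh|have [s sa sl] := bint_isint bf].
have /bochner_approxP[s1 s2] := sa.
have fs n : fsimple (fun t => s n (t + h)).
  have [[f1 f2] _] := s1 n; split.
    by apply: sub_finite_set f1 => _ [t _ <-]; exists (t + h).
  move=> x; apply: (@measurable_preimage (fun t => t + h) (s n @^-1` [set x])) => //.
  exact: measurable_shift.
apply: isint_bint; [exact: bfh|exists (fun n t => s n (t + h))].
  apply/bochner_approxP; split.
    move=> n; split; first exact: fs.
    by rewrite nE; [exact: (s1 n).2|exact: smeas_fsimple (s1 n).1].
  move: s2; rewrite (_ : (fun n => nint (fun t => f t - s n t)%R) =
    (fun n => nint (fun t => f (t + h) - s n (t + h))%R)) //.
  apply/funext => n; rewrite (nE (fun t => f t - s n t)%R) //.
  by apply: smeas_sub => //; exact: smeas_fsimple (s1 n).1.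
move: sl; rewrite (_ : (fun n => simple_integral setT (s n)) =
  (fun n => simple_integral setT (fun t => s n (t + h)))) //.
apply/funext => n; rewrite /simple_integral.
have -> : range (fun t => s n (t + h)) = range (s n).
  apply/seteqP; split => _ [t _ <-]; first by exists (t + h).
  by exists (t - h) => //; rewrite subrK.
apply: eq_fsbigr => x _; congr ((fine _)%:C *: _); rewrite !setTI.
by rewrite -[LHS](lebesgue_measure_shift h) //; exact: (s1 n).1.2.
Qed.

Lemma bint_simple f : fsimple f -> (nint f < +oo)%E -> bint f = simple_integral setT f.
Proof.
move=> sf nf; apply: isint_bint; first by split=> //; exact: smeas_fsimple.
exists (fun=> f); last exact: cvg_cst.
apply/bochner_approxP; split => //.
rewrite (_ : (fun n => _) = fun=> 0%E); first exact: cvg_cst.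
apply/funext => n; rewrite /nint; apply: integral0_eq => t _.
by rewrite subrr rnorm0.
Qed.

Lemma dsc_le (n : nat) (y : R) : 0 <= y -> 0 <= dsc n y <= y.
Proof.
move=> y0; rewrite /dsc; case: ifP => yn; last by rewrite lexx.
have n0 : 0 < n%:R :> R by apply: le_lt_trans yn; exact: normr_ge0.
rewrite divr_ge0 ?ler0z ?floor_ge0 ?mulr_ge0 ?(ltW n0) //=.
by rewrite ler_pdivrMr // [y * _]mulrC; exact: floor_le.
Qed.

Lemma fsimple_dsc_comp (n : nat) (phi : R -> R) : measurable_fun setT phi -> fsimple (dsc n \o phi).
Proof.
move=> mphi; have [f1 f2] := @fsimple_dsc R n; split.
  by apply: sub_finite_set f1 => _ [t _ <-]; exists (phi t).
by move=> x; apply: (@measurable_preimage phi (dsc n @^-1` [set x])).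
Qed.

Lemma smeas_real_scale (phi : R -> R) (x : V) : measurable_fun setT phi ->
  smeas (fun t => (phi t)%:C *: x).
Proof.
move=> mphi; apply: (@smeas_lim R V (fun n t => (dsc n (phi t))%:C *: x)).
  move=> n; apply: smeas_fsimple.
  exact: (fsimple_comp (fun r : R => r%:C *: x) (fsimple_dsc_comp n mphi)).
move=> t; apply: (@cvg_scale R V); last exact: cvg_cst.
by apply: ccvg_ReIm => /=; [exact: dsc_cvg|exact: cvg_cst].
Qed.

(** Carries scalar integrals, such as the mass of a Gaussian, over to vector integrals. The density
    is approximated from below by its grid values [dsc n \o phi], which are simple. *)
Lemma bint_real_scale (phi : R -> R) (x : V) (c : R) : measurable_fun setT phi ->
  (forall t, 0 <= phi t) -> (\int[mu]_t (phi t)%:E = c%:E)%E ->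
  binteg (fun t => (phi t)%:C *: x) /\ bint (fun t => (phi t)%:C *: x) = c%:C *: x.
Proof.
move=> mphi phi0 ic.
pose ph n t := dsc n (phi t).
have ph1 n t : 0 <= ph n t <= phi t by exact: dsc_le.
have ph0 n t : 0 <= ph n t by have /andP[] := ph1 n t.
have fph n : fsimple (ph n) by exact: fsimple_dsc_comp.
have mph n : measurable_fun setT (ph n).
  by apply: (@measurable_fsimple_dep R R (ph n) (fun r _ => r)) => // r; exact: measurable_cst.
have iph n : (\int[mu]_t (ph n t)%:E <= c%:E)%E by rewrite -ic; exact: le_integralT.
have nrm (r : R) : 0 <= r -> rnorm (r%:C *: x) = rnorm x * r.
  by move=> r0; rewrite rnormZr ger0_norm // mulrC.
have iG : (\int[mu]_t (rnorm x * phi t)%:E < +oo)%E.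
  by rewrite integralTZ ?rnorm_ge0 // ic -EFinM ltry.
have mG : measurable_fun setT (fun t => rnorm x * phi t).
  by apply: measurable_funM => //; exact: measurable_cst.
have bnd n t : rnorm ((ph n t)%:C *: x) <= rnorm x * phi t.
  by rewrite nrm // ler_wpM2l ?rnorm_ge0 //; have /andP[] := ph1 n t.
have ptw t : (ph n t)%:C *: x @[n --> \oo] --> (phi t)%:C *: x.
  apply: (@cvg_scale R V); last exact: cvg_cst.
  by apply: ccvg_ReIm => /=; [exact: dsc_cvg|exact: cvg_cst].
have [b l] := @bint_dominated_cvg R V (fun n t => (ph n t)%:C *: x) (fun t => (phi t)%:C *: x)
  (fun t => rnorm x * phi t) (fun n => smeas_real_scale x (mph n)) mG iG bnd ptw.
split; first exact: b.
have [x0|x0] := eqVneq x 0.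
  rewrite x0 scaler0 (_ : (fun t => _) = fun=> 0 : V); first exact: bint0.
  by apply/funext => t; rewrite scaler0.
(* Both integrals are sums over the level sets of [ph n], which have finite measure at nonzero
   values. *)
have E n : bint (fun t => (ph n t)%:C *: x) = (fine (\int[mu]_t (ph n t)%:E)%E)%:C *: x.
  have nb : (nint (fun t => (ph n t)%:C *: x) < +oo)%E.
    apply: le_lt_trans iG; apply: le_integralT => //.
      by apply: smeas_rnorm; exact: smeas_real_scale.
    by move=> t; rewrite rnorm_ge0 bnd.
  have fx := fsimple_comp (fun r : R => r%:C *: x) (fph n).
  have fin i : i != 0 -> (mu (ph n @^-1` [set i]) < +oo)%E.
    move=> i0; have [_ /(_ (i%:C *: x))] := (simple_integrableP _).2 (conj fx nb).
    rewrite scaler_eq0 negb_or x0 andbT => /(_ _)/le_lt_trans; apply; last first.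
      by apply: contra i0 => /eqP/(congr1 (@complex.Re R)) /= ->.
    rewrite setTI; apply: le_measure; rewrite ?inE; [exact: (fph n).2|exact: fx.2|].
    by move=> t /= ->.
  rewrite bint_simple // (simple_integral_label (l := ph n) (phi := fun r : R => r%:C *: x)) //; last first.
    by move=> i; rewrite scaler_eq0 negb_or => /andP[i0 _]; apply: fin; apply: contra i0 => /eqP ->.
  have -> : (\int[mu]_t (ph n t)%:E = \int[mu]_t `|ph n t|%:E)%E.
    by apply: eq_integral => t _; rewrite ger0_norm.
  rewrite (integral_label (l := ph n) (g := fun r : R => `|r|)) //.
  rewrite !fsbig_finite; [|exact: (fph n).1|exact: (fph n).1].
  rewrite (eq_big_seq (fun i => (fine (mu (ph n @^-1` [set i])) * i)%:E)); last first.
    move=> i; rewrite in_fset_set; last exact: (fph n).1.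
    move=> /set_mem[t _ <-]; rewrite ger0_norm //.
    have [->|i0] := eqVneq (ph n t) 0; first by rewrite mule0 mulr0.
    by rewrite EFinM fineK // ge0_fin_numE // fin.
  rewrite sumEFin /= rmorph_sum /= scaler_suml; apply: eq_bigr => i _.
  by rewrite rmorphM /= scalerA.
have l2 : bint (fun t => (ph n t)%:C *: x) @[n --> \oo] --> c%:C *: x.
  rewrite (_ : (fun n => _) = fun n => (fine (\int[mu]_t (ph n t)%:E)%E)%:C *: x); last exact/funext.
  apply: (@cvg_scale R V); last exact: cvg_cst.
  apply: ccvg_ReIm => /=; last exact: cvg_cst.
  have h : (\int[mu]_t (phi t - ph n t)%:E)%E @[n --> \oo] --> 0%E.
    apply: (@dominated_cvg0T R (fun n t => phi t - ph n t) phi) => //.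
    - by move=> n; apply: measurable_funB.
    - by move=> n t; have /andP[h1 h2] := ph1 n t; rewrite subr_ge0 h2 gerBl.
    - by rewrite ic ltry.
    - by move=> t; rewrite -(subrr (phi t)); apply: cvgB; [exact: cvg_cst|exact: dsc_cvg].
  apply/cvgrPdist_lt => e e0; apply: filterS (cvge0_near_lt h e0) => n.
  have ph2 t : 0 <= phi t - ph n t by rewrite subr_ge0; have /andP[] := ph1 n t.
  have := integralTD (measurable_funB mphi (mph n)) (mph n) ph2 (ph0 n).
  under eq_integral do rewrite subrK.
  rewrite ic; have := integralT_ge0 (ph0 n); have := integralT_ge0 ph2.
  case: (\int[mu]_t (phi t - ph n t)%:E)%E => [d| |] // d0.
  case: (\int[mu]_t (ph n t)%:E)%E => [a| |] // a0 [cE].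
  by rewrite lte_fin /= cE addrK => de; rewrite ger0_norm.
exact: (cvg_rnorm_unique l l2).
Qed.

End bochner_translation.

(** * Density of the transforms of Schwartz functions *)

Section fourier_rules.
Context (R : realType) (V : completeNormedModType R[i]).
Implicit Types (v : R -> V).

Lemma has_deriv_seq (W : normedModType R[i]) (f : R -> W) (t : R) (l : W) (u : nat -> R) :
  has_deriv f t l ->
  (forall n, u n != 0) -> u n @[n --> \oo] --> (0 : R) ->
  (u n)^-1%:C *: (f (t + u n) - f t) @[n --> \oo] --> l.
Proof.
move=> /cvg_rnormP fl u0 ut; apply/cvg_rnormP.
exact: ((@cvgr_dnbhsP R (fun h => rnorm (h^-1%:C *: (f (t + h) - f t) - l)) 0 0).1 fl u (conj u0 ut)).
Qed.

Lemma has_deriv_expi_scale (s r : R) (x : V) :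
  has_deriv (fun r => expi (s * r) *: x) r (expi (s * r) *: (imag s *: x)).
Proof.
apply: has_deriv_eq (has_deriv_scale (cderiv_expi s r) (has_deriv_cst x r)) _.
by rewrite scaler0 addr0 scalerA mulrC.
Qed.

Lemma rnorm_imag_scale (s : R) (x : V) : rnorm (imag s *: x) = `|s| * rnorm x.
Proof.
by rewrite rnormZ normc_def /= expr0n /= add0r sqrtr_sqr.
Qed.

Lemma rnorm_diffq_le (f f' : R -> V) (t h C : R) : h != 0 -> (forall r, has_deriv f r (f' r)) ->
  (forall r, `|r - t| <= `|h| -> rnorm (f' r) <= C) ->
  rnorm (h^-1%:C *: (f (t + h) - f t)) <= C.
Proof.
move=> h0 fd fC; have hn : 0 < `|h| by rewrite normr_gt0.
rewrite rnormZr normfV ler_pdivrMl //.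
have [hp|hn0] := leP 0 h.
  have -> : `|h| * C = C * (t + h - t) by rewrite addrAC subrr add0r ger0_norm // mulrC.
  apply: (@rnorm_mvt R V f f') => //; first by rewrite lerDl.
  by move=> r /andP[r1 r2]; apply: fC; rewrite !ger0_norm // ?subr_ge0 // lerBlDl.
rewrite rnormC; have -> : `|h| * C = C * (t - (t + h)) by rewrite opprD addNKr ltr0_norm // mulrC.
apply: (@rnorm_mvt R V f f') => //.
  by rewrite gerDl ltW.
move=> r /andP[r1 r2]; apply: fC; rewrite [leRHS]ltr0_norm // distrC ger0_norm ?subr_ge0 //.
by rewrite lerBlDr addrC -lerBlDr opprK.
Qed.

Lemma smeas_imag_scale v : smeas v -> smeas (fun s => imag s *: v s).
Proof.
move=> mv; apply: (@smeas_car R V V (fun s x => imag s *: x) v) => //; last first.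
  by move=> s x; exact: cscale_continuous.
move=> x s; apply: (@cvg_scale R V _ _ _ (@imag R)); last exact: cvg_cst.
by apply: ccvg_ReIm => /=; [exact: cvg_cst|exact: cvg_id].
Qed.

Lemma osc_integral_deriv v (t : R) : binteg v -> binteg (fun s => imag s *: v s) ->
  has_deriv (osc_integral v) t (osc_integral (fun s => imag s *: v s) t).
Proof.
move=> bv biv; apply: cvg_dnbhs_of_seq => u u0 ut.
pose F n s := (u n)^-1%:C *: (expi (s * (t + u n)) *: v s - expi (s * t) *: v s).
have FE n : (u n)^-1%:C *: (osc_integral v (t + u n) - osc_integral v t) = bint (F n).
  rewrite /osc_integral -!/(bint _) -bintB; [|exact: binteg_osc_integrand..].
  by rewrite -bintZ //; apply: bintegB; exact: binteg_osc_integrand.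
rewrite (_ : (fun n => _) = fun n => bint (F n)); last exact/funext.
apply: (@bint_dominated_cvg R V F _ (fun s => `|s| * rnorm (v s)) _ _ _ _ _).2.
- move=> n; apply: smeas_scale; apply: smeas_sub; apply: smeas_osc_integrand; exact: bv.1.
- apply: measurable_funM; last by apply: smeas_rnorm; exact: bv.1.
  exact: normr_measurable.
- have := biv.2; rewrite /nint; congr (_ < _)%E.
  by apply: eq_integral => s _; rewrite rnorm_imag_scale.
(* The derivative in [r] has norm [|s|] times that of [v s] for every [r], so the mean value
   inequality gives an integrable majorant. *)
- move=> n s; apply: (@rnorm_diffq_le (fun r => expi (s * r) *: v s)) => //.
    by move=> r; exact: has_deriv_expi_scale.
  by move=> r _; rewrite rnormZ norm_expi mul1r rnorm_imag_scale.
- move=> s; exact: (@has_deriv_seq V (fun r => expi (s * r) *: v s) t _ u (@has_deriv_expi_scale s t (v s)) u0 ut).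
Qed.

Lemma schwartz_binteg_imag v : schwartz v -> binteg (fun s => imag s *: v s).
Proof.
move=> sv; apply: binteg_rapid.
  by apply: smeas_imag_scale; apply: smeas_continuous; exact: schwartz_continuous.
move=> m; have [M hM] := schwartz_rapid sv m.+1; exists M => t.
by rewrite rnorm_imag_scale mulrA -exprSr.
Qed.

(** By translation invariance every difference quotient of [v] has integral 0, and the quotients
    converge dominatedly to [v']. *)
Lemma bint_deriv_schwartz v v' : schwartz v -> schwartz v' -> (forall t, has_deriv v t (v' t)) ->
  bint v' = 0.
Proof.
move=> sv sv' hv; have bv := binteg_schwartz sv; have bv' := binteg_schwartz sv'.
pose u n : R := n.+1%:R^-1.
have u0 n : u n != 0 by rewrite invr_eq0 pnatr_eq0.
have ut : u n @[n --> \oo] --> (0 : R) by exact: cvg_harmonic.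
pose F n s := (u n)^-1%:C *: (v (s + u n) - v s).
have [M hM] := rapid_oneDsqr (schwartz_rapid sv').
have M0 : 0 <= M.
  by have := le_trans (rnorm_ge0 _) (hM 0); rewrite pmulr_lge0 // invr_gt0 oneDsqr_gt0.
have [_ l] : binteg v' /\ bint (F n) @[n --> \oo] --> bint v'.
  apply: (@bint_dominated_cvg R V F _ (fun s => (M * 3) * (1 + s ^+ 2)^-1)).
  - move=> n; apply: smeas_scale; apply: smeas_sub; last exact: bv.1.
    exact: (smeas_comp (measurable_shift (u n)) bv.1).
  - by apply: measurable_funM; [exact: measurable_cst|exact: measurable_oneDsqrV].
  - by apply: integral_oneDsqrV_lty; rewrite mulr_ge0.
  - move=> n s; apply: (@rnorm_diffq_le v v') => // r rs; apply: le_trans (hM r) _.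
    (* The 3 comes from [1 + s^2 <= 3 (1 + r^2)] for [|r - s| <= 1]. *)
    rewrite -mulrA ler_wpM2l // -[leLHS]mul1r ler_pdivrMr ?oneDsqr_gt0 //.
    rewrite mulrAC ler_pdivlMr ?oneDsqr_gt0 //.
    have un : `|u n| <= 1 by rewrite ger0_norm ?invr_ge0 // invf_le1 ?ler1n.
    have d1 : (r - s) ^+ 2 <= 1.
      by rewrite -(expr1n _ 2) -real_normK ?num_real // lerXn2r ?nnegrE // (le_trans rs).
    have := sqr_ge0 (s - 2 * r); rewrite !sqrrB !expr2 in d1 *; nra.
  - by move=> s; exact: has_deriv_seq.
apply: (cvg_rnorm_unique l).
rewrite (_ : (fun n => bint (F n)) = fun=> 0); first exact: cvg_cst.
apply/funext => n; have [b e] := bint_translate (u n) bv.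
by rewrite /F bintZ; [rewrite bintB // e subrr scaler0|exact: bintegB].
Qed.

Lemma osc_integral_of_deriv v v' (t : R) : schwartz v -> schwartz v' ->
  (forall s, has_deriv v s (v' s)) -> osc_integral v' t = - (imag t *: osc_integral v t).
Proof.
move=> sv sv' hv; apply/eqP; rewrite -addr_eq0 addrC; apply/eqP.
have bv := binteg_schwartz sv; have bv' := binteg_schwartz sv'.
(* Integration by parts: the integrand is the derivative of [e^{ist} v s]. *)
have h : bint (fun s => expi (s * t) *: (imag t *: v s + v' s)) = 0.
  apply: (@bint_deriv_schwartz (fun s => expi (s * t) *: v s)).
  - exact: schwartz_modulate.
  - by apply: schwartz_modulate; apply: schwartz_add => //; exact: schwartz_scale.
  - move=> s; apply: has_deriv_eq (has_deriv_scale (cderiv_expi' t s) (hv s)) _.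
    by rewrite scalerDr scalerA mulrC.
rewrite -(osc_integralZ _ _ bv) -(osc_integralD _ (bintegZ _ bv) bv').
exact: h.
Qed.

End fourier_rules.

(** * The transform of a Gaussian *)

Section gaussian.
Context (R : realType) (V : completeNormedModType R[i]).
Variables (c : R) (x : V).
Hypothesis (c0 : 0 < c).

Definition gaussian (s : R) : V := (expR (- (c * s ^+ 2)))%:C *: x.

(** Polynomials times the Gaussian: a class of rapidly decreasing functions closed under
    differentiation, as [schwartz_coind] requires. *)
Inductive gpoly : (R -> V) -> Prop :=
| gpoly_gauss : gpoly gaussian
| gpoly_mul f : gpoly f -> gpoly (fun s => s%:C *: f s)
| gpoly_add f g : gpoly f -> gpoly g -> gpoly (fun s => f s + g s)
| gpoly_scale a f : gpoly f -> gpoly (fun s => a *: f s).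

Lemma is_derive_sqr (k r : R) : is_derive r 1 (fun s : R => k * s ^+ 2) (2 * k * r).
Proof.
have := @is_deriveZ _ _ _ _ k r 1 _ (is_deriveM (is_derive_id r 1) (is_derive_id r 1)).
rewrite (_ : k \*: _ = fun s : R => k * s ^+ 2); last by apply/funext => s /=; rewrite expr2.
by move=> /is_derive_eq; apply; rewrite /= /GRing.scale /=; ring.
Qed.

Lemma rapid_gaussian : rapid gaussian.
Proof.
(* The 1 serves for [|t| <= 1]; beyond, [e^y >= y^{m+1} / (m+1)!] at [y = c t^2] compensates
   [|t|^m <= t^{2(m+1)}]. *)
move=> m; exists ((1 + m.+1`!%:R / c ^+ m.+1) * rnorm x) => t.
rewrite /gaussian rnormZr (ger0_norm (expR_ge0 _)) mulrA ler_wpM2r ?rnorm_ge0 //.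
have ct0 : 0 <= c * t ^+ 2 by rewrite mulr_ge0 ?sqr_ge0 // ltW.
have e1 : expR (- (c * t ^+ 2)) <= 1 by rewrite -expR0 ler_expR oppr_le0.
have [t1|t1] := leP `|t| 1.
  apply: (@le_trans _ _ 1).
    by rewrite -[leRHS]mul1r ler_pM ?exprn_ge0 ?expR_ge0 // exprn_ile1.
  by rewrite lerDl divr_ge0 ?ler0n // exprn_ge0 // ltW.
apply: (@le_trans _ _ (m.+1`!%:R / c ^+ m.+1)); last by rewrite lerDr.
rewrite expRN ler_pdivrMr ?expR_gt0 //.
apply: (@le_trans _ _ ((t ^+ 2) ^+ m.+1)).
  rewrite -exprM -[t ^+ (2 * _)]ger0_norm ?normrX; last first.
    by rewrite exprM exprn_ge0 ?sqr_ge0.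
  by apply: ler_weXn2l; [exact: ltW|lia].
have cm : 0 < c ^+ m.+1 by rewrite exprn_gt0.
rewrite mulrAC ler_pdivlMr // mulrC -exprMn mulrC.
have := expR_ge1Dxn m ct0; rewrite -lerBrDl => /le_trans -/(_ (expR (c * t ^+ 2))).
rewrite gerBl => /(_ ler01); rewrite ler_pdivrMr ?ltr0n ?fact_gt0 //.
by rewrite (mulrC (t ^+ 2) c) (mulrC (m.+1`!%:R)).
Qed.

Lemma has_deriv_gaussian s : has_deriv gaussian s ((- (2 * c * s))%:C *: gaussian s).
Proof.
have d : is_derive s 1 (fun s => expR (- (c * s ^+ 2))) (- (2 * c * s) * expR (- (c * s ^+ 2))).
  have d1 := is_derive_sqr (- c) s.
  have := @is_derive1_comp _ expR (fun s => - c * s ^+ 2) _ _ _ (is_derive_expR _) d1.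
  rewrite (_ : expR \o _ = fun s => expR (- (c * s ^+ 2))); last by apply/funext => y /=; rewrite mulNr.
  by move=> /is_derive_eq; apply; rewrite /= /GRing.scale /= mulNr; ring.
apply: has_deriv_eq (has_deriv_scale (cderiv_real d) (has_deriv_cst x s)) _.
by rewrite scaler0 addr0 /gaussian scalerA -rmorphM.
Qed.

Lemma has_deriv_mulid (f : R -> V) s l : has_deriv f s l -> has_deriv (fun s => s%:C *: f s) s (f s + s%:C *: l).
Proof.
move=> fl; have d : is_derive s 1 (fun s : R => s) 1 by exact: is_derive_id.
by have := has_deriv_scale (cderiv_real d) fl; rewrite scale1r.
Qed.

Lemma gpoly_schwartz f : gpoly f -> schwartz f.
Proof.
apply: schwartz_coind => {}f; elim=> [|{}f Pf [rf [f' Pf' hf]]|{}f g Pf [rf [f' Pf' hf]] Pg [rg [g' Pg' hg]]|a {}f Pf [rf [f' Pf' hf]]].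
- split; first exact: rapid_gaussian.
  exists (fun s => (- (2 * c))%:C *: (s%:C *: gaussian s)).
    by apply: gpoly_scale; apply: gpoly_mul; exact: gpoly_gauss.
  move=> s; apply: has_deriv_eq (@has_deriv_gaussian s) _.
  by rewrite scalerA -rmorphM mulNr.
- split.
    move=> m; have [M hM] := rf m.+1; exists M => t.
    by rewrite rnormZr mulrA -exprSr.
  exists (fun s => f s + s%:C *: f' s); first by apply: gpoly_add => //; exact: gpoly_mul.
  by move=> s; exact: has_deriv_mulid.
- split; first exact: rapid_add.
  exists (fun s => f' s + g' s); first exact: gpoly_add.
  by move=> s; exact: has_deriv_add.
- split.
    by apply: (@rapid_le R V (cn a) f) => //; [exact: cn_ge0|move=> t; rewrite rnormZ].
  exists (fun s => a *: f' s); first exact: gpoly_scale.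
  by move=> s; exact: has_deriv_cscale.
Qed.

Lemma schwartz_gaussian : schwartz gaussian.
Proof. exact/gpoly_schwartz/gpoly_gauss. Qed.

(* The Fourier transform F of the Gaussian solves F' = - t / (2c) F. *)
Lemma osc_gaussian_ode t :
  has_deriv (osc_integral gaussian) t ((- (t / (2 * c)))%:C *: osc_integral gaussian t).
Proof.
have sg := schwartz_gaussian; have bg := binteg_schwartz sg.
have sg' : schwartz (fun s => (- (2 * c))%:C *: (s%:C *: gaussian s)).
  by apply: gpoly_schwartz; apply: gpoly_scale; apply: gpoly_mul; exact: gpoly_gauss.
have h := osc_integral_of_deriv t sg sg' (fun s => _).
apply: has_deriv_eq (@osc_integral_deriv R V gaussian t bg (schwartz_binteg_imag sg)) _.
(* The derivative of the Gaussian is [-2cs] times it, so [is] times it is [-i/(2c)] times the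
   derivative, whose transform is a multiple of the original transform. *)
have -> : (fun s => imag s *: gaussian s) =
    fun s => (imag (- (2 * c)^-1)) *: ((- (2 * c))%:C *: (s%:C *: gaussian s)).
  apply/funext => s; rewrite !scalerA; congr (_ *: _).
  by rewrite /imag; simpc; congr (_ +i* _); field; rewrite gt_eqF.
rewrite osc_integralZ; last exact: binteg_schwartz.
rewrite h; last first.
  by move=> s; apply: has_deriv_eq (@has_deriv_gaussian s) _; rewrite scalerA -rmorphM mulNr.
rewrite scalerN scalerA -scaleNr; congr (_ *: _).
by rewrite /imag; simpc; congr (_ +i* _); field; rewrite gt_eqF.
Qed.

Lemma osc_gaussian0 t :
  osc_integral gaussian t = (expR (- (t ^+ 2 / (4 * c))))%:C *: osc_integral gaussian 0.
Proof.
(* The integrating factor of the differential equation: [E] has derivative 0. *)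
pose E r := (expR (r ^+ 2 / (4 * c)))%:C *: osc_integral gaussian r.
have dE r : has_deriv E r 0.
  have d : is_derive r 1 (fun r => expR (r ^+ 2 / (4 * c))) (r / (2 * c) * expR (r ^+ 2 / (4 * c))).
    have d1 := is_derive_sqr (4 * c)^-1 r.
    have := @is_derive1_comp _ expR (fun s => (4 * c)^-1 * s ^+ 2) _ _ _ (is_derive_expR _) d1.
    rewrite (_ : expR \o _ = fun s => expR (s ^+ 2 / (4 * c))); last by apply/funext => y /=; rewrite mulrC.
    by move=> /is_derive_eq; apply; rewrite /= /GRing.scale /= [_^-1 * _]mulrC; field; rewrite gt_eqF.
  apply: has_deriv_eq (has_deriv_scale (cderiv_real d) (@osc_gaussian_ode r)) _.
  by rewrite scalerA -scalerDl -rmorphM -rmorphD mulrN mulrC subrr scale0r.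
have := has_deriv0_cst dE t; rewrite /E expr0n /= mul0r expR0 scale1r => <-.
by rewrite scalerA -rmorphM /= -expRD addNr expR0 scale1r.
Qed.

End gaussian.

Section density_closure.
Context (R : realType) (V : completeNormedModType R[i]).
Variables (p : R) (hp : 1 <= p).
Local Notation mu := (@lebesgue_measure R).
Implicit Types (f g : R -> V).

(* Membership in the [L^p] closure of the transforms of Schwartz functions. *)
Definition fdense f := smeas f /\ forall e : R, 0 < e -> exists v, schwartz v /\
  (Np p (fun t => f t - osc_integral v t)%R < e%:E)%E.

Let p0 : 0 < p. Proof. exact: lt_le_trans hp. Qed.

Lemma Np0 : Np p (fun=> 0 : V) = 0%E.
Proof.
apply/eqP; rewrite eq_le Np_ge0 andbT Np_le_powR //; rewrite powR0 ?gt_eqF // /Jp.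
by rewrite integral0_eq // => t _; rewrite rnorm0 powR0 // gt_eqF.
Qed.

Lemma smeas_osc_schwartz (v : R -> V) : schwartz v -> smeas (osc_integral v).
Proof. by move=> sv; apply: smeas_osc_integral; exact: binteg_schwartz. Qed.

Lemma fdense_lim f : smeas f ->
  (forall e : R, 0 < e -> exists g, fdense g /\ (Np p (fun t => f t - g t)%R < e%:E)%E) -> fdense f.
Proof.
move=> mf h; split=> // e e0; have e2 : 0 < e / 2 by rewrite divr_gt0.
have [g [[mg hg] fg]] := h _ e2; have [v [sv gv]] := hg _ e2; exists v; split=> //.
have mv := smeas_osc_schwartz sv.
have -> : (fun t => f t - osc_integral v t) = fun t => (f t - g t) + (g t - osc_integral v t).
  by apply/funext => t; rewrite addrA subrK.
apply: le_lt_trans (Np_add hp (smeas_sub mf mg) (smeas_sub mg mv)) _.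
by rewrite [e]splitr EFinD; exact: (lteD fg gv).
Qed.

Lemma fdense_osc (v : R -> V) : schwartz v -> fdense (osc_integral v).
Proof.
move=> sv; split; first exact: smeas_osc_schwartz.
move=> e e0; exists v; split=> //; rewrite (_ : (fun t => _) = fun=> 0 : V).
  by rewrite Np0 lte_fin.
by apply/funext => t; rewrite subrr.
Qed.

Lemma fdense_add f g : fdense f -> fdense g -> fdense (fun t => f t + g t).
Proof.
move=> [mf hf] [mg hg]; split; first exact: smeas_add.
move=> e e0; have e2 : 0 < e / 2 by rewrite divr_gt0.
have [u [su fu]] := hf _ e2; have [v [sv gv]] := hg _ e2.
exists (fun s => u s + v s); split; first exact: schwartz_add.
have -> : (fun t => f t + g t - osc_integral (fun s => u s + v s) t) =
    fun t => (f t - osc_integral u t) + (g t - osc_integral v t).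
  by apply/funext => t; rewrite osc_integralD; [rewrite opprD addrACA|exact: binteg_schwartz..].
apply: le_lt_trans (Np_add hp _ _) _; [by apply: smeas_sub => //; exact: smeas_osc_schwartz..|].
by rewrite [e]splitr EFinD; exact: (lteD fu gv).
Qed.

Lemma fdense_scale (a : R[i]) f : fdense f -> fdense (fun t => a *: f t).
Proof.
move=> [mf hf]; split; first exact: smeas_scale.
move=> e e0; have a0 : 0 < cn a + 1 by rewrite ltr_wpDl ?cn_ge0.
have ea : 0 < e / (cn a + 1) by rewrite divr_gt0.
have [v [sv fv]] := hf _ ea; exists (fun s => a *: v s); split; first exact: schwartz_scale.
have mv := smeas_osc_schwartz sv.
apply: (@le_lt_trans _ _ ((cn a + 1)%:E * Np p (fun t => f t - osc_integral v t)%R)%E).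
  apply: Np_scale_le => //; first exact: ltW.
  - exact: smeas_sub.
  - by apply: smeas_sub; [exact: smeas_scale|apply: smeas_osc_schwartz; exact: schwartz_scale].
  - move=> t; rewrite osc_integralZ; last exact: binteg_schwartz.
    by rewrite -scalerBr rnormZ ler_wpM2r ?rnorm_ge0 // -/(cn a) lerDl.
have -> : e%:E = ((cn a + 1)%:E * (e / (cn a + 1))%:E)%E.
  by rewrite -EFinM mulrC divfK // gt_eqF.
by rewrite lte_pmul2l // lte_fin.
Qed.

Lemma fdense0 : fdense (fun=> 0).
Proof.
split; first exact: smeas_cst.
move=> e e0; exists (fun=> 0); split.
  exists (fun _ _ => 0); split=> //; first by move=> n t; exact: has_deriv_cst.
  by move=> m n; exists 0 => t; rewrite rnorm0 mulr0.
rewrite (_ : (fun t => _) = fun=> 0 : V) ?Np0 ?lte_fin //.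
apply/funext => t; rewrite /osc_integral /osc_integrand.
rewrite (_ : (fun s => _) = fun=> 0 : V) -?/(bint _) ?bint0 ?subrr //.
by apply/funext => s; rewrite scaler0.
Qed.

Lemma fdense_sum (I : Type) (r : seq I) (F : I -> R -> V) :
  (forall i, fdense (F i)) -> fdense (fun t => \sum_(i <- r) F i t).
Proof.
move=> h; elim: r => [|i r IH].
  rewrite (_ : (fun t => _) = fun=> 0); first exact: fdense0.
  by apply/funext => t; rewrite big_nil.
rewrite (_ : (fun t => _) = fun t => F i t + \sum_(i <- r) F i t); first exact: fdense_add.
by apply/funext => t; rewrite big_cons.
Qed.

Lemma fdense_opp f : fdense f -> fdense (fun t => - f t).
Proof.
move=> df; rewrite (_ : (fun t => - f t) = fun t => (-1) *: f t); first exact: fdense_scale.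
by apply/funext => t; rewrite scaleN1r.
Qed.

Lemma Np_ae f g (N : set R) : @measurable _ (measurableTypeR R) N -> mu N = 0%E ->
  (forall t, ~ N t -> f t = g t) -> Np p f = Np p g.
Proof.
move=> mN N0 h; rewrite -(@Lpnorm_version R V p setT g f).
  by rewrite -(@Lpnorm_version R V p setT g g) //; exact: ae_version_refl.
by exists N; split=> // [t _ /h //|t /(_ I)].
Qed.

Lemma fdense_ae f g (N : set R) : @measurable _ (measurableTypeR R) N -> mu N = 0%E ->
  (forall t, ~ N t -> f t = g t) -> smeas f -> fdense g -> fdense f.
Proof.
move=> mN N0 h mf dg; apply: fdense_lim => // e e0; exists g; split=> //.
rewrite (@Np_ae _ (fun=> 0) N) ?Np0 ?lte_fin // => t Nt.
by rewrite h // subrr.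
Qed.

Lemma fdense_dominated f (F : nat -> R -> V) (G : R -> R) : smeas f ->
  (forall n, fdense (F n)) -> measurable_fun setT G ->
  (\int[mu]_t (G t)%:E < +oo)%E -> (forall n t, rnorm (f t - F n t) `^ p <= G t) ->
  (forall t, F n t @[n --> \oo] --> f t) -> fdense f.
Proof.
move=> mf dF mG iG hG hF; apply: fdense_lim => // e e0.
have h := @Np_dominated R V p hp (fun n t => f t - F n t) G
  (fun n => smeas_sub mf (dF n).1) mG iG hG _ e e0.
have [|N _ hN] := h.
  move=> t; rewrite -(subrr (f t)); apply: cvgB; [exact: cvg_cst|exact: hF].
by exists (F N); split=> //; apply: hN => /=.
Qed.

Lemma powR_oneDsqr_le (B t y : R) : 0 <= y -> y <= B * (1 + t ^+ 2)^-1 ->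
  y `^ p <= B `^ p * (1 + t ^+ 2)^-1.
Proof.
move=> y0 yB; have t1 : 1 <= 1 + t ^+ 2 by rewrite lerDl sqr_ge0.
have j0 : 0 <= (1 + t ^+ 2)^-1 by rewrite invr_ge0 ltW // oneDsqr_gt0.
have B0 : 0 <= B by have := le_trans y0 yB; rewrite pmulr_lge0 // invr_gt0 oneDsqr_gt0.
apply: (@le_trans _ _ ((B * (1 + t ^+ 2)^-1) `^ p)).
  by apply: ge0_ler_powR => //; rewrite ?nnegrE ?mulr_ge0 // ltW.
rewrite powRM // ler_wpM2l ?powR_ge0 //.
have j1 : 0 < (1 + t ^+ 2)^-1 <= 1.
  by rewrite invr_gt0 oneDsqr_gt0 invf_le1 ?oneDsqr_gt0.
by have := @ger_powR R _ j1 1 p hp; rewrite powRr1.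
Qed.

Lemma fdense_oneDsqr f (F : nat -> R -> V) (B : R) : smeas f ->
  (forall n, fdense (F n)) -> (forall n t, rnorm (f t - F n t) <= B * (1 + t ^+ 2)^-1) ->
  (forall t, F n t @[n --> \oo] --> f t) -> fdense f.
Proof.
move=> mf dF hB hF; apply: (@fdense_dominated f F (fun t => B `^ p * (1 + t ^+ 2)^-1)) => //.
- by apply: measurable_funM; [exact: measurable_cst|exact: measurable_oneDsqrV].
- exact/integral_oneDsqrV_lty/powR_ge0.
- by move=> n t; apply: powR_oneDsqr_le; rewrite ?rnorm_ge0.
Qed.

End density_closure.

(** * Indicators of intervals from averaged normal densities *)

Section density_intervals.
Context (R : realType) (V : completeNormedModType R[i]).
Variables (p : R) (hp : 1 <= p).
Local Notation mu := (@lebesgue_measure R).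
Local Notation fdense := (@fdense R V p).

Lemma integral_gaussian (c : R) : 0 < c -> exists k : R, 0 < k /\
  (\int[mu]_s (expR (- (c * s ^+ 2)))%:E = k%:E)%E.
Proof.
(* The standard deviation whose normal density is proportional to the Gaussian:
   [c = 1 / (2 s0^2)]. *)
move=> c0; pose s0 := Num.sqrt (2 * c)^-1.
have s00 : 0 < s0 by rewrite sqrtr_gt0 invr_gt0 mulr_gt0.
have s0N : s0 != 0 by rewrite gt_eqF.
have peak0 := normal_peak_gt0 s0N.
exists (normal_peak s0)^-1; split; first by rewrite invr_gt0.
have E s : expR (- (c * s ^+ 2)) = (normal_peak s0)^-1 * normal_pdf 0 s0 s.
  rewrite normal_pdfE // mulrA mulVf ?gt_eqF // mul1r /normal_fun subr0.
  congr expR; rewrite /s0 sqr_sqrtr ?invr_ge0 ?mulr_ge0 ?(ltW c0) //.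
  by rewrite -mulr_natr; field; rewrite gt_eqF.
under eq_integral do rewrite E.
rewrite integralTZ ?integral_normal_pdf ?mule1 ?invr_ge0 ?(ltW peak0) //.
  exact: measurable_normal_pdf.
by move=> t; exact: normal_pdf_ge0.
Qed.

(** A normal density is exactly a transform: the Gaussian with [c = s^2 / 2] transforms into one of
    standard deviation [s], and the modulation [e^{-iur}] moves its center to [u]. *)
Lemma fdense_normal (u s : R) (x : V) : 0 < s -> fdense (fun t => (normal_pdf u s t)%:C *: x).
Proof.
move=> s0; have sN : s != 0 by rewrite gt_eqF.
pose c := s ^+ 2 / 2; have c0 : 0 < c by rewrite divr_gt0 // exprn_gt0.
have [k [k0 ik]] := integral_gaussian c0.
have sg := schwartz_gaussian x c0.
pose v (r : R) := (normal_peak s / k)%:C *: (expi (r * - u) *: gaussian c x r).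
have sv : schwartz v by apply: schwartz_scale; exact: schwartz_modulate.
rewrite (_ : (fun t => _) = osc_integral v); first exact: fdense_osc.
apply/funext => t; rewrite /v osc_integralZ; last first.
  by apply: binteg_schwartz; exact: schwartz_modulate.
have -> : osc_integral (fun r => expi (r * - u) *: gaussian c x r) t =
    osc_integral (gaussian c x) (t - u).
  congr bint; apply/funext => r; rewrite /osc_integrand scalerA -expiD -mulrDr //.
rewrite osc_gaussian0 //.
have -> : osc_integral (gaussian c x) 0 = k%:C *: x.
  have mg : measurable_fun setT (fun s : R => expR (- (c * s ^+ 2))).
    apply: measurableT_comp; first exact: measurable_expR.
    apply: measurableT_comp => //; apply: measurable_funM; first exact: measurable_cst.
    exact: measurable_funX.
  have [_ <-] := bint_real_scale x mg (fun s => expR_ge0 _) ik.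
  by congr bint; apply/funext => r; rewrite /osc_integrand mulr0 expi0 scale1r.
rewrite !scalerA -!rmorphM /= normal_pdfE //; congr (_%:C *: _).
rewrite /c /normal_fun.
have -> : - ((t - u) ^+ 2 / (4 * (s ^+ 2 / 2))) = - (t - u) ^+ 2 / (s ^+ 2 *+ 2).
  by rewrite -mulr_natl; field; rewrite gt_eqF.
by field; rewrite gt_eqF.
Qed.

End density_intervals.

Section normal_estimates.
Context (R : realType).

Lemma normal_pdf_sym (u s t : R) : s != 0 -> normal_pdf u s t = normal_pdf t s u.
Proof. by move=> s0; rewrite !normal_pdfE // /normal_fun -(sqrrN (t - u)) opprB. Qed.

(** Combines [e^{-y} <= 1 / (1 + y)] with Peetre's inequality
    [1 + t^2 <= 2 (1 + u^2)(1 + (t - u)^2)], which shifts the decay from [t - u] to [t]. *)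
Lemma normal_pdf_le_oneDsqr (u s t : R) : 0 < s ->
  normal_pdf u s t <= normal_peak s * (1 + 2 * s ^+ 2) * (2 * (1 + u ^+ 2)) * (1 + t ^+ 2)^-1.
Proof.
move=> s0; have sN : s != 0 by rewrite gt_eqF.
rewrite normal_pdfE // -!mulrA ler_wpM2l ?normal_peak_ge0 // /normal_fun.
have s2 : 0 < s ^+ 2 *+ 2 by rewrite mulrn_wgt0 // exprn_gt0.
have t0 := oneDsqr_gt0 t; have u0 := oneDsqr_gt0 u.
set y := (t - u) ^+ 2 / (s ^+ 2 *+ 2).
have y0 : 0 <= y by rewrite divr_ge0 ?sqr_ge0 // ltW.
rewrite mulNr -/y expRN.
apply: (@le_trans _ _ (1 + y)^-1).
  rewrite lef_pV2 ?posrE ?expR_gt0 ?expR_ge1Dx //.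
  by rewrite ltr_wpDr.
rewrite -[leLHS]mul1r ler_pdivrMr ?ltr_wpDr // !mulrA mulrAC ler_pdivlMr // mul1r.
have yE : (t - u) ^+ 2 = 2 * s ^+ 2 * y.
  by rewrite /y -mulr_natl; field; rewrite gt_eqF.
have h1 : 1 + (t - u) ^+ 2 <= (1 + 2 * s ^+ 2) * (1 + y).
  rewrite yE -subr_ge0 (_ : _ - _ = 2 * s ^+ 2 + y); last by ring.
  by rewrite addr_ge0 // mulr_ge0 ?sqr_ge0.
have h2 : 1 + t ^+ 2 <= 2 * (1 + u ^+ 2) * (1 + (t - u) ^+ 2).
  rewrite -subr_ge0 (_ : _ - _ = (2 * (1 + u ^+ 2) * (1 + (t - u) ^+ 2) - (1 + t ^+ 2))) //.
  have := sqr_ge0 (t - u - u); have := sqr_ge0 (u * (t - u)).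
  rewrite !expr2; nra.
apply: le_trans h2 _.
rewrite [leRHS](_ : _ = 2 * (1 + u ^+ 2) * ((1 + 2 * s ^+ 2) * (1 + y))); last by ring.
by rewrite ler_wpM2l // mulr_ge0 // ltW.
Qed.

(** Doubling the deviation halves the peak and leaves a factor [e^{-y}],
    [y = 3 (t - u)^2 / (8 s^2)], controlled by [e^y >= y]. The new density still has mass 1, so a
    tail integral is at most the constant in front. *)
Lemma normal_pdf_tail (u s t d : R) : 0 < s -> 0 < d -> d <= `|t - u| ->
  normal_pdf u s t <= 6 * s ^+ 2 / d ^+ 2 * normal_pdf u (2 * s) t.
Proof.
move=> s0 d0 dt; have sN : s != 0 by rewrite gt_eqF.
have s2N : 2 * s != 0 by rewrite gt_eqF // mulr_gt0.
rewrite !normal_pdfE // /normal_fun.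
have -> : normal_peak s = 2 * normal_peak (2 * s).
  rewrite /normal_peak (_ : (2 * s) ^+ 2 * pi *+ 2 = 2 ^+ 2 * (s ^+ 2 * pi *+ 2)); last first.
    by rewrite exprMn -mulrA mulrnAr.
  by rewrite sqrtrM ?sqr_ge0 // sqrtr_sqr ger0_norm // invfM mulrA divff ?mul1r.
rewrite -[leLHS]mulrA [leRHS]mulrCA [leRHS]mulrA.
rewrite [X in _ <= X * _]mulrC.
rewrite (_ : 2 * (normal_peak (2 * s) * _) = normal_peak (2 * s) * (2 * expR (- (t - u) ^+ 2 / (s ^+ 2 *+ 2)))); last by rewrite mulrCA.
rewrite -[X in _ <= X]mulrA [X in _ <= X]mulrCA ler_wpM2l ?normal_peak_ge0 //.
set r := (t - u) ^+ 2.
have rd : d ^+ 2 <= r.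
  by rewrite /r -(real_normK (num_real (t - u))) lerXn2r ?nnegrE ?(ltW d0).
have -> : - r / (s ^+ 2 *+ 2) = - (3 * r / (8 * s ^+ 2)) + - r / ((2 * s) ^+ 2 *+ 2).
  have E1 : s ^+ 2 *+ 2 = 2 * s ^+ 2 by rewrite mulr_natl.
  have E2 : (2 * s) ^+ 2 *+ 2 = 2 * (2 * s) ^+ 2 by rewrite [RHS]mulr_natl.
  by rewrite E1 E2; field; rewrite gt_eqF.
rewrite expRD mulrA ler_wpM2r ?expR_ge0 //.
have y0 : 0 < 3 * r / (8 * s ^+ 2).
  have r0 : 0 < r by apply: lt_le_trans rd; rewrite exprn_gt0.
  by apply: divr_gt0; apply: mulr_gt0 => //; exact: exprn_gt0.
rewrite expRN ler_pdivrMr ?expR_gt0 //.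
apply: (@le_trans _ _ (6 * s ^+ 2 / d ^+ 2 * (3 * r / (8 * s ^+ 2)))).
  rewrite (_ : _ * _ = 9 / 4 * (r / d ^+ 2)); last by field; rewrite !gt_eqF.
  have : 1 <= r / d ^+ 2 by rewrite ler_pdivlMr ?exprn_gt0 // mul1r.
  by lra.
rewrite ler_wpM2l ?divr_ge0 ?mulr_ge0 ?exprn_ge0 ?ltW //.
by apply: lt_le_trans (expR_ge1Dx _); rewrite ltrDr.
Qed.

End normal_estimates.

Section density_window.
Context (R : realType) (V : completeNormedModType R[i]).
Variables (p : R) (hp : 1 <= p).
Local Notation mu := (@lebesgue_measure R).
Local Notation fdense := (@fdense R V p).
Variables (a l : R) (x : V).
Hypothesis (l0 : 0 <= l).

Definition wstep (s t u : R) : V := if u <= l then (normal_pdf (a + u) s t)%:C *: x else 0.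
(* The average over [a <= y <= a + l] of normal densities centered at [y], written as a causal
   convolution to reuse the convergence of its Riemann sums; it tends to [wlim] as [s] tends to [0]. *)
Definition window (s t : R) : V := bint (fun tau => if tau <= 0 then wstep s t (0 - tau) else 0).

(** For [0 <= u <= l] the center [a + u] is at most [|a| + l] in absolute value; [e^l] pays for
    writing a bound on [[0, l]] with the weight [e^{-u}] that the Riemann sums require. *)
Let K (s : R) : R := normal_peak s * (1 + 2 * s ^+ 2) * (2 * (1 + (`|a| + l) ^+ 2)) * rnorm x * expR l.

Let K0 s : 0 <= K s.
Proof.
rewrite !mulr_ge0 ?normal_peak_ge0 ?rnorm_ge0 ?expR_ge0 //.
  by rewrite addr_ge0 // mulr_ge0 // sqr_ge0.
by rewrite addr_ge0 ?sqr_ge0.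
Qed.

Lemma wstep_le (s t u : R) : 0 < s -> 0 <= u ->
  rnorm (wstep s t u) <= K s * (1 + t ^+ 2)^-1 * exponential_pdf 1 u.
Proof.
move=> s0 u0; have t0 := oneDsqr_gt0 t.
rewrite /wstep; case: ifP => ul; last first.
  rewrite rnorm0; apply: mulr_ge0 (ek_ge0 ltr01 _).
  by apply: mulr_ge0; rewrite ?K0 ?invr_ge0 ?ltW.
rewrite exponential_pdfE // mul1r mulN1r rnormZr ger0_norm ?normal_pdf_ge0 //.
apply: (@le_trans _ _ (normal_peak s * (1 + 2 * s ^+ 2) * (2 * (1 + (`|a| + l) ^+ 2)) * (1 + t ^+ 2)^-1 * rnorm x)).
  rewrite ler_wpM2r ?rnorm_ge0 //; apply: le_trans (normal_pdf_le_oneDsqr _ _ s0) _.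
  rewrite ler_wpM2r ?invr_ge0 ?(ltW t0) // ler_wpM2l //.
    by rewrite mulr_ge0 ?normal_peak_ge0 // addr_ge0 // mulr_ge0 // sqr_ge0.
  rewrite ler_wpM2l // lerD2l -(real_normK (num_real (a + u))) lerXn2r ?nnegrE ?addr_ge0 //.
  by apply: le_trans (ler_normD _ _) _; rewrite lerD2l ger0_norm.
have e1 : 1 <= expR l * expR (- u) by rewrite -expRD -expR0 ler_expR subr_ge0.
rewrite /K; set A := normal_peak s * _ * _.
have A0 : 0 <= A.
  rewrite /A !mulr_ge0 ?normal_peak_ge0 //; last by rewrite addr_ge0 ?sqr_ge0.
  by rewrite addr_ge0 // mulr_ge0 // sqr_ge0.
rewrite [leRHS](_ : _ = A * (1 + t ^+ 2)^-1 * rnorm x * (expR l * expR (- u))); last by ring.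
rewrite ler_peMr // mulr_ge0 ?rnorm_ge0 // mulr_ge0 // invr_ge0.
exact: ltW.
Qed.

(** An approach from the left is harmless at the cut-off [u = l], where [wstep] may jump. *)
Lemma wstep_left (s t : R) : 0 < s -> forall (u : R) (v : nat -> R),
  (forall n, 0 <= v n <= u) -> v n @[n --> \oo] --> u -> wstep s t (v n) @[n --> \oo] --> wstep s t u.
Proof.
move=> s0 u v vu vc; have sN : s != 0 by rewrite gt_eqF.
have [ul|lu] := leP u l.
  rewrite (_ : (fun n => _) = fun n => (normal_pdf t s (a + v n))%:C *: x); last first.
    apply/funext => n; rewrite /wstep ifT ?(normal_pdf_sym t _ sN) //.
    by have /andP[_ h] := vu n; exact: le_trans h ul.
  rewrite /wstep ul (normal_pdf_sym (a + u) _ sN).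
  apply: (@cvg_scale R V); last exact: cvg_cst.
  apply: ccvg_ReIm => /=; last exact: cvg_cst.
  apply: (@cvg_comp _ _ _ (fun n => a + v n) (normal_pdf t s) _ (nbhs (a + u))).
    by apply: cvgD => //; exact: cvg_cst.
  exact: (@continuous_normal_pdf R t s sN (a + u)).
have -> : wstep s t u = 0 by rewrite /wstep leNgt lu.
have h : (0 : V) @[n --> \oo] --> (0 : V) by exact: cvg_cst.
move: h; apply: (@cvg_near_eq R V).
have : \forall n \near \oo, l < v n by exact: (cvgr_gt u vc).
by apply: filterS => n hn; rewrite /wstep leNgt hn.
Qed.

Lemma fdense_window (s : R) : 0 < s -> fdense (window s).
Proof.
move=> s0; pose B := K s * expR 1.
have C0 t : 0 <= K s * (1 + t ^+ 2)^-1 by rewrite mulr_ge0 ?K0 // invr_ge0 ltW // oneDsqr_gt0.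
have rc t : rsum n (wstep s t) @[n --> \oo] --> window s t.
  by have [_ h] := @rsum_cvg R V 1 ltr01 (wstep s t) _ (@wstep_left s t s0) (fun u u0 => @wstep_le s t u s0 u0) (C0 t) 0.
have rl t n : rnorm (rsum n (wstep s t)) <= B * (1 + t ^+ 2)^-1.
  have := @rsum_le R V 1 ltr01 (wstep s t) _ (fun u u0 => @wstep_le s t u s0 u0) (C0 t) n.
  by rewrite /B mulrAC.
have fd n : fdense (fun t => rsum n (wstep s t)).
  apply: fdense_sum => // k; apply: fdense_scale => //; rewrite /wstep.
  by have [_|_] := leP ((k : nat)%:R / n.+1%:R) l; [exact: fdense_normal|exact: fdense0].
have mw : smeas (window s).
  by apply: (@smeas_lim R V (fun n t => rsum n (wstep s t))) => // n; exact: (fd n).1.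
apply: (@fdense_oneDsqr R V p hp _ (fun n t => rsum n (wstep s t)) (2 * B)) => // n t.
apply: le_trans (ler_rnormB _ _) _; rewrite mulrDl mul1r mulrDl lerD //.
by apply: (rnorm_cvg_le (rc t)); apply: nearW => k; exact: rl.
Qed.

(** The scalar integrand of [window]. By symmetry of the normal density, the average over centers
    becomes the mass that one normal law centered at [a - t] gives to [[-l, 0]]. *)
Definition wmass (s t : R) (tau : R) : R :=
  if (- l <= tau) && (tau <= 0) then normal_pdf (a - t) s tau else 0.

Lemma normal_pdf_shift (s t tau : R) : 0 < s -> normal_pdf (a + (0 - tau)) s t = normal_pdf (a - t) s tau.
Proof.
move=> s0; have sN : s != 0 by rewrite gt_eqF.
have E : (t - (a + (0 - tau))) ^+ 2 = (tau - (a - t)) ^+ 2 by ring.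
by rewrite !normal_pdfE // /normal_fun E.
Qed.

Lemma measurable_wset : @measurable _ (measurableTypeR R) [set tau : R | (- l <= tau) && (tau <= 0)].
Proof.
rewrite (_ : [set _ | _] = `[- l, 0]%classic); first exact: measurable_itv.
by apply/seteqP; split => y /=; rewrite in_itv.
Qed.

Lemma measurable_wmass s t : measurable_fun setT (wmass s t).
Proof.
have m1 : measurable_fun setT (fun tau : R => (- l <= tau) && (tau <= 0)).
  by apply: (measurable_fun_bool true); rewrite setTI; exact: measurable_wset.
by apply: measurable_fun_ifT => //; exact: measurable_normal_pdf.
Qed.

Lemma wmass_ge0 s t tau : 0 <= wmass s t tau.
Proof. by rewrite /wmass; case: ifP => // _; exact: normal_pdf_ge0. Qed.

Lemma window_real (s t : R) : 0 < s -> exists c : R, [/\ 0 <= c <= 1,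
  (\int[mu]_tau (wmass s t tau)%:E = c%:E)%E & window s t = c%:C *: x].
Proof.
move=> s0.
have h : (\int[mu]_tau (wmass s t tau)%:E <= 1)%E.
  rewrite -(integral_normal_pdf (a - t) s); apply: le_integralT.
  - exact: measurable_wmass.
  - exact: measurable_normal_pdf.
  by move=> tau; rewrite wmass_ge0 /= /wmass; case: ifP => // _; exact: normal_pdf_ge0.
have := integralT_ge0 (@wmass_ge0 s t).
case E : (\int[mu]_tau (wmass s t tau)%:E)%E h => [c| |] // c1 c0.
exists c; split; [by rewrite -!lee_fin c0 c1|by []|].
have [_ <-] := bint_real_scale x (measurable_wmass s t) (@wmass_ge0 s t) E.
congr bint; apply/funext => tau; rewrite /wmass /wstep sub0r lerNl andbC.
case: ifP => _ /=; last by rewrite scale0r.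
by case: ifP => _; rewrite ?scale0r // -sub0r normal_pdf_shift.
Qed.

Definition wlim (t : R) : V := if (a < t) && (t < a + l) then x else 0.

Lemma window_dist1 (s t : R) : 0 < s -> rnorm (wlim t - window s t) <= rnorm x.
Proof.
move=> s0; have [c [/andP[c0 c1] _ ->]] := window_real t s0.
rewrite /wlim; case: ifP => _; last by rewrite sub0r rnormN rnormZr ger0_norm // ler_piMl ?rnorm_ge0.
rewrite -{1}[x]scale1r -scalerBl -[1]/(1%:C) -rmorphB rnormZr ger0_norm ?subr_ge0 //.
by rewrite ler_piMl ?rnorm_ge0 // gerBl.
Qed.

(** The hypothesis keeps the center [a - t] at distance [d] from all [tau] at which membership in
    [[-l, 0]] differs from that of [t] in []a, a + l[]. The error is then at most the mass of a
    normal tail beyond [d]. *)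
Lemma window_dist (s t d : R) : 0 < s -> 0 < d ->
  (forall tau, ((- l <= tau) && (tau <= 0)) != ((a < t) && (t < a + l)) -> d <= `|tau - (a - t)|) ->
  rnorm (wlim t - window s t) <= 6 * s ^+ 2 / d ^+ 2 * rnorm x.
Proof.
move=> s0 d0 hd; have [c [/andP[c0 c1] ic ->]] := window_real t s0.
have k0 : 0 <= 6 * s ^+ 2 / d ^+ 2.
  by apply: divr_ge0; [apply: mulr_ge0 => //; exact: sqr_ge0|exact: sqr_ge0].
have tail (phi : R -> R) : measurable_fun setT phi -> (forall tau, 0 <= phi tau) ->
    (forall tau, phi tau <= 6 * s ^+ 2 / d ^+ 2 * normal_pdf (a - t) (2 * s) tau) ->
    (\int[mu]_tau (phi tau)%:E <= (6 * s ^+ 2 / d ^+ 2)%:E)%E.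
  move=> mphi phi0 hphi; rewrite -[leRHS]mule1 -(integral_normal_pdf (a - t) (2 * s)).
  rewrite -integralTZ //; first last.
  - by move=> tau; exact: normal_pdf_ge0.
  - exact: measurable_normal_pdf.
  apply: le_integralT => //; last by move=> tau; rewrite phi0 hphi.
  by apply: measurable_funM; [exact: measurable_cst|exact: measurable_normal_pdf].
have rhs0 tau : 0 <= 6 * s ^+ 2 / d ^+ 2 * normal_pdf (a - t) (2 * s) tau.
  by rewrite mulr_ge0 ?normal_pdf_ge0.
rewrite /wlim; case: ifP => tin.
  rewrite -{1}[x]scale1r -scalerBl -[1]/(1%:C) -rmorphB rnormZr ger0_norm ?subr_ge0 //.
  rewrite ler_wpM2r ?rnorm_ge0 //.
  pose phi tau := normal_pdf (a - t) s tau - wmass s t tau.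
  have mphi : measurable_fun setT phi.
    by apply: measurable_funB; [exact: measurable_normal_pdf|exact: measurable_wmass].
  have phi0 tau : 0 <= phi tau.
    by rewrite /phi /wmass; case: ifP => _; rewrite ?subrr // subr0 normal_pdf_ge0.
  have := integralTD mphi (measurable_wmass s t) phi0 (@wmass_ge0 s t).
  under eq_integral do rewrite /phi subrK.
  rewrite integral_normal_pdf ic.
  have hphi tau : phi tau <= 6 * s ^+ 2 / d ^+ 2 * normal_pdf (a - t) (2 * s) tau.
    rewrite /phi /wmass; case: ifP => hin; first by rewrite subrr.
    by rewrite subr0; apply: normal_pdf_tail => //; apply: hd; rewrite hin tin.
  have := tail phi mphi phi0 hphi.
  have := integralT_ge0 phi0; case: (\int[mu]_tau (phi tau)%:E)%E => [b| |] // b0 bl [bE].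
  have -> : 1 - c = b by rewrite bE addrK.
  by rewrite -lee_fin.
rewrite sub0r rnormN rnormZr ger0_norm // ler_wpM2r ?rnorm_ge0 // -lee_fin -ic.
apply: tail; [exact: measurable_wmass|exact: wmass_ge0|].
move=> tau; rewrite /wmass; case: ifP => hin //.
by apply: normal_pdf_tail => //; apply: hd; rewrite hin tin.
Qed.

Lemma fdense_open_window : fdense wlim.
Proof.
pose s n : R := n.+1%:R^-1.
have s0 n : 0 < s n by rewrite invr_gt0 ltr0n.
have s1 n : s n <= 1 by rewrite invf_le1 ?ler1n ?ltr0n.
(* At the two endpoints [window] need not tend to [wlim], since the normal law is then centered on
   the boundary of [[-l, 0]]; the values are corrected on this null set. *)
pose F n t := if (t == a) || (t == a + l) then wlim t else window (s n) t.
have mw : smeas wlim.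
  rewrite /wlim; apply: smeas_if; [|exact: smeas_cst|exact: smeas_cst].
  rewrite (_ : [set _ | _] = `]a, a + l[%classic); first exact: measurable_itv.
  by apply/seteqP; split => y /=; rewrite in_itv.
have mE : @measurable _ (measurableTypeR R) ([set a] `|` [set a + l]) by apply: measurableU.
have E0 : mu ([set a] `|` [set a + l]) = 0%E.
  by apply: null_set_setU => //; exact: lebesgue_measure_set1.
have Eb (t : R) : reflect (([set a] `|` [set a + l]) t) ((t == a) || (t == a + l)).
  by apply: (iffP orP) => [[]/eqP ->|[]->]; [left|right|left; rewrite eqxx|right; rewrite eqxx].
have dF n : fdense (F n).
  apply: (@fdense_ae R V p hp (F n) (window (s n)) ([set a] `|` [set a + l])) => //.
  - by move=> t /Eb; rewrite /F => /negbTE ->.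
  - apply: smeas_if; [|exact: mw|exact: (fdense_window (s0 n)).1].
    by rewrite (_ : [set t | _] = [set a] `|` [set a + l]) //; apply/seteqP; split => t /= /Eb.
  - exact: fdense_window.
pose L := `|a| + l + 1; have L0 : 1 <= L by rewrite lerDr addr_ge0.
(* For [|t| <= 2L] the error is at most the norm of [x], and [1 + t^2 <= 1 + 4 L^2]. Beyond,
   [window_dist] with [d = |t| / 2] gives the factor [24 s^2 / t^2], at most [48 / (1 + t^2)]. *)
apply: (@fdense_oneDsqr R V p hp wlim F ((1 + 4 * L ^+ 2 + 48) * rnorm x)) => //.
  move=> n t; have t0 := oneDsqr_gt0 t.
  have B0 : 0 <= 1 + 4 * L ^+ 2 + 48 by rewrite !addr_ge0 // mulr_ge0 // sqr_ge0.
  rewrite /F; case: ifP => _.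
    by rewrite subrr rnorm0 !mulr_ge0 ?rnorm_ge0 // invr_ge0 ltW.
  rewrite mulrAC; have [tL|tL] := leP `|t| (2 * L).
    apply: le_trans (window_dist1 t (s0 n)) _; rewrite -[leLHS]mul1r ler_wpM2r ?rnorm_ge0 //.
    rewrite ler_pdivlMr // mul1r.
    have : t ^+ 2 <= (2 * L) ^+ 2 by rewrite -(real_normK (num_real t)) lerXn2r ?nnegrE // (le_trans _ tL).
    by rewrite exprMn; lra.
  have d0 : 0 < `|t| / 2 by rewrite divr_gt0 // (lt_trans _ tL) // mulr_gt0 // (lt_le_trans _ L0).
  apply: (@le_trans _ _ (6 * s n ^+ 2 / (`|t| / 2) ^+ 2 * rnorm x)).
    apply: window_dist => // tau.
    have -> : (a < t) && (t < a + l) = false.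
      apply/negP => /andP[h1 h2]; move: tL; rewrite ltNge => /negP; apply.
      have : `|t| <= `|a| + l.
        have := ler_norm a; have := ler_norm (- a); rewrite normrN => h3 h4.
        by rewrite ler_norml; apply/andP; split; lra.
      by rewrite /L => h; have := normr_ge0 a; lra.
    rewrite eqbF_neg negbK => /andP[h1 h2].
    have := ler_normD (t - (a - tau)) (a - tau); rewrite subrK => h3.
    have h4 : `|a - tau| <= `|a| + l.
      by apply: le_trans (ler_normB _ _) _; rewrite lerD2l ler0_norm //; lra.
    have -> : tau - (a - t) = t - (a - tau) by ring.
    by move: tL; rewrite /L; lra.
  rewrite ler_wpM2r ?rnorm_ge0 //.
  have t1 : 1 <= t ^+ 2.
    rewrite -(real_normK (num_real t)) expr_ge1 //; apply: le_trans (ltW tL).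
    by lra.
  rewrite expr_div_n real_normK ?num_real //.
  rewrite ler_pdivlMr // [leLHS](_ : _ = s n ^+ 2 * (24 * (1 + t ^+ 2) / t ^+ 2)); last first.
    by field; rewrite -sqrf_eq0 gt_eqF // (lt_le_trans _ t1).
  have h1 : 24 * (1 + t ^+ 2) / t ^+ 2 <= 48.
    by rewrite ler_pdivrMr ?(lt_le_trans _ t1) //; lra.
  have h2 : s n ^+ 2 <= 1 by rewrite expr2 mulr_ile1 // ltW.
  have h3 : 0 <= 24 * (1 + t ^+ 2) / t ^+ 2.
    by apply: divr_ge0; [apply: mulr_ge0 => //; exact: ltW|exact: sqr_ge0].
  apply: (@le_trans _ _ (1 * 48)); first by rewrite ler_pM ?sqr_ge0.
  by rewrite mul1r lerDr addr_ge0 // mulr_ge0 // sqr_ge0.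
move=> t; rewrite /F; have [_|] := boolP ((t == a) || (t == a + l)); first exact: cvg_cst.
rewrite negb_or => /andP[ta tl].
have [d d0 hd] : exists2 d : R, 0 < d & forall tau,
    ((- l <= tau) && (tau <= 0)) != ((a < t) && (t < a + l)) -> d <= `|tau - (a - t)|.
  (* These are the distances from [a - t] to the ends 0 and [-l] of the window. *)
  exists (Num.min `|t - a| `|t - (a + l)|).
    by rewrite lt_min !normr_gt0 !subr_eq0 ta tl.
  move=> tau; rewrite ge_min; case: (ltP a t) => h1; case: (ltP t (a + l)) => h2 /=.
  - rewrite eqb_id negb_and -!ltNge => /orP[h|h]; apply/orP.
      right; rewrite ltr0_norm ?subr_lt0 // ler_normr; apply/orP; right; lra.
    by left; rewrite gtr0_norm ?subr_gt0 // ler_normr; apply/orP; left; lra.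
  - rewrite eqbF_neg negbK => /andP[h3 h4]; apply/orP; right.
    by rewrite ger0_norm ?subr_ge0 // ler_normr; apply/orP; left; lra.
  - rewrite eqbF_neg negbK => /andP[h3 h4]; apply/orP; left.
    by rewrite ler0_norm ?subr_le0 // ler_normr; apply/orP; right; lra.
  - rewrite eqbF_neg negbK => /andP[h3 h4]; apply/orP; left.
    by rewrite ler0_norm ?subr_le0 // ler_normr; apply/orP; right; lra.
apply: (@cvg_rnorm_le R V _ _ _ _ _ (fun n => 6 / d ^+ 2 * rnorm x * s n)).
  apply: nearW => n; rewrite rnormC; apply: le_trans (window_dist (s0 n) d0 hd) _.
  rewrite [leLHS](_ : _ = 6 / d ^+ 2 * rnorm x * s n ^+ 2); last by ring.
  apply: ler_wpM2l; last by rewrite expr2 ler_piMl // ltW.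
  by apply: mulr_ge0 (rnorm_ge0 _); apply: divr_ge0 => //; exact: sqr_ge0.
rewrite -(mulr0 (6 / d ^+ 2 * rnorm x)); apply: cvgM; first exact: cvg_cst.
exact: cvg_harmonic.
Qed.

End density_window.

(** * From intervals to all of L^p *)

Section density.
Context (R : realType) (V : completeNormedModType R[i]).
Variables (p : R) (hp : 1 <= p).
Local Notation mu := (@lebesgue_measure R).
Local Notation fdense := (@fdense R V p).
Local Notation ind E x := (fun t : R => if t \in E then x else 0 : V).

Let p0 : 0 < p. Proof. exact: lt_le_trans hp. Qed.

Lemma smeas_ind (E : set R) (x : V) : @measurable _ (measurableTypeR R) E -> smeas (ind E x).
Proof. by move=> mE; apply: smeas_indic => //; exact: smeas_cst. Qed.

Lemma fdense_itv (a b : R) (x : V) : fdense (ind `]a, b]%classic x).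
Proof.
have [ba|ab] := leP b a.
  rewrite (_ : (fun t => _) = fun=> 0); first exact: fdense0.
  apply/funext => t; rewrite mem_setE in_itv /= ifF //.
  by apply/negP => /andP[h1 h2]; have := lt_le_trans h1 (le_trans h2 ba); rewrite ltxx.
have l0 : 0 <= b - a by rewrite subr_ge0 ltW.
apply: (@fdense_ae R V p hp _ (wlim a (b - a) x) [set b]) => //.
- exact: lebesgue_measure_set1.
- move=> t tb; rewrite /wlim mem_setE in_itv /= subrKC.
  by rewrite le_eqVlt; case: eqP => //= tb'; case: tb.
- by apply: smeas_ind; exact: measurable_itv.
- exact: fdense_open_window.
Qed.

Lemma measurable_ind_real (E : set R) (c : R) : @measurable _ (measurableTypeR R) E ->
  measurable_fun setT (fun t : R => c * \1_E t).
Proof. by move=> mE; apply: measurable_funM => //; exact: measurable_cst. Qed.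

Lemma integral_ind_lty (E : set R) (c : R) : @measurable _ (measurableTypeR R) E -> 0 <= c ->
  (mu E < +oo)%E -> (\int[mu]_t (c * \1_E t)%:E < +oo)%E.
Proof.
move=> mE c0 hE; rewrite integralTZ //.
have -> : (\int[mu]_t (\1_E t)%:E = mu E)%E by rewrite integral_indic // setIT.
by rewrite lte_mul_pinfty ?lee_fin.
Qed.

Lemma fdense_ind_lim (F : nat -> set R) (E J : set R) (x : V) :
  @measurable _ (measurableTypeR R) E -> @measurable _ (measurableTypeR R) J -> (mu J < +oo)%E ->
  (forall n, fdense (ind (F n) x)) -> E `<=` J -> (forall n, F n `<=` J) ->
  (forall t, \forall n \near \oo, (t \in F n) = (t \in E)) ->
  fdense (ind E x).
Proof.
move=> mE mJ hJ dF EJ FJ FE.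
apply: (@fdense_dominated R V p hp _ (fun n => ind (F n) x) (fun t => rnorm x `^ p * \1_J t)) => //.
- exact: smeas_ind.
- exact: measurable_ind_real.
- by apply: integral_ind_lty => //; exact: powR_ge0.
- move=> n t; rewrite indicE.
  have [tJ|tJ] := boolP (t \in J).
    rewrite mulr1; apply: ge0_ler_powR; rewrite ?(ltW p0) ?nnegrE ?rnorm_ge0 //.
    by case: ifP => _; case: ifP => _; rewrite ?subrr ?subr0 ?sub0r ?rnormN ?rnorm0 ?rnorm_ge0.
  have h (G : set R) : G `<=` J -> (t \in G) = false.
    by move=> GJ; apply/negP => /set_mem/GJ/mem_set; exact/negP.
  by rewrite !h // subrr rnorm0 powR0 ?mulr0 // gt_eqF.
- move=> t; have h : (if t \in E then x else 0) @[n --> \oo] --> (if t \in E then x else 0).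
    exact: cvg_cst.
  move: h; apply: (@cvg_near_eq R V).
  by apply: filterS (FE t) => n ->.
Qed.

(** Dynkin's argument from half-open intervals, inside a bounded [J] so that complements keep finite
    measure: a complement is a difference with the indicator of [J], a disjoint union a dominated
    limit of finite sums. *)
Lemma fdense_bounded_borel (k : R) (x : V) (E : set R) : @measurable _ (measurableTypeR R) E ->
  fdense (ind (E `&` `]- k, k]%classic) x).
Proof.
move=> mE; set J := `]- k, k]%classic.
have mJ : @measurable _ (measurableTypeR R) J by exact: measurable_itv.
have hJ : (mu J < +oo)%E.
  by rewrite /J lebesgue_measure_itv /=; case: ifP => // _; rewrite -EFinB ltry.
apply: (@dynkin_induction _ (measurableTypeR R) (@ocitv R)
  (fun E => fdense (ind (E `&` J) x))) => //.
- exact: ocitvI.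
- by rewrite setTI; exact: fdense_itv.
- move=> _ [[a b] _ <-] /=.
  have [[c d] _ /= E0] : ocitv (`]a, b]%classic `&` J).
    exact: (ocitvI (is_ocitv a b) (is_ocitv (- k) k)).
  by rewrite -E0; exact: fdense_itv.
- move=> S mS dS.
  rewrite (_ : (fun t => _) = fun t => (if t \in J then x else 0) + - (if t \in S `&` J then x else 0)).
    by apply: fdense_add => //; [exact: fdense_itv|exact: fdense_opp].
  apply/funext => t; rewrite !in_setI in_setC.
  by case: (t \in S); case: (t \in J); rewrite /= ?subrr ?subr0.
- move=> F mF tF dF.
  have mU : @measurable _ (measurableTypeR R) (\bigcup_k0 F k0 `&` J).
    by apply: measurableI => //; exact: bigcup_measurable.
  apply: (@fdense_ind_lim (fun n => (\bigcup_(i in `I_n) F i) `&` J) _ J) => //.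
  - move=> n; rewrite (_ : (fun t => _) = fun t => \sum_(i < n) (if t \in F i `&` J then x else 0)).
      by apply: fdense_sum.
    apply/funext => t; have [tU|tU] := boolP (t \in _).
      have [[i /= iN Fi] Jt] := set_mem tU.
      rewrite (bigD1 (Ordinal iN)) //= mem_set // big1 ?addr0 // => j ji.
      rewrite memNset // => -[Fj _]; move/negP : ji; apply; apply/eqP/val_inj => /=.
      by apply: (tF j i) => //; exists t.
    rewrite big1 // => i _; rewrite memNset // => -[Fi Jt].
    move/negP : tU; apply; apply/mem_set; split=> //.
    by exists i => /=.
  - move=> t; have [tU|tU] := boolP (t \in \bigcup_k0 F k0 `&` J).
      have [[i _ Fi] Jt] := set_mem tU; exists i.+1 => // n /= ni.
      by apply/mem_set; split=> //; exists i.
    apply: nearW => n; apply/negP => tn; move/negP : tU; apply.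
    have [[i _ Fi] Jt] := set_mem tn; apply/mem_set; split=> //.
    by exists i.
Qed.

Lemma fdense_borel (x : V) (E : set R) : @measurable _ (measurableTypeR R) E -> (mu E < +oo)%E ->
  fdense (ind E x).
Proof.
move=> mE hE.
apply: (@fdense_ind_lim (fun n => E `&` `]- n%:R, n%:R]%classic) _ E) => //.
- by move=> n; exact: fdense_bounded_borel.
- move=> t; near=> n; rewrite in_setI.
  have tn : `|t| < n%:R by near: n; exact: nbhs_infty_gtr.
  move: tn; rewrite ltr_norml => /andP[t1 t2].
  by rewrite (mem_set (A := `]_, _]%classic)) ?andbT //= in_itv /= t1 (ltW t2).
Unshelve. all: by end_near. Qed.

Lemma fdense_simple (s : R -> V) : fsimple s ->
  (forall x, x != 0 -> (mu (s @^-1` [set x]) < +oo)%E) -> fdense s.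
Proof.
move=> [fs ms] hs.
rewrite (_ : s = fun t => \sum_(x <- finmap.enum_fset (fset_set (range s)))
    (if t \in s @^-1` [set x] then x else 0)).
  apply: fdense_sum => // x; have [->|x0] := eqVneq x 0.
    rewrite (_ : (fun t => _) = fun=> 0); first exact: fdense0.
    by apply/funext => t; case: ifP.
  by apply: fdense_borel; [exact: ms|exact: hs].
apply/funext => t.
have st : s t \in finmap.enum_fset (fset_set (range s)) by rewrite in_fset_set // mem_set //; exists t.
rewrite (bigD1_seq (s t) st (finmap.fset_uniq _)) ifT; last exact/mem_set.
rewrite big1 => [|x xs]; first by rewrite /= addr0.
by rewrite memNset //= => /esym/eqP; exact/negP.
Qed.

Theorem fdense_Lp (f : R -> V) : smeas f -> (Np p f < +oo)%E -> fdense f.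
Proof.
move=> mf hf; apply: fdense_lim => // e e0.
have [s [fs ms hs]] := Np_simple_approx hp mf hf e0.
by exists s; split=> //; exact: fdense_simple.
Qed.

End density.

(** * Multipliers and input-output operators *)

Section ratio_suprema.
Context (R : realType) (I : Type).
Implicit Types (S : set I) (num den : I -> \bar R).

Lemma sup_ratio_ge0 S num den : (0 <= sup_ratio S num den)%E.
Proof. by apply: ereal_sup_ubound; left. Qed.

(** The inverse of 0 is [+oo] and that of [+oo] is 0: infinite denominators contribute 0, and a zero
    denominator forces a zero numerator through the bound. *)
Lemma sup_ratio_le S num den (c : R) : 0 <= c ->
  (forall i, S i -> (0 <= num i)%E /\ (0 <= den i)%E) ->
  (forall i, S i -> (den i < +oo)%E -> (num i <= c%:E * den i)%E) ->
  (sup_ratio S num den <= c%:E)%E.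
Proof.
move=> c0 h0 h; apply: ge_ereal_sup => _ [->|[i Si <-]]; first by rewrite lee_fin.
have := h _ Si; have [] := h0 _ Si.
case: (num i) => [n| |]; case: (den i) => [d| |] // n0 d0.
- move=> /(_ (ltry _)); rewrite -EFinM lee_fin => nd; rewrite inver.
  have [d00|dz] := eqVneq d 0.
    have -> : n = 0.
      by apply/eqP; rewrite eq_le -[0 <= n]lee_fin n0 andbT; move: nd; rewrite d00 mulr0.
    by rewrite mul0e lee_fin.
  by rewrite -EFinM lee_fin ler_pdivrMr // lt_neqAle eq_sym dz -lee_fin.
- by rewrite invey mule0 lee_fin.
- by move=> /(_ (ltry _)); rewrite -EFinM leye_eq.
- by rewrite invey mule0 lee_fin.
Qed.

Lemma sup_ratio_num_le S num den (c : R) i : S i -> (sup_ratio S num den <= c%:E)%E ->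
  (0 <= num i)%E -> (0 <= den i)%E -> (den i < +oo)%E -> (num i <= c%:E * den i)%E.
Proof.
move=> Si hc; have : (num i / den i <= c%:E)%E.
  by apply: le_trans hc; apply: ereal_sup_ubound; right; exists i.
case: (num i) => [n| |]; case: (den i) => [d| |] // h n0 d0 _.
- move: h; rewrite inver; have [->|dz] := eqVneq d 0.
    rewrite mule0 lee_fin; have [->//|nz] := eqVneq n 0.
    by rewrite gt0_muley ?leye_eq // lte_fin lt_neqAle eq_sym nz -lee_fin.
  by rewrite -!EFinM !lee_fin ler_pdivrMr // lt_neqAle eq_sym dz -lee_fin.
- move: h; rewrite inver; case: eqP => [_|/eqP dz]; first by rewrite gt0_muley ?leye_eq.
  by rewrite gt0_mulye ?leye_eq // lte_fin invr_gt0 lt_neqAle eq_sym dz -lee_fin.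
Qed.

End ratio_suprema.

Section multiplier_suprema.
Context (R : realType) (V W : completeNormedModType R[i]).
Variables (p : R) (hp : 1 <= p).

Lemma multiplier_sup_ge0 (N : R -> V -> W) : (0 <= multiplier_sup p N)%E.
Proof. exact: sup_ratio_ge0. Qed.

Lemma multiplier_sup_lty (N : R -> V -> W) : (multiplier_sup p N < +oo)%E ->
  exists2 c : R, 0 <= c & (multiplier_sup p N <= c%:E)%E.
Proof.
have := multiplier_sup_ge0 N; case: (multiplier_sup p N) => // c c0 _.
by exists c.
Qed.

Lemma multiplier_sup_le (N : R -> V -> W) (c : R) : 0 <= c ->
  (forall v, schwartz v -> (osc_Lpnorm p v < +oo)%E ->
    (osc_Lpnorm p (fun s => N s (v s)) <= c%:E * osc_Lpnorm p v)%E) ->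
  (multiplier_sup p N <= c%:E)%E.
Proof.
move=> c0 h; apply: sup_ratio_le => // v [sv _]; first by split; exact: osc_Lpnorm_ge0.
exact: h.
Qed.

Lemma multiplier_le (N : R -> V -> W) (c : R) : (forall s, N s 0 = 0) ->
  (multiplier_sup p N <= c%:E)%E -> forall v, schwartz v -> (osc_Lpnorm p v < +oo)%E ->
  (osc_Lpnorm p (fun s => N s (v s)) <= c%:E * osc_Lpnorm p v)%E.
Proof.
(* The zero function is excluded from the supremum and has to be treated by hand. *)
move=> N0 hc v sv vlt; have [v0|v0] := pselect (v = fun=> 0); last first.
  by apply: (sup_ratio_num_le (conj sv v0) hc) => //; exact: osc_Lpnorm_ge0.
have c0 : (0 <= c%:E)%E by apply: le_trans hc; exact: multiplier_sup_ge0.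
rewrite {1}v0; under eq_fun do rewrite N0.
have -> : osc_Lpnorm p (fun=> 0 : W) = 0%E.
  rewrite (osc_Lpnorm_binteg p (binteg0 W)) -[RHS](@Np0 R W p hp).
  congr (Np p _); apply/funext => t; rewrite -[RHS](@bint0 R W); congr bint.
  by apply/funext => s; rewrite /osc_integrand scaler0.
by apply: mule_ge0 => //; exact: osc_Lpnorm_ge0.
Qed.

End multiplier_suprema.

Section input_output.
Context (R : realType) (X U Y : completeNormedModType R[i]).
Variables (T : R -> {linear X -> X}) (M w : R).
Hypotheses (sT : C0_semigroup T) (w0 : 0 < w) (M1 : 1 <= M)
  (hM : forall t x, 0 <= t -> rnorm (T t x) <= M * expR (- w * t) * rnorm x).
Variables (B : {linear U -> X}) (C : {linear X -> Y}).
Hypotheses (cB : continuous B) (cC : continuous C).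
Variables (p : R) (hp : 1 <= p).

(** The counterpart of [Lop] on the whole line. *)
Definition io_conv (u : R -> U) (t : R) : Y := C (sconv T (fun s => B (u s)) t).

Lemma smeas_linear (u : R -> U) : smeas u -> smeas (fun s => B (u s)).
Proof. exact: (@smeas_continuous_comp R U X B u cB). Qed.

Lemma smeas_io_conv (u : R -> U) : tame w (fun s => B (u s)) -> smeas (io_conv u).
Proof.
move=> tu; apply: (@smeas_continuous_comp R X Y C (sconv T (fun s => B (u s))) cC).
exact: (smeas_sconv sT w0 M1 hM).
Qed.

Lemma Np_map_le (u : R -> U) (K : R) : 0 <= K -> (forall x, rnorm (B x) <= K * rnorm x) ->
  smeas u -> (Np p (fun s => B (u s)) <= K%:E * Np p u)%E.
Proof.
move=> K0 hK mu; apply: Np_scale_le => //; exact: smeas_linear.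
Qed.

Lemma tame_io (u : R -> U) : smeas u -> (Np p u < +oo)%E -> tame w (fun s => B (u s)).
Proof.
move=> mu hu; have [K K0 hK] := continuous_linear_bound cB.
apply: (tame_Lp w0 hp); first exact: smeas_linear.
apply: le_lt_trans (Np_map_le (ltW K0) hK mu) _.
by rewrite lte_mul_pinfty ?lee_fin ?ltW.
Qed.

Lemma io_conv_young : exists2 c : R, 0 <= c & forall u, smeas u -> (Np p u < +oo)%E ->
  (Np p (io_conv u) <= c%:E * Np p u)%E.
Proof.
have [K K0 hK] := continuous_linear_bound cB.
have [L L0 hL] := continuous_linear_bound cC.
have c0 : 0 <= M / w * 2 by rewrite mulr_ge0 // divr_ge0 ?ltW // (lt_le_trans _ M1).
exists (L * (M / w * 2 * K)); first by apply: mulr_ge0 (ltW L0) (mulr_ge0 c0 (ltW K0)).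
move=> u mu hu; have tu := tame_io mu hu.
have hB := Np_map_le (ltW K0) hK mu.
have hBy : (Np p (fun s => B (u s)) < +oo)%E.
  by apply: le_lt_trans hB _; rewrite lte_mul_pinfty ?lee_fin ?ltW.
have hy := sconv_young sT w0 M1 hM hp (smeas_linear mu) hBy.
have hC : (Np p (io_conv u) <= L%:E * Np p (sconv T (fun s => B (u s))))%E.
  apply: (@Np_scale_le R X Y p hp L); first exact: ltW.
  - exact: (smeas_sconv sT w0 M1 hM).
  - exact: smeas_io_conv.
  - by move=> t; exact: hL.
apply: (le_trans hC); rewrite EFinM -muleA; apply: lee_wpmul2l; first by rewrite lee_fin ltW.
apply: (le_trans hy); rewrite [((_ * K)%:E)]EFinM -muleA; apply: lee_wpmul2l; first by rewrite lee_fin.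
exact: hB.
Qed.

Lemma io_convB (u v : R -> U) t : tame w (fun s => B (u s)) -> tame w (fun s => B (v s)) ->
  io_conv (fun s => u s - v s) t = io_conv u t - io_conv v t.
Proof.
move=> tu tv; rewrite /io_conv -linearB -(sconvB sT w0 M1 hM _ tu tv).
by congr (C (sconv T _ t)); apply/funext => s; rewrite linearB.
Qed.

Lemma osc_Lpnorm_io (v : R -> U) : binteg v ->
  osc_Lpnorm p (fun s => C (res_at T s (B (v s)))) = Np p (io_conv (osc_integral v)).
Proof.
move=> bv; have bB := (bint_linear cB bv).1.
have [b e] := osc_integral_res sT w0 M1 hM bB.
have [b' _] := osc_integral_map cC 0 b.
rewrite (osc_Lpnorm_binteg p b') -(Np_opp p (io_conv _)); congr (Np p _); apply/funext => t.
rewrite (osc_integral_map cC t b).2 e /io_conv linearN; congr (- C (sconv T _ t)).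
by apply/funext => s; rewrite (osc_integral_map cB s bv).2.
Qed.

Lemma res_at0 s : res_at T s 0 = 0.
Proof.
apply: rnorm_eq0; apply/eqP; rewrite eq_le rnorm_ge0 andbT.
by apply: le_trans (rnorm_res_at sT w0 M1 hM s 0) _; rewrite rnorm0 mulr0.
Qed.

Lemma io_conv_le_multiplier (c : R) :
  (multiplier_sup p (fun s u => C (res_at T s (B u))) <= c%:E)%E ->
  forall f, smeas f -> (Np p f < +oo)%E -> (Np p (io_conv f) <= c%:E * Np p f)%E.
Proof.
move=> hc f mf hf; have [K K0 hK] := io_conv_young.
have c0 : (0 <= c%:E)%E by apply: le_trans hc; exact: multiplier_sup_ge0.
have tf := tame_io mf hf.
(* [K e] bounds the image of the approximation error, by Young's inequality; [c e] appears because
   the approximating transform may have norm up to [Np p f + e]. *)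
suff h (e : R) : 0 < e -> (Np p (io_conv f) <= c%:E * Np p f + ((K + c) * e)%:E)%E.
  apply/lee_addgt0Pr => e e0.
  have d0 : 0 < K + c + 1 by rewrite ltr_wpDl // addr_ge0 // -lee_fin.
  apply: le_trans (h _ (divr_gt0 e0 d0)) _; apply: leeD2l.
  by rewrite lee_fin mulrA ler_pdivrMr // mulrC ler_wpM2l ?(ltW e0) // lerDl.
move=> e0; have [_ /(_ e e0)[v [sv hv]]] := fdense_Lp hp mf hf.
have mv := smeas_osc_schwartz sv; set vh := osc_integral v in hv mv *.
have vf : (Np p vh <= Np p f + e%:E)%E.
  have -> : vh = fun t => f t - (f t - vh t) by apply/funext => t; rewrite opprB addrC subrK.
  apply: le_trans (Np_sub hp mf (smeas_sub mf mv)) _; apply: leeD2l.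
  exact: ltW.
have vlt : (Np p vh < +oo)%E by apply: (le_lt_trans vf); rewrite lte_add_pinfty ?ltry.
have tv := tame_io mv vlt.
have mfv := smeas_sub mf mv.
have -> : io_conv f = fun t => io_conv (fun s => f s - vh s) t + io_conv vh t.
  by apply/funext => t; rewrite io_convB // subrK.
have tfv : tame w (fun s => B (f s - vh s)) by apply: tame_io => //; apply: lt_trans hv (ltry _).
apply: le_trans (Np_add hp (smeas_io_conv tfv) (smeas_io_conv tv)) _.
have h1 : (Np p (io_conv (fun s => f s - vh s)%R) <= (K * e)%:E)%E.
  apply: le_trans (hK _ mfv (lt_trans hv (ltry _))) _.
  by rewrite EFinM; apply: lee_wpmul2l; [rewrite lee_fin|exact: ltW].
have bv := binteg_schwartz sv.
have h2 : (Np p (io_conv vh) <= c%:E * Np p f + (c * e)%:E)%E.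
  rewrite -(osc_Lpnorm_io bv).
  have vlt' : (osc_Lpnorm p v < +oo)%E by rewrite (osc_Lpnorm_binteg p bv).
  apply: le_trans (multiplier_le hp _ hc sv vlt') _.
    by move=> s; rewrite linear0 res_at0 linear0.
  rewrite (osc_Lpnorm_binteg p bv) EFinM -ge0_muleDr ?Np_ge0 ?lee_fin ?(ltW e0) //.
  exact: lee_wpmul2l.
apply: le_trans (leeD h1 h2) _.
by rewrite mulrDl EFinD addeCA.
Qed.

End input_output.

(** * The resolvent identity and differentiation in frequency *)

Section resolvent_identity.
Context (R : realType) (X : completeNormedModType R[i]).
Variables (T : R -> {linear X -> X}) (M w : R).
Hypotheses (sT : C0_semigroup T) (w0 : 0 < w) (M1 : 1 <= M)
  (hM : forall t x, 0 <= t -> rnorm (T t x) <= M * expR (- w * t) * rnorm x).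
Variable (A : partial_op X).
Hypothesis gA : generates A T.

Lemma op_inv_right_half_plane (l : R[i]) y : 0 <= complex.Re l ->
  op_inv (op_shift A l) y = res_op (rescale l T) y.
Proof.
move=> l0; exact: (op_inv_res (rescale_C0 l sT) w0 M1 (rescale_bound hM l0) (generates_rescale l gA)).
Qed.

Lemma resolvent_right_half_plane (l : R[i]) : 0 <= complex.Re l -> resolvent_set A l.
Proof.
move=> l0; split.
  exact: (bij_generator (rescale_C0 l sT) w0 M1 (rescale_bound hM l0) (generates_rescale l gA)).
exists (M / w) => y; rewrite op_inv_right_half_plane //.
exact: (rnorm_res_op (rescale_C0 l sT) w0 M1 (rescale_bound hM l0)).
Qed.

Lemma spectrum_right_half_plane : spectrum A `&` @closed_right_half_plane R = set0.
Proof.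
by rewrite -subset0 => l [sl l0]; apply: sl; exact: resolvent_right_half_plane.
Qed.

Let sTs s : C0_semigroup (rescale (imag s) T). Proof. exact: rescale_C0. Qed.
Let hMs s : forall t x, 0 <= t -> rnorm (rescale (imag s) T t x) <= M * expR (- w * t) * rnorm x.
Proof. exact: rescale_bound. Qed.
Let gAs s : generates (op_shift A (imag s)) (rescale (imag s) T).
Proof. exact: generates_rescale. Qed.

Lemma op_inv_imag s y : op_inv (op_shift A (imag s)) y = res_at T s y.
Proof. exact: op_inv_right_half_plane. Qed.

Lemma res_at_lin s (a : R[i]) x y : res_at T s (a *: x + y) = a *: res_at T s x + res_at T s y.
Proof. exact: (res_op_lin (sTs s) w0 M1 (@hMs s)). Qed.

Lemma res_atD s x y : res_at T s (x + y) = res_at T s x + res_at T s y.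
Proof. by have := res_at_lin s 1 x y; rewrite !scale1r. Qed.

Lemma res_atZ s (a : R[i]) x : res_at T s (a *: x) = a *: res_at T s x.
Proof. by have := res_at_lin s a x 0; rewrite (res_at0 sT w0 M1 hM) !addr0. Qed.

Lemma res_atB s x y : res_at T s (x - y) = res_at T s x - res_at T s y.
Proof. by rewrite res_atD -scaleN1r res_atZ scaleN1r. Qed.

Lemma res_at_right s y : pdom A (res_at T s y) /\ papp A (res_at T s y) - imag s *: res_at T s y = y.
Proof. exact: (res_op_right (sTs s) w0 M1 (@hMs s) (gAs s)). Qed.

Lemma res_at_left s x : pdom A x -> res_at T s (papp A x - imag s *: x) = x.
Proof. exact: (res_op_left (sTs s) w0 M1 (@hMs s) (gAs s)). Qed.

Lemma res_at_identity s r y z :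
  res_at T s z - res_at T r y = res_at T s (z - y + (imag s - imag r) *: res_at T r y).
Proof.
have [d e] := res_at_right r y.
have := res_at_left s d; rewrite -{1}(subrK (imag r *: res_at T r y) (papp A _)) e => h.
rewrite -{1}h -res_atB scalerBl; move: (res_at T r y) => x; congr (res_at T s _).
by rewrite !opprD opprK -!addrA [_ + imag s *: x]addrC.
Qed.

Lemma res_at_diff s r q z :
  res_at T s q - res_at T r z = res_at T s (q - z) + (res_at T s z - res_at T r z).
Proof. by rewrite res_atB addrA subrK. Qed.

Lemma imagB (a b : R) : imag a - imag b = imag (a - b).
Proof. by rewrite /imag; simpc. Qed.

Lemma rnorm_imagZ (a : R) (x : X) : rnorm (imag a *: x) = `|a| * rnorm x.
Proof. by rewrite rnormZ /imag normc_def /= expr0n add0r sqrtr_sqr. Qed.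

Lemma has_deriv_res v t v' : has_deriv v t v' ->
  has_deriv (fun s => res_at T s (v s)) t (res_at T t (v' + imag 1 *: res_at T t (v t))).
Proof.
move=> dv; set u := res_at T t (v t); set z := v' + imag 1 *: u.
have K0 : 0 <= M / w by rewrite divr_ge0 ?(ltW w0) // (le_trans ler01).
apply: (@cvg_rnorm_le R X _ _ _ _ _ (fun h : R =>
  M / w * rnorm (h^-1%:C *: (v (t + h) - v t) - v') + `|h| * ((M / w) * ((M / w) * rnorm z)))).
  near=> h; have h0 : h != 0 by near: h; exact: nbhs_dnbhs_neq.
  (* The resolvent identity rewrites the difference quotient as a resolvent applied to a convergent
     argument; the uniform bound [M / w] on resolvents then gives the limit. *)
  have E : h^-1%:C *: (res_at T (t + h) (v (t + h)) - u) =
      res_at T (t + h) (h^-1%:C *: (v (t + h) - v t) + imag 1 *: u).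
    rewrite res_at_identity -res_atZ scalerDr; congr (res_at T _ (_ + _)).
    rewrite imagB scalerA; congr (_ *: _).
    by rewrite addrAC subrr add0r /imag; simpc; rewrite mulVf.
  rewrite E res_at_diff (_ : _ + _ - z = h^-1%:C *: (v (t + h) - v t) - v'); last first.
    by rewrite /z [v' + _]addrC addrKA.
  apply: le_trans (ler_rnormD _ _) _; apply: lerD; first exact: rnorm_res_at.
  rewrite res_at_identity subrr add0r imagB addrAC subrr add0r.
  apply: le_trans (rnorm_res_at sT w0 M1 hM _ _) _.
  rewrite rnorm_imagZ mulrCA ler_wpM2l // ler_wpM2l //.
  exact: rnorm_res_at.
rewrite -[X in _ --> X](_ : M / w * 0 + 0 * ((M / w) * ((M / w) * rnorm z)) = 0); last first.
  by rewrite mulr0 mul0r addr0.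
apply: cvgD; apply: cvgM; try exact: cvg_cst.
  by apply: (cvg_rnormP _ _).1; exact: dv.
by have := @ccvg_id0 R; rewrite /ccvg; under eq_fun do rewrite subr0 /cn Re_norm_real.
Unshelve. all: by end_near. Qed.

(* The derivative of [R(is) v] is [R(is) (v' + i R(is) v)], so this class is closed under
   differentiation. *)
Inductive resolvent_iterate : (R -> X) -> Prop :=
| iterate_schwartz v : schwartz v -> resolvent_iterate v
| iterate_add u v : resolvent_iterate u -> resolvent_iterate v -> resolvent_iterate (fun s => u s + v s)
| iterate_scale a v : resolvent_iterate v -> resolvent_iterate (fun s => a *: v s)
| iterate_res v : resolvent_iterate v -> resolvent_iterate (fun s => res_at T s (v s)).

Lemma resolvent_iterate_deriv v : resolvent_iterate v -> rapid v /\
  exists2 v', resolvent_iterate v' & forall t, has_deriv v t (v' t).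
Proof.
elim=> {v} [v sv|u v _ [ru [u' Pu du]] _ [rv [v' Pv dv]]|a v _ [rv [v' Pv dv]]|v Rv [rv [v' Pv dv]]].
- split; first exact: schwartz_rapid.
  by have [v' sv' dv] := schwartz_deriv sv; exists v' => //; exact: iterate_schwartz.
- split; first exact: rapid_add.
  exists (fun s => u' s + v' s); first exact: iterate_add.
  by move=> t; exact: has_deriv_add.
- split.
    apply: (@rapid_le _ _ (complex.Re `|a|) v) => //; last by move=> t; rewrite rnormZ.
    exact: cn_ge0.
  exists (fun s => a *: v' s); first exact: iterate_scale.
  by move=> t; exact: has_deriv_cscale.
- split.
    apply: (@rapid_le _ _ (M / w) v) => //; last by move=> t; exact: rnorm_res_at.
    by rewrite divr_ge0 ?(ltW w0) // (le_trans ler01).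
  exists (fun s => res_at T s (v' s + imag 1 *: res_at T s (v s))).
    by apply/iterate_res/iterate_add => //; exact/iterate_scale/iterate_res.
  by move=> t; exact: has_deriv_res.
Qed.

Lemma schwartz_res v : schwartz v -> schwartz (fun s => res_at T s (v s)).
Proof.
move=> sv; apply: (schwartz_coind resolvent_iterate_deriv).
exact/iterate_res/iterate_schwartz.
Qed.

End resolvent_identity.

(** * Operators on the half line *)

Section half_line_operators.
Context (R : realType) (X U Y : completeNormedModType R[i]).
Variable (T : R -> {linear X -> X}).
Local Notation mu := (@lebesgue_measure R).

Lemma Rplus_measurable : @measurable _ (measurableTypeR R) (@Rplus R).
Proof. exact: measurable_itv. Qed.

Lemma RplusE (t : R) : @Rplus R t = (0 <= t) :> Prop.
Proof. by apply/propext; rewrite /Rplus /= in_itv /= andbT. Qed.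

Lemma Gop_sconv (f f' : R -> X) (t : R) : 0 <= t -> ae_version (@Rplus R) f f' ->
  binteg (ckern T f' t) -> Gop T f t = sconv T f' t.
Proof.
move=> t0 [N [mN N0 ff f0]] bf; apply: bochner_integral_version => //; exists N; split=> //.
- move=> u; rewrite /= in_itv /= => /andP[u0 ut] Nu; rewrite /ckern ut (max_idPl _) ?subr_ge0 //.
  by rewrite ff // RplusE.
- move=> u; rewrite /= in_itv /= => ut; rewrite /ckern; case: ifP => // u1.
  by rewrite f0 ?linear0 // RplusE => u0; apply: ut; rewrite u0.
Qed.

Lemma sconv_lt0 (f : R -> X) (t : R) : (forall u, u < 0 -> f u = 0) -> t < 0 -> sconv T f t = 0.
Proof.
move=> f0 t0; rewrite -[RHS](@bint0 R X); congr bint; apply/funext => u; rewrite /ckern.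
by case: ifP => // ut; rewrite f0 ?linear0 // (le_lt_trans ut).
Qed.

Lemma ae_version_lt0 (V : completeNormedModType R[i]) (f f' : R -> V) (u : R) :
  ae_version (@Rplus R) f f' -> u < 0 -> f' u = 0.
Proof. by move=> [N [_ _ _ h]] u0; apply: h; rewrite RplusE => /(lt_le_trans u0); rewrite ltxx. Qed.

Variables (M w : R).
Hypotheses (sT : C0_semigroup T) (w0 : 0 < w) (M1 : 1 <= M)
  (hM : forall t x, 0 <= t -> rnorm (T t x) <= M * expR (- w * t) * rnorm x).
Variables (B : {linear U -> X}) (C : {linear X -> Y}).
Hypotheses (cB : continuous B) (cC : continuous C).
Variables (p : R) (hp : 1 <= p).

Lemma Lop_version (u u' : R -> U) : ae_version (@Rplus R) u u' -> smeas u' -> (Np p u' < +oo)%E ->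
  ae_version (@Rplus R) (Lop T B C u) (io_conv T B C u').
Proof.
move=> uu mu hu; exists set0; split; [exact: measurable0|exact: measure0| |].
- move=> t; rewrite RplusE => t0 _; rewrite /Lop /io_conv /=; congr (C _).
  apply: Gop_sconv => //; last by apply: (binteg_ckern sT w0 M1 hM); exact: (tame_io w0 cB hp).
  have [N [mN N0 h h0]] := uu; exists N; split=> //.
    by move=> s s0 Ns /=; rewrite h.
  by move=> s s0; rewrite h0 ?linear0.
- move=> t; rewrite RplusE => /negP; rewrite -ltNge => t0.
  rewrite /io_conv sconv_lt0 ?linear0 // => s s0.
  by rewrite (ae_version_lt0 uu s0) linear0.
Qed.

Lemma Lop_in_Lp (u : R -> U) : in_Lp (@Rplus R) p u -> exists u',
  [/\ smeas u', (Np p u' < +oo)%E, in_Lp (@Rplus R) p (Lop T B C u),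
      Lpnorm (@Rplus R) p u = Np p u' &
      Lpnorm (@Rplus R) p (Lop T B C u) = Np p (io_conv T B C u')].
Proof.
have [c c0 hc] := io_conv_young sT w0 M1 hM cB cC hp.
move=> /(in_Lp_version _ _ Rplus_measurable)[u' [uu mu hu]]; exists u'.
have vL := Lop_version uu mu hu; split.
- exact: mu.
- exact: hu.
- apply/(in_Lp_version _ _ Rplus_measurable); exists (io_conv T B C u'); split; first exact: vL.
    by apply: (smeas_io_conv sT w0 M1 hM cC); exact: (tame_io w0 cB hp).
  apply: le_lt_trans (hc _ mu hu) _; apply: lte_mul_pinfty; [|by []|exact: hu].
  by rewrite lee_fin.
- exact: Lpnorm_version uu.
- exact: Lpnorm_version vL.
Qed.

Lemma Lop_bounded : Lp_bounded (@Rplus R) p (Lop T B C).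
Proof.
have [c c0 hc] := io_conv_young sT w0 M1 hM cB cC hp.
exists c => u /Lop_in_Lp[u' [mu hu hL -> ->]]; split; [exact: hL|exact: hc].
Qed.

End half_line_operators.

(** * Stability criteria *)

Section Datko.
Context (R : realType) (X : completeNormedModType R[i]).
Variable (T : R -> {linear X -> X}).
Hypothesis sT : C0_semigroup T.
Variables (p : R) (hp : 1 <= p).
Local Notation mu := (@lebesgue_measure R).

Let p0 : 0 < p. Proof. exact: lt_le_trans hp. Qed.

Lemma contraction_exp_stable (t0 q : R) : 0 < t0 -> 0 < q < 1 ->
  (forall x, rnorm (T t0 x) <= q * rnorm x) -> exp_stable T.
Proof.
move=> t00 /andP[q0 q1] hq; have [M [w [M1 w0 hM]]] := semigroup_exp_bound sT.
have [T0 TD _ _] := sT.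
have iter n x : rnorm (T (n%:R * t0) x) <= q ^+ n * rnorm x.
  elim: n x => [|n IH] x; first by rewrite mul0r T0 expr0 mul1r.
  rewrite (_ : n.+1%:R * t0 = t0 + n%:R * t0); last by rewrite (natrD _ 1%N) mulrDl mul1r.
  rewrite TD ?(ltW t00) //; last by rewrite mulr_ge0 ?(ltW t00).
  apply: le_trans (hq _) _; rewrite exprS -mulrA; apply: ler_wpM2l (IH _); exact: ltW.
have lq : ln q < 0 by rewrite ln_lt0 // q0.
have E0 : 1 <= expR (w * t0) by rewrite -expR0 ler_expR mulr_ge0 // ltW.
have q1' : 1 <= q^-1 by rewrite invf_ge1 // ltW.
(* Write [t = n t0 + r] with [0 <= r <= t0]: the rest [r] costs [M e^{w t0}], and
   [q^n <= q^-1 q^{t / t0}] because [n + 1 >= t / t0]. *)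
exists (M * expR (w * t0) * q^-1), (ln q / t0); split.
- by rewrite -[leLHS]mulr1 -[in leLHS](mulr1 1); apply: ler_pM => //; rewrite ?mulr1 //;
    apply: mulr_ege1.
- by rewrite pmulr_llt0 // invr_gt0.
- move=> t t_0 x; pose n := Num.truncn (t / t0).
  have nt : n%:R * t0 <= t by rewrite -ler_pdivlMr // truncn_le // divr_ge0 // ltW.
  have nt' : t <= n.+1%:R * t0 by rewrite -ler_pdivrMr // ltW // truncnS_gt.
  have r0 : 0 <= t - n%:R * t0 by rewrite subr_ge0.
  have rt : t - n%:R * t0 <= t0 by rewrite lerBlDr; move: nt'; rewrite (natrD _ 1%N) mulrDl mul1r.
  rewrite -{1}(subrK (n%:R * t0) t) TD //; last by rewrite mulr_ge0 ?(ltW t00).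
  apply: le_trans (hM _ _ r0) _.
  have h1 : M * expR (w * (t - n%:R * t0)) <= M * expR (w * t0).
    by rewrite ler_wpM2l ?(le_trans ler01) // ler_expR ler_wpM2l.
  have M0 : 0 <= M * expR (w * t0) by rewrite mulr_ge0 ?expR_ge0 // (le_trans ler01).
  apply: le_trans (ler_wpM2r (rnorm_ge0 _) h1) _.
  apply: le_trans (ler_wpM2l M0 (iter n x)) _; rewrite !mulrA ler_wpM2r ?rnorm_ge0 //.
  rewrite -!mulrA !ler_wpM2l ?expR_ge0 ?(le_trans ler01) //.
  have qE : q = expR (ln q) by rewrite lnK.
  rewrite ler_pdivlMl // {1}qE [X in _ * X ^+ n]qE -expRM_natl -expRD ler_expR.
  rewrite -[X in X + _]mul1r -mulrDl -(natrD _ 1%N) mulrC ler_nM2l // mulrC.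
  by rewrite ler_pdivrMr.
Qed.

(** It starts at time 1 because the convolution of the semigroup with the piece of an orbit over
    [[0, 1]] reproduces the orbit only from then on. *)
Definition tail_orbit (x : X) (t : R) : X :=
  if t \in `[1, +oo[%classic then T (Num.max t 0) x else 0.

Lemma smeas_tail_orbit x : smeas (tail_orbit x).
Proof.
apply: smeas_indic; first exact: measurable_itv.
by apply: smeas_continuous; exact: semigroup_continuous.
Qed.

Lemma tail_orbitE x t : 1 <= t -> tail_orbit x t = T t x.
Proof.
move=> t1; rewrite /tail_orbit mem_set; last by rewrite /= in_itv /= t1.
by rewrite (max_idPl _) // (le_trans ler01).
Qed.

(** A Chebyshev estimate: the lower bound on the orbit over [[a, b]] is raised to the power [p] and
    integrated. *)
Lemma tail_average (x : X) (a b c D K : R) : 1 <= a -> a <= b -> 0 <= c -> 0 < D -> 0 < K ->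
  (forall s, a <= s -> s <= b -> c <= D * rnorm (T s x)) ->
  (Np p (tail_orbit x) <= K%:E)%E -> (b - a) * c `^ p <= (D * K) `^ p.
Proof.
move=> a1 ab c0 D0 K0 hc; rewrite Np_le_powR // ?(ltW K0) // => hK.
have mJ : @measurable _ (measurableTypeR R) `[a, b]%classic by exact: measurable_itv.
have hJ : mu `[a, b]%classic = (b - a)%:E.
  by rewrite lebesgue_measure_itv /= lte_fin; have [_//|] := ltP a b; rewrite le_eqVlt => /orP[/eqP->|];
    rewrite ?subrr // ltNge ab.
have E : (\int[mu]_t (c `^ p * \1_(`[a, b]%classic) t)%:E = ((b - a) * c `^ p)%:E)%E.
  rewrite integralTZ ?powR_ge0 //.
  have -> : (\int[mu]_t (\1_(`[a, b]%classic) t)%:E = mu `[a, b]%classic)%E.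
    by rewrite integral_indic // setIT.
  by rewrite hJ -EFinM mulrC.
rewrite -lee_fin -E; apply: (@le_trans _ _ (\int[mu]_t (D `^ p * rnorm (tail_orbit x t) `^ p)%:E)%E).
  apply: le_integralT.
  - by apply: measurable_funM => //; exact: measurable_indic.
  - apply: measurable_funM => //; apply: measurable_rnormp => //; exact: smeas_tail_orbit.
  - move=> t; rewrite mulr_ge0 ?powR_ge0 //= indicE; have [tJ|_] := boolP (t \in _); last first.
      by rewrite mulr0 mulr_ge0 ?powR_ge0.
    have := set_mem tJ; rewrite /= in_itv /= => /andP[at_ tb].
    rewrite mulr1 -powRM ?rnorm_ge0 ?(ltW D0) //; apply: ge0_ler_powR; rewrite ?nnegrE ?(ltW p0) //.
      by rewrite mulr_ge0 ?rnorm_ge0 // ltW.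
    by rewrite tail_orbitE ?(le_trans a1) //; exact: hc.
rewrite integralTZ ?powR_ge0 //; last 2 first.
- by apply: measurable_rnormp => //; exact: smeas_tail_orbit.
- by move=> t; exact: powR_ge0.
rewrite powRM ?(ltW D0) ?(ltW K0) // EFinM; apply: lee_wpmul2l => //.
by rewrite lee_fin powR_ge0.
Qed.

(* Depends on [T] only through the two bounds: the same time works for a family of semigroups. *)
Definition datko_time (L K : R) : R := 1 + (2 * Num.max (L * L) (L * K) * K) `^ p.

(** For [t > 2], the value at [t] is at most [L] times every value on [[t - 1, t]], so the [L^p]
    bound makes the semigroup uniformly bounded by [c]. Then [T t1 x] is at most [c] times every
    earlier value, and averaging over [[1, t1]] gives [(t1 - 1) |T t1 x|^p <= (c K |x|)^p];
    [datko_time] is chosen so that this reads [|T t1 x| <= |x| / 2]. *)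
Lemma datko (L K : R) : 1 <= L -> 0 < K ->
  (forall t x, 0 <= t -> t <= 1 -> rnorm (T t x) <= L * rnorm x) ->
  (forall x, (Np p (tail_orbit x) <= (K * rnorm x)%:E)%E) ->
  forall x, rnorm (T (datko_time L K) x) <= 2^-1 * rnorm x.
Proof.
move=> L1 K0 hL hK x; have [T0 TD _ _] := sT.
have L0 : 0 < L by exact: lt_le_trans L1.
have unpow (a b : R) : 0 <= a -> 0 <= b -> a `^ p <= b `^ p -> a <= b.
  move=> a0 b0 ab; rewrite leNgt; apply/negP => ba.
  have := lt_le_trans (gt0_ltr_powR p0 b0 a0 ba) ab; by rewrite ltxx.
have TL (y : X) s t : 0 <= s -> s <= t -> t <= s + 1 -> rnorm (T t y) <= L * rnorm (T s y).
  move=> s0 st ts; rewrite -{1}(subrK s t) TD ?subr_ge0 //; apply: hL; first by rewrite subr_ge0.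
  by rewrite lerBlDl.
set c := Num.max (L * L) (L * K).
have c0 : 0 < c by rewrite /c lt_max mulr_gt0.
have pos (y : X) : y != 0 -> 0 < K * rnorm y.
  by move=> y0; rewrite mulr_gt0 // lt_neqAle eq_sym rnorm_eq0P y0 rnorm_ge0.
have bd (y : X) t : 0 <= t -> rnorm (T t y) <= c * rnorm y.
  have [-> _|y0 t0] := eqVneq y 0; first by rewrite linear0 rnorm0 mulr0.
  have [t2|t2] := leP t 2.
    apply: (@le_trans _ _ (L * L * rnorm y)); last by rewrite ler_wpM2r ?rnorm_ge0 // le_max lexx.
    have [t1|t1] := leP t 1.
      apply: le_trans (hL _ _ t0 t1) _; rewrite ler_wpM2r ?rnorm_ge0 //.
      by rewrite -[leLHS]mulr1 ler_pM2l.
    apply: le_trans (TL y 1 t _ _ _) _ => //; [exact: ltW|].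
    by rewrite -mulrA ler_pM2l //; exact: hL.
  apply: (@le_trans _ _ (L * K * rnorm y)); last by rewrite ler_wpM2r ?rnorm_ge0 // le_max lexx orbT.
  apply: unpow; rewrite ?rnorm_ge0 ?mulr_ge0 ?rnorm_ge0 ?(ltW L0) ?(ltW K0) //.
  have := @tail_average y (t - 1) t (rnorm (T t y)) L (K * rnorm y).
  rewrite opprB addrCA subrr addr0 mul1r mulrA; apply=> //.
  - lra.
  - lra.
  - exact: rnorm_ge0.
  - exact: pos.
  - by move=> s s1 s2; apply: TL => //; lra.
have [->|x0] := eqVneq x 0; first by rewrite linear0 rnorm0 mulr0.
set t1 := datko_time L K.
have P0 : 0 <= 2 * c * K by rewrite !mulr_ge0 // ltW.
have t11 : 1 <= t1 by rewrite lerDl powR_ge0.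
rewrite -(ler_pM2l (_ : 0 < 2)) // mulrA mulfV ?gt_eqF // mul1r.
have P1 : 0 < (2 * c * K) `^ p by rewrite powR_gt0 // !mulr_gt0.
apply: unpow; rewrite ?mulr_ge0 ?rnorm_ge0 // powRM ?rnorm_ge0 //.
have := @tail_average x 1 t1 (rnorm (T t1 x)) c (K * rnorm x).
have -> : t1 - 1 = (2 * c * K) `^ p by rewrite /t1 /datko_time addrAC subrr add0r.
move=> /(_ (lexx _) t11 (rnorm_ge0 _) c0 (pos x x0)) h.
have {}h : (2 * c * K) `^ p * rnorm (T t1 x) `^ p <= (c * (K * rnorm x)) `^ p.
  apply: h => // s s1 s2; rewrite -(subrK s t1) TD ?subr_ge0 // ?(le_trans ler01) //.
  by apply: bd; rewrite subr_ge0.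
rewrite -(ler_pM2l P1) mulrCA; apply: le_trans (ler_wpM2l _ h) _; first exact: powR_ge0.
rewrite -!powRM ?rnorm_ge0 // ?mulr_ge0 ?rnorm_ge0 // ?(ltW c0) ?(ltW K0) //.
by rewrite !mulrA.
Qed.

End Datko.

(** * Resolvents under feedback *)

Section partial_operators.
Context (R : realType) (X : completeNormedModType R[i]).
Implicit Types (A D : partial_op X).

Lemma op_shiftD A (a b : R[i]) : op_shift (op_shift A a) b = op_shift A (a + b).
Proof.
rewrite /op_shift /=; congr PartialOp; apply/funext => x.
by rewrite scalerDl opprD addrA.
Qed.

Lemma op_shift_add A (P : X -> X) (a : R[i]) :
  op_shift (op_add A P) a = op_add (op_shift A a) P.
Proof. by rewrite /op_shift /op_add /=; congr PartialOp; apply/funext => x; rewrite addrAC. Qed.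

(** A [partial_op] carries no linear structure; linearity of a generator is read off the difference
    quotients of its semigroup. *)
Lemma generator_lin A (T : R -> {linear X -> X}) (a : R[i]) x y : generates A T ->
  pdom A x -> pdom A y ->
  pdom A (a *: x + y) /\ papp A (a *: x + y) = a *: papp A x + papp A y.
Proof.
move=> gA Ax Ay; apply/gA.
have hx : h^-1%:C *: (T h x - x) @[h --> (0 : R)^'+] --> papp A x by apply/gA.
have hy : h^-1%:C *: (T h y - y) @[h --> (0 : R)^'+] --> papp A y by apply/gA.
have : a *: (h^-1%:C *: (T h x - x)) + h^-1%:C *: (T h y - y) @[h --> (0 : R)^'+] -->
    a *: papp A x + papp A y.
  by apply: cvgD => //; apply: (@cvg_scale R X) => //; exact: ccvg_cst.
apply: (@cvg_near_eq R X); apply: nearW => h.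
rewrite linearP scalerA mulrC -scalerA -scalerDr; congr (_ *: _).
by rewrite scalerBr opprD addrACA.
Qed.

Section inverse.
Variables (D : partial_op X) (S : R -> {linear X -> X}).
Hypotheses (bD : set_bij (pdom D) [set: X] (papp D)) (gD : generates D S).

Lemma op_invP y : pdom D (op_inv D y) /\ papp D (op_inv D y) = y.
Proof.
rewrite /op_inv; case: xgetP => [_ _ []//|no].
by have [_ _ /(_ y I)[x Dx e]] := bD; case: (no x).
Qed.

Lemma op_inv_left x : pdom D x -> op_inv D (papp D x) = x.
Proof.
move=> Dx; have [D1 e1] := op_invP (papp D x).
by have [_ inj _] := bD; apply: inj => //; exact/mem_set.
Qed.

Lemma op_inv_lin (a : R[i]) x y : op_inv D (a *: x + y) = a *: op_inv D x + op_inv D y.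
Proof.
have [[Dx ex] [Dy ey]] := (op_invP x, op_invP y).
have [Dz ez] := generator_lin a gD Dx Dy.
by rewrite -(op_inv_left Dz) ez ex ey.
Qed.

Lemma op_inv0 : op_inv D 0 = 0.
Proof. by have := op_inv_lin (-1) 0 0; rewrite scaler0 addr0 scaleN1r addNr. Qed.

Lemma op_invD x y : op_inv D (x + y) = op_inv D x + op_inv D y.
Proof. by have := op_inv_lin 1 x y; rewrite !scale1r. Qed.

Lemma op_invZ (a : R[i]) x : op_inv D (a *: x) = a *: op_inv D x.
Proof. by have := op_inv_lin a x 0; rewrite op_inv0 !addr0. Qed.

End inverse.

End partial_operators.

Section feedback.
Context (R : realType) (X : completeNormedModType R[i]).
Variables (D : partial_op X) (S : R -> {linear X -> X}).
Hypothesis gD : generates D S.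
Hypothesis bD : forall s, set_bij (pdom D) [set: X] (papp (op_shift D (imag s))).
Local Notation res s := (op_inv (op_shift D (imag s))).

Let gDs s : generates (op_shift D (imag s)) (rescale (imag s) S).
Proof. exact: generates_rescale. Qed.

Let resP s y : pdom D (res s y) /\ papp D (res s y) - imag s *: res s y = y.
Proof. exact: (@op_invP R X (op_shift D (imag s)) (bD s)). Qed.

Let res_left s x : pdom D x -> res s (papp D x - imag s *: x) = x.
Proof. exact: (@op_inv_left R X (op_shift D (imag s)) (bD s)). Qed.

Lemma imag_resolventD s x y : res s (x + y) = res s x + res s y.
Proof. exact: (@op_invD R X (op_shift D (imag s)) _ (bD s) (@gDs s)). Qed.

Lemma imag_resolventZ s (a : R[i]) x : res s (a *: x) = a *: res s x.
Proof. exact: (@op_invZ R X (op_shift D (imag s)) _ (bD s) (@gDs s)). Qed.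

Lemma imag_resolvent0 s : res s 0 = 0.
Proof. exact: (@op_inv0 R X (op_shift D (imag s)) _ (bD s) (@gDs s)). Qed.

Variables (T' : R -> {linear X -> X}) (M w : R).
Hypotheses (sT' : C0_semigroup T') (w0 : 0 < w) (M1 : 1 <= M)
  (hM : forall t x, 0 <= t -> rnorm (T' t x) <= M * expR (- w * t) * rnorm x).
Variable (P : X -> X).
Hypothesis gT' : generates (op_add D P) T'.

Lemma feedback_left s y : res s y = res_at T' s y + res s (P (res_at T' s y)).
Proof.
have [/= Dx e] := res_at_right sT' w0 M1 hM gT' s y.
rewrite -[X in _ = X + _](res_left s Dx) -imag_resolventD; congr (res s _).
by rewrite -[LHS]e addrAC.
Qed.

Lemma feedback_right s y : res s y = res_at T' s y + res_at T' s (P (res s y)).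
Proof.
have [/= Dx e] := resP s y.
rewrite -(res_atD sT' w0 M1 hM) -[X in res_at _ _ (X + _)]e addrAC.
by rewrite -[LHS](res_at_left sT' w0 M1 hM gT' s Dx).
Qed.

Let c : R := M / w * 2.
Let c0 : 0 <= c. Proof. by rewrite mulr_ge0 // divr_ge0 ?(ltW w0) // (le_trans ler01). Qed.

Variables (p : R) (hp : 1 <= p).

Lemma lte_osc_res v : schwartz v -> (osc_Lpnorm p v < +oo)%E ->
  (osc_Lpnorm p (fun s => res_at T' s (v s)) < +oo)%E.
Proof.
move=> sv hv; apply: le_lt_trans (osc_Lpnorm_res_le sT' w0 M1 hM v hp) _.
by apply: lte_mul_pinfty; [rewrite lee_fin|by []|exact: hv].
Qed.

Section stabilized.
Context (U Y : completeNormedModType R[i]).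
Variables (B : {linear U -> X}) (F : {linear X -> U}) (C : {linear X -> Y}).
Hypotheses (cF : continuous F) (cC : continuous C) (PE : P = B \o F).

(** The hypothesis is applied to [F] composed with the resolvent of the stabilized system, evaluated
    on [v]; this is a Schwartz function by [schwartz_res]. *)
Lemma multiplier_stabilized :
  (multiplier_sup p (fun s u => C (res s (B u))) < +oo)%E ->
  (multiplier_sup p (fun s x => C (res s x)) < +oo)%E.
Proof.
move=> /multiplier_sup_lty[k k0 hk].
have [KF KF0 hF] := continuous_linear_bound cF.
have [KC KC0 hC] := continuous_linear_bound cC.
have d0 : 0 <= KC * c + k * (KF * c).
  by apply: addr_ge0; apply: mulr_ge0 => //; [exact: ltW|apply: mulr_ge0; [exact: ltW|]].
apply: le_lt_trans (ltry (KC * c + k * (KF * c))); apply: (multiplier_sup_le d0) => v sv hv.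
set N := osc_Lpnorm p v in hv *.
have N0 : (0 <= N)%E by exact: osc_Lpnorm_ge0.
have hr := osc_Lpnorm_res_le sT' w0 M1 hM v hp; rewrite -/c -/N in hr.
have sr := schwartz_res sT' w0 M1 hM gT' sv.
have sF : schwartz (fun s => F (res_at T' s (v s))) by exact: (schwartz_map cF sr).
have hFr : (osc_Lpnorm p (fun s => F (res_at T' s (v s))) <= (KF * c)%:E * N)%E.
  apply: le_trans (osc_Lpnorm_map hp cF KF0 hF _) _; rewrite EFinM -muleA.
  by apply: lee_wpmul2l; [rewrite lee_fin ltW|exact: hr].
have hCr : (osc_Lpnorm p (fun s => C (res_at T' s (v s))) <= (KC * c)%:E * N)%E.
  apply: le_trans (osc_Lpnorm_map hp cC KC0 hC _) _; rewrite EFinM -muleA.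
  by apply: lee_wpmul2l; [rewrite lee_fin ltW|exact: hr].
have E : (fun s => C (res s (v s))) = fun s =>
    C (res_at T' s (v s)) + C (res s (B (F (res_at T' s (v s))))).
  by apply/funext => s; rewrite feedback_left PE linearD.
rewrite E; apply: le_trans (osc_Lpnorm_add hp _ _) _.
rewrite EFinD ge0_muleDl ?lee_fin; last 2 first.
- by apply: mulr_ge0 c0; exact: ltW.
- by apply: mulr_ge0 => //; apply: mulr_ge0 c0; exact: ltW.
apply: leeD; first exact: hCr.
have Fy : (osc_Lpnorm p (fun s => F (res_at T' s (v s))) < +oo)%E.
  apply: le_lt_trans hFr _; apply: lte_mul_pinfty; [|by []|exact: hv].
  by rewrite lee_fin; apply: mulr_ge0 c0; exact: ltW.
apply: le_trans (multiplier_le hp _ hk sF Fy) _.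
  by move=> s; rewrite linear0 imag_resolvent0 linear0.
by rewrite [(k * _)%:E]EFinM -muleA; apply: lee_wpmul2l; [rewrite lee_fin|exact: hFr].
Qed.

End stabilized.

Section detected.
Context (Y : completeNormedModType R[i]).
Variables (C : {linear X -> Y}) (K : {linear Y -> X}).
Hypotheses (cK : continuous K) (PE : P = K \o C).

(** The outer factor is here the resolvent of the stable system, whose bound [osc_Lpnorm_res_le]
    holds for every function and so covers the output [C (res s (v s))], of unknown smoothness. *)
Lemma multiplier_detected :
  (multiplier_sup p (fun s x => C (res s x)) < +oo)%E ->
  (multiplier_sup p (fun s x => res s x) < +oo)%E.
Proof.
move=> /multiplier_sup_lty[k k0 hk].
have [L L0 hL] := continuous_linear_bound cK.
have d0 : 0 <= c + c * (L * k).
  by apply: addr_ge0 => //; apply: mulr_ge0 => //; apply: mulr_ge0 => //; exact: ltW.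
apply: le_lt_trans (ltry (c + c * (L * k))); apply: (multiplier_sup_le d0) => v sv hv.
set N := osc_Lpnorm p v in hv *.
have N0 : (0 <= N)%E by exact: osc_Lpnorm_ge0.
have hr := osc_Lpnorm_res_le sT' w0 M1 hM v hp; rewrite -/c -/N in hr.
have E : (fun s => res s (v s)) = fun s =>
    res_at T' s (v s) + res_at T' s (K (C (res s (v s)))).
  by apply/funext => s; rewrite {1}feedback_right PE.
rewrite E; apply: le_trans (osc_Lpnorm_add hp _ _) _.
rewrite EFinD ge0_muleDl ?lee_fin //; last first.
  by apply: mulr_ge0 => //; apply: mulr_ge0 => //; exact: ltW.
apply: leeD; first exact: hr.
apply: le_trans (osc_Lpnorm_res_le sT' w0 M1 hM _ hp) _.
rewrite [(c * _)%:E]EFinM -muleA; apply: lee_wpmul2l; first by rewrite lee_fin.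
apply: le_trans (osc_Lpnorm_map hp cK L0 hL _) _.
rewrite [(L * _)%:E]EFinM -muleA; apply: lee_wpmul2l; first by rewrite lee_fin ltW.
apply: (multiplier_le hp _ hk sv hv).
by move=> s; rewrite imag_resolvent0 linear0.
Qed.

End detected.

End feedback.

Section stability_criteria.
Context (R : realType) (X : completeNormedModType R[i]).
Local Notation mu := (@lebesgue_measure R).
Variables (p : R) (hp : 1 <= p).

Let p0 : 0 < p. Proof. exact: lt_le_trans hp. Qed.

Lemma exp_stable_rate (T : R -> {linear X -> X}) : exp_stable T -> exists M w : R,
  [/\ 0 < w, 1 <= M & forall t x, 0 <= t -> rnorm (T t x) <= M * expR (- w * t) * rnorm x].
Proof.
move=> [M [w [M1 w0 h]]]; exists M, (- w); split=> //; first by rewrite oppr_gt0.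
by move=> t x t0; rewrite opprK; exact: h.
Qed.

Lemma exp_stable_bound (T : R -> {linear X -> X}) (M w : R) : 1 <= M -> 0 < w ->
  (forall t x, 0 <= t -> rnorm (T t x) <= M * expR (- w * t) * rnorm x) -> exp_stable T.
Proof. by move=> M1 w0 h; exists M, (- w); split=> //; [rewrite oppr_lt0|move=> t t0 x; exact: h]. Qed.

(** A decay rate [w] leaves room to decrease the shift by any amount below [w]. *)
Lemma exp_stable_rescale_open (T : R -> {linear X -> X}) (a : R) : exp_stable (rescale a%:C T) ->
  exists2 e : R, 0 < e & forall b, a - e < b -> exp_stable (rescale b%:C T).
Proof.
move=> /exp_stable_rate[M [w [w0 M1 h]]]; exists w => // b ab.
apply: (@exp_stable_bound _ M (w + b - a)) => //; first by lra.
move=> t x t0; have := h t x t0; rewrite !rnorm_rescale /= => {}h.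
rewrite (_ : - t * b = - t * (b - a) + - t * a); last by ring.
rewrite expRD -mulrA (_ : - (w + b - a) * t = - t * (b - a) + - w * t); last by ring.
rewrite [in leRHS]expRD [M * _]mulrCA -[leRHS]mulrA; apply: ler_wpM2l => //; exact: expR_ge0.
Qed.

Section test_function.
Variables (T : R -> {linear X -> X}) (L : R).
Hypotheses (sT : C0_semigroup T) (L1 : 1 <= L).
Hypothesis hL : forall t x, 0 <= t -> t <= 1 -> rnorm (T t x) <= L * rnorm x.

Definition orbit_start (x : X) (s : R) : X :=
  if s \in `[0, 1]%classic then T (Num.max s 0) x else 0.

Lemma smeas_orbit_start x : smeas (orbit_start x).
Proof.
apply: smeas_indic; first exact: measurable_itv.
by apply: smeas_continuous; exact: semigroup_continuous.
Qed.

Lemma Np_orbit_start x : (Np p (orbit_start x) <= (L * rnorm x)%:E)%E.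
Proof.
have Lx : 0 <= L * rnorm x by rewrite mulr_ge0 ?rnorm_ge0 // (le_trans ler01).
rewrite Np_le_powR // /Jp.
have E : (\int[mu]_t ((L * rnorm x) `^ p * \1_(`[0%R, 1%R]%classic) t)%:E = ((L * rnorm x) `^ p)%:E)%E.
  rewrite integralTZ ?powR_ge0 //.
  have -> : (\int[mu]_t (\1_(`[0%R, 1%R]%classic) t)%:E = mu `[0%R, 1%R]%classic)%E.
    by rewrite integral_indic // setIT.
  by rewrite lebesgue_measure_itv /= lte_fin ltr01 oppr0 adde0 mule1.
rewrite -E; apply: le_integralT.
- by apply: measurable_rnormp => //; exact: smeas_orbit_start.
- by apply: measurable_funM => //; exact: measurable_indic.
- move=> t; rewrite powR_ge0 /= /orbit_start indicE; have [tI|_] := boolP (t \in _).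
    have := set_mem tI; rewrite /= in_itv /= => /andP[t0 t1].
    rewrite mulr1; apply: ge0_ler_powR; rewrite ?nnegrE ?rnorm_ge0 ?(ltW p0) //.
    by rewrite (max_idPl t0); exact: hL.
  by rewrite rnorm0 mulr0 powR0 // gt_eqF.
Qed.

(** On [[0, 1]] the integrand [T (t - u) (T u x)] is the constant [T t x], and the interval has
    length 1. *)
Lemma sconv_orbit_start x t : 1 <= t ->
  binteg (ckern T (orbit_start x) t) /\ sconv T (orbit_start x) t = T t x.
Proof.
move=> t1; have [T0 TD _ _] := sT.
have E : ckern T (orbit_start x) t = fun u => if u \in `[0, 1]%classic then T t x else 0.
  apply/funext => u; rewrite /ckern /orbit_start; have [uI|uI] := boolP (u \in _); last first.
    by case: ifP => // _; rewrite linear0.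
  have := set_mem uI; rewrite /= in_itv /= => /andP[u0 u1].
  have ut : u <= t by exact: le_trans t1.
  by rewrite ut !(max_idPl _) ?subr_ge0 // -TD ?subr_ge0 // subrK.
have mI : (mu `[0%R, 1%R]%classic = 1)%E by rewrite lebesgue_measure_itv /= lte_fin ltr01 oppr0 adde0.
have [b e] : binteg (fun u => if u \in `[0, 1]%classic then T t x else 0) /\
    bint (fun u => if u \in `[0, 1]%classic then T t x else 0) = (fine (mu `[0%R, 1%R]%classic))%:C *: T t x.
  by apply: (bint_indic (T t x)); [exact: measurable_itv|rewrite mI ltry].
by rewrite /sconv E e mI /= scale1r; split.
Qed.

Lemma ae_version_orbit_start x : ae_version (@Rplus R) (orbit_start x) (orbit_start x).
Proof.
exists set0; split; [exact: measurable0|exact: measure0|by []|move=> u].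
rewrite RplusE => u0; rewrite /orbit_start memNset //= in_itv /= => /andP[h _].
exact: u0.
Qed.

(** Asking only for agreement almost everywhere from time 1 on serves both the operator [Gop] on the
    half line and the convolution on the whole line. *)
Lemma datko_conv (g : X -> R -> X) (K : R) : 0 < K ->
  (forall x, smeas (g x) /\ exists2 N : set R,
    @measurable _ (measurableTypeR R) N /\ mu N = 0%E &
    forall t, ~ N t -> 1 <= t -> g x t = sconv T (orbit_start x) t) ->
  (forall x, (Np p (g x) <= K%:E * Np p (orbit_start x))%E) ->
  forall x, rnorm (T (datko_time p L (K * L)) x) <= 2^-1 * rnorm x.
Proof.
move=> K0 hg hK; have L0 : 0 < L by exact: lt_le_trans L1.
apply: (datko sT hp L1 (mulr_gt0 K0 L0) hL) => x.
have [mg [N [mN N0] gN]] := hg x.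
have mJ : @measurable _ (measurableTypeR R) `[1%R, +oo[%classic by exact: measurable_itv.
rewrite -mulrA EFinM.
apply: (@le_trans _ _ (K%:E * Np p (orbit_start x))%E); last first.
  by apply: lee_wpmul2l; [rewrite lee_fin ltW|exact: Np_orbit_start].
apply: le_trans (hK x).
rewrite (@Np_ae R X p _ (fun t => if t \in `[1, +oo[%classic then g x t else 0) N mN N0); last first.
  move=> t Nt; rewrite /tail_orbit; case: ifP => // /set_mem; rewrite /= in_itv /= andbT => t1.
  rewrite gN // (sconv_orbit_start x t1).2 (max_idPl _) //.
  exact: le_trans t1.
apply: (Np_le hp) => //; first exact: smeas_indic.
by move=> t; case: ifP => // _; rewrite rnorm0 rnorm_ge0.
Qed.

End test_function.

Lemma semigroup_unit_bound (T : R -> {linear X -> X}) : C0_semigroup T -> exists2 L : R, 1 <= L &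
  forall t x, 0 <= t -> t <= 1 -> rnorm (T t x) <= L * rnorm x.
Proof.
move=> sT; have [M [w [M1 w0 h]]] := semigroup_exp_bound sT.
have E1 : 1 <= expR w by rewrite -expR0 ler_expR.
exists (M * expR w); first exact: mulr_ege1.
move=> t x t0 t1; apply: le_trans (h t x t0) _; apply: ler_wpM2r; first exact: rnorm_ge0.
apply: ler_wpM2l; first exact: le_trans M1.
by rewrite ler_expR -[leRHS]mulr1 ler_wpM2l.
Qed.

Lemma Gop_bounded_stable (T : R -> {linear X -> X}) : C0_semigroup T ->
  Lp_bounded (@Rplus R) p (Gop T) -> exp_stable T.
Proof.
move=> sT [M hM]; have [L L1 hL] := semigroup_unit_bound sT.
have L0 : 0 < L by exact: lt_le_trans L1.
have version x : exists g, [/\ ae_version (@Rplus R) (Gop T (orbit_start T x)) g, smeas g &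
    (Np p g <= M%:E * Np p (orbit_start T x))%E].
  have vf := ae_version_orbit_start T x.
  have fL : in_Lp (@Rplus R) p (orbit_start T x).
    apply: (in_Lp_version p (orbit_start T x) (@Rplus_measurable R)).2; exists (orbit_start T x); split; first exact: vf.
      exact: smeas_orbit_start.
    exact: le_lt_trans (Np_orbit_start sT L1 hL x) (ltry _).
  have [/(in_Lp_version _ _ (@Rplus_measurable R))[g [vg mg hg]]] := hM _ fL.
  by rewrite (Lpnorm_version p vg) (Lpnorm_version p vf) => h; exists g.
have [g hg] := choice version.
(* [Lp_bounded] gives no sign for [M]; the maximum makes the constant positive. *)
have K0 : 0 < Num.max M 1 by rewrite lt_max ltr01 orbT.
apply: (@contraction_exp_stable R X T sT (datko_time p L (Num.max M 1 * L)) 2^-1).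
- by rewrite ltr_pwDl // powR_ge0.
- by rewrite invr_gt0 ltr0n /= invf_lt1 ?ltr1n.
apply: (datko_conv sT L1 hL K0 (g := g)) => x; have [[N [mN N0 h _]] mg hM'] := hg x.
  split=> //; exists N => // t Nt t1; have t0 : 0 <= t by exact: le_trans t1.
  rewrite -h ?RplusE //; apply: Gop_sconv => //; first exact: ae_version_orbit_start.
  exact: (sconv_orbit_start sT x t1).1.
apply: le_trans hM' _; apply: lee_wpmul2r; first exact: Np_ge0.
by rewrite lee_fin le_max lexx.
Qed.

End stability_criteria.

(** * Stability from resolvent multipliers *)

Section frequency_domain_criterion.
Context (R : realType) (X : completeNormedModType R[i]).
Variables (T : R -> {linear X -> X}) (A : partial_op X).
Hypotheses (sT : C0_semigroup T) (gA : generates A T).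
Variables (p : R) (hp : 1 <= p).
Local Notation res D s := (op_inv (op_shift D (imag s))).

(** The last term on the right is at most [n / 2]; as [n] is finite, it can be subtracted. *)
Lemma absorb_half (n N : \bar R) (k d : R) : (0 <= n)%E -> (n < +oo)%E -> (0 <= N)%E -> (N < +oo)%E ->
  d * k <= 2^-1 -> (n <= k%:E * N + k%:E * (d%:E * n))%E -> (n <= (2 * k)%:E * N)%E.
Proof.
case: n => [n| |] //; case: N => [N| |] //; rewrite -!EFinM !lee_fin => n0 _ N0 _ dk h.
have : d * k * n <= 2^-1 * n by exact: ler_wpM2r.
by lra.
Qed.

(** [A - (a + d)] is the feedback of [A - a] by [-d], so its resolvent is [R' = R + d R R'].
    Stability at [a + d] makes the norm of [R' v] finite beforehand, and half of it is absorbed. *)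
Lemma multiplier_shift (a d k : R) : 0 < d -> 0 <= k -> d * k <= 2^-1 ->
  (forall s, set_bij (pdom A) [set: X] (papp (op_shift (op_shift A a%:C) (imag s)))) ->
  exp_stable (rescale (a + d)%:C T) ->
  (multiplier_sup p (fun s x => res (op_shift A a%:C) s x) <= k%:E)%E ->
  (multiplier_sup p (fun s x => res_at (rescale (a + d)%:C T) s x) <= (2 * k)%:E)%E.
Proof.
move=> d0 k0 dk bA /exp_stable_rate[M [w [w0 M1 hM]]] hk.
set T' := rescale (a + d)%:C T.
have sT' : C0_semigroup T' by exact: rescale_C0.
have gD := generates_rescale a%:C gA.
have gT' : generates (op_add (op_shift A a%:C) (fun x => - (d%:C *: x))) T'.
  have E : op_shift A (a + d)%:C = op_shift (op_shift A a%:C) d%:C by rewrite op_shiftD -rmorphD.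
  by have := generates_rescale (a + d)%:C gA; rewrite E.
have left s y := feedback_left gD bA sT' w0 M1 hM gT' s y.
have Z s (b : R[i]) y : res (op_shift A a%:C) s (b *: y) = b *: res (op_shift A a%:C) s y.
  exact: (imag_resolventZ gD bA).
have R0 s : res (op_shift A a%:C) s 0 = 0 by exact: (imag_resolvent0 gD bA).
apply: multiplier_sup_le; first exact: mulr_ge0.
move=> v sv hv; set N := osc_Lpnorm p v in hv *.
have N0 : (0 <= N)%E by exact: osc_Lpnorm_ge0.
have sr := schwartz_res sT' w0 M1 hM gT' sv.
have hr : (osc_Lpnorm p (fun s => res_at T' s (v s)) < +oo)%E.
  exact: (lte_osc_res sT' w0 M1 hM hp sv hv).
have sd := schwartz_scale d%:C sr.
have hd : (osc_Lpnorm p (fun s => d%:C *: res_at T' s (v s)) <=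
    d%:E * osc_Lpnorm p (fun s => res_at T' s (v s)))%E.
  apply: (@osc_Lpnorm_map R X X p hp [the {linear X -> X} of d%:C \*: idfun] d) => //.
    exact: (@cscale_continuous R X d%:C).
  by move=> x /=; rewrite rnormZr gtr0_norm.
have hd' : (osc_Lpnorm p (fun s => d%:C *: res_at T' s (v s)) < +oo)%E.
  apply: (le_lt_trans hd); apply: lte_mul_pinfty; [by rewrite lee_fin ltW|by []|exact: hr].
have E : (fun s => res_at T' s (v s)) = fun s => res (op_shift A a%:C) s (v s) +
    res (op_shift A a%:C) s (d%:C *: res_at T' s (v s)).
  apply/funext => s; rewrite [X in X + _]left -scaleN1r Z scaleN1r subrK //.
have h1 := multiplier_le hp R0 hk sv hv.
have h2 := multiplier_le hp R0 hk sd hd'.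
apply: (absorb_half (osc_Lpnorm_ge0 p _) hr N0 hv dk).
rewrite {1}E; apply: le_trans (osc_Lpnorm_add hp _ _) _; apply: leeD; first exact: h1.
by apply: (le_trans h2); apply: lee_wpmul2l; [rewrite lee_fin|exact: hd].
Qed.

(* At the infimum [al] of the shifts [a] for which [e^{-at} T t] is stable, the multiplier bound at
   [al] controls those at nearby [a > al] uniformly. Datko's argument then gives one time at which all
   these semigroups are contractions, so the shift [al] itself is stable; stability being an open
   condition on [a], this contradicts the choice of [al]. *)
Theorem multiplier_exp_stable :
  (forall (a s : R), 0 <= a ->
    set_bij (pdom A) [set: X] (papp (op_shift (op_shift A a%:C) (imag s)))) ->
  (forall a : R, 0 <= a ->
    (multiplier_sup p (fun s x => res (op_shift A a%:C) s x) < +oo)%E) ->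
  exp_stable T.
Proof.
move=> bA hS; set E := [set a : R | exp_stable (rescale a%:C T)].
have rescale0 : exp_stable (rescale 0%:C T) -> exp_stable T.
  move=> [M [w [M1 w0 h]]]; exists M, w; split=> // t t0 x.
  by have := h t t0 x; rewrite rnorm_rescale /= mulr0 expR0 mul1r.
apply: contrapT => nst.
have up a b : E a -> a <= b -> E b.
  move=> Ea ab; have [e e0 h] := exp_stable_rescale_open Ea; apply: h.
  by apply: lt_le_trans ab; rewrite ltrBlDr ltrDl.
have Epos a : E a -> 0 < a.
  move=> Ea; rewrite ltNge; apply/negP => a0; apply: nst; apply: rescale0.
  exact: (up _ _ Ea a0).
have nE : E !=set0.
  have [M [w [M1 w0 h]]] := semigroup_exp_bound sT.
  (* One more than the growth rate leaves the decay [e^{-t}]. *)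
  exists (w + 1); apply: (@exp_stable_bound R X _ M 1) => // t x t0.
  rewrite rnorm_rescale /=; apply: le_trans (ler_wpM2l (expR_ge0 _) (h t x t0)) _.
  rewrite mulrA mulrCA -expRD (_ : - t * (w + 1) + w * t = - 1 * t) //; ring.
have hasinf : has_inf E by split=> //; exists 0 => a /Epos/ltW.
set al := inf E.
have al0 : 0 <= al by apply: lb_le_inf => // a /Epos/ltW.
have nal : ~ E al.
  move=> Eal; have [e e0 h] := exp_stable_rescale_open Eal.
  have : E (al - e / 2) by apply: h; rewrite ltrD2l ltrN2 ltr_pdivrMr // ltr_pMr // ltr1n.
  move=> /(ge_inf hasinf.2); rewrite leNgt => /negP; apply.
  by rewrite ltrBlDr ltrDl divr_gt0.
have [k0 k00 hk0] := multiplier_sup_lty (hS al al0).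
pose k := Num.max k0 1.
have k1 : 1 <= k by rewrite le_max lexx orbT.
have kpos : 0 < k by exact: lt_le_trans k1.
have hk : (multiplier_sup p (fun s x => res (op_shift A al%:C) s x) <= k%:E)%E.
  by apply: le_trans hk0 _; rewrite lee_fin le_max lexx.
have [L L1 hL] := semigroup_unit_bound sT.
(* [2 * k] will bound the multipliers of the shifts just above [al], and [L] bounds their semigroups
   on [[0, 1]] because these shifts are nonnegative: the time is fixed before the shift is
   chosen. *)
pose t0 := datko_time p L (2 * k * L).
have t00 : 0 < t0 by rewrite ltr_pwDl // powR_ge0.
(* The first bound allows the absorption in [multiplier_shift]. The second limits to 3/2 the factor
   lost at time [t0] when returning from [al + d] to [al], so that the contraction factor 1/2
   becomes 3/4. *)
pose d0 := Num.min (2 * k)^-1 (ln (3 / 2) / t0).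
have d00 : 0 < d0 by rewrite lt_min invr_gt0 mulr_gt0 //= divr_gt0 // ln_gt0; lra.
have [a Ea ad] : exists2 a, E a & a < al + d0.
  by have [a Ea ad] := inf_adherent d00 hasinf; exists a.
have ala : al < a.
  rewrite lt_neqAle (ge_inf hasinf.2 Ea) andbT; apply/eqP => ea; apply: nal.
  by rewrite ea.
pose d := a - al.
have d_0 : 0 < d by rewrite subr_gt0.
have dd0 : d < d0 by rewrite /d ltrBlDl.
have aE : a = al + d by rewrite /d addrC subrK.
have sta : exp_stable (rescale (al + d)%:C T) by rewrite -aE.
have dk : d * k <= 2^-1.
  have : d <= (2 * k)^-1 by rewrite (le_trans (ltW dd0)) // ge_min lexx.
  rewrite -(ler_pM2r kpos) => /le_trans; apply.
  by rewrite invfM -mulrA mulVf ?mulr1 // gt_eqF.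
have hm := multiplier_shift d_0 (ltW kpos) dk (fun s => bA al s al0) sta hk.
pose T' := rescale (al + d)%:C T.
have sT' : C0_semigroup T' by exact: rescale_C0.
have [M [w [w0 M1 hM]]] := exp_stable_rate sta.
have cid : continuous (idfun : X -> X) by move=> x; exact: cvg_id.
have hL' t x : 0 <= t -> t <= 1 -> rnorm (T' t x) <= L * rnorm x.
  move=> t_0 t1; rewrite rnorm_rescale /=; apply: le_trans (hL _ _ t_0 t1).
  rewrite -[leRHS]mul1r ler_wpM2r ?rnorm_ge0 // -expR0 ler_expR mulNr oppr_le0.
  by rewrite mulr_ge0 // addr_ge0 // ltW.
have tame_start x : smeas (orbit_start T' x) /\ (Np p (orbit_start T' x) < +oo)%E.
  split; first exact: smeas_orbit_start.
  exact: le_lt_trans (Np_orbit_start hp sT' L1 hL' x) (ltry _).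
have half x : rnorm (T' t0 x) <= 2^-1 * rnorm x.
  apply: (@datko_conv R X p hp T' L sT' L1 hL' (fun x => sconv T' (orbit_start T' x)) (2 * k)) => //.
  - by rewrite mulr_gt0.
  - move=> y; split.
      have [m1 m2] := tame_start y.
      exact: (smeas_sconv sT' w0 M1 hM (tame_Lp w0 hp m1 m2)).
    by exists set0.
  - move=> y; have [m1 m2] := tame_start y.
    exact: (io_conv_le_multiplier (B := [the {linear X -> X} of idfun])
      (C := [the {linear X -> X} of idfun]) sT' w0 M1 hM cid cid hp hm m1 m2).
apply: nal; apply: (@contraction_exp_stable R X _ (rescale_C0 al%:C sT) t0 (3 / 4)) => //.
  by apply/andP; split; lra.
move=> x; have := half x; rewrite !rnorm_rescale /= => h.
rewrite (_ : - t0 * al = d * t0 + - t0 * (al + d)); last by ring.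
rewrite expRD -mulrA; apply: le_trans (ler_wpM2l (expR_ge0 _) h) _.
rewrite mulrA ler_wpM2r ?rnorm_ge0 //.
have : expR (d * t0) <= 3 / 2.
  rewrite -[leRHS]lnK ?posrE; last by lra.
  rewrite ler_expR -ler_pdivlMr //; apply: le_trans (ltW dd0) _.
  by rewrite ge_min lexx orbT.
by lra.
Qed.

End frequency_domain_criterion.

(** * Translations and the norm of the input-output operator *)

Section translation.
Context (R : realType) (V : completeNormedModType R[i]).
Variables (p : R) (hp : 1 <= p).

Let p0 : 0 < p. Proof. exact: lt_le_trans hp. Qed.

Lemma smeas_translate (f : R -> V) (c : R) : smeas f -> smeas (fun t => f (t - c)).
Proof. by apply: (@smeas_comp R V f (fun t => t - c)); exact: measurable_funB. Qed.

Lemma Np_translate (f : R -> V) (c : R) : smeas f -> Np p (fun t => f (t - c)) = Np p f.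
Proof.
move=> mf; rewrite (NpE p (fun t => f (t - c))) (NpE p f).
have -> : Jp p (fun t => f (t - c)) = Jp p f; last by [].
apply: (@integral_translate R c (fun t => rnorm (f t) `^ p)); first exact: measurable_rnormp.
by move=> t; exact: powR_ge0.
Qed.

Lemma Np_tail_small (f : R -> V) (e : R) : smeas f -> (Np p f < +oo)%E -> 0 < e ->
  exists c : R, (Np p (fun t => f t - (if t \in `[c, +oo[%classic then f t else 0))%R < e%:E)%E.
Proof.
move=> mf hf e0.
have h : \forall n \near \oo,
    (Np p (fun t => f t - (if t \in `[- (n%:R : R), +oo[%classic then f t else 0))%R < e%:E)%E.
  apply: (@Np_dominated R V p hp _ (fun t => rnorm (f t) `^ p)) => //.
  - move=> n; apply: smeas_sub => //; apply: smeas_indic => //; exact: measurable_itv.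
  - exact: measurable_rnormp.
  - by move: hf; rewrite (Np_lty hp).
  - move=> n t; apply: ge0_ler_powR; rewrite ?nnegrE ?rnorm_ge0 ?(ltW p0) //.
    by case: ifP => _; rewrite ?subrr ?subr0 ?rnorm0 ?rnorm_ge0.
  - move=> t; apply: (@cvg_near_eq R V _ _ _ (fun=> 0 : V)); last exact: cvg_cst.
    near=> n; rewrite mem_set ?subrr //= in_itv /= andbT lerNl.
    by apply/ltW/(le_lt_trans (ler_norm _)); rewrite normrN; near: n; exact: nbhs_infty_gtr.
by have [n _ /(_ n (leqnn n)) hn] := h; exists (- n%:R).
Unshelve. all: by end_near. Qed.

End translation.

Section translation_invariance.
Context (R : realType) (X U Y : completeNormedModType R[i]).
Variables (T : R -> {linear X -> X}) (M w : R).
Hypotheses (sT : C0_semigroup T) (w0 : 0 < w) (M1 : 1 <= M)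
  (hM : forall t x, 0 <= t -> rnorm (T t x) <= M * expR (- w * t) * rnorm x).
Variables (B : {linear U -> X}) (C : {linear X -> Y}).
Hypotheses (cB : continuous B) (cC : continuous C).
Variables (p : R) (hp : 1 <= p).
Local Notation mu := (@lebesgue_measure R).

Lemma sconv_translate (f : R -> X) (c t : R) : tame w f ->
  sconv T (fun s => f (s - c)) t = sconv T f (t - c).
Proof.
move=> tf; rewrite /sconv.
rewrite -(bint_translate (- c) (binteg_ckern sT w0 M1 hM (t - c) tf)).2.
congr bint; apply/funext => s; rewrite /ckern lerD2r.
by rewrite opprB addrA subrK.
Qed.

Lemma io_conv_translate (f : R -> U) (c t : R) : smeas f -> (Np p f < +oo)%E ->
  io_conv T B C (fun s => f (s - c)) t = io_conv T B C f (t - c).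
Proof.
by move=> mf hf; rewrite /io_conv (sconv_translate c t (tame_io w0 cB hp mf hf)).
Qed.

(* Translating a function far to the right makes it almost supported in the half line. *)
Lemma io_conv_le_causal (k : R) : 0 <= k ->
  (forall u, smeas u -> (Np p u < +oo)%E -> (forall t, t < 0 -> u t = 0) ->
    (Np p (io_conv T B C u) <= k%:E * Np p u)%E) ->
  forall u, smeas u -> (Np p u < +oo)%E -> (Np p (io_conv T B C u) <= k%:E * Np p u)%E.
Proof.
move=> k0 hk u mu hu; have [K K0 hK] := io_conv_young sT w0 M1 hM cB cC hp.
suff h (e : R) : 0 < e -> (Np p (io_conv T B C u) <= k%:E * Np p u + (K * e)%:E)%E.
  apply/lee_addgt0Pr => e e0.
  have K1 : 0 < K + 1 by rewrite ltr_wpDl.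
  apply: le_trans (h _ (divr_gt0 e0 K1)) _; apply: leeD2l.
  by rewrite lee_fin mulrA ler_pdivrMr // mulrC ler_wpM2l ?(ltW e0) // lerDl.
move=> e0; have [c hc] := Np_tail_small hp mu hu e0.
set g := fun t => if t \in `[c, +oo[%classic then u t else 0.
have mg : smeas g by apply: smeas_indic => //; exact: measurable_itv.
have gu : (Np p g <= Np p u)%E.
  by apply: Np_le => // t; rewrite /g; case: ifP => // _; rewrite rnorm0 rnorm_ge0.
have hg : (Np p g < +oo)%E by exact: le_lt_trans hu.
have mug := smeas_sub mu mg.
have hug : (Np p (fun t => u t - g t)%R < +oo)%E by apply: (lt_trans hc); exact: ltry.
have -> : io_conv T B C u = fun t => io_conv T B C (fun s => u s - g s) t + io_conv T B C g t.
  apply/funext => t; rewrite (io_convB sT w0 M1 hM) ?subrK //; exact: (tame_io w0 cB hp).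
have mio v : smeas v -> (Np p v < +oo)%E -> smeas (io_conv T B C v).
  by move=> mv hv; apply: (smeas_io_conv sT w0 M1 hM cC); exact: (tame_io w0 cB hp).
apply: le_trans (Np_add hp (mio _ mug hug) (mio _ mg hg)) _; rewrite addeC; apply: leeD; last first.
  apply: le_trans (hK _ mug hug) _; rewrite EFinM.
  by apply: lee_wpmul2l; [rewrite lee_fin|exact: ltW].
pose h t := g (t + c).
have mh : smeas h by have := smeas_translate (- c) mg; rewrite opprK.
have gh : g = fun t => h (t - c) by apply/funext => t; rewrite /h subrK.
have Nh : Np p h = Np p g by rewrite gh Np_translate.
have hh : (Np p h < +oo)%E by rewrite Nh.
have -> : io_conv T B C g = fun t => io_conv T B C h (t - c).
  by apply/funext => t; rewrite -(io_conv_translate c t mh hh) -gh.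
rewrite (@Np_translate R Y p _ c (mio _ mh hh)).
apply: le_trans (hk _ mh hh _) _.
  move=> t t0; rewrite /h /g memNset //= in_itv /= andbT lerDr leNgt t0; exact/negP.
by rewrite Nh; apply: lee_wpmul2l; [rewrite lee_fin|exact: gu].
Qed.

Lemma multiplier_res_lty : (multiplier_sup p (fun s u => C (res_at T s (B u))) < +oo)%E.
Proof.
have [K K0 hK] := io_conv_young sT w0 M1 hM cB cC hp.
apply: le_lt_trans (ltry K); apply: (multiplier_sup_le K0) => v sv hv.
have bv := binteg_schwartz sv.
rewrite (osc_Lpnorm_io sT w0 M1 hM cB cC p bv) (osc_Lpnorm_binteg p bv).
apply: hK; first exact: smeas_osc_integral.
by move: hv; rewrite (osc_Lpnorm_binteg p bv).
Qed.

Theorem Lop_opnorm : Lp_opnorm (@Rplus R) p (Lop T B C) =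
  multiplier_sup p (fun s u => C (res_at T s (B u))).
Proof.
have [K K0 hK] := io_conv_young sT w0 M1 hM cB cC hp.
have num0 u : in_Lp (@Rplus R) p u -> (0 <= Lpnorm (@Rplus R) p (Lop T B C u))%E /\
    (0 <= Lpnorm (@Rplus R) p u)%E.
  move=> /(Lop_in_Lp sT w0 M1 hM cB cC hp)[u' [_ _ _ -> ->]].
  by split; exact: Np_ge0.
apply/eqP; rewrite eq_le; apply/andP; split.
  have := multiplier_res_lty; have := multiplier_sup_ge0 p (fun s u => C (res_at T s (B u))).
  case E : (multiplier_sup _ _) => [k| |] // k0 _; rewrite lee_fin in k0.
  apply: sup_ratio_le => // u [Lu _]; first exact: num0.
  have [u' [mu hu _ -> ->]] := Lop_in_Lp sT w0 M1 hM cB cC hp Lu => _.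
  apply: (io_conv_le_multiplier sT w0 M1 hM cB cC hp) => //.
  by rewrite E.
have : (Lp_opnorm (@Rplus R) p (Lop T B C) < +oo)%E.
  apply: le_lt_trans (ltry K); apply: sup_ratio_le => // u [Lu _]; first exact: num0.
  have [u' [mu hu _ -> ->]] := Lop_in_Lp sT w0 M1 hM cB cC hp Lu => _.
  exact: hK.
have := sup_ratio_ge0 [set f | in_Lp (@Rplus R) p f /\ Lpnorm (@Rplus R) p f != 0%E]
    (fun f => Lpnorm (@Rplus R) p (Lop T B C f)) (fun f => Lpnorm (@Rplus R) p f).
rewrite -/(Lp_opnorm _ p (Lop T B C)); case E : (Lp_opnorm _ _ _) => [k| |] // k0 _.
rewrite lee_fin in k0; apply: (multiplier_sup_le k0) => v sv hv.
have bv := binteg_schwartz sv.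
rewrite (osc_Lpnorm_io sT w0 M1 hM cB cC p bv) (osc_Lpnorm_binteg p bv).
apply: (io_conv_le_causal k0); first last.
- by move: hv; rewrite (osc_Lpnorm_binteg p bv).
- exact: smeas_osc_integral.
move=> u mu hu u0.
have vu : ae_version (@Rplus R) u u.
  exists set0; split; [exact: measurable0|exact: measure0|by []|move=> t].
  by rewrite RplusE => /negP; rewrite -ltNge; exact: u0.
have uL : in_Lp (@Rplus R) p u by apply: (in_Lp_version p u (@Rplus_measurable R)).2; exists u.
rewrite -(Lpnorm_version p vu) -(Lpnorm_version p (Lop_version sT w0 M1 hM C cB hp vu mu hu)).
have [n0 d0] := num0 u uL.
(* Inputs of norm 0 are excluded from [Lp_opnorm]; for them Young's inequality makes the output norm
   0. *)
have [uz|uz] := eqVneq (Lpnorm (@Rplus R) p u) 0%E.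
  rewrite uz mule0 (Lpnorm_version p (Lop_version sT w0 M1 hM C cB hp vu mu hu)).
  by apply: le_trans (hK _ mu hu) _; rewrite -(Lpnorm_version p vu) uz mule0.
have hk : (Lp_opnorm (@Rplus R) p (Lop T B C) <= k%:E)%E by rewrite E.
apply: (@sup_ratio_num_le R _ _ (fun f => Lpnorm (@Rplus R) p (Lop T B C f))
  (fun f => Lpnorm (@Rplus R) p f) k u (conj uL uz) hk n0 d0).
by rewrite (Lpnorm_version p vu).
Qed.

End translation_invariance.

(** * The equivalences *)

Section stable_generator.
Context (R : realType) (X : completeNormedModType R[i]).
Variables (T : R -> {linear X -> X}) (A : partial_op X).
Hypotheses (sT : C0_semigroup T) (gA : generates A T).
Variables (p : R) (hp : 1 <= p).

Lemma exp_stable_spectrum : exp_stable T -> spectrum A `&` @closed_right_half_plane R = set0.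
Proof. by move=> /exp_stable_rate[M [w [w0 M1 hM]]]; exact: (spectrum_right_half_plane sT w0 M1 hM gA). Qed.

Lemma exp_stable_multiplier (U Y : completeNormedModType R[i])
    (B : {linear U -> X}) (C : {linear X -> Y}) (a : R) :
  continuous B -> continuous C -> exp_stable T -> 0 <= a ->
  (multiplier_sup p (fun s (u : U) =>
     C (op_inv (op_shift (op_shift A a%:C) (imag s)) (B u))) < +oo)%E.
Proof.
move=> cB cC /exp_stable_rate[M [w [w0 M1 hM]]] a0.
have sTa := rescale_C0 a%:C sT; have gAa := generates_rescale a%:C gA.
have hMa := rescale_bound (l := a%:C) hM a0.
rewrite (_ : (fun s u => _) = fun s u => C (res_at (rescale a%:C T) s (B u))).
  exact: (multiplier_res_lty sTa w0 M1 hMa cB cC hp).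
by apply/funext => s; apply/funext => u; rewrite (op_inv_imag sTa w0 M1 hMa gAa).
Qed.

Lemma exp_stable_stabilizable (U : completeNormedModType R[i]) (B : {linear U -> X}) :
  exp_stable T -> stabilizable A B.
Proof.
move=> st; exists [the {linear X -> U} of \0]; first by move=> x; exact: cvg_cst.
exists T; split=> //; rewrite (_ : op_add A _ = A) //.
case: (A) => D f; rewrite /op_add /=; congr PartialOp; apply/funext => x.
by rewrite /= linear0 addr0.
Qed.

Lemma exp_stable_detectable (Y : completeNormedModType R[i]) (C : {linear X -> Y}) :
  exp_stable T -> detectable A C.
Proof.
move=> st; exists [the {linear Y -> X} of \0]; first by move=> x; exact: cvg_cst.
exists T; split=> //; rewrite (_ : op_add A _ = A) //.
case: (A) => D f; rewrite /op_add /=; congr PartialOp; apply/funext => x.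
by rewrite /= addr0.
Qed.

Hypothesis spA : spectrum A `&` @closed_right_half_plane R = set0.

Lemma imag_resolvent_bij (a s : R) : 0 <= a ->
  set_bij (pdom A) [set: X] (papp (op_shift (op_shift A a%:C) (imag s))).
Proof.
move=> a0; rewrite op_shiftD.
suff [h _] : resolvent_set A (a%:C + imag s) by exact: h.
apply: contrapT => h.
have : (spectrum A `&` @closed_right_half_plane R) (a%:C + imag s).
  by split; [exact: h|rewrite /closed_right_half_plane /= addr0].
by rewrite spA.
Qed.

Lemma stabilizable_multiplier (U Y : completeNormedModType R[i])
    (B : {linear U -> X}) (C : {linear X -> Y}) (a : R) :
  continuous C -> stabilizable A B -> 0 <= a ->
  (multiplier_sup p (fun s (u : U) =>
     C (op_inv (op_shift (op_shift A a%:C) (imag s)) (B u))) < +oo)%E ->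
  (multiplier_sup p (fun s (x : X) =>
     C (op_inv (op_shift (op_shift A a%:C) (imag s)) x)) < +oo)%E.
Proof.
move=> cC [F cF [T' [sT' gT' /exp_stable_rate[M [w [w0 M1 hM]]]]]] a0.
have gD := generates_rescale a%:C gA.
have gT'a := generates_rescale a%:C gT'; rewrite op_shift_add in gT'a.
exact: (multiplier_stabilized gD (fun s => imag_resolvent_bij s a0) (rescale_C0 a%:C sT') w0 M1
  (rescale_bound (l := a%:C) hM a0) gT'a hp cF cC erefl).
Qed.

Lemma detectable_multiplier (Y : completeNormedModType R[i]) (C : {linear X -> Y}) (a : R) :
  detectable A C -> 0 <= a ->
  (multiplier_sup p (fun s (x : X) =>
     C (op_inv (op_shift (op_shift A a%:C) (imag s)) x)) < +oo)%E ->
  (multiplier_sup p (fun s (x : X) =>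
     op_inv (op_shift (op_shift A a%:C) (imag s)) x) < +oo)%E.
Proof.
move=> [K cK [T' [sT' gT' /exp_stable_rate[M [w [w0 M1 hM]]]]]] a0.
have gD := generates_rescale a%:C gA.
have gT'a := generates_rescale a%:C gT'; rewrite op_shift_add in gT'a.
exact: (multiplier_detected gD (fun s => imag_resolvent_bij s a0) (rescale_C0 a%:C sT') w0 M1
  (rescale_bound (l := a%:C) hM a0) gT'a hp cK erefl).
Qed.

End stable_generator.

Theorem theorem5p4 (R : realType) (X U Y : completeNormedModType R[i])
    (T : R -> {linear X -> X}) (A : partial_op X)
    (B : {linear U -> X}) (C : {linear X -> Y}) (p : R)
    (hT : C0_semigroup T) (hA : generates A T)
    (hB : continuous B) (hC : continuous C) (hp : 1 <= p) :
  [<-> (* (i) *)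
       exp_stable T;
       (* (ii) *)
       Lp_bounded (@Rplus R) p (Gop T);
       (* (iii) *)
       spectrum A `&` @closed_right_half_plane R = set0 /\
       (forall a : R, 0 <= a ->
         (multiplier_sup p (fun s (x : X) =>
            op_inv (op_shift (op_shift A a%:C) (imag s)) x) < +oo)%E);
       (* (iv) *)
       [/\ spectrum A `&` @closed_right_half_plane R = set0,
           (forall a : R, 0 <= a ->
             (multiplier_sup p (fun s (u : U) =>
                op_inv (op_shift (op_shift A a%:C) (imag s)) (B u)) < +oo)%E) &
           stabilizable A B];
       (* (v) *)
       [/\ spectrum A `&` @closed_right_half_plane R = set0,
           (forall a : R, 0 <= a ->
             (multiplier_sup p (fun s (x : X) =>
                C (op_inv (op_shift (op_shift A a%:C) (imag s)) x)) < +oo)%E) &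
           detectable A C];
       (* (vi) *)
       [/\ spectrum A `&` @closed_right_half_plane R = set0,
           (forall a : R, 0 <= a ->
             (multiplier_sup p (fun s (u : U) =>
                C (op_inv (op_shift (op_shift A a%:C) (imag s)) (B u)))
              < +oo)%E),
           stabilizable A B &
           detectable A C] ] /\
  (exp_stable T ->
     Lp_bounded (@Rplus R) p (Lop T B C) /\
     Lp_opnorm (@Rplus R) p (Lop T B C) =
       multiplier_sup p (fun s (u : U) =>
         C (op_inv (op_shift A (imag s)) (B u)))).
Proof.
pose iX := [the {linear X -> X} of idfun].
have cX : continuous iX by move=> x; exact: cvg_id.
pose res (a : R) s := op_inv (op_shift (op_shift A a%:C) (imag s)).
have stable_of_res : spectrum A `&` @closed_right_half_plane R = set0 ->
    (forall a : R, 0 <= a -> (multiplier_sup p (fun s (x : X) => res a s x) < +oo)%E) -> exp_stable T.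
  move=> sp h; apply: (multiplier_exp_stable hT hA hp) => // a s a0.
  exact: (imag_resolvent_bij sp s a0).
have stable_res (V W : completeNormedModType R[i]) (L : {linear V -> X}) (N : {linear X -> W}) a :
    continuous L -> continuous N -> exp_stable T -> 0 <= a ->
    (multiplier_sup p (fun s (u : V) => N (res a s (L u))) < +oo)%E.
  by move=> cL cN st a0; exact: (exp_stable_multiplier hT hA hp cL cN st a0).
have sp := exp_stable_spectrum hT hA.
have stb := exp_stable_stabilizable hT hA B.
have dtc := exp_stable_detectable hT hA C.
split; last first.
  move=> st; have [M [w [w0 M1 hM]]] := exp_stable_rate st; split.
    exact: (Lop_bounded hT w0 M1 hM hB hC hp).
  rewrite (Lop_opnorm hT w0 M1 hM hB hC hp); congr (multiplier_sup p _).
  by apply/funext => s; apply/funext => u; rewrite (op_inv_imag hT w0 M1 hM hA).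
(* Every condition after the first is first shown to imply exponential stability, from which the
   next one is derived. *)
tfae.
- move=> st; have [M [w [w0 M1 hM]]] := exp_stable_rate st.
  (* [Gop T] is [Lop] with the identity as input and output operators. *)
  exact: (Lop_bounded hT w0 M1 hM cX cX hp).
- move=> /(Gop_bounded_stable hp hT) st; split; first exact: sp.
  by move=> a; exact: (stable_res X X iX iX a cX cX st).
- move=> [h1 h2]; have st := stable_of_res h1 h2; split.
  + exact: h1.
  + by move=> a; exact: (stable_res U X B iX a hB cX st).
  + exact: stb.
- move=> [h1 h2 h3].
  have st : exp_stable T.
    apply: (stable_of_res h1) => a a0.
    exact: (stabilizable_multiplier (C := iX) hA hp h1 cX h3 a0 (h2 a a0)).
  split.
  + exact: h1.
  + by move=> a; exact: (stable_res X Y iX C a cX hC st).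
  + exact: dtc.
- move=> [h1 h2 h3].
  have st : exp_stable T.
    apply: (stable_of_res h1) => a a0.
    exact: (detectable_multiplier hA hp h1 h3 a0 (h2 a a0)).
  split.
  + exact: h1.
  + by move=> a; exact: (stable_res U Y B C a hB hC st).
  + exact: stb.
  + exact: dtc.
- move=> [h1 h2 h3 h4]; apply: (stable_of_res h1) => a a0.
  apply: (detectable_multiplier hA hp h1 h4 a0).
  exact: (stabilizable_multiplier hA hp h1 hC h3 a0 (h2 a a0)).
Qed.
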